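(* Let $\mathbb K=\mathbb R$ or $\mathbb C$, let $1\leqslant k\leqslant d/2$, let $(\Gamma,\mathcal P)$ be a relatively hyperbolic group and let $\rho_0:\Gamma\to\mathsf{SL}(d,\mathbb K)$ be a representation that is $P_k$-divergent and extended geometrically finite relative to $\mathcal P$ (with boundary extension in $\mathcal F_{k,d-k}$). Let $$\mathrm{Hom}_{\mathcal P}(\rho_0)=\{\rho\in\mathrm{Hom}(\Gamma,\mathsf{SL}(d,\mathbb K)):\ \forall P\in\mathcal P,\ \rho|_P\text{ is conjugate to }\rho_0|_P\}.$$ Then there exists an open neighborhood $O\subset\mathrm{Hom}_{\mathcal P}(\rho_0)$ of $\rho_0$ such that any $\rho\in O$ is $P_k$-divergent and extended geometrically finite relative to $\mathcal P$.
   Context: $\mathrm{Hom}(\Gamma,\mathsf{SL}(d,\mathbb K))$ carries the topology of pointwise convergence and $\mathrm{Hom}_{\mathcal P}(\rho_0)$ the subspace topology; conjugation is by elements of $\mathsf{SL}(d,\mathbb K)$ (which may depend on $P$). **Relatively hyperbolic groups.** A geodesic metric space $X$ is taut if there is $R\geqslant 0$ such that every point of $X$ lies in the $R$-neighborhood of some bi-infinite geodesic. Let $\Gamma$ be a finitely generated group, $\mathcal P$ a finite collection of finitely generated infinite subgroups, $\mathcal P^\Gamma=\{\gamma P\gamma^{-1}:\gamma\in\Gamma,P\in\mathcal P\}$. $(\Gamma,\mathcal P)$ is relatively hyperbolic if there is a taut, proper Gromov hyperbolic space $X$ with a properly discontinuous isometric $\Gamma$-action such that (i) there is a $\Gamma$-invariant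 collection $\{B_P:P\in\mathcal P^\Gamma\}$ of pairwise disjoint open horoballs, the stabilizer of $B_P$ being $P$; (ii) $\Gamma$ acts cocompactly on $X\setminus\bigcup_P B_P$. Such an $X$ is a Gromov model. The Bowditch boundary $\partial(\Gamma,\mathcal P)$ is the Gromov boundary of $X$ (independent of $X$). For $(\gamma_n)\subset\Gamma$, $\gamma_n\to p\in\partial(\Gamma,\mathcal P)$ means $\gamma_n o\to p$ in $X\cup\partial X$ for $o\in X$. **Extended geometrically finite.** A boundary extension of $(\Gamma,\mathcal P)$ is a continuous $\Gamma$-equivariant surjection $\zeta:\Lambda\to\partial(\Gamma,\mathcal P)$, where $\Lambda$ is a compact metrizable Hausdorff $\Gamma$-space. $\mathcal F_{k,d-k}=\{(V,W)\in\mathrm{Gr}_k(\mathbb K^d)\times\mathrm{Gr}_{d-k}(\mathbb K^d):V\subset W\}$; $(V_1,W_1),(V_2,W_2)$ are transverse if $V_1\oplus W_2=V_2\oplus W_1=\mathbb K^d$; two subsets are transverse if all pairs of their elements are. A boundary extension is in $\mathcal F_{k,d-k}$ if $\Lambda$ is a closed $\rho(\Gamma)$-invariant subset of $\mathcal F_{k,d-k}$ on which $\Gamma$ acts via $\rho$; it is transverse if $\zeta^{-1}(p),\zeta^{-1}(q)$ are transverse for $p\ne q$. $\rho$ is extended geometrically finite with boundary extension $\zeta:\Lambda\to\partial(\Gamma,\mathcal P)$ if $\zeta$ is a transverse boundary extension in $\mathcal F_{k,d-k}$ and there are open sets $C_p\subset\mathcal F_{k,d-k}$, $p\in\partial(\Gamma,\mathcal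 P)$, with $\Lambda\setminus\zeta^{-1}(p)\subset C_p$, such that whenever $\gamma_n\to p$ and $\gamma_n^{-1}\to q$, for every compact $L\subset C_q$ and open $U\supset\zeta^{-1}(p)$ one has $\rho(\gamma_n)L\subset U$ for all large $n$. It is extended geometrically finite relative to $\mathcal P$ if this holds for some boundary extension. **Divergence.** $\sigma_i$ denotes the $i$-th largest singular value. $\rho$ is $P_k$-divergent if $\sigma_k(\rho(\gamma_n))/\sigma_{k+1}(\rho(\gamma_n))\to+\infty$ for every sequence of pairwise distinct $\gamma_n\in\Gamma$. *)

(* Defs.v *)
From HB Require Import structures.
From mathcomp Require Import all_boot all_order all_algebra.
From mathcomp Require Import all_classical all_reals all_analysis.
From mathcomp Require Import complex.

Set Implicit Arguments.
Unset Strict Implicit.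
Unset Printing Implicit Defensive.

Import Order.TTheory GRing.Theory Num.Theory.
Import numFieldTopology.Exports.

Local Open Scope classical_set_scope.
Local Open Scope ring_scope.

Variant scalar_kind := RealScalars | ComplexScalars.

Definition scalars (R : realType) (F : scalar_kind) : numFieldType :=
  match F with
  | RealScalars => R : numFieldType
  | ComplexScalars => R[i] : numFieldType
  end.

Definition to_complex (R : realType) (F : scalar_kind) :
    scalars R F -> R[i] :=
  match F return scalars R F -> R[i] with
  | RealScalars => fun x => Complex x 0
  | ComplexScalars => fun z => z
  end.

Record special_linear (K : numFieldType) (d : nat) := SpecialLinear {
  sl_mx :> 'M[K]_d;
  sl_det : \det sl_mx == 1 }.

HB.instance Definition _ (K : numFieldType) (d : nat) :=
  [isSub for @sl_mx K d].
HB.instance Definition _ (K : numFieldType) (d : nat) :=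
  [Choice of special_linear K d by <:].

Section SpecialLinearGroup.
Variables (K : numFieldType) (d : nat).
Implicit Types g h : special_linear K d.

Lemma sl_unit g : sl_mx g \in unitmx.
Proof. by rewrite unitmxE (eqP (sl_det g)) unitr1. Qed.

Lemma sl_one_subproof : \det (1%:M : 'M[K]_d) == 1.
Proof. by rewrite det1. Qed.

Lemma sl_mul_subproof g h : \det (sl_mx g *m sl_mx h) == 1.
Proof. by rewrite det_mulmx (eqP (sl_det g)) (eqP (sl_det h)) mulr1. Qed.

Lemma sl_inv_subproof g : \det (invmx (sl_mx g)) == 1.
Proof. by rewrite det_inv (eqP (sl_det g)) invr1. Qed.

Definition sl_one := SpecialLinear sl_one_subproof.
Definition sl_mul g h := SpecialLinear (sl_mul_subproof g h).
Definition sl_inv g := SpecialLinear (sl_inv_subproof g).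

Lemma sl_mulA : associative sl_mul.
Proof. by move=> g h k; apply: val_inj; rewrite /= mulmxA. Qed.
Lemma sl_mul1 : left_id sl_one sl_mul.
Proof. by move=> g; apply: val_inj; rewrite /= mul1mx. Qed.
Lemma sl_mulr1 : right_id sl_one sl_mul.
Proof. by move=> g; apply: val_inj; rewrite /= mulmx1. Qed.
Lemma sl_mulV : left_inverse sl_one sl_inv sl_mul.
Proof. by move=> g; apply: val_inj; rewrite /= mulVmx ?sl_unit. Qed.
Lemma sl_mulrV : right_inverse sl_one sl_inv sl_mul.
Proof. by move=> g; apply: val_inj; rewrite /= mulmxV ?sl_unit. Qed.

HB.instance Definition _ := isGroup.Build (special_linear K d)
  sl_mulA sl_mul1 sl_mulr1 sl_mulV sl_mulrV.

HB.instance Definition _ := Topological.copy (special_linear K d)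
  (initial_topology (@sl_mx K d)).

End SpecialLinearGroup.

Definition representations (Gam : groupType) (K : numFieldType) (d : nat) :
    set {ptws Gam -> special_linear K d} :=
  [set rho : Gam -> special_linear K d |
    {morph rho : x y / (x * y)%g >-> (x * y)%g}].

Arguments representations : clear implicits.

(* Eigenvalues with multiplicity, i.e. the roots of the characteristic
   polynomial, which splits over R[i]. *)
Definition eigenvalues (R : realType) (d : nat) (A : 'M[R[i]]_d) : seq R[i] :=
  sval (closed_field_poly_normal (char_poly A)).

(* Decreasingly sorted square roots of the (real, nonnegative) eigenvalues
   of A^* A. *)
Definition singular_values (R : realType) (d : nat) (A : 'M[R[i]]_d) : seq R :=
  sort (fun x y => y <= x)
    [seq Num.sqrt (complex.Re z) | z <- eigenvalues ((map_mx conjc A)^T *m A)].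

(* Singular values are numbered from 1 as usual. *)
Definition sigma (R : realType) (F : scalar_kind) (d : nat) (i : nat)
    (g : 'M[scalars R F]_d) : R :=
  nth 0 (singular_values (map_mx (@to_complex R F) g)) i.-1.

Definition divergent (R : realType) (F : scalar_kind) (d : nat) (k : nat)
    (Gam : groupType) (rho : Gam -> special_linear (scalars R F) d) : Prop :=
  forall gs : nat -> Gam, injective gs ->
    (fun n => sigma k (rho (gs n)) / sigma k.+1 (rho (gs n))) @ \oo --> +oo.

Record grassmannian (K : numFieldType) (d k : nat) := Grassmannian {
  gr_space :> {vspace 'cV[K]_d};
  gr_dim : \dim gr_space == k }.

HB.instance Definition _ (K : numFieldType) (d k : nat) :=
  [isSub for @gr_space K d k].
HB.instance Definition _ (K : numFieldType) (d k : nat) :=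
  [Choice of grassmannian K d k by <:].

Section GrassmannianTopology.
Variables (K : numFieldType) (d k : nat).

Definition colspan (A : 'M[K]_(d, k)) : {vspace 'cV[K]_d} :=
  limg (linfun (mulmx A : 'cV[K]_k -> 'cV[K]_d)).

(* Quotient topology of the map sending a k-frame, i.e. a matrix whose
   columns are linearly independent, to its column space. *)
Definition frames : set 'M[K]_(d, k) := [set A | \dim (colspan A) = k].

Definition gr_open (U : set (grassmannian K d k)) : Prop :=
  open ([set A | exists2 V, U V & colspan A = gr_space V] :
    set (subspace frames)).

Lemma gr_openT : gr_open [set: grassmannian K d k].
Proof.
rewrite /gr_open.
have -> : [set A | exists2 V : grassmannian K d k, [set: _] V &
    colspan A = gr_space V] = frames.
  apply/seteqP; split=> A /=.
    by move=> [V _ AV]; rewrite /frames /= AV (eqP (gr_dim V)).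
  by move=> /eqP dA; exists (Grassmannian dA).
exact: open_subspaceT.
Qed.

Lemma gr_openI : setI_closed gr_open.
Proof.
move=> U V oU oV.
have := openI oU oV; rewrite /gr_open; congr open; apply/seteqP; split=> A /=.
  move=> [[X UX AX] [Y VY AY]]; exists X => //; split=> //.
  by have -> : X = Y by apply: val_inj; rewrite /= -AX -AY.
by move=> [X [UX VX] AX]; split; exists X.
Qed.

Lemma gr_open_bigcup (I : Type) (f : I -> set (grassmannian K d k)) :
  (forall i, gr_open (f i)) -> gr_open (\bigcup_i f i).
Proof.
move=> of_; have := bigcup_open (fun i _ => of_ i).
rewrite /gr_open => /(_ setT); congr open; apply/seteqP; split=> A /=.
  by move=> [i _ [V fV AV]]; exists V => //; exists i.
by move=> [V [i _ fV] AV]; exists i => //; exists V.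
Qed.

End GrassmannianTopology.

HB.instance Definition _ (K : numFieldType) (d k : nat) :=
  @isOpenTopological.Build (grassmannian K d k) (@gr_open K d k)
    (@gr_openT K d k) (@gr_openI K d k) (@gr_open_bigcup K d k).

Section Flags.
Variables (K : numFieldType) (d k : nat).

Definition sl_lfun (g : special_linear K d) : 'End('cV[K]_d) :=
  linfun (mulmx (sl_mx g) : 'cV[K]_d -> 'cV[K]_d).

Lemma sl_lfun_ker (g : special_linear K d) : lker (sl_lfun g) == 0%VS.
Proof.
apply/lker0P => u v; rewrite !lfunE /= => /(congr1 (mulmx (invmx (sl_mx g)))).
by rewrite !mulKmx ?sl_unit.
Qed.

Lemma gr_act_subproof m (g : special_linear K d) (V : grassmannian K d m) :
  \dim (sl_lfun g @: gr_space V) == m.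
Proof. by rewrite limg_dim_eq ?(gr_dim V) // (eqP (sl_lfun_ker g)) capv0. Qed.

Definition gr_act m g (V : grassmannian K d m) : grassmannian K d m :=
  Grassmannian (gr_act_subproof g V).

Definition flags : set (grassmannian K d k * grassmannian K d (d - k)) :=
  [set VW | (gr_space VW.1 <= gr_space VW.2)%VS].

Lemma flag_act_subproof g (x : flags) :
  (gr_act g (set_val x).1, gr_act g (set_val x).2) \in flags.
Proof.
by apply/mem_set; apply: limgS; have := set_mem (valP x).
Qed.

Definition flag_act g (x : flags) : flags :=
  exist (fun y => y \in flags) _ (flag_act_subproof g x).

Definition complementary (V W : {vspace 'cV[K]_d}) : Prop :=
  (V + W)%VS = fullv /\ (V :&: W)%VS = 0%VS.

Definition transverse (x y : flags) : Prop :=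
  complementary (set_val x).1 (set_val y).2 /\
  complementary (set_val y).1 (set_val x).2.

Definition transverse_sets (A B : set flags) : Prop :=
  forall x y, A x -> B y -> transverse x y.

End Flags.

Arguments flags : clear implicits.

Section Hyperbolic.
Variables (R : realType) (X : metricType R).
Implicit Types (o x y z : X) (u v : nat -> X).

Definition geodesic_space : Prop :=
  forall x y, exists c : R -> X,
    [/\ c 0 = x, c (mdist x y) = y &
        {in `[0, mdist x y] &, forall s t, mdist (c s) (c t) = `|s - t|}].

Definition taut : Prop :=
  exists2 r : R, 0 <= r & forall x, exists c : R -> X,
    (forall s t, mdist (c s) (c t) = `|s - t|) /\
    exists t, mdist x (c t) <= r.

Definition proper_space : Prop :=
  forall x (r : R), compact [set y | mdist x y <= r].

Definition gromov_product o x y : R :=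
  (mdist o x + mdist o y - mdist x y) / 2.

Definition gromov_hyperbolic : Prop :=
  exists delta : R, forall o x y z,
    Num.min (gromov_product o x y) (gromov_product o y z) - delta
      <= gromov_product o x z.

Definition asymptotic u v : Prop :=
  forall o (r : R), \forall i \near \oo & j \near \oo,
    r <= gromov_product o (u i) (v j).

Definition gromov_class u : set (nat -> X) :=
  [set v | asymptotic v v /\ asymptotic u v].

(* Sequential model: boundary points are equivalence classes of sequences
   converging to infinity, so that u converges to p iff u belongs to p. *)
Record gromov_boundary := GromovBoundary {
  bd_class :> set (nat -> X);
  bd_classP : exists2 u, asymptotic u u & bd_class = gromov_class u }.

HB.instance Definition _ := gen_eqMixin gromov_boundary.
HB.instance Definition _ := gen_choiceMixin gromov_boundary.

(* Basic neighbourhoods of p in the boundary, see Bridson and Haefliger,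
   Metric spaces of non-positive curvature, Section III.H.3. *)
Definition bd_near o (r : R) (p : gromov_boundary) : set gromov_boundary :=
  [set q | exists u v, [/\ bd_class p u, bd_class q v &
    \forall i \near \oo & j \near \oo, r <= gromov_product o (u i) (v j)]].

Definition bd_open (U : set gromov_boundary) : Prop :=
  forall o p, U p -> exists r, bd_near o r p `<=` U.

Lemma bd_openT : bd_open setT.
Proof. by move=> o p _; exists 0. Qed.

Lemma bd_near_le o (r s : R) p : r <= s -> bd_near o s p `<=` bd_near o r p.
Proof.
move=> rs q [u [v [pu qv near_uv]]]; exists u, v; split=> //.
by apply: filterS near_uv => ij; apply: le_trans.
Qed.

Lemma bd_openI : setI_closed bd_open.
Proof.
move=> U V oU oV o p [/oU - /(_ o)[r rU] /oV - /(_ o)[s sV]].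
exists (Num.max r s) => q pq; split.
  by apply: rU; apply: bd_near_le pq; rewrite le_max lexx.
by apply: sV; apply: bd_near_le pq; rewrite le_max lexx orbT.
Qed.

Lemma bd_open_bigcup (I : Type) (f : I -> set gromov_boundary) :
  (forall i, bd_open (f i)) -> bd_open (\bigcup_i f i).
Proof.
move=> of_ o p [i _ fp]; have [r rf] := of_ i o p fp.
by exists r => q /rf fq; exists i.
Qed.

HB.instance Definition _ :=
  isOpenTopological.Build gromov_boundary bd_openT bd_openI bd_open_bigcup.

(* Coarse horofunctions centred at p, in the sense of Gromov and Bowditch:
   h agrees up to a bounded error with the Busemann cocycle of p. Busemann
   functions of rays towards p are examples. *)
Definition horofunction (p : gromov_boundary) (h : X -> R) : Prop :=
  exists D : R, forall x y u, bd_class p u ->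
    \forall n \near \oo,
      `|(h x - h y) - (mdist x (u n) - mdist y (u n))| <= D.

Definition horoball (B : set X) : Prop :=
  exists p h, horofunction p h /\ exists c : R,
    (forall x, B x -> h x <= c) /\ (forall x, ~ B x -> - c <= h x).

End Hyperbolic.

Record isometric_action (R : realType) (Gam : groupType) (X : metricType R) :=
  IsometricAction {
  iact :> Gam -> X -> X;
  iact1 : forall x, iact 1%g x = x;
  iactM : forall g h x, iact (g * h)%g x = iact g (iact h x);
  iact_isom : forall g x y, mdist (iact g x) (iact g y) = mdist x y }.

Section BoundaryAction.
Variables (R : realType) (Gam : groupType) (X : metricType R).
Variable a : isometric_action Gam X.

Lemma iactK g : cancel (a g) (a g^-1%g).
Proof. by move=> x; rewrite -iactM mulVg iact1. Qed.

Lemma iactVK g : cancel (a g^-1%g) (a g).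
Proof. by move=> x; rewrite -iactM mulgV iact1. Qed.

Lemma gromov_product_iact g o x y :
  gromov_product (a g o) (a g x) (a g y) = gromov_product o x y.
Proof. by rewrite /gromov_product !iact_isom. Qed.

Lemma asymptotic_iact g u v :
  asymptotic u v -> asymptotic (a g \o u) (a g \o v).
Proof.
move=> uv o r; have := uv (a g^-1%g o) r.
by apply: filterS => ij; rewrite -(gromov_product_iact g) iactVK.
Qed.

Lemma bd_act_subproof g (p : gromov_boundary X) :
  exists2 u, asymptotic u u &
    [set a g \o v | v in bd_class p] = gromov_class u.
Proof.
have [u uu ->] := bd_classP p.
exists (a g \o u); first exact: asymptotic_iact.
apply/seteqP; split=> [_ [v [vv uv] <-]|w [ww uw]].
  by split; apply: asymptotic_iact.
have aVK (v : nat -> X) : a g^-1%g \o (a g \o v) = v.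
  by apply/funext => n /=; rewrite iactK.
exists (a g^-1%g \o w); last by apply/funext => n /=; rewrite iactVK.
split; first exact: asymptotic_iact.
by rewrite -(aVK u); exact: asymptotic_iact.
Qed.

Definition bd_act g (p : gromov_boundary X) : gromov_boundary X :=
  GromovBoundary (bd_act_subproof g p).

Definition properly_discontinuous : Prop :=
  forall C : set X, compact C ->
    finite_set [set g | (a g @` C) `&` C !=set0].

Definition stabilizer (B : set X) : set Gam := [set g | a g @` B = B].

Definition cocompact_on (A : set X) : Prop :=
  exists2 C : set X, compact C & A = \bigcup_g (a g @` C).

(* gs n . o -> p in the union of X and its boundary; this does not depend
   on o. *)
Definition converges_to_boundary (gs : nat -> Gam) (p : gromov_boundary X) :
    Prop :=
  forall o, bd_class p (fun n => a (gs n) o).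

End BoundaryAction.

Section RelativelyHyperbolic.
Variables (R : realType) (Gam : groupType).

Definition is_subgroup (H : set Gam) : Prop :=
  H 1%g /\ forall x y, H x -> H y -> H (x * y^-1)%g.

Definition finitely_generated (H : set Gam) : Prop :=
  exists2 S : set Gam, finite_set S & H = smallest is_subgroup S.

Definition conjugates (P : set (set Gam)) : set (set Gam) :=
  [set H | exists2 Q, P Q & exists g, H = [set (g * x * g^-1)%g | x in Q]].

Record gromov_model (P : set (set Gam)) := GromovModel {
  model_space :> metricType R;
  model_action : isometric_action Gam model_space;
  model_inhabited : [set: model_space] !=set0;
  model_geodesic : geodesic_space model_space;
  model_taut : taut model_space;
  model_proper : proper_space model_space;
  model_hyperbolic : gromov_hyperbolic model_space;
  model_discontinuous : properly_discontinuous model_action;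
  model_horoballs : exists B : set Gam -> set model_space,
    [/\ forall H, conjugates P H -> open (B H) /\ horoball (B H),
        trivIset (conjugates P) B,
        forall g H, conjugates P H ->
          exists2 H', conjugates P H' & model_action g @` B H = B H',
        forall H, conjugates P H -> stabilizer model_action (B H) = H &
        cocompact_on model_action (~` \bigcup_(H in conjugates P) B H)] }.

Definition relatively_hyperbolic (P : set (set Gam)) : Prop :=
  [/\ finitely_generated [set: Gam], finite_set P,
      forall H, P H ->
        [/\ is_subgroup H, finitely_generated H & infinite_set H] &
      inhabited (gromov_model P)].

(* Up to equivariant homeomorphism this does not depend on M. *)
Definition bowditch_boundary (P : set (set Gam)) (M : gromov_model P) :
    topologicalType :=
  gromov_boundary M.

End RelativelyHyperbolic.

Definition metrizable (R : realType) (T : topologicalType) : Prop :=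
  exists dist : T -> T -> R,
    [/\ forall x y, dist x y = 0 <-> x = y,
        forall x y, dist x y = dist y x,
        forall x y z, dist x z <= dist x y + dist y z &
        forall x, nbhs x =
          filter_from [set e | 0 < e] (fun e => [set y | dist x y < e])].

Definition continuous_action (Gam : groupType) (T : topologicalType)
    (act : Gam -> T -> T) : Prop :=
  [/\ forall x, act 1%g x = x,
      forall g h x, act (g * h)%g x = act g (act h x) &
      forall g, continuous (act g)].

Section ExtendedGeometricallyFinite.
Variables (R : realType) (Gam : groupType) (P : set (set Gam)).
Variable M : gromov_model R P.
Local Notation bd := (bowditch_boundary M).

Definition boundary_extension (T : topologicalType) (act : Gam -> T -> T)
    (zeta : T -> bd) : Prop :=
  [/\ compact [set: T], hausdorff_space T & metrizable R T] /\
  [/\ continuous_action act, continuous zeta, set_surj setT setT zeta &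
      forall g x, zeta (act g x) = bd_act (model_action M) g (zeta x)].

Variables (K : numFieldType) (d k : nat).

Definition fiber (Lam : set (flags K d k)) (zeta : Lam -> bd) (p : bd) :
    set (flags K d k) :=
  [set set_val x | x in zeta @^-1` [set p]].

(* The equation on act says both that Lam is rho-invariant and that Gam acts
   on it through rho. *)
Definition flag_boundary_extension (rho : Gam -> special_linear K d)
    (Lam : set (flags K d k)) (act : Gam -> Lam -> Lam) (zeta : Lam -> bd) :
    Prop :=
  [/\ closed Lam,
      forall g x, set_val (act g x) = flag_act (rho g) (set_val x) &
      boundary_extension act zeta].

Definition transverse_extension (Lam : set (flags K d k)) (zeta : Lam -> bd) :
    Prop :=
  forall p q : bd, p <> q -> transverse_sets (fiber zeta p) (fiber zeta q).

Definition extended_dynamics (rho : Gam -> special_linear K d)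
    (Lam : set (flags K d k)) (zeta : Lam -> bd) : Prop :=
  exists C : bd -> set (flags K d k),
    (forall p, open (C p) /\ Lam `\` fiber zeta p `<=` C p) /\
    forall (gs : nat -> Gam) (p q : bd),
      converges_to_boundary (model_action M) gs p ->
      converges_to_boundary (model_action M) (fun n => (gs n)^-1%g) q ->
      forall L U : set (flags K d k),
        compact L -> L `<=` C q -> open U -> fiber zeta p `<=` U ->
        \forall n \near \oo, flag_act (rho (gs n)) @` L `<=` U.

Definition extended_geometrically_finite (rho : Gam -> special_linear K d) :
    Prop :=
  exists (Lam : set (flags K d k)) (act : Gam -> Lam -> Lam)
    (zeta : Lam -> bd),
    [/\ flag_boundary_extension rho act zeta,
        transverse_extension zeta & extended_dynamics rho zeta].

End ExtendedGeometricallyFinite.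

Definition conjugate_on (Gam : groupType) (K : numFieldType) (d : nat)
    (H : set Gam) (rho rho' : Gam -> special_linear K d) : Prop :=
  exists h : special_linear K d,
    forall x, H x -> rho x = (h * rho' x * h^-1)%g.

Definition relative_representations (Gam : groupType) (P : set (set Gam))
    (K : numFieldType) (d : nat) (rho0 : Gam -> special_linear K d) :
    set {ptws Gam -> special_linear K d} :=
  [set rho | representations Gam K d rho /\
    forall H, P H -> conjugate_on H rho rho0].

(* Main.v *)
(* Decompose every matrix as A = U D V with D diagonal and sorted, and with U and
   V bounded together with their inverses. For rho0, a compactness argument turns
   divergence and the extended dynamics into uniform transversality: if alpha and
   beta are long and their orbit points have bounded Gromov product, then the
   upper left k x k block of V(rho0 alpha^-1) U(rho0 beta) has a bounded inverse.

   A geodesic of the Gromov model is shadowed by an orbit path with long steps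
   f x f', where f and f' range over a finite set and x is peripheral. A relative
   deformation rho near rho0 is conjugate to rho0 on the peripheral subgroups by
   matrices near 1, hence rho (f x f') = a rho0 (f x f') b with a and b near 1,
   uniformly over these infinitely many steps. So the singular value gaps of the
   steps and the transversality of consecutive steps persist for rho, and a
   local-to-global argument for products of such matrices shows that rho is
   divergent and uniformly transverse over distinct boundary points. The limits
   of the flags of U(rho g) as g tends to boundary points then form a boundary
   extension for rho. Limits are taken along ultrafilters, so that no
   subsequences have to be extracted. *)

Require Import Defs.
From HB Require Import structures.
From mathcomp Require Import all_boot all_order all_algebra.
From mathcomp Require Import all_classical all_reals all_analysis.
From mathcomp Require Import perm complex spectral ring lra zify.

Set Implicit Arguments.
Unset Strict Implicit.
Unset Printing Implicit Defensive.

Import Order.TTheory GRing.Theory Num.Theory.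
Import numFieldTopology.Exports.

Local Open Scope classical_set_scope.
Local Open Scope ring_scope.

(** * Absolute values, matrix norms and limits along filters *)

(** The peripheral subgroups are infinite, so closeness on generators alone says nothing uniform
    about long excursions into horoballs; the conjugacy condition controls all of them at once, and
    paths are cut so that each excursion stays inside one step. The constants must be chosen in a
    non-circular order. Consecutive steps have Gromov product at most [3 * thickR o] whatever the
    step length, so the transversality constant of [rho0] comes first, then the tolerances [e], [L],
    [eps], then the step length [S], then the finite set [E], and last the neighbourhood. The given
    extension serves only to extract uniform transversality of [rho0]. It is not deformed: the
    extension of [rho] is built afresh, and no comparison between its fibres and the old ones is
    made. The decomposition of a product keeps precise track of the expanding space at the starting
    end only. Transversality over two boundary points is therefore obtained by starting two chains
    at one point near the base point, one in each direction, and looking at the junction of their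
    first steps. *)

Section AbsoluteValue.
Variables (R : realType) (F : scalar_kind).
Local Notation K := (scalars R F).

Lemma to_complexD (x y : K) : to_complex (x + y) = to_complex x + to_complex y.
Proof. by case: F x y => //= x y; apply/eqP; rewrite eq_complex /= addr0 !eqxx. Qed.

Lemma to_complexN (x : K) : to_complex (- x) = - to_complex x.
Proof. by case: F x => //= x; apply/eqP; rewrite eq_complex /= oppr0 !eqxx. Qed.

Lemma to_complexM (x y : K) : to_complex (x * y) = to_complex x * to_complex y.
Proof.
case: F x y => //= x y; apply/eqP.
by rewrite eq_complex /= !(mulr0, mul0r) subr0 addr0 !eqxx.
Qed.

Lemma to_complex0 : to_complex (0 : K) = 0.
Proof. by case: F. Qed.

Lemma to_complex1 : to_complex (1 : K) = 1.
Proof. by case: F. Qed.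

(** Passing through [to_complex] gives both scalar fields one absolute value with values in [R]; the
    norm attached to [R[i]] as a numeric field takes its values in [R[i]]. *)
Definition nrm (x : K) : R := Normc.normc (to_complex x).

Lemma nrmM x y : nrm (x * y) = nrm x * nrm y.
Proof. by rewrite /nrm to_complexM Normc.normcM. Qed.

Lemma nrmN x : nrm (- x) = nrm x.
Proof. by rewrite /nrm to_complexN; exact: normcN. Qed.

Lemma ler_nrmD x y : nrm (x + y) <= nrm x + nrm y.
Proof. by rewrite /nrm to_complexD; exact: le_normcD. Qed.

Lemma nrm_ge0 x : 0 <= nrm x.
Proof. by rewrite /nrm; case: (to_complex x) => a b; exact: sqrtr_ge0. Qed.

Lemma nrm0 : nrm 0 = 0.
Proof. by rewrite /nrm to_complex0 Normc.normc0. Qed.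

Lemma nrm1 : nrm 1 = 1.
Proof. by rewrite /nrm to_complex1 Normc.normc1. Qed.

Lemma nrm_eq0 x : (nrm x == 0) = (x == 0).
Proof.
apply/eqP/eqP => [|->]; last exact: nrm0.
move=> /Normc.eq0_normc; case: F x => //= x [] //.
Qed.

Lemma nrm_gt0 x : (0 < nrm x) = (x != 0).
Proof. by rewrite lt_def nrm_eq0 nrm_ge0 andbT. Qed.

Lemma nrmV x : nrm x^-1 = (nrm x)^-1.
Proof.
have [->|x0] := eqVneq x 0; first by rewrite invr0 nrm0 invr0.
apply: (@mulIf _ (nrm x)); first by rewrite nrm_eq0.
by rewrite -nrmM mulVf // nrm1 mulVf // nrm_eq0.
Qed.

Lemma nrm_nat n : nrm n%:R = n%:R.
Proof.
have to_complexn : to_complex (n%:R : K) = n%:R.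
  elim: n => [|n IH]; first exact: to_complex0.
  by rewrite -natr1 to_complexD IH to_complex1 natr1.
have -> : (n%:R : R) = complex.Re (n%:R%:C)%C by [].
rewrite /nrm to_complexn -(rmorph_nat (real_complex R)) /=.
by rewrite expr0n addr0 sqrtr_sqr ger0_norm.
Qed.

Lemma ler_nrm_sum I (r : seq I) (P : pred I) (f : I -> K) :
  nrm (\sum_(i <- r | P i) f i) <= \sum_(i <- r | P i) nrm (f i).
Proof.
elim/big_rec2: _ => [|i y x _ le_xy]; first by rewrite nrm0.
by apply: le_trans (ler_nrmD _ _) _; rewrite lerD2l.
Qed.

End AbsoluteValue.

Arguments nrm {R F} x.

Lemma ultra_fmap (T U : Type) (f : T -> U) (G : set_system T) :
  UltraFilter G -> UltraFilter (f @ G).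
Proof.
move=> UG; split; first exact: fmap_proper_filter.
move=> H PH sH; apply/seteqP; split=> // A HA.
have [//|] := in_ultra_setVsetC (f @^-1` A) UG; rewrite preimage_setC => GC.
have : H (A `&` ~` A) by apply: filterI => //; exact: sH.
by rewrite setICr => /filter_not_empty.
Qed.

Section ScalarTopology.
Variables (R : realType).

Lemma nrm_realE (x : scalars R RealScalars) : nrm x = `|x|.
Proof. by rewrite /nrm /= expr0n addr0 sqrtr_sqr. Qed.

Lemma nrm_complexE (x : scalars R ComplexScalars) : (nrm x)%:C%C = `|x|.
Proof. by rewrite normc_def; case: x. Qed.

Lemma nbhs_nrm F (x : scalars R F) (A : set (scalars R F)) :
  nbhs x A <-> exists2 e : R, 0 < e & forall y, nrm (y - x) < e -> A y.
Proof.
rewrite -(@nbhs_ballE (scalars R F)); case: F x A => x A; split.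
- case=> e /= e0 sA; exists e => // y xy; apply: sA.
  by rewrite /ball /= distrC -nrm_realE.
- case=> e e0 sA; exists e => //= y; rewrite /ball /= distrC => xy.
  by apply: sA; rewrite nrm_realE.
(* A complex radius is positive only if it is real, so its real part describes the same ball. *)
- case=> e /= e0 sA; exists (complex.Re e); first by case: e e0 {sA} => a b; rewrite ltcE /= => /andP[].
  move=> y xy; apply: sA; rewrite /ball /= distrC -nrm_complexE.
  by case: e e0 xy => a b; rewrite !ltcE /= => /andP[/eqP-> _] ->; rewrite eqxx.
- case=> e e0 sA; exists (e%:C)%C => /=; first by rewrite ltcR.
  by move=> y; rewrite /ball /= distrC -nrm_complexE ltcR; exact: sA.
Qed.

(** The source of all limits of matrices and flags below. Segments are compact, so a bounded real
    family converges along an ultrafilter; the complex case treats real and imaginary parts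
    separately. *)
Lemma ultra_nrm_cvg F (I : Type) (G : set_system I) (f : I -> scalars R F) (M : R) :
  UltraFilter G -> G [set i | nrm (f i) <= M] ->
  exists x, forall e, 0 < e -> G [set i | nrm (f i - x) < e].
Proof.
have real_case (g : I -> R) (N : R) : UltraFilter G -> G [set i | `|g i| <= N] ->
    exists x, forall e, 0 < e -> G [set i | `|g i - x| < e].
  move=> UG GN; pose H := g @ G.
  have UH : UltraFilter H by exact: ultra_fmap.
  have cN : compact [set` `[- N, N]] by exact: segment_compact.
  rewrite compact_ultra in cN; have [|x [_ Hx]] := cN H UH.
    rewrite /H /nbhs /=; apply: filterS GN => i /=.
    by rewrite in_itv /= ler_norml.
  exists x => e e0; have := Hx _ (nbhsx_ballx x e e0).
  by rewrite /H /nbhs /=; apply: filterS => i; rewrite /ball /= distrC.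
case: F f => f UG GM.
  have [|x xP] := real_case f M UG.
    by apply: filterS GM => i /=; rewrite nrm_realE.
  by exists x => e /xP; apply: filterS => i /=; rewrite nrm_realE.
have le_Re (z : R[i]) : `|complex.Re z| <= Normc.normc z.
  case: z => a b /=; rewrite -sqrtr_sqr ler_wsqrtr // lerDl sqr_ge0 //.
have le_Im (z : R[i]) : `|complex.Im z| <= Normc.normc z.
  case: z => a b /=; rewrite -sqrtr_sqr ler_wsqrtr // lerDr sqr_ge0 //.
have [|x xP] := real_case (fun i => complex.Re (f i)) M UG.
  by apply: filterS GM => i /=; apply: le_trans; exact: le_Re.
have [|y yP] := real_case (fun i => complex.Im (f i)) M UG.
  by apply: filterS GM => i /=; apply: le_trans; exact: le_Im.
exists (x +i* y)%C => e e0; have e20 : 0 < e / 2 by rewrite divr_gt0.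
apply: filterS2 (xP _ e20) (yP _ e20) => i /= xi yi; rewrite /nrm /=.
case: (f i) xi yi => a b /= ax b_y.
apply: le_lt_trans (_ : `|a - x| + `|b - y| < e); last by rewrite [e]splitr ltrD.
have s0 := addr_ge0 (normr_ge0 (a - x)) (normr_ge0 (b - y)).
have -> : `|a - x| + `|b - y| = Num.sqrt ((`|a - x| + `|b - y|) ^+ 2).
  by rewrite sqrtr_sqr; symmetry; exact: (ger0_norm s0).
apply: ler_wsqrtr; rewrite [leRHS]sqrrD !real_normK ?num_real // [leRHS]addrAC lerDl.
by rewrite mulrn_wge0 // mulr_ge0.
Qed.

End ScalarTopology.

Section MatrixNorm.
Variables (R : realType) (F : scalar_kind).
Local Notation K := (scalars R F).

(** The entrywise sum is submultiplicative without a constant, also for rectangular blocks, and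
    additive over blocks ([mn_block]). The price is that the identity has norm [n]. *)
Definition mn m n (A : 'M[K]_(m, n)) : R := \sum_i \sum_j nrm (A i j).

Lemma mn_ge0 m n (A : 'M[K]_(m, n)) : 0 <= mn A.
Proof. by do 2 apply: sumr_ge0 => ? _; exact: nrm_ge0. Qed.

Lemma mn_entry m n (A : 'M[K]_(m, n)) i j : nrm (A i j) <= mn A.
Proof.
rewrite /mn (bigD1 i) //= (bigD1 j) //= -addrA lerDl addr_ge0 //.
  by apply: sumr_ge0 => ? _; exact: nrm_ge0.
by do 2 apply: sumr_ge0 => ? _; exact: nrm_ge0.
Qed.

Lemma mn_eq0 m n (A : 'M[K]_(m, n)) : (mn A == 0) = (A == 0).
Proof.
apply/eqP/eqP => [A0|->].
  apply/matrixP => i j; rewrite mxE; apply/eqP; rewrite -nrm_eq0.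
  by rewrite eq_le nrm_ge0 -A0 mn_entry.
by apply: big1 => i _; apply: big1 => j _; rewrite mxE nrm0.
Qed.

Lemma mn0 m n : mn (0 : 'M[K]_(m, n)) = 0.
Proof. by apply/eqP; rewrite mn_eq0. Qed.

Lemma mn_le m n (A : 'M[K]_(m, n)) e :
  (forall i j, nrm (A i j) <= e) -> mn A <= (m * n)%:R * e.
Proof.
move=> Ae; rewrite /mn; apply: (@le_trans _ _ (\sum_(i < m) \sum_(j < n) e)).
  by apply: ler_sum => i _; apply: ler_sum => j _.
by rewrite !sumr_const !card_ord -mulrnA mulr_natl mulnC.
Qed.

Lemma mnN m n (A : 'M[K]_(m, n)) : mn (- A) = mn A.
Proof. by apply: eq_bigr => i _; apply: eq_bigr => j _; rewrite mxE nrmN. Qed.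

Lemma ler_mnD m n (A B : 'M[K]_(m, n)) : mn (A + B) <= mn A + mn B.
Proof.
rewrite /mn -big_split; apply: ler_sum => i _; rewrite -big_split.
by apply: ler_sum => j _; rewrite mxE ler_nrmD.
Qed.

Lemma mnB m n (A B : 'M[K]_(m, n)) : mn (A - B) = mn (B - A).
Proof. by rewrite -mnN opprB. Qed.

Lemma ler_mnM m n p (A : 'M[K]_(m, n)) (B : 'M[K]_(n, p)) :
  mn (A *m B) <= mn A * mn B.
Proof.
rewrite {2}/mn mulr_suml; apply: ler_sum => i _; rewrite mulr_suml.
apply: (@le_trans _ _ (\sum_k \sum_j nrm (A i j) * nrm (B j k))).
  apply: ler_sum => k _; rewrite mxE; apply: le_trans (ler_nrm_sum _ _ _) _.
  by apply: ler_sum => j _; rewrite nrmM.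
rewrite exchange_big; apply: ler_sum => j _.
rewrite -mulr_sumr ler_wpM2l ?nrm_ge0 // /mn [leRHS](bigD1 j) //= lerDl.
by do 2 apply: sumr_ge0 => ? _; exact: nrm_ge0.
Qed.

Lemma mnM_le m n p (A : 'M[K]_(m, n)) (B : 'M[K]_(n, p)) a b :
  mn A <= a -> mn B <= b -> mn (A *m B) <= a * b.
Proof.
move=> Aa Bb; apply: le_trans (ler_mnM _ _) _.
by apply: ler_pM => //; exact: mn_ge0.
Qed.

Lemma mn_tr m n (A : 'M[K]_(m, n)) : mn A^T = mn A.
Proof.
rewrite /mn exchange_big; apply: eq_bigr => i _.
by apply: eq_bigr => j _; rewrite mxE.
Qed.

Lemma mn1 n : mn (1%:M : 'M[K]_n) = n%:R.
Proof.
have -> : n%:R = \sum_(i < n) (1 : R) by rewrite sumr_const card_ord.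
apply: eq_bigr => i _.
rewrite (bigD1 i) //= mxE eqxx nrm1 big1 ?addr0 // => j ji.
by rewrite mxE eq_sym (negbTE ji) nrm0.
Qed.

Lemma mn_block m1 m2 n1 n2 (A : 'M[K]_(m1, n1)) (B : 'M[K]_(m1, n2))
    (C : 'M[K]_(m2, n1)) (D : 'M[K]_(m2, n2)) :
  mn (block_mx A B C D) = mn A + mn B + (mn C + mn D).
Proof.
rewrite /mn big_split_ord /=; congr (_ + _); rewrite -big_split /=;
  apply: eq_bigr => i _; rewrite big_split_ord /=; congr (_ + _);
  apply: eq_bigr => j _.
- by rewrite block_mxEul.
- by rewrite block_mxEur.
- by rewrite block_mxEdl.
- by rewrite block_mxEdr.
Qed.

Section Submatrices.
Variables (m1 m2 n1 n2 : nat) (A : 'M[K]_(m1 + m2, n1 + n2)).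

Let mnA : mn A = mn (ulsubmx A) + mn (ursubmx A) + (mn (dlsubmx A) + mn (drsubmx A)).
Proof. by rewrite -mn_block submxK. Qed.

Lemma mn_ulsub : mn (ulsubmx A) <= mn A.
Proof. by rewrite mnA -addrA lerDl ?addr_ge0 ?mn_ge0. Qed.

Lemma mn_ursub : mn (ursubmx A) <= mn A.
Proof. by rewrite mnA [X in X + _]addrC -addrA lerDl ?addr_ge0 ?mn_ge0. Qed.

Lemma mn_dlsub : mn (dlsubmx A) <= mn A.
Proof. by rewrite mnA addrC -addrA lerDl ?addr_ge0 ?mn_ge0. Qed.

Lemma mn_drsub : mn (drsubmx A) <= mn A.
Proof. by rewrite mnA addrC [X in X + _]addrC -addrA lerDl ?addr_ge0 ?mn_ge0. Qed.

End Submatrices.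

(** Bounding the inverse too makes this a compact condition inside the invertible matrices: limits
    of such matrices stay invertible ([mcvg_bnd]). *)
Definition bnd n (c : R) (A : 'M[K]_n) : Prop :=
  [/\ A \in unitmx, mn A <= c & mn (invmx A) <= c].

Lemma bnd_le n c c' (A : 'M[K]_n) : c <= c' -> bnd c A -> bnd c' A.
Proof. by move=> cc' [uA Ac Vc]; split=> //; apply: le_trans cc'. Qed.

Lemma bnd_ge0 n c (A : 'M[K]_n) : bnd c A -> 0 <= c.
Proof. by case=> _ Ac _; apply: le_trans Ac; exact: mn_ge0. Qed.

Lemma bnd_inv n c (A : 'M[K]_n) : bnd c A -> bnd c (invmx A).
Proof. by case=> uA Ac Vc; split; rewrite ?unitmx_inv ?invmxK. Qed.

Lemma invmxM n (A B : 'M[K]_n) : A \in unitmx -> B \in unitmx ->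
  invmx (A *m B) = invmx B *m invmx A.
Proof.
move=> uA uB; have uAB : A *m B \in unitmx by rewrite unitmx_mul uA.
by rewrite -[RHS](mulKmx uAB) -!mulmxA (mulmxA B) mulmxV // mul1mx mulmxV // mulmx1.
Qed.

Lemma bnd_mul n a b (A B : 'M[K]_n) : bnd a A -> bnd b B -> bnd (a * b) (A *m B).
Proof.
case=> uA Aa VA [uB Bb VB]; split; first by rewrite unitmx_mul uA.
  exact: mnM_le.
by rewrite invmxM // mulrC; exact: mnM_le.
Qed.

Lemma bnd_tr n c (A : 'M[K]_n) : bnd c A -> bnd c A^T.
Proof. by case=> uA Ac Vc; split; rewrite ?unitmx_tr -?trmx_inv ?mn_tr. Qed.

Lemma bnd1 n : bnd n%:R (1%:M : 'M[K]_n).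
Proof. by split; rewrite ?unitmx1 ?invmx1 ?mn1. Qed.

(** No Neumann series is summed: a kernel vector satisfies [v = - v E], so its norm is at most half
    of itself, and the bound on the inverse [N] follows by absorbing [E N] in [N = 1 - E N]. *)
Lemma unitmx_near1 n (E : 'M[K]_n) : mn E <= 1 / 2 ->
  1%:M + E \in unitmx /\ mn (invmx (1%:M + E)) <= 2 * n%:R.
Proof.
move=> E2; have uE : 1%:M + E \in unitmx.
  rewrite -row_free_unit; apply: inj_row_free => v.
  rewrite mulmxDr mulmx1 => /eqP; rewrite addr_eq0 => /eqP vE.
  apply/eqP; rewrite -mn_eq0 eq_le mn_ge0 andbT.
  have : mn v <= mn v * (1 / 2) by rewrite {1}vE mnN; exact: mnM_le.
  have := mn_ge0 v; lra.
split=> //; set N := invmx _.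
have NE : N = 1%:M - E *m N.
  by apply/eqP; rewrite eq_sym subr_eq -{1}[N]mul1mx -mulmxDl mulmxV.
have : mn N <= n%:R + 1 / 2 * mn N.
  rewrite {1}NE; apply: le_trans (ler_mnD _ _) _.
  by rewrite mn1 mnN lerD2l; exact: mnM_le.
lra.
Qed.

Lemma unitmx_near n c (A B : 'M[K]_n) : A \in unitmx -> mn (invmx A) <= c ->
  c * mn (B - A) <= 1 / 2 -> B \in unitmx /\ mn (invmx B) <= 2 * n%:R * c.
Proof.
move=> uA Ac cBA; pose E := invmx A *m (B - A).
have BE : B = A *m (1%:M + E).
  by rewrite mulmxDr mulmx1 mulKVmx // addrC subrK.
have [|uE VE] := @unitmx_near1 _ E.
  by apply: le_trans (ler_mnM _ _) (le_trans _ cBA); rewrite ler_wpM2r ?mn_ge0.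
by rewrite BE unitmx_mul uA uE invmxM //; split=> //; exact: mnM_le.
Qed.

Section Convergence.
Variables (I : Type) (G : set_system I).
Context {PG : ProperFilter G}.

(** Stated with the real-valued norm so that one notion serves both scalar fields and any index
    filter; [nbhs_mn] and [mcvg_nbhs] link it to the matrix topology. *)
Definition mcvg m n (A_ : I -> 'M[K]_(m, n)) (A : 'M[K]_(m, n)) : Prop :=
  forall e, 0 < e -> G [set i | mn (A_ i - A) < e].

Lemma mcvg_cst m n (A : 'M[K]_(m, n)) : mcvg (fun=> A) A.
Proof. by move=> e e0; apply: filterS filterT => i _ /=; rewrite subrr mn0. Qed.

Lemma mcvg_near m n (A_ B_ : I -> 'M[K]_(m, n)) A :
  G [set i | A_ i = B_ i] -> mcvg A_ A -> mcvg B_ A.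
Proof. by move=> AB cA e /cA; apply: filterS2 AB => i /= ->. Qed.

Lemma mcvg_squeeze m n (A_ : I -> 'M[K]_(m, n)) A (f : I -> R) :
  (forall e, 0 < e -> G [set i | f i < e]) ->
  G [set i | mn (A_ i - A) <= f i] -> mcvg A_ A.
Proof. by move=> cf Af e /cf; apply: filterS2 Af => i /=; exact: le_lt_trans. Qed.

Lemma mcvg_unique m n (A_ : I -> 'M[K]_(m, n)) A B :
  mcvg A_ A -> mcvg A_ B -> A = B.
Proof.
move=> cA cB; apply/eqP; rewrite -subr_eq0 -mn_eq0 eq_le mn_ge0 andbT.
apply/ler_addgt0Pl => e e0; rewrite addr0.
have e20 : 0 < e / 2 by rewrite divr_gt0.
have [i [/= Ai Bi]] := filter_ex (filterI (cA _ e20) (cB _ e20)).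
have -> : A - B = (A - A_ i) + (A_ i - B) by rewrite addrA subrK.
apply: le_trans (ler_mnD _ _) _; rewrite [e]splitr.
by apply: lerD; rewrite ltW // mnB.
Qed.

Lemma mcvg_le m n (A_ : I -> 'M[K]_(m, n)) A c :
  mcvg A_ A -> G [set i | mn (A_ i) <= c] -> mn A <= c.
Proof.
move=> cA Ac; apply/ler_addgt0Pl => e e0.
have [i [/= Ai Aic]] := filter_ex (filterI (cA _ e0) Ac).
have -> : A = (A - A_ i) + A_ i by rewrite subrK.
by apply: le_trans (ler_mnD _ _) _; rewrite lerD // ltW // mnB.
Qed.

Lemma mcvgM m n p (A_ : I -> 'M[K]_(m, n)) (B_ : I -> 'M[K]_(n, p)) A B :
  mcvg A_ A -> mcvg B_ B -> mcvg (fun i => A_ i *m B_ i) (A *m B).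
Proof.
move=> cA cB e e0; pose N := 1 + mn A + mn B.
have N0 : 0 < N by have := mn_ge0 A; have := mn_ge0 B; rewrite /N; lra.
have eN : 0 < e / (2 * N) by rewrite divr_gt0 // mulr_gt0.
apply: filterS3 (cA _ ltr01) (cA _ eN) (cB _ eN) => i /= A1 Ai Bi.
have -> : A_ i *m B_ i - A *m B = A_ i *m (B_ i - B) + (A_ i - A) *m B.
  by rewrite mulmxBr mulmxBl addrA subrK.
have AiN : mn (A_ i) <= N.
  have -> : A_ i = (A_ i - A) + A by rewrite subrK.
  apply: le_trans (ler_mnD _ _) _; rewrite /N.
  by have := mn_ge0 B; lra.
have BN : mn B <= N by rewrite /N; have := mn_ge0 A; lra.
apply: le_lt_trans (ler_mnD _ _) _.
have -> : e = N * (e / (2 * N)) + (e / (2 * N)) * N by field; lra.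
apply: ltr_leD.
  apply: le_lt_trans (ler_mnM _ _) _.
  apply: le_lt_trans (ler_wpM2r (mn_ge0 _) AiN) _.
  by rewrite ltr_pM2l.
apply: le_trans (ler_mnM _ _) _; apply: ler_pM; rewrite ?mn_ge0 //.
exact: ltW.
Qed.

Lemma mcvg_inv n (A_ : I -> 'M[K]_n) A : A \in unitmx ->
  mcvg A_ A -> mcvg (fun i => invmx (A_ i)) (invmx A).
Proof.
move=> uA cA; pose c := 1 + mn (invmx A).
have c0 : 0 < c by rewrite /c; have := mn_ge0 (invmx A); lra.
have d0 : 0 < 1 / (2 * c) by rewrite divr_gt0 // mulr_gt0.
have near : G [set i | A_ i \in unitmx /\ mn (invmx (A_ i)) <= 2 * n%:R * c].
  apply: filterS (cA _ d0) => i /= Ai.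
  apply: (unitmx_near uA); first by rewrite /c; lra.
  apply: le_trans (ler_wpM2l (ltW c0) (ltW Ai)) _.
  by rewrite le_eqVlt; apply/orP; left; apply/eqP; field; lra.
pose f i := 2 * n%:R * c * c * mn (A_ i - A).
apply: (@mcvg_squeeze _ _ _ _ f).
  move=> e e0; pose N := 1 + 2 * n%:R * c * c.
  have N0 : 0 < N.
    by have := ltW c0; rewrite /N => c0'; rewrite ltr_wpDr // !mulr_ge0.
  have eN : 0 < e / N by rewrite divr_gt0.
  apply: filterS (cA _ eN) => i /= Ai; rewrite /f.
  apply: le_lt_trans (_ : N * mn (A_ i - A) < e).
    by apply: ler_wpM2r; rewrite ?mn_ge0 // /N; lra.
  by rewrite mulrC -ltr_pdivlMr.
apply: filterS near => i /= [ui Vi].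
have -> : invmx (A_ i) - invmx A = - (invmx (A_ i) *m ((A_ i - A) *m invmx A)).
  by rewrite mulmxBl mulmxBr mulKmx // mulmxV // mulmx1 opprB.
rewrite mnN /f -mulrA; apply: mnM_le => //.
rewrite mulrC; apply: mnM_le => //; rewrite /c; lra.
Qed.

Lemma mcvg_tr m n (A_ : I -> 'M[K]_(m, n)) A :
  mcvg A_ A -> mcvg (fun i => (A_ i)^T) A^T.
Proof. by move=> cA e /cA; apply: filterS => i /=; rewrite -linearB mn_tr. Qed.

Lemma mcvg_ulsub m1 m2 n1 n2 (A_ : I -> 'M[K]_(m1 + m2, n1 + n2)) A :
  mcvg A_ A -> mcvg (fun i => ulsubmx (A_ i)) (ulsubmx A).
Proof.
move=> cA e /cA; apply: filterS => i /=; apply: le_lt_trans.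
have -> : ulsubmx (A_ i) - ulsubmx A = ulsubmx (A_ i - A).
  by apply/matrixP => s t; rewrite !mxE.
exact: mn_ulsub.
Qed.

Lemma mcvg_dlsub m1 m2 n1 n2 (A_ : I -> 'M[K]_(m1 + m2, n1 + n2)) A :
  mcvg A_ A -> mcvg (fun i => dlsubmx (A_ i)) (dlsubmx A).
Proof.
move=> cA e /cA; apply: filterS => i /=; apply: le_lt_trans.
have -> : dlsubmx (A_ i) - dlsubmx A = dlsubmx (A_ i - A).
  by apply/matrixP => s t; rewrite !mxE.
exact: mn_dlsub.
Qed.

Lemma mcvg_ursub m1 m2 n1 n2 (A_ : I -> 'M[K]_(m1 + m2, n1 + n2)) A :
  mcvg A_ A -> mcvg (fun i => ursubmx (A_ i)) (ursubmx A).
Proof.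
move=> cA e /cA; apply: filterS => i /=; apply: le_lt_trans.
have -> : ursubmx (A_ i) - ursubmx A = ursubmx (A_ i - A).
  by apply/matrixP => s t; rewrite !mxE.
exact: mn_ursub.
Qed.

Lemma mcvg_entry0 m n (A_ : I -> 'M[K]_(m, n)) A i j : mcvg A_ A ->
  (forall e, 0 < e -> G [set s | nrm (A_ s i j) < e]) -> A i j = 0.
Proof.
move=> cA c0; apply/eqP; rewrite -nrm_eq0 eq_le nrm_ge0 andbT.
apply/ler_addgt0Pl => e e0; rewrite addr0.
have e20 : 0 < e / 2 by rewrite divr_gt0.
have [s [/= As A0]] := filter_ex (filterI (cA _ e20) (c0 _ e20)).
have -> : A i j = (A - A_ s) i j + A_ s i j by rewrite !mxE subrK.
apply: le_trans (ler_nrmD _ _) _; rewrite [e]splitr; apply: lerD (ltW A0).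
by apply: le_trans (mn_entry _ _ _) _; rewrite mnB ltW.
Qed.

(** A single [A_ i] closer to [A] than [1 / (2 * c')], with inverse bounded by [c'], already forces
    [A] to be invertible. Taking [c' = 1 + |c|] makes this radius positive whatever the sign of
    [c]. *)
Lemma mcvg_inv_le n c (A_ : I -> 'M[K]_n) A :
  G [set i | A_ i \in unitmx /\ mn (invmx (A_ i)) <= c] -> mcvg A_ A ->
  A \in unitmx /\ mn (invmx A) <= c.
Proof.
move=> bA cA; pose c' := 1 + `|c|.
have c'0 : 0 < c' by rewrite /c' ltr_wpDr.
have d0 : 0 < 1 / (2 * c') by rewrite divr_gt0 // mulr_gt0.
have [i [/= [ui Vi] Ai]] := filter_ex (filterI bA (cA _ d0)).
have uA : A \in unitmx.
  have [] // := unitmx_near (c := c') (B := A) ui _ _.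
    by apply: le_trans Vi _; rewrite /c'; have := ler_norm c; lra.
  rewrite mnB; apply: le_trans (ler_wpM2l (ltW c'0) (ltW Ai)) _.
  by rewrite le_eqVlt; apply/orP; left; apply/eqP; field; lra.
split=> //; apply: mcvg_le (mcvg_inv uA cA) _.
by apply: filterS bA => j [].
Qed.

Lemma mcvg_bnd n c (A_ : I -> 'M[K]_n) A :
  G [set i | bnd c (A_ i)] -> mcvg A_ A -> bnd c A.
Proof.
move=> bA cA; have [|uA Vc] := mcvg_inv_le _ cA (c := c).
  by apply: filterS bA => i [].
by split=> //; apply: mcvg_le cA _; apply: filterS bA => i [].
Qed.

End Convergence.

Lemma mcvg_ultra I (G : set_system I) (UG : UltraFilter G) m n c
    (A_ : I -> 'M[K]_(m, n)) :
  G [set i | mn (A_ i) <= c] -> exists A, mcvg G A_ A.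
Proof.
move=> Ac; have /choice[f fP] : forall i, exists x : 'I_n -> K,
    forall j, forall e, 0 < e -> G [set s | nrm (A_ s i j - x j) < e].
  move=> i.
  have /choice[x xP] : forall j, exists x, forall e, 0 < e ->
      G [set s | nrm (A_ s i j - x) < e]; last by exists x.
  move=> j.
  apply: (ultra_nrm_cvg (M := c)); apply: filterS Ac => s /=.
  exact: le_trans (mn_entry _ _ _).
exists (\matrix_(i, j) f i j) => e e0.
pose d := e / (m * n).+1%:R; have d0 : 0 < d by rewrite divr_gt0.
have : G [set s | forall i j, nrm (A_ s i j - f i j) < d].
  by do 2 apply: filter_forall => ?; exact: fP.
apply: filterS => s /= As.
apply: (@le_lt_trans _ _ ((m * n)%:R * d)).
  by apply: mn_le => i j; rewrite !mxE ltW.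
rewrite /d mulrA ltr_pdivrMr // mulrC ltr_pM2l // ltr_nat //.
Qed.

Lemma mcvg_bnd_ultra I (G : set_system I) (UG : UltraFilter G) n c
    (A_ : I -> 'M[K]_n) :
  G [set i | bnd c (A_ i)] -> exists2 A, mcvg G A_ A & bnd c A.
Proof.
move=> bA; have [|A cA] := mcvg_ultra UG (A_ := A_) (c := c).
  by apply: filterS bA => i [].
by exists A => //; apply: mcvg_bnd bA cA.
Qed.

End MatrixNorm.

(** * Bounded decompositions *)

Section Decompositions.
Variables (R : realType) (F : scalar_kind).
Local Notation K := (scalars R F).

Definition lower k m (T : 'M[K]_(m, k)) : 'M[K]_(k + m) := block_mx 1%:M 0 T 1%:M.
Definition upper k m (T : 'M[K]_(k, m)) : 'M[K]_(k + m) := block_mx 1%:M T 0 1%:M.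
Definition bdiag k m (Y : 'M[K]_k) (Z : 'M[K]_m) : 'M[K]_(k + m) := block_mx Y 0 0 Z.

Lemma bnd_of_inv n c (A B : 'M[K]_n) :
  A *m B = 1%:M -> mn A <= c -> mn B <= c -> bnd c A.
Proof.
move=> AB Ac Bc; have [uA uB] := mulmx1_unit AB; split=> //.
by have -> : invmx A = B by rewrite -[RHS](mulKmx uA) AB mulmx1.
Qed.

Lemma lowerM k m (T T' : 'M[K]_(m, k)) : lower T *m lower T' = lower (T + T').
Proof.
rewrite /lower mulmx_block !mulmx1 !mul1mx !(mulmx0, mul0mx) ?addr0 ?add0r.
by rewrite addrC.
Qed.

Lemma upperM k m (T T' : 'M[K]_(k, m)) : upper T *m upper T' = upper (T + T').
Proof.
rewrite /upper mulmx_block !mulmx1 !mul1mx !(mulmx0, mul0mx) ?addr0 ?add0r.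
by rewrite addrC.
Qed.

Lemma bdiagM k m (Y Y' : 'M[K]_k) (Z Z' : 'M[K]_m) :
  bdiag Y Z *m bdiag Y' Z' = bdiag (Y *m Y') (Z *m Z').
Proof. by rewrite /bdiag mulmx_block !(mulmx0, mul0mx) ?addr0 ?add0r. Qed.

Lemma lower0 k m : lower (0 : 'M[K]_(m, k)) = 1%:M.
Proof. by rewrite /lower -scalar_mx_block. Qed.

Lemma upper0 k m : upper (0 : 'M[K]_(k, m)) = 1%:M.
Proof. by rewrite /upper -scalar_mx_block. Qed.

Lemma bdiag1 k m : bdiag (1%:M : 'M[K]_k) (1%:M : 'M[K]_m) = 1%:M.
Proof. by rewrite /bdiag -scalar_mx_block. Qed.

Lemma lower_tr k m (T : 'M[K]_(m, k)) : (lower T)^T = upper T^T.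
Proof. by rewrite /lower tr_block_mx !trmx1 trmx0. Qed.

Lemma bdiag_tr k m (Y : 'M[K]_k) (Z : 'M[K]_m) : (bdiag Y Z)^T = bdiag Y^T Z^T.
Proof. by rewrite /bdiag tr_block_mx !trmx0. Qed.

Lemma bnd_lower k m t (T : 'M[K]_(m, k)) :
  mn T <= t -> bnd ((k + m)%:R + t) (lower T).
Proof.
move=> Tt; apply: (@bnd_of_inv _ _ _ (lower (- T))).
- by rewrite lowerM subrr lower0.
- rewrite /lower mn_block mn0 !mn1 natrD; lra.
- rewrite /lower mn_block mn0 !mn1 natrD mnN; lra.
Qed.

Lemma bnd_upper k m t (T : 'M[K]_(k, m)) :
  mn T <= t -> bnd ((k + m)%:R + t) (upper T).
Proof.
move=> Tt; apply: (@bnd_of_inv _ _ _ (upper (- T))).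
- by rewrite upperM subrr upper0.
- rewrite /upper mn_block mn0 !mn1 natrD; lra.
- rewrite /upper mn_block mn0 !mn1 natrD mnN; lra.
Qed.

Lemma bnd_bdiag k m a b (Y : 'M[K]_k) (Z : 'M[K]_m) :
  bnd a Y -> bnd b Z -> bnd (a + b) (bdiag Y Z).
Proof.
case=> uY Ya VYa [uZ Zb VZb].
apply: (@bnd_of_inv _ _ _ (bdiag (invmx Y) (invmx Z))).
- by rewrite bdiagM !mulmxV // bdiag1.
- rewrite /bdiag mn_block !mn0; lra.
- rewrite /bdiag mn_block !mn0; lra.
Qed.

Lemma bnd_tperm n (i j : 'I_n) : bnd (n * n)%:R (tperm_mx i j : 'M[K]_n).
Proof.
have le1 : mn (tperm_mx i j : 'M[K]_n) <= (n * n)%:R.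
  rewrite -[leRHS]mulr1; apply: mn_le => s t; rewrite !mxE.
  by case: eqP => _; rewrite ?nrm1 ?nrm0.
apply: (@bnd_of_inv _ _ _ (tperm_mx i j)) => //.
by rewrite /tperm_mx -perm_mxM tperm2 perm_mx1.
Qed.

Lemma tperm_mxK n m (i j : 'I_n) (A : 'M[K]_(n, m)) :
  tperm_mx i j *m (tperm_mx i j *m A) = A.
Proof. by rewrite mulmxA /tperm_mx -perm_mxM tperm2 perm_mx1 mul1mx. Qed.

Section Schur.
Variables (n : nat) (a : K) (r : 'rV[K]_n) (c : 'cV[K]_n) (B : 'M[K]_n).
Hypothesis a0 : a != 0.

Definition schur : 'M[K]_n := B - a^-1 *: (c *m r).

Lemma block_lower_schur :
  block_mx a%:M r c B = lower (a^-1 *: c) *m block_mx a%:M r 0 schur.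
Proof.
rewrite /lower mulmx_block !mul1mx !(mulmx0, mul0mx) ?addr0 ?add0r.
by rewrite mul_mx_scalar scalerA divff // scale1r /schur -scalemxAl addrC subrK.
Qed.

Lemma block_schur_upper :
  block_mx a%:M r 0 schur = bdiag a%:M schur *m upper (a^-1 *: r).
Proof.
rewrite /bdiag /upper mulmx_block !mulmx1 !(mulmx0, mul0mx) ?addr0 ?add0r.
by rewrite mul_scalar_mx scalerA divff // scale1r.
Qed.

End Schur.

(** Gaussian elimination with complete pivoting: the pivot [a] is a largest entry, so all
    multipliers have modulus at most 1. The later diagonal entries need not be smaller than the
    pivot, only smaller than a fixed multiple [N] of it; storing [N * a] on the diagonal and [N^-1]
    in [U] restores the sorting and costs only a constant. *)
Theorem bounded_udv n : exists c, forall A : 'M[K]_n,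
  exists U V, exists D : 'rV[K]_n,
  [/\ bnd c U, bnd c V, A = U *m diag_mx D *m V &
      forall i j : 'I_n, (i <= j)%N -> nrm (D 0 j) <= nrm (D 0 i)].
Proof.
elim: n => [|n [c0 IH]].
  exists 0 => A; exists 1%:M, 1%:M, 0; split; try exact: bnd1.
    by rewrite [LHS]flatmx0 [RHS]flatmx0.
  by case.
(* The middle factor, times the modulus of the pivot, bounds the Schur complement; the two [c0] come
   from solving for its diagonal part by the inverses of [U'] and [V']. *)
pose M := c0 * ((n * n)%:R * 2) * c0.
pose N := Num.bound `|M|.
have MN : M <= N%:R.
  by apply: le_trans (ler_norm _) (ltW (archi_boundP (normr_ge0 M))).
have N0 : (0 < N)%N.
  by rewrite -(ltr_nat R); exact: le_lt_trans (normr_ge0 M) (archi_boundP (normr_ge0 M)).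
pose p : R := (n.+1 * n.+1)%:R.
pose t : R := (1 + n)%:R + n%:R.
pose u : R := N%:R + 1 + c0.
exists (Num.max (n.+1%:R) (Num.max (p * t * u) (u * t * p))) => A.
have [->|A0] := eqVneq A 0.
  exists 1%:M, 1%:M, 0; split.
  - by apply: bnd_le (bnd1 _ _ _); rewrite le_max lexx.
  - by apply: bnd_le (bnd1 _ _ _); rewrite le_max lexx.
  - by rewrite mulmx1 mul1mx; apply/matrixP => i j; rewrite !mxE mul0rn.
  - by move=> i j _; rewrite !mxE.
pose f (p : 'I_n.+1 * 'I_n.+1) := nrm (A p.1 p.2).
pose q := [arg max_(q > (0, 0)) f q]%O.
have fq s v : nrm (A s v) <= f q.
  by rewrite /q; case: Order.TotalTheory.arg_maxP => //= q' _ /(_ (s, v)); apply.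
have a0 : A q.1 q.2 != 0.
  apply: contra A0 => /eqP a0; apply/eqP/matrixP => s v; rewrite mxE; apply/eqP.
  by rewrite -nrm_eq0 eq_le nrm_ge0 andbT; have := fq s v; rewrite /f a0 nrm0.
have [A' A'def] : exists B : 'M[K]_(1 + n),
  B = tperm_mx 0 q.1 *m A *m tperm_mx 0 q.2 by eexists.
have A'E s v : A' s v = A (tperm 0 q.1 s) (tperm 0 q.2 v).
  by rewrite A'def -xrowE -xcolE !mxE.
have A'q s v : nrm (A' s v) <= f q by rewrite A'E.
pose a := A q.1 q.2; pose r := ursubmx A'; pose c := dlsubmx A'.
pose S := schur a r c (drsubmx A').
have A'blk : A' = lower (a^-1 *: c) *m (bdiag a%:M S *m upper (a^-1 *: r)).
  rewrite -block_schur_upper // -block_lower_schur // -[LHS]submxK.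
  congr block_mx; apply/matrixP => s v; rewrite !ord1 !mxE eqxx mulr1n.
  by rewrite A'E !lshift0 !tpermL.
have fa : f q = nrm a by [].
have nrma : 0 < nrm a by rewrite nrm_gt0.
have mnr : mn (a^-1 *: r) <= n%:R.
  rewrite -[leRHS]mulr1 -[n in leRHS]mul1n; apply: mn_le => s v; rewrite !mxE nrmM nrmV.
  by rewrite mulrC ler_pdivrMr // mul1r -fa.
have mnc : mn (a^-1 *: c) <= n%:R.
  rewrite -[leRHS]mulr1 -[n in leRHS]muln1; apply: mn_le => s v; rewrite !mxE nrmM nrmV.
  by rewrite mulrC ler_pdivrMr // mul1r -fa.
have mnS : mn S <= (n * n)%:R * 2 * nrm a.
  rewrite -mulrA; apply: mn_le => s v; rewrite /S /schur !mxE big_ord1 !mxE.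
  apply: le_trans (ler_nrmD _ _) _; rewrite nrmN !nrmM nrmV.
  rewrite [X in _ <= X * _](_ : 2 = 1 + 1) // mulrDl mul1r lerD // ?A'q //.
  rewrite mulrC ler_pdivrMr //; apply: ler_pM; rewrite ?nrm_ge0 //; exact: A'q.
have [U' [V' [D' [bU' bV' SE D'sort]]]] := IH S.
have c00 := bnd_ge0 bU'.
have D'le s : nrm (D' 0 s) <= N%:R * nrm a.
  apply: (@le_trans _ _ (M * nrm a)); last by rewrite ler_wpM2r // nrm_ge0.
  have -> : D' 0 s = diag_mx D' s s by rewrite mxE eqxx mulr1n.
  apply: le_trans (mn_entry _ _ _) _.
  have [uU _ VU] := bU'; have [uV _ VV] := bV'.
  have -> : diag_mx D' = invmx U' *m S *m invmx V'.
    by rewrite SE -!mulmxA mulmxV // mulmx1 mulKmx.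
  have -> : M * nrm a = c0 * ((n * n)%:R * 2 * nrm a) * c0 by rewrite /M; ring.
  by apply: mnM_le => //; exact: mnM_le.
have NK : (N%:R : K) != 0 by rewrite -nrm_eq0 nrm_nat pnatr_eq0 -lt0n.
have bN : bnd N%:R ((N%:R^-1 : K)%:M : 'M[K]_1).
  have mns (x : K) : mn (x%:M : 'M[K]_1) = nrm x.
    by rewrite /mn !big_ord1 mxE eqxx mulr1n.
  apply: (@bnd_of_inv _ _ _ (N%:R)%:M); rewrite ?mns ?nrmV ?nrm_nat //.
    by rewrite -scalar_mxM mulVf.
  by rewrite (@le_trans _ _ 1) ?ler1n // invf_le1 ?ltr0n // ler1n.
exists (tperm_mx 0 q.1 *m lower (a^-1 *: c) *m bdiag (N%:R^-1)%:M U').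
exists (bdiag 1%:M V' *m upper (a^-1 *: r) *m tperm_mx 0 q.2).
exists (row_mx (N%:R * a)%:M D'); split.
- apply: bnd_le (_ : p * t * u <= _) _; first by rewrite !le_max lexx !orbT.
  apply: bnd_mul; first by apply: bnd_mul; [exact: bnd_tperm|exact: (bnd_lower mnc)].
  apply: bnd_le (bnd_bdiag bN bU'); rewrite /u; lra.
- apply: bnd_le (_ : u * t * p <= _) _; first by rewrite !le_max lexx !orbT.
  apply: bnd_mul; last exact: bnd_tperm.
  apply: bnd_mul; last exact: (bnd_upper mnr).
  apply: bnd_le (bnd_bdiag (bnd1 _ _ 1) bV').
  by rewrite /u; have := ler0n R N; lra.
- have AA' : A = tperm_mx 0 q.1 *m A' *m tperm_mx 0 q.2.
    rewrite A'def -(mulmxA _ A) tperm_mxK -mulmxA; apply: trmx_inj.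
    rewrite !trmx_mul; have -> : (tperm_mx 0 q.2)^T = tperm_mx 0 q.2 :> 'M[K]_n.+1.
      by rewrite /tperm_mx tr_perm_mx tpermV.
    by rewrite -mulmxA tperm_mxK.
  rewrite {1}AA' A'blk.
  have -> : diag_mx (row_mx (N%:R * a)%:M D' : 'rV[K]_n.+1) =
      block_mx (diag_mx (N%:R * a)%:M) 0 0 (diag_mx D').
    exact: (@diag_mx_row _ n 1 (N%:R * a)%:M D').
  have -> : bdiag a%:M S = bdiag (N%:R^-1)%:M U' *m
      block_mx (diag_mx (N%:R * a)%:M) 0 0 (diag_mx D') *m bdiag 1%:M V'.
    have -> : diag_mx (N%:R * a)%:M = (N%:R * a)%:M :> 'M[K]_1.
      by apply/matrixP => s v; rewrite !ord1 !mxE.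
    rewrite -[block_mx (_ * _)%:M _ _ _]/(bdiag _ _) !bdiagM -SE mulmx1.
    by rewrite -scalar_mxM mulrA mulVf // mul1r.
  by rewrite !mulmxA.
- have DE (s : 'I_(1 + n)) : (row_mx (N%:R * a)%:M D' : 'rV[K]_(1 + n)) 0 s =
      match fintype.split s with inl _ => N%:R * a | inr v => D' 0 v end.
    by rewrite mxE; case: fintype.splitP => // v _; rewrite !ord1 mxE eqxx mulr1n.
  move=> s v; rewrite (DE s) (DE v).
  case: (@fintype.splitP 1 n s) => s' sE; case: (@fintype.splitP 1 n v) => v' vE //.
  + by move=> _; rewrite nrmM nrm_nat; exact: D'le.
  + by rewrite sE vE; case: v' {vE} => -[].
  + by rewrite sE vE leq_add2l => /D'sort.
Qed.

(** Gaussian elimination with row exchanges: the pivot is a largest entry of its column, so the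
    multipliers stay bounded and the size of [A] goes into the triangular factor. A triangular
    change of basis keeps the spans of the initial columns, hence every flag has a frame in one
    fixed compact set of matrices. *)
Theorem bounded_lu n : exists c, forall A : 'M[K]_n, A \in unitmx ->
  exists2 g, bnd c g & forall i j : 'I_n, (j < i)%N -> (invmx g *m A) i j = 0.
Proof.
elim: n => [|n [c0 IH]].
  by exists 0 => A _; exists 1%:M; [exact: bnd1|case].
exists ((n.+1 * n.+1)%:R * ((1 + n)%:R + n%:R) * (1 + c0)) => A uA.
pose q := [arg max_(q > 0) nrm (A q 0)]%O.
have fq s : nrm (A s 0) <= nrm (A q 0).
  by rewrite /q; case: Order.TotalTheory.arg_maxP => //= q' _ /(_ s); apply.
pose a := A q 0.
have a0 : a != 0.
  apply/negP => /eqP a0; have : col 0 A = 0.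
    apply/matrixP => s v; rewrite !mxE; apply/eqP.
    by rewrite -nrm_eq0 eq_le nrm_ge0 andbT; have := fq s; rewrite -/a a0 nrm0.
  rewrite colE => /(congr1 (mulmx (invmx A))); rewrite mulmx0 mulKmx //.
  by move=> /matrixP /(_ 0 0); rewrite !mxE !eqxx => /eqP; rewrite oner_eq0.
have [A' A'def] : exists B : 'M[K]_(1 + n), B = tperm_mx 0 q *m A by eexists.
have A'E s v : A' s v = A (tperm 0 q s) v by rewrite A'def -xrowE !mxE.
pose r := ursubmx A'; pose c := dlsubmx A'.
pose S := schur a r c (drsubmx A').
have A'blk : A' = lower (a^-1 *: c) *m block_mx a%:M r 0 S.
  rewrite -block_lower_schur // -[LHS]submxK.
  congr block_mx; apply/matrixP => s v; rewrite !ord1 !mxE eqxx mulr1n.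
  by rewrite A'E !lshift0 !tpermL.
have mnc : mn (a^-1 *: c) <= n%:R.
  rewrite -[leRHS]mulr1 -[n in leRHS]muln1; apply: mn_le => s v; rewrite !mxE nrmM nrmV.
  by rewrite mulrC ler_pdivrMr ?nrm_gt0 // mul1r A'E ord1 lshift0.
have bL := bnd_lower mnc.
have uS : S \in unitmx.
  have : A' \in unitmx.
    by rewrite A'def unitmx_mul uA andbT; case: (bnd_tperm 0 q).
  rewrite A'blk unitmx_mul => /andP[_].
  by rewrite !unitmxE det_ublock unitrM => /andP[].
have [g' bg' g'S] := IH S uS.
have [ug' _ _] := bg'; have [uL _ _] := bL.
have bB : bnd (1 + c0) (bdiag (1%:M : 'M[K]_1) g').
  by apply: bnd_le (bnd_bdiag (bnd1 _ _ 1) bg').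
have [uB _ _] := bB; have [uT _ _] := bnd_tperm 0 q.
exists (tperm_mx 0 q *m lower (a^-1 *: c) *m bdiag 1%:M g').
  by apply: bnd_mul => //; apply: bnd_mul => //; exact: bnd_tperm.
have -> : invmx (tperm_mx 0 q *m lower (a^-1 *: c) *m bdiag 1%:M g') *m A =
    block_mx a%:M r 0 (invmx g' *m S).
  have -> : A = tperm_mx 0 q *m A' by rewrite A'def tperm_mxK.
  rewrite A'blk.
  have -> : block_mx a%:M r 0 S = bdiag 1%:M g' *m block_mx a%:M r 0 (invmx g' *m S).
    by rewrite /bdiag mulmx_block !mul1mx !(mulmx0, mul0mx) ?addr0 ?add0r mulKVmx.
  set Y := block_mx a%:M r 0 (_ *m _); set P := _ *m bdiag _ _.
  have -> : tperm_mx 0 q *m (lower (a^-1 *: c) *m (bdiag 1%:M g' *m Y)) = P *m Y.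
    by rewrite /P !mulmxA.
  by rewrite mulKmx // !unitmx_mul uT uL.
move=> s v; rewrite -[s](@fintype.splitK 1 n) -[v](@fintype.splitK 1 n).
case: (@fintype.splitP 1 n s) => s' sE; case: (@fintype.splitP 1 n v) => v' vE /=.
- by rewrite !ord1.
- by rewrite ord1.
- by move=> _; apply: etrans (block_mxEdl _ _ _ _ _ _) _; rewrite mxE.
- rewrite ltn_add2l => /g'S sv0.
  exact: etrans (block_mxEdr _ _ _ _ _ _) sv0.
Qed.

End Decompositions.

(** * Singular values *)

Section SortedCount.
Variable R : realType.

Lemma count_sorted_ge (s : seq R) (t : R) k :
  sorted (fun x y => y <= x) s -> (0 < k)%N ->
  (k <= count (fun x => (t <= x)%R) s)%N -> t <= nth 0 s k.-1.
Proof.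
case: k => // k ss _ /= kt; rewrite leNgt; apply/negP => lt_t.
have ks : (k < size s)%N by apply: leq_trans kt (count_size _ _).
move: kt; rewrite -(cat_take_drop k s) count_cat => kt.
have d0 : count (fun x => (t <= x)%R) (drop k s) = 0%N.
  apply/eqP; rewrite -leqn0 leqNgt -has_count; apply/hasPn => x.
  case/(nthP 0) => i; rewrite size_drop nth_drop => ik <-; rewrite -ltNge.
  apply: le_lt_trans lt_t.
  apply: (sorted_leq_nth (leT := fun x y => y <= x)) => //.
  - by move=> ? ? ?; move=> h1 h2; exact: le_trans h2 h1.
  - by rewrite inE -ltn_subRL.
  - by rewrite leq_addr.
move: kt; rewrite d0 addn0 => kt.
have := leq_trans kt (count_size _ _).
by rewrite size_take ks ltnn.
Qed.

Lemma count_sorted_le (s : seq R) (t : R) k :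
  sorted (fun x y => y <= x) s -> (k < size s)%N ->
  (size s <= count (fun x => x <= t)%R s + k)%N -> nth 0 s k <= t.
Proof.
move=> ss ks kt; rewrite leNgt; apply/negP => lt_t.
have : (k < count (predC (fun x => x <= t)%R) s)%N.
  rewrite -(cat_take_drop k.+1 s) count_cat.
  have -> : count (predC (fun x => x <= t)%R) (take k.+1 s) = k.+1.
    rewrite -[RHS](size_takel ks); apply/eqP; rewrite -all_count.
    apply/(all_nthP 0) => i; rewrite size_takel // => ik; rewrite /= nth_take // -ltNge.
    apply: lt_le_trans lt_t _.
    apply: (sorted_leq_nth (leT := fun x y => y <= x)) => //.
    - by move=> ? ? ?; move=> h1 h2; exact: le_trans h2 h1.
    - by rewrite inE; apply: leq_ltn_trans ks.
  by rewrite leq_addr.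
rewrite -(ltn_add2l (count (fun x => x <= t)%R s)) count_predC.
by rewrite ltnNge kt.
Qed.

End SortedCount.

Section SingularValues.
Variables (R : realType) (d : nat).
Local Notation C := R[i].
Implicit Types (A : 'M[C]_d) (y : 'cV[C]_d).

Definition nsq n (y : 'cV[C]_n) : R := \sum_i Normc.normc (y i 0) ^+ 2.

Lemma conjc_mul_normc (x : C) : conjc x * x = ((Normc.normc x) ^+ 2)%:C%C.
Proof.
case: x => a b /=; rewrite sqr_sqrtr ?addr_ge0 ?sqr_ge0 //.
by apply/eqP; rewrite eq_complex /= !mulNr opprK !expr2 eqxx [b * a]mulrC subrr eqxx.
Qed.

Lemma nsqE n (y : 'cV[C]_n) : ((map_mx conjc y)^T *m y) 0 0 = (nsq y)%:C%C.
Proof.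
rewrite mxE /nsq rmorph_sum; apply: eq_bigr => i _.
by rewrite !mxE conjc_mul_normc.
Qed.

(** Makes the definition of [singular_values] by roots of a characteristic polynomial usable: a
    unitary [P] diagonalises the Gram matrix, and [D] lists the same roots in an order that is not
    controlled, whence [perm_eq]. *)
Lemma gram_spectral A : exists2 P : 'M[C]_d, P \in unitmx &
  exists2 D : 'I_d -> R,
    perm_eq (singular_values A) [seq Num.sqrt (D i) | i <- enum 'I_d] &
    forall y, nsq (P *m y) = nsq y /\
      nsq (A *m y) = \sum_i D i * Normc.normc ((P *m y) i 0) ^+ 2.
Proof.
pose H := (map_mx conjc A)^T *m A.
have herm : H \is hermsymmx.
  apply/is_hermitianmxP; rewrite expr0 scale1r /H.
  have -> : (@Num.conj_op R[i] : R[i] -> R[i]) = @conjc R by [].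
  apply/matrixP => i j; rewrite !mxE rmorph_sum; apply: eq_bigr => l _.
  by rewrite !mxE rmorphM /= conjcK mulrC.
pose P := spectralmx H; pose D := spectral_diag H.
have uP : P \in unitmx := spectral_unit H.
have HE : H = invmx P *m diag_mx D *m P.
  by apply/orthomx_spectralP; exact: hermitian_normalmx.
have PV : invmx P = (map_mx conjc P)^T.
  by rewrite invmx_unitary ?spectral_unitarymx // map_trmx.
have realD i : D 0 i = (complex.Re (D 0 i))%:C%C.
  have /mxOverP /(_ 0 i) := hermitian_spectral_diag_real herm.
  by move=> /RRe_real ->.
exists P => //; exists (fun i => complex.Re (D 0 i)).
  rewrite /singular_values perm_sort (map_comp Num.sqrt (fun i => complex.Re (D 0 i))).
  rewrite (map_comp Num.sqrt (@complex.Re R)); apply: perm_map.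
  rewrite (map_comp (@complex.Re R) (fun i => D 0 i)); apply: perm_map.
  rewrite /eigenvalues; case: closed_field_poly_normal => r /= rE.
  apply: prod_XsubC_eq; rewrite -[LHS]scale1r -(monicP (char_poly_monic H)) -rE.
  have -> : char_poly H = char_poly (diag_mx D).
    rewrite /char_poly /char_poly_mx HE !map_mxM map_invmx.
    have uPp : map_mx polyC P \in unitmx by rewrite unitmxE det_map_mx rmorph_unit -?unitmxE.
    have -> : 'X%:M = invmx (map_mx polyC P) *m 'X%:M *m map_mx polyC P.
      by rewrite mul_mx_scalar -scalemxAl mulVmx // scalemx1.
    rewrite -mulmxBl -mulmxBr !det_mulmx mulrAC -det_mulmx mulVmx // det1 mul1r.
    by rewrite mul_mx_scalar -scalemxAl mulVmx // scalemx1.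
  rewrite char_poly_trig ?diag_mx_is_trig // big_map big_enum /=.
  by apply: eq_bigr => i _; rewrite mxE eqxx mulr1n.
move=> y; have ipP (z : 'cV[C]_d) : (map_mx conjc (P *m z))^T = (map_mx conjc z)^T *m invmx P.
  by rewrite map_mxM trmx_mul PV.
split.
  apply: (@complexI R); rewrite -!nsqE ipP -mulmxA mulKmx //.
apply: (@complexI R); rewrite -nsqE map_mxM trmx_mul -!mulmxA (mulmxA _ A) -/H HE.
rewrite -!mulmxA mulmxA -ipP mxE rmorph_sum; apply: eq_bigr => i _.
have [z ->] : exists z, P *m y = z by eexists.
have -> : (diag_mx D *m z) i 0 = D 0 i * z i 0 by rewrite mul_diag_mx mxE.
have -> : (map_mx conjc z)^T 0 i = conjc (z i 0) by rewrite !mxE.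
by rewrite mulrCA conjc_mul_normc {1}realD -rmorphM.
Qed.

Lemma ker_ex (K : fieldType) m n (N : 'M[K]_(m, n)) : (n < m)%N ->
  exists2 v : 'rV[K]_m, v != 0 & v *m N = 0.
Proof.
move=> nm; have : ~~ row_free N.
  by rewrite -row_leq_rank -ltnNge; apply: leq_ltn_trans (rank_leq_col N) nm.
by rewrite -kermx_eq0 => /rowV0Pn[v /sub_kermxP vN v0]; exists v.
Qed.

(** Fewer than [n] linear conditions leave a nonzero solution; this dimension count is what drives
    the min-max estimates. *)
Lemma common_ker (K : fieldType) n (P V : 'M[K]_n) (S T : {set 'I_n}) :
  (#|S| + #|T| < n)%N -> exists2 y : 'cV[K]_n, y != 0 &
    (forall i, i \in S -> (P *m y) i 0 = 0) /\
    (forall i, i \in T -> (V *m y) i 0 = 0).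
Proof.
move=> ST; pose N := row_mx (\matrix_(j < n, i < #|S|) P (enum_val i) j)
  (\matrix_(j < n, i < #|T|) V (enum_val i) j).
have [v v0 vN] := ker_ex N ST; exists v^T.
  by apply: contra v0 => /eqP /(congr1 trmx); rewrite trmxK trmx0 => ->.
move: vN; rewrite mul_mx_row -[0 in RHS]hsubmxK => /eq_row_mx[vS vT].
split=> i iS.
  move/matrixP/(_ 0 (enum_rank_in iS i)): vS; rewrite !mxE => vi.
  rewrite -[RHS]vi; by apply: eq_bigr => j _; rewrite !mxE enum_rankK_in // mulrC.
move/matrixP/(_ 0 (enum_rank_in iS i)): vT; rewrite !mxE => vi.
rewrite -[RHS]vi; by apply: eq_bigr => j _; rewrite !mxE enum_rankK_in // mulrC.
Qed.

Lemma card_ord_lt n p : (p <= n)%N -> #|finset (fun i : 'I_n => (i < p)%N)| = p.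
Proof.
move=> pn; have -> : finset (fun i : 'I_n => (i < p)%N) = imset (widen_ord pn) (mem predT).
  apply/setP => i; rewrite inE; apply/idP/imsetP => [ip|[j _ ->]]; last exact: (ltn_ord j).
  by exists (Ordinal ip) => //; apply: val_inj.
by rewrite card_imset ?card_ord // => i j [] /val_inj.
Qed.

Lemma card_ord_ge n p : (p <= n)%N ->
  #|finset (fun i : 'I_n => (p <= i)%N)| = (n - p)%N.
Proof.
move=> pn; rewrite -[n in RHS]card_ord -(cardsC (finset (fun i : 'I_n => (i < p)%N))).
rewrite card_ord_lt // addKn; apply: eq_card => i.
by rewrite !inE -leqNgt.
Qed.

Lemma nsq_ge0 n (y : 'cV[C]_n) : 0 <= nsq y.
Proof. by apply: sumr_ge0 => i _; exact: sqr_ge0. Qed.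

Lemma nsq_gt0 n (y : 'cV[C]_n) : y != 0 -> 0 < nsq y.
Proof.
move=> y0; rewrite lt_def nsq_ge0 andbT; apply: contra y0.
rewrite psumr_eq0 => [/allP y0|i _]; last exact: sqr_ge0.
apply/eqP/matrixP => i j; rewrite !ord1 mxE; apply: Normc.eq0_normc.
by apply/eqP; rewrite -sqrf_eq0; apply: y0; rewrite mem_index_enum.
Qed.

Lemma size_singular_values A : size (singular_values A) = d.
Proof.
have [P _ [D pD _]] := gram_spectral A.
by rewrite (perm_size pD) size_map size_enum_ord.
Qed.

Lemma sorted_singular_values A : sorted (fun x y : R => y <= x) (singular_values A).
Proof. by apply: sort_sorted => x y; exact: le_total. Qed.

Lemma count_singular_values A (a : pred R) (D : 'I_d -> R) :
  perm_eq (singular_values A) [seq Num.sqrt (D i) | i <- enum 'I_d] ->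
  count a (singular_values A) = #|finset (fun i => a (Num.sqrt (D i)))|.
Proof.
move=> /seq.permP/(_ a) ->; rewrite count_map -sum1_count big_enum_cond -sum1_card.
by apply: eq_bigl => i; rewrite !inE.
Qed.

Lemma weighted_lt (I : finType) (f w : I -> R) t :
  (forall i, 0 <= w i) -> 0 < \sum_i w i -> (forall i, w i = 0 \/ f i < t) ->
  \sum_i f i * w i < t * \sum_i w i.
Proof.
move=> w0 sw0 wf; rewrite mulr_sumr -subr_gt0 -sumrB.
have fi i : 0 <= t * w i - f i * w i.
  rewrite -mulrBl; have [->|fit] := wf i; first by rewrite mulr0.
  by rewrite mulr_ge0 // subr_ge0 ltW.
rewrite lt_def sumr_ge0 // andbT; apply/negP => /eqP /(psumr_eq0P (fun i _ => fi i)) sum0.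
move: sw0; rewrite big1 ?ltxx // => i _; have [//|fit] := wf i.
have /eqP := sum0 i isT; rewrite -mulrBl mulf_eq0 subr_eq0 => /orP[/eqP ft|/eqP//].
by move: fit; rewrite ft ltxx.
Qed.

Lemma sqrt_lt_sqr (x s : R) : Num.sqrt x < s -> x < s ^+ 2.
Proof.
move=> xs; have s0 : 0 <= s by apply: le_trans (ltW xs); exact: sqrtr_ge0.
rewrite ltNge; apply/negP => /ler_wsqrtr; rewrite sqrtr_sqr ger0_norm //.
by rewrite leNgt xs.
Qed.

Lemma sqr_lt_sqrt (x s : R) : 0 <= s -> s < Num.sqrt x -> s ^+ 2 < x.
Proof.
move=> s0 xs; rewrite ltNge; apply/negP => /ler_wsqrtr; rewrite sqrtr_sqr ger0_norm //.
by rewrite leNgt xs.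
Qed.

(** Half of the min-max principle. If fewer than [p] singular values were at least [s], killing the
    corresponding coordinates of [P y] and the last [d - p] coordinates of [V y] would take fewer
    than [d] conditions; on a nonzero solution [A] would expand both by at least [s] and by strictly
    less. *)
Lemma singular_value_ge A (V : 'M[C]_d) (s : R) p :
  0 <= s -> (0 < p)%N -> (p <= d)%N ->
  (forall y, (forall i : 'I_d, (p <= i)%N -> (V *m y) i 0 = 0) ->
     s ^+ 2 * nsq y <= nsq (A *m y)) ->
  s <= nth 0 (singular_values A) p.-1.
Proof.
move=> s0 p0 pd sA; have [P uP [D pD PA]] := gram_spectral A.
apply: count_sorted_ge => //; first exact: sorted_singular_values.
rewrite (count_singular_values _ pD) leqNgt; apply/negP => lt_p.
pose S := finset (fun i => s <= Num.sqrt (D i)).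
pose T := finset (fun i : 'I_d => (p <= i)%N).
have cT : #|T| = (d - p)%N by exact: card_ord_ge.
have [|y y0 [yS yT]] := @common_ker _ _ P V S T.
  by rewrite cT addnC -ltn_subRL subKn.
have [yP yA] := PA y.
have Vy (i : 'I_d) : (p <= i)%N -> (V *m y) i 0 = 0 by move=> pi; apply: yT; rewrite inE.
have := sA y Vy; rewrite yA -yP leNgt => /negP; apply.
apply: weighted_lt => [i||i]; rewrite ?sqr_ge0 //.
  rewrite -[X in 0 < X]/(nsq (P *m y)); apply: nsq_gt0.
  by apply: contra y0 => /eqP Py; rewrite -(mulKmx uP y) Py mulmx0.
have [iS|] := boolP (i \in S); first by left; rewrite (yS i iS) Normc.normc0 expr0n.
by rewrite inE -ltNge => lt_s; right; apply: sqrt_lt_sqr.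
Qed.

Lemma singular_value_le A (V : 'M[C]_d) (s : R) p :
  0 <= s -> (p < d)%N ->
  (forall y, (forall i : 'I_d, (i < p)%N -> (V *m y) i 0 = 0) ->
     nsq (A *m y) <= s ^+ 2 * nsq y) ->
  nth 0 (singular_values A) p <= s.
Proof.
move=> s0 pd sA; have [P uP [D pD PA]] := gram_spectral A.
apply: count_sorted_le; rewrite ?size_singular_values //.
  exact: sorted_singular_values.
rewrite (count_singular_values _ pD) leqNgt; apply/negP => lt_p.
pose S := finset (fun i => Num.sqrt (D i) <= s).
pose T := finset (fun i : 'I_d => (i < p)%N).
have [|y y0 [yS yT]] := @common_ker _ _ P V S T.
  by rewrite card_ord_lt // ltnW.
have [yP yA] := PA y.
have Vy (i : 'I_d) : (i < p)%N -> (V *m y) i 0 = 0 by move=> pi; apply: yT; rewrite inE.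
have := sA y Vy; rewrite yA -yP leNgt => /negP; apply.
rewrite -ltrN2 -sumrN -mulNr; under eq_bigr => i _ do rewrite -mulNr.
apply: weighted_lt => [i||i]; rewrite ?sqr_ge0 //.
  rewrite -[X in 0 < X]/(nsq (P *m y)); apply: nsq_gt0.
  by apply: contra y0 => /eqP Py; rewrite -(mulKmx uP y) Py mulmx0.
have [iS|] := boolP (i \in S); first by left; rewrite (yS i iS) Normc.normc0 expr0n.
by rewrite inE -ltNge => lt_s; right; rewrite ltrN2; apply: sqr_lt_sqrt.
Qed.

End SingularValues.

Section Sigma.
Variables (R : realType) (F : scalar_kind) (d : nat).
Local Notation K := (scalars R F).
Local Notation C := (scalars R ComplexScalars).
Local Notation toC := (map_mx (@to_complex R F)).

Lemma toC_mul m n p (A : 'M[K]_(m, n)) (B : 'M[K]_(n, p)) :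
  toC (A *m B) = toC A *m toC B.
Proof.
apply/matrixP => i j; rewrite !mxE.
rewrite (big_morph _ (@to_complexD R F) (@to_complex0 R F)).
by apply: eq_bigr => l _; rewrite !mxE to_complexM.
Qed.

Lemma toC1 n : toC (1%:M : 'M[K]_n) = 1%:M.
Proof.
apply/matrixP => i j; rewrite !mxE.
by case: eqP => _; rewrite ?to_complex1 ?to_complex0.
Qed.

Lemma mn_toC m n (A : 'M[K]_(m, n)) : mn (toC A : 'M[C]_(m, n)) = mn A.
Proof. by apply: eq_bigr => i _; apply: eq_bigr => j _; rewrite mxE. Qed.

Lemma bnd_toC n c (A : 'M[K]_n) : bnd c A -> bnd c (toC A : 'M[C]_n).
Proof.
case=> uA Ac Vc; apply: (@bnd_of_inv _ _ _ _ _ (toC (invmx A) : 'M[C]_n)).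
- by rewrite -toC_mul mulmxV // toC1.
- by rewrite mn_toC.
- by rewrite mn_toC.
Qed.

Lemma nsq_le_mn n (y : 'cV[C]_n) : nsq y <= mn y ^+ 2.
Proof.
have mnE : mn y = \sum_i nrm (y i 0) by apply: eq_bigr => i _; rewrite big_ord1.
rewrite /nsq [leRHS]expr2 {1}mnE mulr_suml; apply: ler_sum => i _.
rewrite expr2; apply: (@ler_wpM2l _ (nrm (y i 0)) _ (nrm (y i 0))).
  exact: nrm_ge0.
exact: mn_entry.
Qed.

Lemma mn_le_nsq n (y : 'cV[C]_n) : mn y ^+ 2 <= n%:R ^+ 2 * nsq y.
Proof.
have sq0 := sqrtr_ge0 (nsq y).
have : mn y <= n%:R * Num.sqrt (nsq y).
  rewrite -[X in X%:R](muln1 n); apply: mn_le => i j; rewrite ord1.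
  rewrite -[leLHS]ger0_norm ?nrm_ge0 // -sqrtr_sqr ler_wsqrtr //.
  rewrite /nsq (bigD1 i) //= lerDl; apply: sumr_ge0 => l _; exact: sqr_ge0.
rewrite -(ler_sqr (x := mn y)) ?nnegrE ?mn_ge0 ?mulr_ge0 //.
by rewrite exprMn sqr_sqrtr // nsq_ge0.
Qed.

(** Min-max in the norm [mn]; the divisor [d] pays for the passage between [mn] and the Euclidean
    norm. *)
Lemma sigma_ge (A : 'M[K]_d) (V : 'M[C]_d) (s : R) p :
  0 <= s -> (0 < p)%N -> (p <= d)%N ->
  (forall y : 'cV[C]_d, (forall i : 'I_d, (p <= i)%N -> (V *m y) i 0 = 0) ->
     s * mn y <= mn (toC A *m y : 'cV[C]_d)) ->
  s / d%:R <= sigma p A.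
Proof.
move=> s0 p0 pd sA; apply: (singular_value_ge (V := V)) => //.
  by rewrite divr_ge0.
move=> y /sA sy.
have d0 : 0 < d%:R :> R by rewrite ltr0n (leq_trans p0).
suff : (s / d%:R) ^+ 2 * nsq (y : 'cV[C]_d) <= nsq (toC A *m y : 'cV[C]_d) by [].
rewrite expr_div_n mulrAC ler_pdivrMr ?exprn_gt0 // [leRHS]mulrC.
have le1 : s ^+ 2 * nsq y <= mn (toC A *m y : 'cV[C]_d) ^+ 2.
  apply: (@le_trans _ _ (s ^+ 2 * mn (y : 'cV[C]_d) ^+ 2)).
    exact: (ler_wpM2l (sqr_ge0 s) (nsq_le_mn (y : 'cV[C]_d))).
  by rewrite -exprMn ler_sqr ?nnegrE ?mn_ge0 // mulr_ge0 // mn_ge0.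
exact: (le_trans le1 (mn_le_nsq (toC A *m y : 'cV[C]_d))).
Qed.

Lemma sigma_le (A : 'M[K]_d) (V : 'M[C]_d) (s : R) p :
  0 <= s -> (p < d)%N ->
  (forall y : 'cV[C]_d, (forall i : 'I_d, (i < p)%N -> (V *m y) i 0 = 0) ->
     mn (toC A *m y : 'cV[C]_d) <= s * mn y) ->
  sigma p.+1 A <= d%:R * s.
Proof.
move=> s0 pd sA; apply: (singular_value_le (V := V)) => //.
  by rewrite mulr_ge0.
move=> y /sA sy.
have le1 : mn (toC A *m y : 'cV[C]_d) ^+ 2 <= (d%:R * s) ^+ 2 * nsq (y : 'cV[C]_d).
  apply: (@le_trans _ _ ((s * mn (y : 'cV[C]_d)) ^+ 2)).
    by rewrite ler_sqr ?nnegrE ?mn_ge0 // mulr_ge0 // mn_ge0.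
  have -> : (d%:R * s) ^+ 2 * nsq (y : 'cV[C]_d) =
      s ^+ 2 * (d%:R ^+ 2 * nsq (y : 'cV[C]_d)) by ring.
  rewrite exprMn; exact: (ler_wpM2l (sqr_ge0 s) (mn_le_nsq (y : 'cV[C]_d))).
exact: (le_trans (nsq_le_mn (toC A *m y : 'cV[C]_d)) le1).
Qed.

End Sigma.

(** * Products of matrices with a gap *)

Section SigmaEstimates.
Variables (R : realType) (F : scalar_kind).
Local Notation K := (scalars R F).
Local Notation C := (scalars R ComplexScalars).
Local Notation toC := (map_mx (@to_complex R F)).

Lemma bnd_gt0 n c (A : 'M[K]_n) : (0 < n)%N -> bnd c A -> 0 < c.
Proof.
move=> n0 [uA Ac _]; apply: lt_le_trans Ac; rewrite lt_def mn_ge0 andbT mn_eq0.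
case: n n0 A uA => // n' _ A uA; apply: contraTneq uA => ->.
by rewrite unitmxE det0 unitr0.
Qed.

Section Middle.
Variables (d : nat) (c : R) (U N V : 'M[K]_d).
Hypotheses (bU : bnd c U) (bV : bnd c V).

Lemma sigma_middle_ge (s : R) p : 0 <= s -> (0 < p)%N -> (p <= d)%N ->
  (forall w : 'cV[C]_d, (forall i : 'I_d, (p <= i)%N -> w i 0 = 0) ->
     s * mn w <= mn (toC N *m w : 'cV[C]_d)) ->
  s <= c ^+ 2 * d%:R * sigma p (U *m N *m V).
Proof.
move=> s0 p0 pd sN; have d0 : (0 < d)%N := leq_trans p0 pd.
have c0 := bnd_gt0 d0 bU.
have [uU Uc UVc] := bnd_toC bU; have [uV Vc VVc] := bnd_toC bV.
have : s / c ^+ 2 / d%:R <= sigma p (U *m N *m V).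
  apply: (sigma_ge (V := toC V)) => //; first by rewrite divr_ge0 // sqr_ge0.
  move=> y /sN sw; rewrite !toC_mul -!mulmxA.
  rewrite mulrAC ler_pdivrMr ?exprn_gt0 //.
  have y_le : mn y <= c * mn (toC V *m y : 'cV[C]_d).
    by rewrite -{1}(mulKmx uV y); exact: mnM_le.
  have n_le : mn (toC N *m (toC V *m y) : 'cV[C]_d) <=
      c * mn (toC U *m (toC N *m (toC V *m y)) : 'cV[C]_d).
    rewrite -{1}(mulKmx uU (toC N *m (toC V *m y))); exact: mnM_le.
  have le1 := ler_wpM2l s0 y_le; have le2 := ler_wpM2l (ltW c0) sw.
  have le3 := ler_wpM2l (ltW c0) n_le.
  apply: le_trans le1 _; rewrite mulrCA; apply: le_trans le2 _.
  by apply: le_trans le3 _; rewrite mulrA -expr2 mulrC.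
rewrite !ler_pdivrMr ?exprn_gt0 ?ltr0n // => le1; apply: le_trans le1 _.
by have -> : c ^+ 2 * d%:R * sigma p (U *m N *m V) =
  sigma p (U *m N *m V) * d%:R * c ^+ 2 by ring.
Qed.

Lemma sigma_middle_le (s : R) p : 0 <= s -> (p < d)%N ->
  (forall w : 'cV[C]_d, (forall i : 'I_d, (i < p)%N -> w i 0 = 0) ->
     mn (toC N *m w : 'cV[C]_d) <= s * mn w) ->
  sigma p.+1 (U *m N *m V) <= c ^+ 2 * d%:R * s.
Proof.
move=> s0 pd sN; have c0 := bnd_ge0 bU.
have [uU Uc UVc] := bnd_toC bU; have [uV Vc VVc] := bnd_toC bV.
rewrite -mulrA mulrCA; apply: (sigma_le (V := toC V)) => //.
  by rewrite mulr_ge0 // sqr_ge0.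
move=> y /sN sw; rewrite !toC_mul -!mulmxA.
apply: (@le_trans _ _ (c * (s * (c * mn y)))); last first.
  by rewrite le_eqVlt; apply/orP; left; apply/eqP; ring.
apply: mnM_le => //; apply: le_trans sw _; apply: ler_wpM2l => //.
exact: mnM_le.
Qed.

End Middle.

Section Blocks.
Variables (k m : nat).
Hypotheses (k0 : (0 < k)%N) (m0 : (0 < m)%N).

(* A expands a k-space by at least l and a complement of it by at most mu. *)
Definition bform c (A U V : 'M[K]_(k + m)) (l mu : R) : Prop :=
  [/\ bnd c U, bnd c V, 0 < l & 0 <= mu] /\
  exists Y Z, [/\ A = U *m bdiag Y Z *m V, Y \in unitmx,
    mn (invmx Y) <= l^-1 & mn Z <= mu].

Lemma bform_sigma_ge c A U V l mu : bform c A U V l mu ->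
  l <= c ^+ 2 * (k + m)%:R * sigma k A.
Proof.
case=> [[bU bV l0 mu0] [Y [Z [-> uY Yl _]]]].
apply: sigma_middle_ge => //; first exact: ltW; first exact: leq_addr.
move=> w w0; rewrite mulrC -ler_pdivlMr //.
have wE : w = col_mx (usubmx w) 0.
  rewrite -[LHS]vsubmxK; congr col_mx; apply/matrixP => i j.
  by rewrite !mxE ord1 w0 //= leq_addr.
have uYC : toC Y \in unitmx.
  have YV : toC Y *m toC (invmx Y) = 1%:M by rewrite -toC_mul mulmxV // toC1.
  by have [uYY _] := mulmx1_unit YV.
have YV : invmx (toC Y) = toC (invmx Y).
  by rewrite -[RHS](mulKmx uYC) -toC_mul mulmxV // toC1 mulmx1.
have mncol (x : 'cV[C]_k) : mn (col_mx x 0 : 'cV[C]_(k + m)) = mn x.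
  rewrite /mn big_split_ord /= [X in _ + X]big1 ?addr0; last first.
    by move=> i _; apply: big1 => j _; rewrite col_mxEd mxE nrm0.
  by apply: eq_bigr => i _; apply: eq_bigr => j _; rewrite col_mxEu.
have -> : toC (bdiag Y Z) *m w = col_mx (toC Y *m usubmx w) 0.
  rewrite {1}wE /bdiag map_block_mx mul_block_col !mulmx0 !addr0; congr col_mx.
  have -> : toC (0 : 'M[K]_(m, k)) = 0 by apply/matrixP => i j; rewrite !mxE to_complex0.
  by rewrite mul0mx.
rewrite {1}wE !mncol -{1}(mulKmx uYC (usubmx w)) YV mulrC.
by apply: mnM_le => //; rewrite mn_toC.
Qed.

Lemma bform_sigma_le c A U V l mu : bform c A U V l mu ->
  sigma k.+1 A <= c ^+ 2 * (k + m)%:R * mu.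
Proof.
case=> [[bU bV l0 mu0] [Y [Z [-> uY Yl Zmu]]]].
apply: sigma_middle_le => //; first by rewrite -{1}(addn0 k) ltn_add2l.
move=> w w0.
have wE : w = col_mx 0 (dsubmx w).
  rewrite -[LHS]vsubmxK; congr col_mx; apply/matrixP => i j.
  by rewrite !mxE ord1 w0 //=.
have mncol (x : 'cV[C]_m) : mn (col_mx 0 x : 'cV[C]_(k + m)) = mn x.
  rewrite /mn big_split_ord /= [X in X + _]big1 ?add0r; last first.
    by move=> i _; apply: big1 => j _; rewrite col_mxEu mxE nrm0.
  by apply: eq_bigr => i _; apply: eq_bigr => j _; rewrite col_mxEd.
have -> : toC (bdiag Y Z) *m w = col_mx 0 (toC Z *m dsubmx w).
  rewrite {1}wE /bdiag map_block_mx mul_block_col !mulmx0 !add0r; congr col_mx.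
  have -> : toC (0 : 'M[K]_(k, m)) = 0 by apply/matrixP => i j; rewrite !mxE to_complex0.
  by rewrite mul0mx.
by rewrite wE !mncol col_mxKd; apply: mnM_le => //; rewrite mn_toC.
Qed.

(* Two such decompositions of one matrix identify the same k-space of
   expansion, up to an error of order mu / l. *)
Lemma bform_unique c c' A U V l mu U' V' l' mu' :
  bform c A U V l mu -> bform c' A U' V' l' mu' ->
  mn (dlsubmx (invmx U *m U')) <= mu * (c * c') * l'^-1 /\
  mn (ursubmx (V *m invmx V')) <= l^-1 * (c * c') * mu'.
Proof.
case=> [[bU bV l0 mu0] [Y [Z [AE uY Yl Zmu]]]].
case=> [[bU' bV' l'0 mu'0] [Y' [Z' [AE' uY' Yl' Zmu']]]].
have [uU _ _] := bU; have [uV _ _] := bV.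
have [uU' _ _] := bU'; have [uV' _ _] := bV'.
set Q := invmx U *m U'; set N := V *m invmx V'.
have bQ : bnd (c * c') Q by apply: bnd_mul => //; exact: bnd_inv.
have bN : bnd (c * c') N by apply: bnd_mul => //; exact: bnd_inv.
have QN : Q *m bdiag Y' Z' = bdiag Y Z *m N.
  rewrite /Q -!mulmxA; have -> : U' *m bdiag Y' Z' = A *m invmx V'.
    by rewrite AE' mulmxK.
  by rewrite AE -!mulmxA mulKmx.
move: QN; rewrite -[Q]submxK -[N]submxK /bdiag !mulmx_block.
rewrite !(mulmx0, mul0mx) ?addr0 ?add0r => /eq_block_mx[_ urE dlE _].
rewrite !block_mxKdl !block_mxKur.
have -> : dlsubmx Q = Z *m dlsubmx N *m invmx Y' by rewrite -dlE mulmxK.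
have -> : ursubmx N = invmx Y *m ursubmx Q *m Z' by rewrite -mulmxA urE mulKmx.
have [_ Qc _] := bQ; have [_ Nc _] := bN.
split; apply: mnM_le => //; apply: mnM_le => //.
  exact: le_trans (mn_dlsub _) _.
exact: le_trans (mn_ursub _) _.
Qed.

Section LocalToGlobal.
Variables (kap c e L : R).
Let c1 := 2 * k%:R * c.
Let kap1 := ((k + m)%:R + 1) * kap.
(** One constant dominating every block in the block LU factorisation of a junction: [kap1] bounds
    the junction after the correction by [T'], and [c1] the inverse of its upper left block. The
    summands are the bounds met for [p], [q], [s] and [invmx m11] in [dform_step]. *)
Definition ltgC : R := 1 + kap1 + c1 + kap1 * c1 + kap1 * c1 * kap1.
Hypotheses (kap0 : 0 <= kap) (c0 : 0 <= c) (e0 : 0 < e) (e1 : e <= 1).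
Hypothesis (ck : c * (e * kap) <= 1 / 2).
Hypotheses (L1 : 2 * ltgC ^+ 2 <= L) (L2 : 2 * ltgC <= L * e).

(* The slack 2 ltgC (mu / l) in the bound on T pays for the corrections of T by
   all later steps, whose sizes decrease geometrically. *)
Definition dform (A U V : 'M[K]_(k + m)) (l mu : R) : Prop :=
  [/\ 0 < l, 0 <= mu & exists T T' Y Z,
   [/\ A = U *m lower T *m bdiag Y Z *m upper T' *m V,
      mn T + 2 * ltgC * (mu / l) <= e, mn T' <= e &
      [/\ Y \in unitmx, mn (invmx Y) <= l^-1 & mn Z <= mu]]].

Let c10 : 0 <= c1. Proof. by rewrite mulr_ge0. Qed.
Let kap10 : 0 <= kap1. Proof. by rewrite mulr_ge0 // addr_ge0. Qed.

Lemma ltgC_ge1 : 1 <= ltgC.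
Proof.
rewrite /ltgC; have := mulr_ge0 kap10 c10; have := mulr_ge0 (mulr_ge0 kap10 c10) kap10.
by have := kap10; have := c10; lra.
Qed.

Lemma dform_base A U V c' l mu : bform c' A U V l mu -> L * mu <= l ->
  dform A U V l mu.
Proof.
case=> [[bU bV l0 mu0] [Y [Z [-> uY Yl Zmu]]]] Lmu; split=> //.
exists 0, 0, Y, Z; split=> //; last by rewrite mn0 ltW.
  by rewrite lower0 upper0 !mulmx1.
rewrite mn0 add0r mulrA ler_pdivrMr //.
have C0 : 0 < ltgC := lt_le_trans ltr01 ltgC_ge1.
apply: le_trans (ler_wpM2r mu0 L2) _.
by rewrite mulrAC mulrC; apply: ler_wpM2l => //; exact: ltW.
Qed.

(** The corrected junction [M'] has an invertible corner, so it factors as lower, block diagonal,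
    upper. Moving the lower factor left through [bdiag Y Z] shrinks it by [mu / l], and moving the
    upper factor right through [bdiag Y1 Z1] shrinks it by [mu1 / l1]. The block diagonal parts
    multiply, so the gaps multiply up to [ltgC], and the outer matrices [U] and [V1] are
    untouched. *)
Lemma dform_step A U V l mu B U1 V1 c' l1 mu1 :
  dform A U V l mu -> bform c' B U1 V1 l1 mu1 -> L * mu1 <= l1 ->
  mn (V *m U1) <= kap -> ulsubmx (V *m U1) \in unitmx ->
  mn (invmx (ulsubmx (V *m U1))) <= c ->
  dform (A *m B) U V1 (l * l1 / ltgC) (ltgC * mu * mu1).
Proof.
case=> l0 mu0 [T [T' [Y [Z [-> Te T'e [uY Yl Zmu]]]]]].
case=> [[bU1 bV1 l10 mu10] [Y1 [Z1 [-> uY1 Yl1 Zmu1]]]] Lmu1.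
set M := V *m U1 => Mk uM Mc.
have Cge1 := ltgC_ge1; have C0 : 0 < ltgC := lt_le_trans ltr01 Cge1.
pose M' := upper T' *m M.
have M'k : mn M' <= kap1.
  apply: mnM_le => //; have [_ + _] := bnd_upper T'e; rewrite natrD.
  move=> h; apply: le_trans h _; rewrite lerD2l //.
have M'ul : ulsubmx M' = ulsubmx M + T' *m dlsubmx M.
  rewrite /M' -[in LHS](submxK M) /upper mulmx_block block_mxKul.
  by rewrite mul1mx.
have [uM' M'c] : ulsubmx M' \in unitmx /\ mn (invmx (ulsubmx M')) <= c1.
  apply: (unitmx_near uM Mc); rewrite M'ul addrC addKr.
  apply: le_trans (_ : c * (e * kap) <= _) => //; apply: ler_wpM2l => //.
  by apply: mnM_le => //; apply: le_trans (mn_dlsub _) _.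
set m11 := ulsubmx M' in uM' M'c; pose m12 := ursubmx M'.
pose m21 := dlsubmx M'; pose m22 := drsubmx M'.
have m12k : mn m12 <= kap1 := le_trans (mn_ursub _) M'k.
have m21k : mn m21 <= kap1 := le_trans (mn_dlsub _) M'k.
have m22k : mn m22 <= kap1 := le_trans (mn_drsub _) M'k.
pose p := m21 *m invmx m11; pose q := invmx m11 *m m12.
pose s := m22 - p *m m12.
have M'E : M' = lower p *m bdiag m11 s *m upper q.
  rewrite /lower /bdiag /upper !mulmx_block !(mulmx0, mul0mx, mulmx1, mul1mx, addr0, add0r).
  rewrite /p /q mulmxKV // mulKVmx // /s -[LHS]submxK; congr block_mx.
  by rewrite /p !mulmxA addrC subrK.
have kc0 := mulr_ge0 kap10 c10; have kck0 := mulr_ge0 kc0 kap10.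
have pC : mn p <= ltgC.
  by apply: le_trans (mnM_le m21k M'c) _; rewrite /ltgC; have := kap10; have := c10; lra.
have qC : mn q <= ltgC.
  by apply: le_trans (mnM_le M'c m12k) _; rewrite mulrC /ltgC; have := kap10; have := c10; lra.
have sC : mn s <= ltgC.
  apply: le_trans (ler_mnD _ _) _; rewrite mnN.
  have : mn (p *m m12) <= kap1 * c1 * kap1 by apply: mnM_le => //; exact: mnM_le.
  by rewrite /ltgC; have := kap10; have := c10; lra.
have mC : mn (invmx m11) <= ltgC.
  by apply: le_trans M'c _; rewrite /ltgC; have := kap10; lra.
pose T2 := T + Z *m p *m invmx Y; pose T2' := invmx Y1 *m q *m Z1.
pose Y2 := Y *m m11 *m Y1; pose Z2 := Z *m s *m Z1.
have lC0 : 0 < l * l1 / ltgC by rewrite divr_gt0 // mulr_gt0.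
have muC0 : 0 <= ltgC * mu * mu1 by rewrite !mulr_ge0 // ltW.
split=> //; exists T2, T2', Y2, Z2; split.
- have e_1 : bdiag Y Z *m lower p = lower (Z *m p *m invmx Y) *m bdiag Y Z.
    rewrite /lower /bdiag !mulmx_block !(mulmx0, mul0mx, mulmx1, mul1mx) ?addr0 ?add0r.
    by rewrite mulmxKV.
  have e_2 : upper q *m bdiag Y1 Z1 = bdiag Y1 Z1 *m upper T2'.
    rewrite /upper /bdiag !mulmx_block !(mulmx0, mul0mx, mulmx1, mul1mx) ?addr0 ?add0r.
    by rewrite /T2' !mulmxA mulmxV // mul1mx.
  have -> : U *m lower T *m bdiag Y Z *m upper T' *m V *m
      (U1 *m bdiag Y1 Z1 *m V1) =
      U *m lower T *m (bdiag Y Z *m (M' *m (bdiag Y1 Z1 *m V1))).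
    by rewrite /M' /M !mulmxA.
  rewrite M'E; have -> : lower p *m bdiag m11 s *m upper q *m (bdiag Y1 Z1 *m V1) =
      lower p *m (bdiag m11 s *m (bdiag Y1 Z1 *m upper T2' *m V1)).
    by rewrite -e_2 !mulmxA.
  rewrite (mulmxA (bdiag Y Z)) e_1 /T2 -lowerM /Y2 /Z2 -!bdiagM !mulmxA.
  by [].
- have T2le : mn T2 <= mn T + ltgC * (mu / l).
    apply: le_trans (ler_mnD _ _) _; rewrite lerD2l mulrA [ltgC * mu]mulrC.
    by apply: mnM_le => //; exact: mnM_le.
  apply: le_trans _ Te; apply: le_trans (lerD T2le (lexx _)) _.
  rewrite -addrA lerD2l.
  have -> : ltgC * mu * mu1 / (l * l1 / ltgC) = ltgC ^+ 2 * (mu1 / l1) * (mu / l).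
    by field; rewrite !gt_eqF.
  (* By [L1] the ratio [mu / l] at least halves at each step. The slack halves with it, and the
     freed [ltgC * (mu / l)] is exactly what [T2] may exceed [T] by. *)
  have r1 : ltgC ^+ 2 * (mu1 / l1) <= 1 / 2.
    rewrite mulrA ler_pdivrMr // mulrC; have := ler_wpM2r mu10 L1; lra.
  have r0 : 0 <= mu / l by rewrite divr_ge0 // ltW.
  have := ler_wpM2r r0 r1; set t := ltgC ^+ 2 * _ * _ => tle.
  have := ler_wpM2l (ltW C0) tle; lra.
- apply: le_trans (_ : l1^-1 * ltgC * mu1 <= _).
    by apply: mnM_le => //; exact: mnM_le.
  have -> : l1^-1 * ltgC * mu1 = ltgC * mu1 / l1 by ring.
  rewrite ler_pdivrMr //.
  have := ler_wpM2l (ltW e0) Lmu1; have := ler_wpM2r mu10 L2.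
  have := mulr_ge0 (ltW C0) mu10.
  have -> : e * (L * mu1) = L * e * mu1 by ring.
  lra.
- split; first by rewrite !unitmx_mul uY uM'.
    have -> : invmx Y2 = invmx Y1 *m (invmx m11 *m invmx Y).
      by rewrite /Y2 invmxM ?unitmx_mul ?uY // invmxM.
    have -> : (l * l1 / ltgC)^-1 = l1^-1 * (ltgC * l^-1) by field; rewrite !gt_eqF.
    by apply: mnM_le => //; exact: mnM_le.
  rewrite [ltgC * mu]mulrC; apply: mnM_le => //; exact: mnM_le.
Qed.

Lemma dform_bform cu A U V l mu : bnd cu U -> bnd cu V -> dform A U V l mu ->
  exists T T', [/\ mn T <= e, mn T' <= e &
    bform (((k + m)%:R + e) * cu) A (U *m lower T) (upper T' *m V) l mu].
Proof.
move=> bU bV [l0 mu0 [T [T' [Y [Z [-> Te T'e [uY Yl Zmu]]]]]]].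
have C0 : 0 < ltgC := lt_le_trans ltr01 ltgC_ge1.
have Te' : mn T <= e.
  apply: le_trans Te; rewrite lerDl mulr_ge0 ?divr_ge0 ?mulr_ge0 //; exact: ltW.
exists T, T'; split=> //; split; first split=> //.
- by rewrite mulrC; apply: bnd_mul => //; exact: bnd_lower.
- by apply: bnd_mul => //; exact: bnd_upper.
by exists Y, Z; split=> //; rewrite !mulmxA.
Qed.

End LocalToGlobal.
End Blocks.
End SigmaEstimates.

Lemma subn_pred_lt d k : (0 < k)%N -> (k < d)%N -> ((d - k).-1 < d)%N.
Proof. lia. Qed.

Lemma leq_predr i k : (i < k)%N -> (i <= k.-1)%N.
Proof. lia. Qed.

Lemma add_pred_lt d k : (0 < k)%N -> (k < d)%N -> (k + (d - k).-1 < d)%N.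
Proof. lia. Qed.

Section Canonical.
Variables (R : realType) (F : scalar_kind) (d : nat).
Local Notation K := (scalars R F).
Local Notation C := (scalars R ComplexScalars).
Local Notation toC := (map_mx (@to_complex R F)).
Implicit Types A : 'M[K]_d.

(* A substitute for the singular value decomposition: U and V are not unitary,
   but they and their inverses are bounded by udvc, so that the moduli of the
   entries of D are comparable to the singular values. *)
Definition udvc : R := projT1 (cid (@bounded_udv R F d)).

Lemma udv_ex A : exists t : 'M[K]_d * 'M[K]_d * 'rV[K]_d,
  [/\ bnd udvc t.1.1, bnd udvc t.1.2, A = t.1.1 *m diag_mx t.2 *m t.1.2 &
      forall i j : 'I_d, (i <= j)%N -> nrm (t.2 0 j) <= nrm (t.2 0 i)].
Proof.
have [U [V [D H]]] := projT2 (cid (@bounded_udv R F d)) A.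
by exists (U, V, D).
Qed.

Definition udvU A := (projT1 (cid (udv_ex A))).1.1.
Definition udvV A := (projT1 (cid (udv_ex A))).1.2.
Definition udvD A := (projT1 (cid (udv_ex A))).2.

Lemma udvU_bnd A : bnd udvc (udvU A).
Proof. by rewrite /udvU; case: cid => /= ? []. Qed.

Lemma udvV_bnd A : bnd udvc (udvV A).
Proof. by rewrite /udvV; case: cid => /= ? []. Qed.

Lemma udvE A : A = udvU A *m diag_mx (udvD A) *m udvV A.
Proof. by rewrite /udvU /udvV /udvD; case: cid => /= ? []. Qed.

Lemma udvD_sorted A (i j : 'I_d) :
  (i <= j)%N -> nrm (udvD A 0 j) <= nrm (udvD A 0 i).
Proof. by rewrite /udvD; case: cid => /= ? [_ _ _]; apply. Qed.

Definition udvd A (i : nat) : R :=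
  if insub i is Some j then nrm (udvD A 0 (j : 'I_d)) else 0.

Lemma udvdE A (i : 'I_d) : udvd A i = nrm (udvD A 0 i).
Proof. by rewrite /udvd valK. Qed.

Lemma udvd_ge0 A i : 0 <= udvd A i.
Proof. by rewrite /udvd; case: insub => [j|] //; exact: nrm_ge0. Qed.

Lemma udvd_le A i j : (i <= j)%N -> (j < d)%N -> udvd A j <= udvd A i.
Proof.
move=> ij jd; have id' := leq_ltn_trans ij jd.
exact: (etrans (congr2 _ (udvdE A (Ordinal jd)) (udvdE A (Ordinal id'))) (udvD_sorted A (i := Ordinal id') (j := Ordinal jd) ij)).
Qed.

Lemma udvd_gt0 A i : A \in unitmx -> (i < d)%N -> 0 < udvd A i.
Proof.
move=> uA id'; rewrite (udvdE A (Ordinal id')) nrm_gt0.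
have : diag_mx (udvD A) \in unitmx.
  by move: uA; rewrite {1}(udvE A) !unitmx_mul => /andP[/andP[]].
rewrite unitmxE det_diag unitfE => /prodf_neq0; exact.
Qed.

Lemma mul_diag_col (D : 'rV[K]_d) (w : 'cV[C]_d) i :
  nrm ((toC (diag_mx D) *m w : 'cV[C]_d) i 0) = nrm (D 0 i) * nrm (w i 0).
Proof.
rewrite mxE (bigD1 i) //= big1 ?addr0 => [|j ji].
  by rewrite !mxE eqxx mulr1n nrmM.
rewrite !mxE eq_sym (negbTE ji) mulr0n.
have -> : to_complex (0 : K) = 0 by rewrite to_complex0.
by rewrite mul0r.
Qed.

Lemma mn_colE n (w : 'cV[C]_n) : mn w = \sum_i nrm (w i 0).
Proof. by apply: eq_bigr => i _; rewrite big_ord1. Qed.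

Lemma sigma_le_udvd A p : (0 < p)%N -> (p <= d)%N ->
  sigma p A <= udvc ^+ 2 * d%:R * udvd A p.-1.
Proof.
move=> p0 pd; have p1d : (p.-1 < d)%N by rewrite prednK.
rewrite -{1}(prednK p0) {1}(udvE A).
apply: sigma_middle_le => //; [exact: udvU_bnd|exact: udvV_bnd|exact: udvd_ge0|].
move=> w w0; rewrite !mn_colE mulr_sumr; apply: ler_sum => i _.
rewrite mul_diag_col -udvdE; have [ip|pi] := ltnP i p.-1.
  by rewrite w0 // nrm0 !mulr0.
by apply: ler_wpM2r; [exact: nrm_ge0|exact: udvd_le].
Qed.

Lemma udvd_le_sigma A p : (0 < p)%N -> (p <= d)%N ->
  udvd A p.-1 <= udvc ^+ 2 * d%:R * sigma p A.
Proof.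
move=> p0 pd; have p1d : (p.-1 < d)%N by rewrite prednK.
rewrite [A in sigma _ A](udvE A).
apply: sigma_middle_ge => //; [exact: udvU_bnd|exact: udvV_bnd|exact: udvd_ge0|].
move=> w w0; rewrite !mn_colE mulr_sumr; apply: ler_sum => i _.
rewrite mul_diag_col -udvdE; have [ip|pi] := leqP i p.-1.
  by apply: ler_wpM2r; [exact: nrm_ge0|exact: udvd_le].
by rewrite w0 ?nrm0 ?mulr0 // -(prednK p0).
Qed.

Lemma mul_diag_entry (D : 'rV[K]_d) n (M : 'M[K]_(d, n)) i j :
  (diag_mx D *m M) i j = D 0 i * M i j.
Proof. by rewrite mul_diag_mx mxE. Qed.

(* With B the inverse of A, write X = V_B U_A and N = D_B X D_A, which is
   bounded together with its inverse. The corner of N below row k and right of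
   column d - k - 1 is too large to be small, which bounds D_B(k) D_A(d-k-1)
   from below, hence X is small where D_B D_A is large. *)
Lemma udv_inv_small A k (i j : 'I_d) : A \in unitmx -> (0 < k)%N ->
  (i < k)%N -> (j < d - k)%N ->
  nrm ((udvV (invmx A) *m udvU A) i j) <=
    (udvc * udvc) ^+ 3 * (udvd (invmx A) k / udvd (invmx A) k.-1).
Proof.
move=> uA k0 ik jk; set B := invmx A; set c2 := udvc * udvc.
have uB : B \in unitmx by rewrite unitmx_inv.
have kd : (k < d)%N by rewrite -subn_gt0; apply: leq_ltn_trans jk.
pose X := udvV B *m udvU A; pose N := invmx (udvU B) *m invmx (udvV A).
have [uUB _ _] := udvU_bnd B; have [uVA _ _] := udvV_bnd A.
have [uUA _ _] := udvU_bnd A; have [uVB _ _] := udvV_bnd B.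
have [uX Xc _] : bnd c2 X by apply: bnd_mul; [exact: udvV_bnd|exact: udvU_bnd].
have [uN Nc NVc] : bnd c2 N.
  by apply: bnd_mul; apply: bnd_inv; [exact: udvU_bnd|exact: udvV_bnd].
have NE : N = diag_mx (udvD B) *m (X *m diag_mx (udvD A)).
  have BA : B *m A = 1%:M by rewrite mulVmx.
  rewrite {1}(udvE B) {1}(udvE A) in BA.
  rewrite /N -[invmx (udvV A)]mul1mx -BA -!mulmxA mulKmx //; congr (_ *m _).
  by rewrite /X mulmxV // mulmx1 !mulmxA.
(* The first [k] rows of [N] and the first [d - k - 1] coordinates impose [d - 1] conditions, so a
   nonzero [y] survives. Only entries of [D_B] from index [k] on and of [D_A] from index [d - k - 1]
   on act on it, while the bounded inverse of [N] prevents [N y] from being small. *)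
have step1 : 1 <= c2 * (udvd B k * (c2 * udvd A (d - k).-1)).
  pose S := finset (fun i : 'I_d => (i < k)%N).
  pose T := finset (fun i : 'I_d => (i < (d - k).-1)%N).
  have [|y y0 [yS yT]] := @common_ker _ _ N 1%:M S T.
    rewrite !card_ord_lt ?(ltnW kd) // ?(ltnW (subn_pred_lt k0 kd)) //.
    exact: add_pred_lt.
  have mny : 0 < mn y by rewrite lt_def mn_ge0 andbT mn_eq0.
  have yN : mn y <= c2 * mn (N *m y).
    by rewrite -{1}(mulKmx uN y); exact: mnM_le.
  have mncE n (w : 'cV[K]_n) : mn w = \sum_i nrm (w i 0).
    by apply: eq_bigr => t _; rewrite big_ord1.
  have Dy : mn (diag_mx (udvD A) *m y) <= udvd A (d - k).-1 * mn y.
    rewrite !mncE mulr_sumr; apply: ler_sum => t _.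
    rewrite mul_diag_entry nrmM -udvdE; have [tk|kt] := ltnP t (d - k).-1.
      by have := yT t; rewrite inE mul1mx => /(_ tk) ->; rewrite nrm0 !mulr0.
    by apply: ler_wpM2r; [exact: nrm_ge0|exact: udvd_le].
  have Ny : mn (N *m y) <= udvd B k * (c2 * (udvd A (d - k).-1 * mn y)).
    apply: le_trans (_ : udvd B k * mn (X *m (diag_mx (udvD A) *m y)) <= _); last first.
      by apply: ler_wpM2l; [exact: udvd_ge0|exact: mnM_le].
    rewrite !mncE mulr_sumr; apply: ler_sum => t _.
    have [tk|kt] := ltnP t k.
      by rewrite yS ?inE // nrm0 mulr_ge0 ?udvd_ge0 ?nrm_ge0.
    rewrite NE -!mulmxA mul_diag_entry nrmM -udvdE.
    by apply: ler_wpM2r; [exact: nrm_ge0|exact: udvd_le].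
  have c20 : 0 <= c2 := le_trans (mn_ge0 _) Xc.
  have := le_trans yN (ler_wpM2l c20 Ny).
  have -> : c2 * (udvd B k * (c2 * (udvd A (d - k).-1 * mn y))) =
    c2 * (udvd B k * (c2 * udvd A (d - k).-1)) * mn y by ring.
  by rewrite -{1}[mn y]mul1r ler_pM2r.
have a0 : 0 < udvd A (d - k).-1 by apply: udvd_gt0 => //; exact: subn_pred_lt.
have b0 : 0 < udvd B k.-1.
  by apply: udvd_gt0 => //; apply: leq_ltn_trans (leq_pred _) kd.
have c20 : 0 <= c2 := le_trans (mn_ge0 _) Xc.
have bka0 := udvd_ge0 B k.
have Xij : nrm (X i j) * (udvd B k.-1 * udvd A (d - k).-1) <= c2.
  apply: le_trans _ Nc; apply: le_trans _ (mn_entry _ i j).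
  have -> : N i j = udvD B 0 i * (X i j * udvD A 0 j).
    by rewrite NE mul_diag_entry mul_mx_diag mxE.
  rewrite !nrmM -!udvdE [leRHS]mulrCA; apply: ler_wpM2l; first exact: nrm_ge0.
  apply: ler_pM; rewrite ?udvd_ge0 //; apply: udvd_le; try exact: leq_predr.
    exact: leq_ltn_trans (leq_pred _) kd.
  exact: subn_pred_lt.
rewrite mulrA ler_pdivlMr // -(ler_pM2r a0) -mulrA.
apply: le_trans Xij _.
have := ler_wpM2l c20 step1; rewrite mulr1 => h; apply: le_trans h _.
rewrite le_eqVlt; apply/orP; left; apply/eqP; ring.
Qed.

End Canonical.

Section CanonicalBlocks.
Variables (R : realType) (F : scalar_kind) (k m : nat).
Local Notation K := (scalars R F).
Hypotheses (k0 : (0 < k)%N) (m0 : (0 < m)%N).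

Lemma mn_diag n (v : 'rV[K]_n) : mn (diag_mx v) = \sum_i nrm (v 0 i).
Proof.
apply: eq_bigr => i _; rewrite (bigD1 i) //= big1 ?addr0 => [|j ji].
  by rewrite mxE eqxx mulr1n.
by rewrite mxE eq_sym (negbTE ji) mulr0n nrm0.
Qed.

(** The factors [k] and [m] appear because [mn] of a diagonal matrix is the sum, not the maximum, of
    the moduli of its entries. *)
Lemma udv_bform (A : 'M[K]_(k + m)) : A \in unitmx ->
  bform (udvc R F (k + m)) A (udvU A) (udvV A)
    (udvd A k.-1 / k%:R) (m%:R * udvd A k).
Proof.
move=> uA; have k1 : (k.-1 < k + m)%N by rewrite prednK // leq_addr.
have l0 : 0 < udvd A k.-1 by apply: udvd_gt0.
split; first split; [exact: udvU_bnd|exact: udvV_bnd| | |].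
- by rewrite divr_gt0 // ltr0n.
- by rewrite mulr_ge0 // udvd_ge0.
pose D := udvD A; pose Dl := lsubmx D; pose Di : 'rV[K]_k := \row_i (Dl 0 i)^-1.
have Dl0 i : Dl 0 i != 0.
  by rewrite mxE -nrm_gt0 -udvdE; apply: udvd_gt0.
have DlV : diag_mx Dl *m diag_mx Di = 1%:M.
  rewrite mulmx_diag; apply/matrixP => i j; rewrite !mxE.
  by case: eqP => // _; rewrite !mulr1n mulfV //; have := Dl0 i; rewrite mxE.
have [uDl _] := mulmx1_unit DlV.
have VDl : invmx (diag_mx Dl) = diag_mx Di.
  by rewrite -[RHS](mulKmx uDl) DlV mulmx1.
exists (diag_mx Dl), (diag_mx (rsubmx D)); split=> //.
- by rewrite /bdiag -diag_mx_row hsubmxK -/D; exact: udvE.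
- rewrite VDl mn_diag invfM invrK.
  apply: (@le_trans _ _ (\sum_(i < k) (udvd A k.-1)^-1)).
    apply: ler_sum => i _; rewrite mxE nrmV lef_pV2 ?posrE //; last first.
      by rewrite nrm_gt0.
    rewrite mxE -udvdE; apply: udvd_le => //=; exact: leq_predr.
  by rewrite sumr_const card_ord mulr_natr.
- rewrite mn_diag; apply: (@le_trans _ _ (\sum_(i < m) udvd A k)).
    apply: ler_sum => i _; rewrite mxE -udvdE; apply: udvd_le => /=.
      exact: leq_addr.
    by rewrite ltn_add2l.
  by rewrite sumr_const card_ord mulr_natl.
Qed.

End CanonicalBlocks.

(** * Flags *)

Section Grassmannian.
Variables (R : realType) (F : scalar_kind) (d : nat).
Local Notation K := (scalars R F).

Lemma mem_colspan j (A : 'M[K]_(d, j)) (v : 'cV[K]_d) :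
  v \in colspan A <-> exists x, v = A *m x.
Proof.
split=> [/memv_imgP[x _ ->]|[x ->]]; first by exists x; rewrite lfunE.
by have := memv_img (linfun (mulmx A)) (memvf x); rewrite lfunE.
Qed.

Lemma dim_colspan j (A : 'M[K]_(d, j)) (B : 'M[K]_(j, d)) :
  B *m A = 1%:M -> \dim (colspan A) = j.
Proof.
move=> BA; have ker0 : (fullv :&: lker (linfun (mulmx A : 'cV[K]_j -> 'cV[K]_d)) = 0)%VS.
  apply/eqP; rewrite -subv0; apply/subvP => x /memv_capP[_].
  rewrite memv_ker lfunE /= memv0 => /eqP Ax; apply/eqP.
  by rewrite -[x]mul1mx -BA -mulmxA Ax mulmx0.
rewrite /colspan limg_dim_eq // dimvf dim_matrix; exact: muln1.
Qed.

Lemma stdframe_inv (g : 'M[K]_d) j : g \in unitmx -> (j <= d)%N ->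
  (pid_mx j *m invmx g) *m (g *m (pid_mx j : 'M[K]_(d, j))) = 1%:M.
Proof.
move=> ug jd; rewrite -mulmxA mulKmx // mul_pid_mx minnn.
by rewrite (minn_idPr jd) pid_mx_1.
Qed.

(* Singular matrices get the junk value 1, so that every matrix has a flag. *)
Definition gn (g : 'M[K]_d) : 'M[K]_d := if g \in unitmx then g else 1%:M.

Lemma gn_unit g : gn g \in unitmx.
Proof. by rewrite /gn; case: ifP => // _; exact: unitmx1. Qed.

Lemma gnE g : g \in unitmx -> gn g = g.
Proof. by rewrite /gn => ->. Qed.

Definition gframe j g : 'M[K]_(d, j) := gn g *m pid_mx j.

Lemma mem_gframe j g v : (j <= d)%N ->
  v \in colspan (gframe j g) <->
  forall i : 'I_d, (j <= i)%N -> (invmx (gn g) *m v) i 0 = 0.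
Proof.
move=> jd; rewrite mem_colspan; split.
  move=> [x ->] i ji; rewrite /gframe -mulmxA mulKmx ?gn_unit // mxE.
  apply: big1 => l _; rewrite mxE; case: eqP => [il|_]; last by rewrite mul0r.
  by rewrite ltnNge ji mul0r.
move=> v0; exists (pid_mx j *m (invmx (gn g) *m v)).
rewrite /gframe -mulmxA (mulmxA (pid_mx j) (pid_mx j)) mul_pid_mx !minnn.
have -> : pid_mx j *m (invmx (gn g) *m v) = invmx (gn g) *m v.
  apply/matrixP => i l; rewrite mxE (bigD1 i) //= big1 => [|s si].
    rewrite mxE eqxx addr0 /= ord1; case: ltnP => [_|ji]; first by rewrite mul1r.
    by rewrite mul0r v0.
  have -> : (pid_mx j : 'M[K]_d) i s = 0.
    by rewrite mxE eq_sym val_eqE (negbTE si).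
  by rewrite mul0r.
by rewrite mulKVmx // gn_unit.
Qed.

Lemma grass_subproof j (jd : (j <= d)%N) g : \dim (colspan (gframe j g)) == j.
Proof. by rewrite (dim_colspan (stdframe_inv (gn_unit g) jd)). Qed.

Definition grass j (jd : (j <= d)%N) g : grassmannian K d j :=
  Grassmannian (grass_subproof jd g).

Lemma grass_act j (jd : (j <= d)%N) (h : special_linear K d) g :
  g \in unitmx -> gr_act h (grass jd g) = grass jd (h *m g).
Proof.
move=> ug; apply: val_inj => /=; apply/vspaceP => v.
have uhg : sl_mx h *m g \in unitmx by rewrite unitmx_mul sl_unit.
apply/idP/idP.
  move=> /memv_imgP[u /mem_colspan[x ->] ->]; apply/mem_colspan; exists x.
  by rewrite lfunE /= /gframe !gnE // !mulmxA.
move=> /mem_colspan[x ->]; apply/memv_imgP; exists (gframe j g *m x).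
  by apply/mem_colspan; exists x.
by rewrite lfunE /= /gframe !gnE // !mulmxA.
Qed.

Lemma nbhs_mn m n (A : 'M[K]_(m, n)) (N : set 'M[K]_(m, n)) : nbhs A N ->
  exists2 e : R, 0 < e & forall B, mn (B - A) < e -> N B.
Proof.
case=> P AP sPN.
have /choice[f fP] : forall ij : 'I_m * 'I_n, exists e : R, 0 < e /\
    forall y, nrm (y - A ij.1 ij.2) < e -> P ij.1 ij.2 y.
  by move=> [i j]; have /nbhs_nrm[e e0 H] := AP i j; exists e.
exists (\big[Num.min/1]_ij f ij).
  by apply: (big_ind (fun x : R => 0 < x)) => // [x y x0 y0|ij _];
    [rewrite lt_min x0|have [] := fP ij].
move=> B Be; apply: sPN => i j; have [_] := fP (i, j); apply => /=.
have -> : B i j - A i j = (B - A) i j by rewrite !mxE.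
apply: le_lt_trans (mn_entry _ _ _) _; apply: lt_le_trans Be _.
by apply: (bigmin_le_cond _ (j := (i, j))).
Qed.

Lemma unitmx_open (g : 'M[K]_d) : g \in unitmx ->
  exists2 e : R, 0 < e & forall h, mn (h - g) < e -> h \in unitmx.
Proof.
move=> ug; pose c := 1 + mn (invmx g).
have c0 : 0 < c by rewrite /c; have := mn_ge0 (invmx g); lra.
exists (1 / (2 * c)); first by rewrite divr_gt0 // mulr_gt0.
move=> h hc; have [] // := unitmx_near (c := c) (B := h) ug.
  by rewrite /c; lra.
apply: le_trans (ler_wpM2l (ltW c0) (ltW hc)) _.
by rewrite le_eqVlt; apply/orP; left; apply/eqP; field; lra.
Qed.

Lemma grass_continuous j (jd : (j <= d)%N) g (U : set (grassmannian K d j)) :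
  g \in unitmx -> open U -> U (grass jd g) ->
  exists2 e : R, 0 < e & forall h, mn (h - g) < e -> h \in unitmx -> U (grass jd h).
Proof.
move=> ug oU Ug; have : gr_open U by [].
move=> /open_subspaceP[Q oQ QE].
have QA : Q (gframe j g).
  suff : (Q `&` @frames K d j) (gframe j g) by case.
  rewrite QE; split; first by exists (grass jd g).
  by rewrite /frames /=; apply/eqP; exact: grass_subproof.
have [e e0 eQ] := nbhs_mn (open_nbhs_nbhs (conj oQ QA)).
pose c := 1 + mn (pid_mx j : 'M[K]_(d, j)).
have c0 : 0 < c by rewrite /c; have := mn_ge0 (pid_mx j : 'M[K]_(d, j)); lra.
exists (e / c); first by rewrite divr_gt0.
move=> h hg uh; have : (Q `&` @frames K d j) (gframe j h).
  split; last by rewrite /frames /=; apply/eqP; exact: grass_subproof.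
  apply: eQ; rewrite /gframe !gnE // -mulmxBl.
  apply: le_lt_trans (ler_mnM _ _) _; rewrite ltr_pdivlMr // in hg.
  apply: le_lt_trans hg; apply: ler_wpM2l; rewrite ?mn_ge0 // /c; lra.
rewrite QE => -[[V UV VE] _]; suff <- : V = grass jd h by [].
by apply: val_inj; rewrite /= -VE.
Qed.

Lemma lu_colspan j (jd : (j <= d)%N) g0 g : g0 \in unitmx -> g \in unitmx ->
  (forall i l : 'I_d, (l < i)%N -> (invmx g *m g0) i l = 0) ->
  grass jd g0 = grass jd g.
Proof.
move=> u0 ug H; apply: val_inj => /=; apply/eqP; rewrite eqEdim.
rewrite (eqP (grass_subproof jd g0)) (eqP (grass_subproof jd g)) leqnn andbT.
apply/subvP => v /(mem_gframe _ _ jd) v0; apply/(mem_gframe _ _ jd) => i ji.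
rewrite gnE //; rewrite (gnE u0) in v0.
have [y yE] : exists y, invmx g0 *m v = y by eexists.
have -> : invmx g *m v = invmx g *m g0 *m y by rewrite -yE -mulmxA mulKVmx.
rewrite yE in v0; rewrite mxE; apply: big1 => l _.
have [li|il] := ltnP l i; first by rewrite H // mul0r.
by rewrite v0 ?mulr0 //; apply: leq_trans il.
Qed.

End Grassmannian.

Section FlagCoordinates.
Variables (R : realType) (F : scalar_kind) (d k : nat).
Local Notation K := (scalars R F).
Hypothesis kd : (k <= d - k)%N.

Let kd' : (k <= d)%N. Proof. exact: leq_trans kd (leq_subr _ _). Qed.
Let dkd : (d - k <= d)%N. Proof. exact: leq_subr. Qed.

Lemma mflag_subproof (g : 'M[K]_d) : (grass kd' g, grass dkd g) \in flags K d k.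
Proof.
apply/mem_set => /=; apply/subvP => v /(mem_gframe _ _ kd') v0.
by apply/(mem_gframe _ _ dkd) => i di; apply: v0; apply: leq_trans di.
Qed.

(** One invertible matrix carries both members of a flag, so the group acts by left multiplication
    ([mflag_act]) and limits of flags reduce to limits of matrices. Bounded representatives exist by
    [mflag_surj]. *)
Definition mflag (g : 'M[K]_d) : flags K d k :=
  exist (fun y => y \in flags K d k) _ (mflag_subproof g).

Lemma mflag_val g : set_val (mflag g) = (grass kd' g, grass dkd g).
Proof. by []. Qed.

Lemma mem_mflag1 g v : v \in gr_space (set_val (mflag g)).1 <->
  forall i : 'I_d, (k <= i)%N -> (invmx (gn g) *m v) i 0 = 0.
Proof. exact: mem_gframe. Qed.

Lemma mem_mflag2 g v : v \in gr_space (set_val (mflag g)).2 <->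
  forall i : 'I_d, (d - k <= i)%N -> (invmx (gn g) *m v) i 0 = 0.
Proof. exact: mem_gframe. Qed.

Lemma mflag_act (h : special_linear K d) g : g \in unitmx ->
  flag_act h (mflag g) = mflag (h *m g).
Proof. by move=> ug; apply: val_inj => /=; rewrite !grass_act. Qed.

Lemma mflag_lu g0 g : g0 \in unitmx -> g \in unitmx ->
  (forall i l : 'I_d, (l < i)%N -> (invmx g *m g0) i l = 0) -> mflag g0 = mflag g.
Proof. by move=> u0 ug H; apply: val_inj => /=; rewrite !(lu_colspan _ u0 ug H). Qed.

Lemma mflag_continuous g (U : set (flags K d k)) :
  g \in unitmx -> open U -> U (mflag g) ->
  exists2 e : R, 0 < e & forall h, mn (h - g) < e -> h \in unitmx /\ U (mflag h).
Proof.
move=> ug oU Ug.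
case: oU => Q oQ QU.
have Qg : Q (grass kd' g, grass dkd g) by move: Ug; rewrite -QU.
have [[Q1 Q2] /= [nO1 nO2] sO] := open_nbhs_nbhs (conj oQ Qg).
rewrite nbhsE /= in nO1; rewrite nbhsE /= in nO2.
have [B1 [oB1 B1g] sB1] := nO1; have [B2 [oB2 B2g] sB2] := nO2.
have [e1 e10 H1] := grass_continuous ug oB1 B1g.
have [e2 e20 H2] := grass_continuous ug oB2 B2g.
have [e3 e30 H3] := unitmx_open ug.
exists (Num.min e3 (Num.min e1 e2)); first by rewrite !lt_min e30 e10 e20.
move=> h; rewrite !lt_min => /andP[hc /andP[h1 h2]]; have uh := H3 h hc.
split=> //; rewrite -QU /=; apply: sO; split=> /=.
  by apply: sB1; apply: H1.
by apply: sB2; apply: H2.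
Qed.

Lemma basis_frame (V W : {vspace 'cV[K]_d}) : (V <= W)%VS ->
  exists2 g : 'M[K]_d, g \in unitmx &
    forall v, (v \in V -> exists x, v = g *m x /\ forall i : 'I_d, (\dim V <= i)%N -> x i 0 = 0)
      /\ (v \in W -> exists x, v = g *m x /\ forall i : 'I_d, (\dim W <= i)%N -> x i 0 = 0).
Proof.
move=> VW; pose W1 := (W :\: V)%VS; pose W2 := (W^C)%VS.
pose s : seq 'cV[K]_d := vbasis V ++ vbasis W1 ++ vbasis W2.
have VW1 : (V + W1 = W)%VS.
  by rewrite addvC addv_diff; exact/addv_idPl.
have dW1 : (\dim V + \dim W1)%N = \dim W.
  by rewrite -VW1 dimv_disjoint_sum // capvC capv_diff.
have dW2 : (\dim W + \dim W2)%N = d.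
  rewrite -dimv_disjoint_sum ?capv_compl // addv_complf dimvf dim_matrix.
  exact: muln1.
have ss : size s = d by rewrite !size_cat !size_tuple addnA dW1 dW2.
pose g : 'M[K]_d := \matrix_(i, j) s`_j i 0.
have gspan n v : (n <= d)%N -> v \in <<take n s>>%VS ->
    exists x, v = g *m x /\ forall i : 'I_d, (n <= i)%N -> x i 0 = 0.
  move=> nd vs; have sub : (<<take n s>> <= colspan (g *m (pid_mx n : 'M[K]_(d, n))))%VS.
    apply/span_subvP => u /(nthP 0) [i +]; rewrite size_takel ?ss // => i_n <-.
    rewrite nth_take //; apply/mem_colspan; exists (delta_mx (Ordinal i_n) 0).
    have i_d : (i < d)%N by apply: leq_trans nd.
    rewrite -mulmxA -colE; have -> : col (Ordinal i_n) (pid_mx n : 'M[K]_(d, n)) =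
        delta_mx (Ordinal i_d) 0.
      apply/matrixP => a b; rewrite !mxE ord1 eqxx andbT -val_eqE /=.
      by case: eqP => // ->; rewrite i_n.
    by rewrite -colE; apply/matrixP => a b; rewrite !mxE ord1.
  have /mem_colspan[x ->] := subvP sub _ vs.
  exists (pid_mx n *m x); rewrite mulmxA; split=> // i ni.
  rewrite mxE; apply: big1 => l _; rewrite mxE; case: eqP => [il|_]; last by rewrite mul0r.
  by rewrite ltnNge ni mul0r.
have takeV : take (\dim V) s = vbasis V by rewrite take_size_cat ?size_tuple.
have takeW : take (\dim W) s = vbasis V ++ vbasis W1.
  by rewrite /s catA take_size_cat // size_cat !size_tuple.
have sV v : v \in V -> v \in <<take (\dim V) s>>%VS.
  by rewrite takeV (span_basis (vbasisP V)).
have sW v : v \in W -> v \in <<take (\dim W) s>>%VS.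
  by rewrite takeW span_cat (span_basis (vbasisP V)) (span_basis (vbasisP W1)) VW1.
have sT v : v \in <<take d s>>%VS.
  rewrite take_oversize ?ss // !span_cat (span_basis (vbasisP V)).
  rewrite (span_basis (vbasisP W1)) (span_basis (vbasisP W2)) addvA VW1.
  by rewrite /W2 addv_complf memvf.
exists g.
  have /choice[f fP] : forall i : 'I_d, exists x : 'cV[K]_d, delta_mx i 0 = g *m x.
    by move=> i; have [x [-> _]] := gspan d _ (leqnn d) (sT (delta_mx i 0)); exists x.
  have gf : g *m (\matrix_(i, j) f j i 0) = 1%:M.
    apply/matrixP => i j; rewrite !mxE; have /matrixP/(_ i 0) := fP j.
    rewrite !mxE eqxx andbT => ->; apply: eq_bigr => l _; by rewrite !mxE.
  by have [] := mulmx1_unit gf.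
move=> v; split=> [/sV|/sW]; apply: gspan; last by rewrite -[X in (_ <= X)%N]dW2 leq_addr.
by rewrite -[X in (_ <= X)%N]dW2 -dW1 -addnA leq_addr.
Qed.

Lemma grass_eq j (jd : (j <= d)%N) g (V : grassmannian K d j) : g \in unitmx ->
  (forall v, v \in gr_space V -> exists x, v = g *m x /\
    forall i : 'I_d, (j <= i)%N -> x i 0 = 0) -> V = grass jd g.
Proof.
move=> ug H; apply: val_inj => /=; apply/eqP; rewrite eqEdim.
rewrite (eqP (grass_subproof jd g)) (eqP (gr_dim V)) leqnn andbT.
apply/subvP => v /H[x [-> x0]]; apply/(mem_gframe _ _ jd) => i ji.
by rewrite gnE // mulKmx // x0.
Qed.

Lemma grass_surj j (jd : (j <= d)%N) (V : grassmannian K d j) :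
  exists2 g, g \in unitmx & V = grass jd g.
Proof.
have [g ug gP] := basis_frame (subvv V); exists g => //.
by apply: grass_eq => // v /((gP v).1); rewrite (eqP (gr_dim V)).
Qed.

Lemma mflag_surj : exists c, forall x : flags K d k,
  exists2 g, bnd c g & x = mflag g.
Proof.
have [c cP] := bounded_lu R F d; exists c => x.
have VW : (gr_space (set_val x).1 <= gr_space (set_val x).2)%VS := set_mem (valP x).
have [g0 u0 gP] := basis_frame VW; have [g bg gu] := cP g0 u0.
have [ug _ _] := bg; exists g => //; rewrite -(mflag_lu u0 ug gu).
apply: val_inj; rewrite -[RHS]/(set_val (mflag g0)) mflag_val.
rewrite -[LHS]/(set_val x); case: (set_val x) VW gP => V W /= _ gP.
congr pair; apply: grass_eq => // v.
  by move=> /((gP v).1); rewrite (eqP (gr_dim V)).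
by move=> /((gP v).2); rewrite (eqP (gr_dim W)).
Qed.

End FlagCoordinates.

(** * Orthogonal projections and a metric on the flag variety *)

Section Adjoint.
Variables (R : realType) (F : scalar_kind).
Local Notation K := (scalars R F).

Definition cj : K -> K :=
  match F return scalars R F -> scalars R F with
  | RealScalars => fun x => x
  | ComplexScalars => fun z => conjc (z : R[i])
  end.

End Adjoint.

Section AdjointTheory.
Variables (R : realType).
Implicit Types F : scalar_kind.

Lemma cjM F (x y : scalars R F) : cj (x * y) = cj x * cj y.
Proof. by case: F x y => //= x y; rewrite /cj; exact: rmorphM. Qed.

Lemma cjB F (x y : scalars R F) : cj (x - y) = cj x - cj y.
Proof. by case: F x y => //= x y; rewrite /cj; exact: rmorphB. Qed.

Lemma cj0 F : cj (0 : scalars R F) = 0.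
Proof. by have := cjB (0 : scalars R F) 0; rewrite !subrr. Qed.

Lemma cjD F (x y : scalars R F) : cj (x + y) = cj x + cj y.
Proof.
by have := cjB x (0 - y); rewrite (cjB 0 y) cj0 !sub0r !opprK.
Qed.

Lemma nrm_cj F (x : scalars R F) : nrm (cj x) = nrm x.
Proof.
case: F x => //= x; rewrite /nrm /=; case: x => a b /=.
by rewrite sqrrN.
Qed.

Lemma to_complex_cj F (x : scalars R F) :
  to_complex (cj x * x) = ((nrm x) ^+ 2)%:C%C.
Proof.
case: F x => x; rewrite to_complexM /nrm; last exact: conjc_mul_normc.
have {1}-> : to_complex (cj x) = conjc (to_complex x) by rewrite /= oppr0.
exact: conjc_mul_normc.
Qed.

Section AdjointMatrix.
Variable F : scalar_kind.
Local Notation K := (scalars R F).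

Definition adj m n (A : 'M[K]_(m, n)) : 'M[K]_(n, m) := (map_mx (@cj R F) A)^T.

Lemma adjM m n p (A : 'M[K]_(m, n)) (B : 'M[K]_(n, p)) :
  adj (A *m B) = adj B *m adj A.
Proof.
apply/matrixP => i j; rewrite !mxE (big_morph _ (@cjD F) (@cj0 F)).
by apply: eq_bigr => l _; rewrite !mxE cjM mulrC.
Qed.

Lemma adjB m n (A B : 'M[K]_(m, n)) : adj (A - B) = adj A - adj B.
Proof. by apply/matrixP => i j; rewrite !mxE cjB. Qed.

Lemma mn_adj m n (A : 'M[K]_(m, n)) : mn (adj A) = mn A.
Proof.
rewrite mn_tr; apply: eq_bigr => i _; apply: eq_bigr => j _.
by rewrite mxE nrm_cj.
Qed.

Lemma adj_mul_eq0 n (y : 'cV[K]_n) : adj y *m y = 0 -> y = 0.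
Proof.
move=> /matrixP/(_ 0 0); rewrite !mxE => /(congr1 (@to_complex R F)).
rewrite to_complex0 (big_morph _ (@to_complexD R F) (@to_complex0 R F)).
under eq_bigr => i _ do rewrite !mxE to_complex_cj.
rewrite -rmorph_sum => -[] /psumr_eq0P y0.
apply/matrixP => i j; rewrite ord1 [RHS]mxE; apply/eqP; rewrite -nrm_eq0.
rewrite -sqrf_eq0; apply/eqP; apply: y0 => // l _; exact: sqr_ge0.
Qed.

Lemma gram_unit d j (A : 'M[K]_(d, j)) (L : 'M[K]_(j, d)) :
  L *m A = 1%:M -> adj A *m A \in unitmx.
Proof.
move=> LA; rewrite -unitmx_tr -row_free_unit; apply: inj_row_free => v vA.
apply: trmx_inj; rewrite trmx0 -[v^T]mul1mx -LA -mulmxA.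
suff -> : A *m v^T = 0 by rewrite mulmx0.
apply: adj_mul_eq0; rewrite adjM -mulmxA (mulmxA (adj A)).
have -> : adj A *m A *m v^T = 0 by apply: trmx_inj; rewrite trmx_mul trmxK vA trmx0.
by rewrite mulmx0.
Qed.

(** Orthogonal projection onto the column space of a full-rank [A]. By [proj_mulX] it depends on
    this space only, so it embeds the Grassmannian in the matrices, from which [fdist] takes its
    metric. *)
Definition proj d j (A : 'M[K]_(d, j)) : 'M[K]_d :=
  A *m invmx (adj A *m A) *m adj A.

Lemma proj_mulX d j (A : 'M[K]_(d, j)) (L : 'M[K]_(j, d)) (X : 'M[K]_j) :
  L *m A = 1%:M -> X \in unitmx -> proj (A *m X) = proj A.
Proof.
move=> LA uX; have uG := gram_unit LA.
have uaX : adj X \in unitmx.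
  have aX : adj (invmx X) *m adj X = 1%:M.
    rewrite -adjM mulmxV //; apply/matrixP => i l; rewrite !mxE eq_sym.
    case: eqP => _; last exact: cj0.
    by rewrite /cj; case: F => //=; rewrite oppr0.
  by have [] := mulmx1_unit aX.
rewrite /proj adjM.
have -> : adj X *m adj A *m (A *m X) = adj X *m ((adj A *m A) *m X) by rewrite !mulmxA.
rewrite invmxM ?unitmx_mul ?uaX ?uG //.
rewrite invmxM // !mulmxA mulmxK // mulmxKV //.
Qed.

Lemma proj_id d j (A : 'M[K]_(d, j)) (L : 'M[K]_(j, d)) :
  L *m A = 1%:M -> proj A *m A = A.
Proof. by move=> /gram_unit uG; rewrite /proj -mulmxA mulmxKV. Qed.

Lemma mcvg_adj I (G : set_system I) {PG : ProperFilter G} m n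
    (A_ : I -> 'M[K]_(m, n)) A : mcvg G A_ A -> mcvg G (fun i => adj (A_ i)) (adj A).
Proof. by move=> cA e /cA; apply: filterS => i /=; rewrite -adjB mn_adj. Qed.

Lemma mcvg_proj I (G : set_system I) {PG : ProperFilter G} d j
    (A_ : I -> 'M[K]_(d, j)) A (L : 'M[K]_(j, d)) : L *m A = 1%:M ->
  mcvg G A_ A -> mcvg G (fun i => proj (A_ i)) (proj A).
Proof.
move=> LA cA; have caA : mcvg G (fun i => adj (A_ i)) (adj A) by exact: mcvg_adj.
exact: (mcvgM (mcvgM cA (mcvg_inv (gram_unit LA) (mcvgM caA cA))) caA).
Qed.

Lemma mcvg_nbhs m n (A : 'M[K]_(m, n)) : mcvg (nbhs A) id A.
Proof.
move=> e e0; pose c := e / (m * n).+1%:R; have c0 : 0 < c by rewrite divr_gt0.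
exists (fun i j => [set y | nrm (y - A i j) < c]).
  by move=> i j; apply/nbhs_nrm; exists c.
move=> B /= AB; apply: (@le_lt_trans _ _ ((m * n)%:R * c)).
  by apply: mn_le => i j; rewrite !mxE ltW // AB.
by rewrite /c mulrA ltr_pdivrMr // mulrC ltr_pM2l // ltr_nat.
Qed.

End AdjointMatrix.
End AdjointTheory.

Section FlagTopology.
Variables (R : realType) (F : scalar_kind) (d : nat).
Local Notation K := (scalars R F).

Section GrassmannianMetric.
Variable j : nat.
Hypothesis jd : (j <= d)%N.

Definition grep (V : grassmannian K d j) : 'M[K]_d :=
  projT1 (cid2 (grass_surj jd V)).

Lemma grepK V : V = grass jd (grep V).
Proof. by rewrite /grep; case: cid2. Qed.

Definition gproj (V : grassmannian K d j) : 'M[K]_d := proj (gframe j (grep V)).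

Lemma gproj_frame (A : 'M[K]_(d, j)) (V : grassmannian K d j) :
  colspan A = gr_space V ->
  (exists L, L *m A = 1%:M) /\ proj A = gproj V.
Proof.
move=> AV; have LG := stdframe_inv (gn_unit (grep V)) jd.
set G := gn (grep V) *m pid_mx j in LG; set L := (pid_mx j *m _) in LG.
have VG : gr_space V = colspan G by rewrite {1}(grepK V).
have /choice[f fP] : forall l : 'I_j, exists x, col l G = A *m x.
  move=> l; apply/mem_colspan; rewrite AV VG; apply/mem_colspan.
  by exists (delta_mx l 0); rewrite colE.
pose X : 'M[K]_j := \matrix_(a, l) f l a 0.
have GX : G = A *m X.
  apply/matrixP => a l; have /matrixP/(_ a 0) := fP l; rewrite !mxE => ->.
  by apply: eq_bigr => b _; rewrite !mxE.
have LAX : (L *m A) *m X = 1%:M by rewrite -mulmxA -GX.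
have [uLA uX] := mulmx1_unit LAX.
have LA : (X *m L) *m A = 1%:M.
  by rewrite -mulmxA; apply: mulmx1C.
split; first by exists (X *m L).
by rewrite /gproj /gframe -/G GX (proj_mulX LA).
Qed.

Lemma gproj_inj : injective gproj.
Proof.
move=> V W VW.
have AV : colspan (gframe j (grep V)) = gr_space V by rewrite {2}(grepK V).
have AW : colspan (gframe j (grep W)) = gr_space W by rewrite {2}(grepK W).
have [[LV LVA] _] := gproj_frame AV; have [[LW LWA] _] := gproj_frame AW.
have sub (A B : 'M[K]_(d, j)) L : L *m A = 1%:M -> proj A = proj B ->
    (colspan A <= colspan B)%VS.
  move=> LA AB; apply/subvP => v /mem_colspan[x ->]; apply/mem_colspan.
  rewrite -(proj_id LA) AB /proj -!mulmxA; eexists; reflexivity.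
apply: val_inj => /=; rewrite -AV -AW; apply/eqP; rewrite eqEsubv.
by rewrite (sub _ _ _ LVA VW) (sub _ _ _ LWA (esym VW)).
Qed.

Lemma gproj_continuous (V : grassmannian K d j) (e : R) : 0 < e ->
  nbhs V [set W | mn (gproj W - gproj V) < e].
Proof.
move=> e0; apply: open_nbhs_nbhs; split; last by rewrite /= subrr mn0.
suff : gr_open [set W | mn (gproj W - gproj V) < e] by [].
rewrite /gr_open openE => A /= [W We AW].
have [[L LA] PA] := gproj_frame AW.
have fA : frames A by rewrite /frames /= AW (eqP (gr_dim W)).
rewrite /interior /nbhs /= -nbhs_subspace_in // /within /=.
have de : 0 < e - mn (gproj W - gproj V) by rewrite subr_gt0.
have : nbhs (A : 'M[K]_(d, j)) [set B | mn (proj B - proj A) < e - mn (gproj W - gproj V)].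
  exact: (mcvg_proj LA (mcvg_nbhs (A : 'M[K]_(d, j))) de).
apply: filterS => B /= BA fB.
have [W' BW'] : exists W' : grassmannian K d j, colspan B = gr_space W'.
  by exists (Grassmannian (introT eqP fB)).
exists W' => //=; have [_ PB] := gproj_frame BW'; rewrite -PB.
have -> : proj B - gproj V = (proj B - proj A) + (gproj W - gproj V).
  by rewrite PA addrA subrK.
apply: le_lt_trans (ler_mnD _ _) _; lra.
Qed.

End GrassmannianMetric.

Section FlagMetric.
Variable k : nat.
Hypothesis kd : (k <= d - k)%N.
Let kd' : (k <= d)%N. Proof. exact: leq_trans kd (leq_subr _ _). Qed.
Let dkd : (d - k <= d)%N. Proof. exact: leq_subr. Qed.
Implicit Types x y z : flags K d k.

Definition fdist x y : R :=
  mn (gproj kd' (set_val x).1 - gproj kd' (set_val y).1) +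
  mn (gproj dkd (set_val x).2 - gproj dkd (set_val y).2).

Lemma fdist_ge0 x y : 0 <= fdist x y.
Proof. by rewrite addr_ge0 ?mn_ge0. Qed.

Lemma fdistC x y : fdist x y = fdist y x.
Proof. by rewrite /fdist mnB [X in _ + X]mnB. Qed.

Lemma fdist_triangle x y z : fdist x z <= fdist x y + fdist y z.
Proof.
rewrite /fdist addrACA; apply: lerD.
  by rewrite -[X in mn X](subrKA (gproj kd' (set_val y).1)); exact: ler_mnD.
by rewrite -[X in mn X](subrKA (gproj dkd (set_val y).2)); exact: ler_mnD.
Qed.

Lemma fdist0 x y : fdist x y = 0 <-> x = y.
Proof.
split=> [|->]; last by rewrite /fdist !subrr !mn0 addr0.
move/eqP; rewrite paddr_eq0 ?mn_ge0 // !mn_eq0 !subr_eq0.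
move=> /andP[/eqP /gproj_inj e1 /eqP /gproj_inj e2]; apply: val_inj.
rewrite -[LHS]/(set_val x) -[RHS]/(set_val y).
by case: (set_val x) (set_val y) e1 e2 => [? ?] [? ?] /= -> ->.
Qed.

Lemma fdist_ball x (e : R) : 0 < e -> nbhs x [set y | fdist x y < e].
Proof.
move=> e0; have e20 : 0 < e / 2 by rewrite divr_gt0.
have n1 := gproj_continuous kd' (set_val x).1 e20.
have n2 := gproj_continuous dkd (set_val x).2 e20.
have cv := @initial_continuous _ _ (@set_val _ (flags K d k)) x.
have : nbhs (set_val x) [set VW | mn (gproj kd' VW.1 - gproj kd' (set_val x).1) < e / 2 /\
    mn (gproj dkd VW.2 - gproj dkd (set_val x).2) < e / 2].
  exists ([set W | mn (gproj kd' W - gproj kd' (set_val x).1) < e / 2],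
    [set W | mn (gproj dkd W - gproj dkd (set_val x).2) < e / 2]).
    split; [exact: n1|exact: n2].
  by move=> [? ?] [].
move=> /cv near_x; apply: (filterS _ (near_x : nbhs x (set_val @^-1` _))) => y [] /= y1 y2.
by rewrite /fdist mnB [X in _ + X]mnB [e]splitr ltrD.
Qed.

Lemma mflag_cvg I (G : set_system I) {PG : ProperFilter G} (g_ : I -> 'M[K]_d) g :
  g \in unitmx -> mcvg G g_ g -> (fun i => mflag kd (g_ i)) @ G --> mflag kd g.
Proof.
move=> ug cg U; rewrite nbhsE => -[V [oV Vg] VU].
have [e e0 H] := mflag_continuous ug oV Vg.
suff : G [set i | U (mflag kd (g_ i))] by [].
by apply: filterS (cg e e0) => i /= /H [_ Vh]; exact: VU.
Qed.

Definition flagc : R := projT1 (cid (mflag_surj R F kd)).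

Definition frep x : 'M[K]_d :=
  projT1 (cid2 (projT2 (cid (mflag_surj R F kd)) x)).

Lemma frep_bnd x : bnd flagc (frep x).
Proof. by rewrite /frep; case: cid2. Qed.

Lemma frep_unit x : frep x \in unitmx.
Proof. by case: (frep_bnd x). Qed.

Lemma frepK x : mflag kd (frep x) = x.
Proof. by rewrite /frep; case: cid2. Qed.

Lemma flags_ultra I (G : set_system I) (UG : UltraFilter G) (f : I -> flags K d k) :
  exists g, [/\ bnd flagc g, mcvg G (frep \o f) g & f @ G --> mflag kd g].
Proof.
have [g cg bg] : exists2 g, mcvg G (frep \o f) g & bnd flagc g.
  by apply: mcvg_bnd_ultra; apply: filterS filterT => i _; exact: frep_bnd.
have [ug _ _] := bg; exists g; split=> //.
have : (fun i => mflag kd ((frep \o f) i)) @ G --> mflag kd g by exact: mflag_cvg.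
by under eq_fun do rewrite /= frepK.
Qed.

(** The nontrivial inclusion is compactness: flags outside [U] at distance below [1 / (n + 1)] from
    [x] have a limit along an ultrafilter, and this limit is at distance 0 from [x], hence equal to
    [x]. *)
Lemma flag_nbhsE x :
  nbhs x = filter_from [set e : R | 0 < e] (fun e => [set y | fdist x y < e]).
Proof.
apply/seteqP; split=> U; last first.
  by case=> e /= e0 eU; apply: filterS eU _; exact: fdist_ball.
move=> nU; apply: contrapT => noe.
have /choice[y yP] : forall n : nat, exists y, fdist x y < n.+1%:R^-1 /\ ~ U y.
  move=> n; apply: contrapT => /forallNP ny; apply: noe.
  exists n.+1%:R^-1 => /=; first by rewrite invr_gt0.
  by move=> y xy; apply: contrapT => Uy; apply: (ny y).
have [G [UG sG]] := @ultraFilterLemma nat \oo _.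
have [g [_ _ yg]] := flags_ultra UG y.
have xg : x = mflag kd g.
  apply/fdist0; apply/eqP; rewrite eq_le fdist_ge0 andbT.
  apply/ler_addgt0Pl => e e0; rewrite addr0.
  have e20 : 0 < e / 2 by rewrite divr_gt0.
  have near1 : G [set n | fdist (mflag kd g) (y n) < e / 2] by exact: yg (fdist_ball _ e20).
  have near2 : G [set n | n.+1%:R^-1 < e / 2] by apply: sG; exact: near_infty_natSinv_lt (PosNum e20).
  have [n [/= n1 n2]] := filter_ex (filterI near1 near2).
  apply: le_trans (fdist_triangle x (y n) _) _; rewrite [e]splitr; apply: lerD.
    exact: ltW (lt_trans (yP n).1 n2).
  by rewrite fdistC ltW.
have : G [set n | U (y n)] by apply: yg; rewrite -xg.
by move=> /filter_ex[n Un]; exact: (yP n).2.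
Qed.

End FlagMetric.
End FlagTopology.

(** * Gromov hyperbolic spaces *)

Section HyperbolicGeometry.
Variables (R : realType) (X : metricType R).
Implicit Types (x y z : X) (u v : nat -> X) (p q : gromov_boundary X).

Lemma mtri y x z : mdist x z <= mdist x y + mdist y z.
Proof. exact: metric_triangle. Qed.

Lemma exists_nat_ge (r : R) : exists N : nat, r <= N%:R.
Proof.
exists (Num.bound `|r|); apply: le_trans (ler_norm r) _.
exact: ltW (archi_boundP (normr_ge0 r)).
Qed.

Lemma near2_natP (P : nat -> nat -> Prop) :
  (\forall i \near \oo & j \near \oo, P i j) <->
  exists N, forall i j, (N <= i)%N -> (N <= j)%N -> P i j.
Proof.
split=> [[[A B] /= [[N _ NA] [M _ MB]] AB]|[N NP]].
  exists (maxn N M) => i j; rewrite !geq_max => /andP[Ni _] /andP[_ Mj].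
  by apply: (AB (i, j)); split; [exact: NA|exact: MB].
exists ([set i | (N <= i)%N], [set i | (N <= i)%N]) => /=.
  by split; exists N.
by move=> [i j] /= [Ni Nj]; exact: NP.
Qed.

Lemma gpC o x y : gromov_product o x y = gromov_product o y x.
Proof. by rewrite /gromov_product (metric_sym y x) [mdist o x + _]addrC. Qed.

Lemma gp_ge0 o x y : 0 <= gromov_product o x y.
Proof.
rewrite /gromov_product divr_ge0 // subr_ge0 [mdist o x]metric_sym.
exact: mtri.
Qed.

Lemma gp_le o x y : gromov_product o x y <= mdist o x.
Proof.
rewrite /gromov_product ler_pdivrMr //; have := mtri x o y; lra.
Qed.

Lemma gpxx o x : gromov_product o x x = mdist o x.
Proof. rewrite /gromov_product mdistxx; lra. Qed.

Lemma gp_base o o' x y :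
  gromov_product o x y <= gromov_product o' x y + mdist o o'.
Proof.
rewrite /gromov_product; have := mtri o' o x; have := mtri o' o y.
lra.
Qed.

Lemma gp_move o x y x' y' : gromov_product o x y <=
  gromov_product o x' y' + mdist x x' + mdist y y'.
Proof.
rewrite /gromov_product; have := mtri x' o x; have := mtri y' o y.
have := mtri x x' y'; have := mtri y x y'.
rewrite [mdist x' x]metric_sym [mdist y' y]metric_sym; lra.
Qed.

Lemma gp_geodesic y x z : mdist x y + mdist y z = mdist x z ->
  gromov_product y x z = 0.
Proof. by rewrite /gromov_product [mdist y x]metric_sym => ->; rewrite subrr mul0r. Qed.

Definition geod (c : R -> X) x y : Prop :=
  [/\ c 0 = x, c (mdist x y) = y &
      {in `[0, mdist x y] &, forall s t, mdist (c s) (c t) = `|s - t|}].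

Lemma geod_rev c x y : geod c x y -> geod (fun t => c (mdist x y - t)) y x.
Proof.
move=> [c0 c1 cd]; split; rewrite ?subr0 // metric_sym; first by rewrite subrr.
move=> s t; rewrite !in_itv /= => /andP[s0 s1] /andP[t0 t1].
rewrite cd ?in_itv /= ?subr_ge0 ?s1 ?t1 ?gerBl ?s0 ?t0 //.
by rewrite opprB addrC addrA subrK distrC.
Qed.

Lemma geod_dist c x y s t : geod c x y -> 0 <= s -> s <= t -> t <= mdist x y ->
  mdist (c s) (c t) = t - s.
Proof.
move=> [_ _ cd] s0 st tl; rewrite cd ?in_itv /= ?s0 ?tl ?(le_trans st) ?(le_trans s0) //.
by rewrite distrC ger0_norm // subr_ge0.
Qed.

Variables (geo : geodesic_space X) (prop : proper_space X).
Variable delta : R.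
Hypothesis hyp : forall o x y z,
  Num.min (gromov_product o x y) (gromov_product o y z) - delta
    <= gromov_product o x z.

Lemma hyp_le o x y z r : r <= gromov_product o x y -> r <= gromov_product o y z ->
  r - delta <= gromov_product o x z.
Proof.
by move=> r1 r2; apply: le_trans (hyp o x y z); rewrite lerD2r le_min r1.
Qed.

Lemma delta_ge0 : X -> 0 <= delta.
Proof. move=> x; have := hyp x x x x; rewrite minxx; lra. Qed.

Definition brep p : nat -> X := projT1 (cid2 (bd_classP p)).

Lemma brep_asym p : asymptotic (brep p) (brep p).
Proof. by rewrite /brep; case: cid2. Qed.

Lemma brepE p : bd_class p = gromov_class (brep p).
Proof. by rewrite /brep; case: cid2. Qed.

Lemma asymptoticP o u v : asymptotic u v <->
  forall r, exists N, forall i j, (N <= i)%N -> (N <= j)%N ->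
    r <= gromov_product o (u i) (v j).
Proof.
split=> [uv r|uv o' r]; first by have /near2_natP := uv o r.
have [N NP] := uv (r + mdist o o'); apply/near2_natP; exists N => i j Ni Nj.
by have := NP i j Ni Nj; have := gp_base o o' (u i) (v j); lra.
Qed.

Lemma asymptotic_sym u v : asymptotic u v -> asymptotic v u.
Proof.
move=> uv o r; have /near2_natP[N NP] := uv o r.
by apply/near2_natP; exists N => i j Ni Nj; rewrite gpC; exact: NP.
Qed.

Lemma asymptotic_trans u v w : asymptotic u v -> asymptotic v w -> asymptotic u w.
Proof.
move=> uv vw o r; have /near2_natP[N NP] := uv o (r + delta).
have /near2_natP[M MP] := vw o (r + delta).
apply/near2_natP; exists (maxn N M) => i j; rewrite !geq_max => /andP[Ni _] /andP[_ Mj].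
rewrite -(addrK delta r); apply: (hyp_le (y := v (maxn N M))).
  by apply: NP; rewrite ?leq_maxl.
by apply: MP; rewrite ?leq_maxr.
Qed.

Lemma bd_eq p q : asymptotic (brep p) (brep q) -> p = q.
Proof.
move=> pq; have : bd_class p = bd_class q.
  rewrite !brepE; apply/seteqP; split=> v [vv av]; split=> //.
    exact: asymptotic_trans (asymptotic_sym pq) av.
  exact: asymptotic_trans pq av.
case: p q {pq} => [P HP] [Q HQ] /= PQ; case: _ / PQ HQ => HQ.
by congr GromovBoundary; exact: Prop_irrelevance.
Qed.

(** The trace in [X] of a neighbourhood of the boundary point [p], seen from [o] and computed with
    the fixed representative [brep p]. A sequence converges to [p] when it eventually enters every
    shadow ([shadow_seq], [shadow_class]). *)
Definition shadow o r p : set X :=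
  [set x | \forall n \near \oo, r <= gromov_product o x (brep p n)].

Lemma shadow_le o r s p : r <= s -> shadow o s p `<=` shadow o r p.
Proof. by move=> rs x; apply: filterS => n; exact: le_trans. Qed.

Lemma shadow_dist o r p x : shadow o r p x -> r <= mdist o x.
Proof. by move=> /filter_ex[n rx]; apply: le_trans rx (gp_le _ _ _). Qed.

Lemma shadow_seq o r p u : bd_class p u -> \forall n \near \oo, shadow o r p (u n).
Proof.
rewrite brepE => -[_ /asymptotic_sym /(_ o r) /near2_natP[N NP]].
by exists N => // n /= Nn; exists N => // i /= Ni; exact: NP.
Qed.

Lemma shadow_member o r p u x : bd_class p u ->
  (\forall n \near \oo, r + delta <= gromov_product o x (u n)) -> shadow o r p x.
Proof.
rewrite brepE => -[_ /asymptotic_sym /(_ o (r + delta)) /near2_natP[N NP]] [M _ MP].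
exists N => // i /= Ni; rewrite -(addrK delta r).
apply: (hyp_le (y := u (maxn N M))); first by apply: MP; rewrite /= leq_maxr.
by apply: NP; rewrite ?leq_maxl.
Qed.

Lemma shadow_move o r p x y : shadow o (r + mdist x y) p x -> shadow o r p y.
Proof.
apply: filterS => n; have := gp_move o x (brep p n) y (brep p n).
rewrite mdistxx; lra.
Qed.

Lemma shadow_class o p u :
  (forall r, \forall n \near \oo, shadow o r p (u n)) -> bd_class p u.
Proof.
move=> us; rewrite brepE.
have key : asymptotic (brep p) u.
  apply/(asymptoticP o) => r; have [N _ NP] := us (r + delta).
  have /near2_natP[M MP] := @brep_asym p o (r + delta).
  exists (maxn N M) => i j; rewrite !geq_max => /andP[_ Mi] /andP[Nj _].
  have [L _ LP] := NP j Nj; rewrite -(addrK delta r) gpC.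
  apply: (hyp_le (y := brep p (maxn L M))); first by apply: LP; rewrite /= leq_maxl.
  by apply: MP => //; rewrite leq_maxr.
by split=> //; exact: asymptotic_trans (asymptotic_sym key) key.
Qed.

(** Points of deep shadows of [p] and [q] with a large mutual product would make the two
    representatives asymptotic by two uses of hyperbolicity, each costing one [delta]. *)
Lemma shadow_separate o p q : p <> q -> exists r, forall x y,
  shadow o r p x -> shadow o r q y -> gromov_product o x y < r.
Proof.
move=> pq; apply: contrapT => nor; apply: pq; apply: bd_eq.
apply/(asymptoticP o) => r; apply: contrapT => nN; apply: nor.
exists (r + delta + delta) => x y [N _ NP] [M _ MP].
rewrite ltNge; apply/negP => rxy; apply: nN; exists (maxn N M) => i j.
rewrite !geq_max => /andP[Ni _] /andP[_ Mj].
have xj : r + delta <= gromov_product o x (brep q j).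
  by rewrite -(addrK delta (r + delta)); apply: (hyp_le rxy); exact: MP.
rewrite -(addrK delta r); apply: (hyp_le (y := x)) => //.
rewrite gpC; apply: le_trans (NP i Ni); rewrite lerDl.
exact: delta_ge0 o.
Qed.

(** At distance [gromov_product x o y] from [x] along the geodesic, the products with [x] and with
    [y] based at [o] coincide, so the hyperbolic inequality can be solved for the distance from
    [o]. *)
Lemma geod_near o c x y : geod c x y -> exists t,
  [/\ 0 <= t, t <= mdist x y & mdist o (c t) <= gromov_product o x y + 2 * delta].
Proof.
move=> gc; have [c0 c1 _] := gc.
have t0 : 0 <= gromov_product x o y := gp_ge0 _ _ _.
have t1 : gromov_product x o y <= mdist x y by rewrite gpC gp_le.
exists (gromov_product x o y); split=> //.
set t := gromov_product x o y in t0 t1 *.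
have d1 : mdist x (c t) = t by rewrite -{1}c0 (geod_dist gc) // subr0.
have d2 : mdist (c t) y = mdist x y - t by rewrite -{1}c1 (geod_dist gc).
have e1 : gromov_product o x (c t) = (gromov_product o x y + mdist o (c t)) / 2.
  rewrite /gromov_product d1 /t /gromov_product [mdist x o]metric_sym; lra.
have e2 : gromov_product o (c t) y = (gromov_product o x y + mdist o (c t)) / 2.
  rewrite /gromov_product d2 /t /gromov_product [mdist x o]metric_sym; lra.
by have := hyp o x (c t) y; rewrite e1 e2 minxx; lra.
Qed.

Lemma proper_ultra (I : Type) (U : set_system I) (UU : UltraFilter U) (f : I -> X) x r :
  U [set i | mdist x (f i) <= r] -> exists z, U [set i | mdist (f i) z < 1].
Proof.
move=> Ur; have UF := ultra_fmap f UU.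
have cp : compact [set y | mdist x y <= r] by exact: prop.
move: cp; rewrite compact_ultra => /(_ _ UF Ur) [z [_ fz]].
exists z; have : nbhs z (ball z 1) by exact: nbhsx_ballx.
move=> /fz; rewrite ballEmdist /nbhs /=; apply: filterS => i /=.
by rewrite metric_sym.
Qed.

(* Geodesics from o to points of a set in U pass through a common ball of
   radius 1 at distance m from o, hence these points have large mutual Gromov
   products. *)
Lemma shadow_ultra o (I : Type) (U : set_system I) (UU : UltraFilter U) (f : I -> X) :
  (forall m : nat, U [set i | m%:R <= mdist o (f i)]) ->
  exists p, forall r, U [set i | shadow o r p (f i)].
Proof.
move=> far.
have /choice[E EP] : forall m : nat, exists E : set I, U E /\
    forall i j, E i -> E j -> m%:R - 1 <= gromov_product o (f i) (f j).
  move=> m; have /choice[g gP] : forall i, exists y, m%:R <= mdist o (f i) ->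
      mdist o y = m%:R /\ mdist y (f i) = mdist o (f i) - m%:R.
    move=> i; have [mi|_] := leP m%:R (mdist o (f i)); last by exists o.
    have [c gc] := geo o (f i); have [c0 c1 _] := gc; exists (c m%:R) => _.
    split; first by rewrite -{1}c0 (geod_dist gc) // subr0.
    by rewrite -{1}c1 (geod_dist gc).
  have [z Uz] : exists z, U [set i | mdist (g i) z < 1].
    apply: (@proper_ultra _ U UU g o m%:R); apply: filterS (far m) => i /= mi.
    by have [-> _] := gP i mi.
  exists ([set i | m%:R <= mdist o (f i)] `&` [set i | mdist (g i) z < 1]).
  split; first exact: filterI.
  move=> i j /= [mi gi] [mj gj]; have [_ di] := gP i mi; have [_ dj] := gP j mj.
  rewrite /gromov_product; have := mtri (g i) (f i) (f j); have := mtri z (g i) (g j).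
  have := mtri (g j) (g i) (f j).
  rewrite [mdist (f i) (g i)]metric_sym di dj [mdist z _]metric_sym; lra.
have UE n : U (\bigcap_(m in `I_n.+1) E m).
  elim: n => [|n IH].
    apply: filterS (EP 0%N).1 => i Ei [|m] //=.
  apply: filterS (filterI IH (EP n.+1).1) => i [Ei En] m /=; rewrite ltnS leq_eqVlt.
  by move=> /orP[/eqP ->|mn] //; apply: Ei.
have /choice[s sP] : forall n, exists i, (\bigcap_(m in `I_n.+1) E m) i.
  by move=> n; exact: filter_ex (UE n).
have asym : asymptotic (f \o s) (f \o s).
  apply/(asymptoticP o) => r; have [N rN] := exists_nat_ge (r + 1).
  exists N => i j Ni Nj /=.
  have := (EP N).2 _ _ (sP i N (_ : N < i.+1)%N) (sP j N (_ : N < j.+1)%N).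
  by rewrite !ltnS => /(_ Ni Nj); lra.
have [p pE] : exists p : gromov_boundary X, bd_class p = gromov_class (f \o s).
  have cP : exists2 u, asymptotic u u & gromov_class (f \o s) = gromov_class u.
    by exists (f \o s).
  by exists (GromovBoundary cP).
exists p => r; have [N rN] := exists_nat_ge (r + delta + 1).
apply: filterS (EP N).1 => i Ei; apply: (shadow_member (u := f \o s)).
  by rewrite pE; split.
exists N => // n /= Nn; have := (EP N).2 _ _ Ei (sP n N (_ : N < n.+1)%N).
by rewrite ltnS => /(_ Nn); lra.
Qed.

Section Horoballs.
Variables (B : set X) (p : gromov_boundary X) (h : X -> R) (D c : R).
Hypothesis hD : forall x y u, bd_class p u ->
  \forall n \near \oo, `|(h x - h y) - (mdist x (u n) - mdist y (u n))| <= D.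
Hypothesis Bc : forall x, B x -> h x <= c.
Hypothesis nBc : forall x, ~ B x -> - c <= h x.

Let up : bd_class p (brep p).
Proof. by rewrite brepE; split; exact: brep_asym. Qed.

(** In a shadow of [q] the product with points near [p] is bounded, so [h x - h o] is the distance
    from [o] to [x] up to a bounded error. It exceeds every constant once the shadow is deep,
    whereas [h] is at most [c] on [B]. *)
Lemma horoball_shadow o q : q <> p -> exists r, forall x, shadow o r q x -> ~ B x.
Proof.
move=> qp; have [r0 r0P] := shadow_separate o qp.
exists (Num.max r0 (c - h o + 2 * r0 + D + 1)) => x sx Bx.
have sx0 : shadow o r0 q x by apply: shadow_le sx; rewrite le_max lexx.
have := shadow_dist sx; rewrite ge_max => /andP[_ dx].
have [n [un hn]] := filter_ex (filterI (shadow_seq o r0 up) (hD x o up)).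
have := r0P _ _ sx0 un; have := Bc Bx.
rewrite /gromov_product [mdist x (brep p n)]metric_sym => hc.
move: hn => /=; rewrite ler_norml => /andP[hn _].
rewrite [mdist x (brep p n)]metric_sym in hn; rewrite [mdist (brep p n) x]metric_sym.
rewrite [mdist (brep p n) x]metric_sym in hn; lra.
Qed.

(** Moving by [s] towards the centre lowers [h] by about [s], deep enough for a whole ball to lie in
    [B]. The radius 2 lets [near_hballs_finite] compare two centres that are each within 1 of a
    common limit. *)
Lemma horoball_deep : exists2 s, 0 <= s & forall x, B x ->
  exists2 y, mdist x y <= s & forall z, mdist y z < 2 -> B z.
Proof.
pose s := Num.max 0 (2 * c + 2 * delta + 2 * D + 3).
have s0 : 0 <= s by rewrite le_max lexx.
have s1 : 2 * c + 2 * delta + 2 * D + 3 <= s by rewrite le_max lexx orbT.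
exists s => // x Bx; set u := brep p.
have /near2_natP[N NP] := @brep_asym p x s.
have sN : s <= mdist x (u N) by rewrite -gpxx; apply: NP.
have [g gg] := geo x (u N); have [g0 g1 _] := gg.
have dx : mdist x (g s) = s by rewrite -{1}g0 (geod_dist gg) // subr0.
have du : mdist (g s) (u N) = mdist x (u N) - s by rewrite -{1}g1 (geod_dist gg).
exists (g s) => [|z gz]; first by rewrite dx.
have gp1 : s <= gromov_product x (g s) (u N).
  rewrite /gromov_product dx du; lra.
apply: contrapT => /nBc nz; have hx := Bc Bx.
have [n [[/= h1 h2] Nn]] := filter_ex (filterI (filterI (hD x (g s) up)
  (hD z (g s) up)) (nbhs_infty_ge N)).
have := hyp_le gp1 (NP N n (leqnn N) Nn); rewrite /gromov_product dx.
move: h1 h2; rewrite !ler_norml => /andP[h1 _] /andP[_ h2].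
have := mtri (g s) z (u n); rewrite [mdist z (g s)]metric_sym -/u in h1 h2 *.
lra.
Qed.

End Horoballs.
End HyperbolicGeometry.

(** * Orbits in a Gromov model *)

Lemma finite_bound (R : realType) (T : Type) (A : set T) (f : T -> R) :
  finite_set A -> exists M, forall x, A x -> f x <= M.
Proof.
move=> fA; have /finite_seqP[s sE] := finite_image f fA.
exists (\big[Num.max/0]_(y <- s) y) => x Ax.
have le_max_seq y : y \in s -> y <= \big[Num.max/0]_(z <- s) z.
  elim: s {sE} => // z s IH; rewrite inE big_cons le_max.
  by move=> /orP[/eqP ->|/IH ->]; rewrite ?lexx ?orbT.
apply: le_max_seq; have : [set` s] (f x) by rewrite -sE; exists x.
by [].
Qed.

Lemma infinite_injection (T : Type) (A : set T) : infinite_set A ->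
  exists2 e : nat -> T, injective e & forall n, A (e n).
Proof.
move=> /infiniteP /card_leP[f].
pose i n : [set: nat] := exist _ n (mem_set (I : [set: nat] n)).
exists (fun n => set_val (f (i n))); last by move=> n; exact: set_mem (valP (f (i n))).
move=> n m /val_inj /(@inj _ _ setT f) e; have : i n = i m by apply: e; rewrite inE.
by move=> /(congr1 val).
Qed.

Section GromovModel.
Variables (R : realType) (Gam : groupType) (P : set (set Gam)).
Variables (M : gromov_model R P) (o : M).
Local Notation a := (model_action M).

Hypothesis rel : relatively_hyperbolic R P.

Definition len (g : Gam) : R := mdist o (a g o).

Lemma len1 : len 1%g = 0.
Proof. by rewrite /len iact1 mdistxx. Qed.

Lemma mdist_orbit g h : mdist (a g o) (a h o) = len (g^-1 * h)%g.
Proof. by rewrite /len -(iact_isom a g^-1%g) -!iactM mulVg iact1. Qed.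

Lemma lenV g : len g^-1%g = len g.
Proof. by rewrite -[g^-1%g]mulg1 -mdist_orbit iact1 metric_sym. Qed.

Lemma len_finite r : finite_set [set g | len g <= r].
Proof.
have cp : compact [set y | mdist o y <= Num.max 0 r] by exact: model_proper.
apply: sub_finite_set (model_discontinuous cp) => g /= gr.
exists (a g o); split; last by rewrite /= le_max gr orbT.
by exists o => //=; rewrite mdistxx le_max lexx.
Qed.

Let horoballs := cid (model_horoballs M).
Definition hball : set Gam -> set M := projT1 horoballs.

Lemma hballP : [/\ forall H, conjugates P H -> open (hball H) /\ horoball (hball H),
        trivIset (conjugates P) hball,
        forall g H, conjugates P H ->
          exists2 H', conjugates P H' & a g @` hball H = hball H',
        forall H, conjugates P H -> stabilizer a (hball H) = H &
        cocompact_on a (~` \bigcup_(H in conjugates P) hball H)].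
Proof. exact: projT2 horoballs. Qed.

Definition cnj (g : Gam) (H : set Gam) : set Gam := [set (g * x * g^-1)%g | x in H].

Lemma cnjM g h H : cnj (g * h)%g H = cnj g (cnj h H).
Proof.
apply/seteqP; split=> x.
  by move=> [y Hy <-]; exists (h * y * h^-1)%g; [exists y|rewrite invgM !mulgA].
by move=> [_ [y Hy <-] <-]; exists y => //; rewrite invgM !mulgA.
Qed.

Lemma cnj1 H : cnj 1%g H = H.
Proof.
apply/seteqP; split=> x; first by move=> [y Hy <-]; rewrite mul1g invg1 mulg1.
by move=> Hx; exists x => //; rewrite mul1g invg1 mulg1.
Qed.

Lemma conjugates_cnj g H : conjugates P H -> conjugates P (cnj g H).
Proof.
move=> [Q PQ [h ->]]; exists Q => //; exists (g * h)%g.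
by rewrite -[RHS]/(cnj (g * h)%g Q) cnjM.
Qed.

Lemma iact_image_comp g h (A : set M) : a g @` (a h @` A) = a (g * h)%g @` A.
Proof.
apply/seteqP; split=> x.
  by move=> [_ [y Ay <-] <-]; exists y => //; rewrite iactM.
by move=> [y Ay <-]; exists (a h y); [exists y|rewrite iactM].
Qed.

Lemma iact_image1 (A : set M) : a 1%g @` A = A.
Proof.
apply/seteqP; split=> x; first by move=> [y Ay <-]; rewrite iact1.
by move=> Ax; exists x => //; rewrite iact1.
Qed.

Lemma hball_cnj g H : conjugates P H -> a g @` hball H = hball (cnj g H).
Proof.
move=> cH; have [_ _ eqv stab _] := hballP.
have [H' cH' E] := eqv g H cH; rewrite E; congr hball.
rewrite -(stab _ cH') -E; apply/seteqP; split=> x; last first.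
  move=> [y Hy <-]; rewrite -(stab H cH) in Hy.
  by rewrite /stabilizer /= iact_image_comp mulgVK -iact_image_comp Hy.
move=> xs; exists (g^-1 * x * g)%g; last by rewrite !mulgA mulgV mul1g mulgK.
rewrite -(stab H cH) /stabilizer /= -!iact_image_comp xs.
by rewrite iact_image_comp mulVg iact_image1.
Qed.

Lemma hball_inj H H' x : conjugates P H -> conjugates P H' ->
  hball H x -> hball H' x -> H = H'.
Proof.
have [_ tI _ _ _] := hballP => cH cH' Hx H'x.
by apply: tI => //; exists x.
Qed.

Let PfinP : finite_set P. Proof. by case: rel. Qed.

Let delta := projT1 (cid (model_hyperbolic M)).
Lemma hypM : forall o' x y z : M,
  Num.min (gromov_product o' x y) (gromov_product o' y z) - delta
    <= gromov_product o' x z.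
Proof. exact: projT2 (cid (model_hyperbolic M)). Qed.

Definition hdelta : R := delta.

Lemma conjugates_sub Q : P Q -> conjugates P Q.
Proof. by move=> PQ; exists Q => //; exists 1%g; rewrite -[RHS]/(cnj 1%g Q) cnj1. Qed.

Lemma hball_deep : exists2 s, 0 <= s & forall H x, conjugates P H -> hball H x ->
  exists2 y, mdist x y <= s & forall z, mdist y z < 2 -> hball H z.
Proof.
have [hb _ _ _ _] := hballP.
have /choice[f fP] : forall Q, exists s, P Q -> 0 <= s /\ forall x, hball Q x ->
    exists2 y, mdist x y <= s & forall z, mdist y z < 2 -> hball Q z.
  move=> Q; have [PQ|nPQ] := pselect (P Q); last by exists 0.
  have [_ [p [h [[D hD] [c [Bc nBc]]]]]] := hb Q (conjugates_sub PQ).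
  have [s s0 sP] := horoball_deep (@model_geodesic _ _ _ M) hypM hD Bc nBc.
  by exists s.
have [S SP] := finite_bound f PfinP.
exists (Num.max 0 S); first by rewrite le_max lexx.
move=> _ x [Q PQ [g ->]] /[dup] Hx; rewrite -[X in hball X]/(cnj g Q).
rewrite -(hball_cnj _ (conjugates_sub PQ)) => -[x' Qx' <-].
have [_ fQ] := fP Q PQ; have [y xy yB] := fQ x' Qx'.
exists (a g y).
  by rewrite iact_isom; apply: le_trans xy _; rewrite le_max SP ?orbT.
move=> z yz; rewrite -(iactVK a g z).
by exists (a g^-1%g z) => //; apply: yB; rewrite -(iact_isom a g) iactVK.
Qed.

Definition near_hballs K : set (set Gam) :=
  [set H | conjugates P H /\ exists2 x, mdist o x <= K & hball H x].

(** Each of these horoballs contains a ball of radius 2 with centre within [K + s] of [o].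
    Infinitely many centres would accumulate by properness, and two distinct horoballs would
    meet. *)
Lemma near_hballs_finite K : finite_set (near_hballs K).
Proof.
apply: contrapT => /infinite_injection[e e_inj eP].
have [s s0 sP] := hball_deep.
have /choice[y yP] : forall n, exists y, mdist o y <= K + s /\
    forall z, mdist y z < 2 -> hball (e n) z.
  move=> n; have [cH [x ox Hx]] := eP n; have [y xy yB] := sP _ _ cH Hx.
  by exists y; split=> //; apply: le_trans (mtri x _ _) _; exact: lerD.
have [U [UU sU]] := @ultraFilterLemma nat \oo _.
have [z Uz] : exists z, U [set n | mdist (y n) z < 1].
  apply: (@proper_ultra _ _ (@model_proper _ _ _ M) _ U UU y o (K + s)).
  by apply: filterS filterT => n _ /=; exact: (yP n).1.
have [n yn] := filter_ex Uz.
have [m [ym nm]] := filter_ex (filterI Uz (sU _ (nbhs_infty_ge n.+1))).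
have ynm : mdist (y n) (y m) < 2.
  apply: le_lt_trans (mtri z _ _) _; rewrite [mdist z _]metric_sym.
  by have := ltrD yn ym; rewrite -[X in _ < X -> _]/(2%:R).
have en : hball (e n) (y m) by exact: (yP n).2.
have em : hball (e m) (y m) by apply: (yP m).2; rewrite mdistxx.
have := e_inj _ _ (hball_inj (eP n).1 (eP m).1 en em).
by move=> nm'; move: nm; rewrite /= nm' ltnn.
Qed.

(** [R1] bounds the distance from [o] to a compact set whose translates cover the complement of the
    horoballs. *)
Lemma thick_radius : exists2 R1, 0 <= R1 & forall x,
  (forall g, R1 < mdist x (a g o)) -> exists2 H, conjugates P H & hball H x.
Proof.
have [_ _ _ _ [C cC CE]] := hballP.
have [R1 R1P] : exists R1, forall x, C x -> mdist o x <= R1.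
  apply: contrapT => /forallNP nb.
  have /choice[f fP] : forall n : nat, exists x, C x /\ n%:R < mdist o x.
    move=> n; apply: contrapT => /forallNP nx; apply: (nb n%:R) => x Cx.
    by rewrite leNgt; apply/negP => ?; apply: (nx x).
  have [U [UU sU]] := @ultraFilterLemma nat \oo _.
  have UF := ultra_fmap f UU.
  move: cC; rewrite compact_ultra => /(_ _ UF).
  case; first by rewrite /nbhs /=; apply: filterS filterT => n _; exact: (fP n).1.
  move=> z [_ fz]; have : nbhs z (ball z 1) by exact: nbhsx_ballx.
  move=> /fz; rewrite ballEmdist /nbhs /= => Uz.
  have [N rN] := exists_nat_ge (mdist o z + 1).
  have [n [/= zn Nn]] := filter_ex (filterI Uz (sU _ (nbhs_infty_ge N))).
  have := (fP n).2; have := mtri z o (f n).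
  have : N%:R <= n%:R :> R by rewrite ler_nat.
  by move: zn rN; clear; lra.
exists (Num.max 0 R1); first by rewrite le_max lexx.
move=> x far; apply: contrapT => nH.
have : (~` \bigcup_(H in conjugates P) hball H) x.
  by move=> [H cH Hx]; apply: nH; exists H.
rewrite CE => -[g _ [y Cy yx]]; have := far g; rewrite -yx iact_isom metric_sym.
by rewrite ltNge le_max R1P ?orbT.
Qed.

(* Both ends of the excursion see the same horoball; two elements carrying it
   to horoballs near the base point differ by an element of its stabilizer. *)
Lemma excursion K : exists2 E : set Gam, finite_set E &
  forall H x1 x2 g1 g2, conjugates P H -> hball H x1 -> hball H x2 ->
  mdist x1 (a g1 o) <= K -> mdist x2 (a g2 o) <= K ->
  exists f x f', [/\ E f, E f', exists2 Q, P Q & Q x & (g1^-1 * g2 = f * x * f')%g].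
Proof.
have [_ _ _ stab _] := hballP.
have /choice[t tP] : forall H, exists fQ : Gam * set Gam, conjugates P H ->
    P fQ.2 /\ H = cnj fQ.1 fQ.2.
  move=> H; have [[Q PQ [f ->]]|nH] := pselect (conjugates P H).
    by exists (f, Q).
  by exists (1%g, set0).
have /choice[w wP] : forall HH : set Gam * set Gam, exists w,
    (exists v, a v @` hball HH.2 = hball HH.1) -> a w @` hball HH.2 = hball HH.1.
  move=> HH; have [[v vE]|nv] := pselect (exists v, a v @` hball HH.2 = hball HH.1).
    by exists v.
  by exists 1%g.
pose N := near_hballs K; have fN : finite_set N := near_hballs_finite K.
pose E1 := [set (t H).1 | H in N].
pose E2 := [set ((t HH.1).1^-1 * w HH)%g | HH in N `*` N].
exists (E1 `|` E2).
  by rewrite finite_setU; split; apply: finite_image => //; exact: finite_setX.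
move=> H x1 x2 g1 g2 cH H1 H2 d1 d2.
have mem g x : hball H x -> mdist x (a g o) <= K -> N (cnj g^-1%g H).
  move=> Hx xg; split; first exact: conjugates_cnj.
  exists (a g^-1%g x); first by rewrite -(iact_isom a g) iactVK metric_sym.
  by rewrite -hball_cnj //; exists x.
have N1 := mem _ _ H1 d1; have N2 := mem _ _ H2 d2.
set Ha := cnj g1^-1%g H in N1; set Hb := cnj g2^-1%g H in N2.
have v12 : a (g1^-1 * g2)%g @` hball Hb = hball Ha.
  by rewrite -iact_image_comp /Ha /Hb -!hball_cnj // (iact_image_comp g2) mulgV iact_image1.
have wE : a (w (Ha, Hb)) @` hball Hb = hball Ha.
  by apply: (wP (Ha, Hb)); exists (g1^-1 * g2)%g.
have [PQ HaE] := tP Ha N1.1.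
have : Ha (g1^-1 * g2 * (w (Ha, Hb))^-1)%g.
  have : stabilizer a (hball Ha) (g1^-1 * g2 * (w (Ha, Hb))^-1)%g.
    rewrite /stabilizer /= -[in LHS]wE iact_image_comp mulgVK; exact: v12.
  by rewrite stab //; exact: N1.1.
rewrite {1}HaE => -[x Qx xE].
exists (t Ha).1, x, ((t Ha).1^-1 * w (Ha, Hb))%g; split.
- by left; exists Ha.
- by right; exists (Ha, Hb).
- by exists (t Ha).2.
- by rewrite mulgA xE mulgVK.
Qed.

Lemma hball_center H : conjugates P H -> exists xi : gromov_boundary M,
  forall q, q <> xi -> exists r, forall x, shadow o r q x -> ~ hball H x.
Proof.
have [hb _ _ _ _] := hballP => /hb[_ [p [h [[D hD] [c [Bc nBc]]]]]].
by exists p => q qp; exact: (horoball_shadow hypM hD Bc o qp).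
Qed.

Lemma hball_open H : conjugates P H -> open (hball H).
Proof. by have [hb _ _ _ _] := hballP => /hb[]. Qed.

End GromovModel.

(** * Cutting geodesics into pieces between orbit points *)

Section Decomposition.
Variables (R : realType) (Gam : groupType) (P : set (set Gam)).
Variables (M : gromov_model R P) (o : M).
Local Notation a := (model_action M).
Local Notation len := (len o).

Hypothesis rel : relatively_hyperbolic R P.

Definition thickR : R := projT1 (cid2 (thick_radius o)).

Lemma thickR_ge0 : 0 <= thickR.
Proof. by rewrite /thickR; case: cid2. Qed.

Lemma thickRP x : (forall g, thickR < mdist x (a g o)) ->
  exists2 H, conjugates P H & hball (M := M) H x.
Proof. by rewrite /thickR; case: cid2 => r ? H /=; exact: H. Qed.

Definition thick x : Prop := exists g, mdist x (a g o) <= thickR.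

Lemma not_thick x : ~ thick x -> exists2 H, conjugates P H & hball (M := M) H x.
Proof.
move=> nx; apply: thickRP => g; rewrite ltNge; apply/negP => xg.
by apply: nx; exists g.
Qed.

(** An open interval is connected, and the disjoint open horoballs that cover its image cut it into
    disjoint open sets; only one of them can be nonempty. *)
Lemma hball_interval c (x y : M) s1 s2 : geod c x y -> 0 <= s1 -> s1 < s2 ->
  s2 <= mdist x y ->
  (forall t, s1 < t -> t < s2 -> ~ thick (c t)) ->
  exists2 H, conjugates P H & forall t, s1 < t -> t < s2 -> hball (M := M) H (c t).
Proof.
move=> gc s10 s12 s2l nth.
pose A : set R := `]s1, s2[%classic.
have Hopen H : conjugates P H -> open [set t | A t /\ hball (M := M) H (c t)].
  move=> cH; rewrite openE => t [At Ht]; rewrite /interior.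
  have : nbhs (c t) (hball (M := M) H) by apply: open_nbhs_nbhs; split=> //; exact: hball_open.
  rewrite -nbhs_ballE => -[e /= e0 eH].
  have nA : nbhs t A by apply: open_nbhs_nbhs; split=> //; exact: interval_open.
  apply: filterS (filterI nA (nbhsx_ballx t e e0)) => u [Au tu]; split=> //.
  apply: eH; rewrite ballEmdist /=; move: tu; rewrite /ball /=.
  move: At Au; rewrite /A /= !in_itv /= => /andP[t1 t2] /andP[u1 u2].
  have [tu|ut] := leP t u.
    by rewrite (geod_dist gc) ?(le_trans s10) ?(ltW t1) ?(le_trans (ltW u2)) // distrC ger0_norm // subr_ge0.
  rewrite metric_sym (geod_dist gc) ?(le_trans s10) ?(ltW u1) ?(ltW ut) ?(le_trans (ltW t2)) //.
  by rewrite ger0_norm // subr_ge0 ltW.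
pose t0 := (s1 + s2) / 2.
have At0 : A t0 by rewrite /A /= in_itv /= /t0; apply/andP; split; lra.
have [H cH Ht0] : exists2 H, conjugates P H & hball (M := M) H (c t0).
  by move: At0; rewrite /A /= in_itv /= => /andP[? ?]; apply: not_thick; exact: nth.
exists H => // t t1 t2; pose B := [set t | A t /\ hball (M := M) H (c t)].
suff BA : B = A by have : A t; [rewrite /A /= in_itv /= t1|rewrite -BA => -[]].
have cA : connected A by apply/connected_intervalP; exact: interval_is_interval.
apply: cA.
- by exists t0.
- exists B; first exact: Hopen.
  by apply/seteqP; split=> [u [Au Bu]|u [_ []]] //.
- pose C := \bigcup_(H' in [set H' | conjugates P H' /\ H' <> H])
    [set t | A t /\ hball (M := M) H' (c t)].
  exists (~` C).
    by apply: open_closedC; apply: bigcup_open => H' [cH' _]; exact: Hopen.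
  apply/seteqP; split=> u.
    move=> [Au Hu]; split=> // -[H' [cH' nH'] [_ H'u]].
    by apply: nH'; exact: hball_inj cH' cH H'u Hu.
  move=> [Au nC]; split=> //.
  move: (Au); rewrite /A /= in_itv /= => /andP[u1 u2].
  have [H' cH' H'u] := not_thick (nth u u1 u2).
  have [<-//|nH] := pselect (H' = H).
  by exfalso; apply: nC; exists H'.
Qed.

(** The case [x = 1%g] includes steps without an excursion; the unbounded part of a step is confined
    to the peripheral factor [x]. *)
Definition piece (E : set Gam) (g : Gam) : Prop := exists f x f',
  [/\ E f, E f', x = 1%g \/ (exists2 Q, P Q & Q x) & g = (f * x * f')%g].

Lemma len_near x y g h : mdist x (a g o) <= thickR -> mdist y (a h o) <= thickR ->
  len (g^-1 * h)%g <= mdist x y + 2 * thickR.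
Proof.
move=> xg yh; rewrite -mdist_orbit.
have := mtri x (a g o) (a h o); have := mtri y x (a h o).
rewrite [mdist (a g o) x]metric_sym; lra.
Qed.

(** The step ends near [inf T], the first thick time from [t + S] on. If this comes before
    [t + S + 1], the step lies in the finite set [L]. Otherwise the geodesic runs in one horoball
    between [sup T'], the last thick time up to [t + S], and [inf T]: the part before [sup T']
    contributes an element of [L], and [excursion] handles the rest. *)
Lemma next_point S : 0 < S -> exists2 E : set Gam, finite_set E &
  forall c (x y : M) t g g', geod c x y -> 0 <= t -> t + S <= mdist x y ->
  mdist (c t) (a g o) <= thickR -> mdist y (a g' o) <= thickR ->
  exists t' h, [/\ t + S <= t', t' <= mdist x y, mdist (c t') (a h o) <= thickR &
    piece E (g^-1 * h)%g].
Proof.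
move=> S0; have r0 := thickR_ge0.
(* One unit pays for replacing the supremum or infimum by a thick time nearby, the other for moving
   by [e] into the open interval, where membership in the horoball is known. *)
have [E0 fE0 E0P] := excursion o rel (thickR + 2).
pose L := [set g | len g <= S + 1 + 2 * thickR].
have fL : finite_set L := len_finite o _.
have L1 : L 1%g by rewrite /L /= len1; lra.
exists (E0 `|` L `|` [set (u * f)%g | u in L & f in E0]).
  by rewrite !finite_setU; split; [split|exact: finite_image2].
move=> c x y t g g' gc t0 tS cg yg'.
have [c0 c1 _] := gc.
pose T := [set s | t + S <= s /\ s <= mdist x y /\ thick (c s)].
have Tl : T (mdist x y) by split=> //; split=> //; rewrite c1; exists g'.
have lbT : has_lbound T by exists (t + S) => s [].
have infT s : T s -> inf T <= s by move=> Ts; exact: ge_inf.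
have tinf : t + S <= inf T by apply: lb_le_inf; [exists (mdist x y)|move=> s []].
have adhT e : 0 < e -> exists2 s, T s & s < inf T + e.
  by move=> e0; apply: inf_adherent => //; split=> //; exists (mdist x y).
have [lt1|ge1] := ltP (inf T) (t + S + 1).
  have [s [ts [sl [h ch]]] s1] : exists2 s, T s & s < t + S + 1.
    by have [|s Ts s1] := adhT (t + S + 1 - inf T); [rewrite subr_gt0|exists s => //; move: s1; rewrite addrC subrK].
  exists s, h; split=> //; exists (g^-1 * h)%g, 1%g, 1%g; rewrite !mulg1; split=> //.
  - left; right; rewrite /L /=; apply: le_trans (len_near cg ch) _.
    rewrite (geod_dist gc) //; lra.
  - by left; right.
  - by left.
pose T' := [set s | t <= s /\ s <= t + S /\ thick (c s)].
have T't : T' t by split=> //; split; [lra|exists g].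
have ubT' : has_ubound T' by exists (t + S) => s [_ []].
have supT' s : T' s -> s <= sup T' by move=> T's; exact: ub_le_sup.
have supt : sup T' <= t + S by apply: ge_sup; [exists t|move=> s [_ []]].
have tsup : t <= sup T' := supT' t T't.
have [s' T's' s'1] : exists2 s, T' s & sup T' - 1 < s.
  by apply: sup_adherent => //; split=> //; exists t.
have [s Ts s1] := adhT 1 ltr01.
have il : inf T <= mdist x y := infT _ Tl.
have [H cH HP] : exists2 H, conjugates P H &
    forall u, sup T' < u -> u < inf T -> hball (M := M) H (c u).
  apply: (hball_interval gc); rewrite ?(le_trans t0) //; first lra.
  move=> u u1 u2 thu; have [ut|tu] := leP u (t + S).
    have : T' u by split; [lra|split].
    by move=> /supT'; lra.
  have : T u by split; [exact: ltW|split=> //; lra].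
  by move=> /infT; lra.
pose m := (inf T - sup T') / 2.
pose e := Num.min 1 m.
have e0 : 0 < e by rewrite lt_min ltr01 /= /m; lra.
have e1 : e <= 1 by rewrite ge_min lexx.
have em : e <= m by rewrite ge_min lexx orbT.
have emE : 2 * m = inf T - sup T' by rewrite /m; lra.
have [t's' [s't' [g1 cg1]]] := T's'; have [ts [sl [h ch]]] := Ts.
have ss' := supT' _ T's'; have ies := infT _ Ts.
have d1 : mdist (c (sup T' + e)) (a g1 o) <= thickR + 2.
  have := mtri (c s') (c (sup T' + e)) (a g1 o).
  by rewrite (metric_sym (c (sup T' + e)) (c s')) (geod_dist gc); lra.
have d2 : mdist (c (inf T - e)) (a h o) <= thickR + 2.
  have := mtri (c s) (c (inf T - e)) (a h o).
  by rewrite (geod_dist gc); lra.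
have h1 : hball (M := M) H (c (sup T' + e)) by apply: HP; lra.
have h2 : hball (M := M) H (c (inf T - e)) by apply: HP; lra.
have [f [u [f' [Ef Ef' Qu E']]]] := E0P H _ _ g1 h cH h1 h2 d1 d2.
exists s, h; split=> //; exists (g^-1 * g1 * f)%g, u, f'; split=> //.
- right; exists (g^-1 * g1)%g; last by exists f.
  rewrite /L /=; apply: le_trans (len_near cg cg1) _.
  by rewrite (geod_dist gc) //; lra.
- by left; left.
- by right.
- have -> : h = (g1 * (f * u * f'))%g by rewrite -E' mulVKg.
  by rewrite !mulgA.
Qed.

Definition step E S (c : R -> M) l t g t' h : Prop :=
  [/\ 0 <= t, t + S <= t', t' <= l, mdist (c t) (a g o) <= thickR &
    mdist (c t') (a h o) <= thickR /\ piece E (g^-1 * h)%g].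

(** Induction along the path, ending once less than [S] of the geodesic remains; each step uses up
    at least [S], which bounds their number. The invariant refers to the last step, not only to its
    endpoint, because prolonging a product requires the junction of the last step with the next
    one. *)
Lemma decomposition_ind S E : 0 < S ->
  (forall c (x y : M) t g g', geod c x y -> 0 <= t -> t + S <= mdist x y ->
   mdist (c t) (a g o) <= thickR -> mdist y (a g' o) <= thickR ->
   exists t' h, [/\ t + S <= t', t' <= mdist x y, mdist (c t') (a h o) <= thickR &
     piece E (g^-1 * h)%g]) ->
  forall c (x y : M) t0 g0 g' (Inv : R -> Gam -> R -> Gam -> Prop),
  geod c x y -> 0 <= t0 -> t0 + S <= mdist x y ->
  mdist (c t0) (a g0 o) <= thickR -> mdist y (a g' o) <= thickR ->
  (forall t g, step E S c (mdist x y) t0 g0 t g -> Inv t0 g0 t g) ->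
  (forall t g t1 g1 t2 g2, Inv t g t1 g1 -> step E S c (mdist x y) t g t1 g1 ->
    step E S c (mdist x y) t1 g1 t2 g2 -> Inv t1 g1 t2 g2) ->
  exists t g t1 g1, [/\ Inv t g t1 g1, step E S c (mdist x y) t g t1 g1 &
    mdist x y < t1 + S].
Proof.
move=> S0 EP c x y t0 g0 g' Inv gc t00 t0S cg0 yg' base ind.
have [t [h [t0t tl ch ph]]] := EP c x y t0 g0 g' gc t00 t0S cg0 yg'.
have st : step E S c (mdist x y) t0 g0 t h by [].
have := base _ _ st; have [N] := exists_nat_ge ((mdist x y - t) / S).
rewrite ler_pdivrMr //.
elim: N t0 g0 t h {t00 t0S cg0 base ph ch t0t tl} st => [|N IH] t0 g0 t h st NS It.
  by exists t0, g0, t, h; split=> //; lra.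
have [lt1|le1] := ltP (mdist x y) (t + S); first by exists t0, g0, t, h.
have [t00 t0t tl ct0 [cth _]] := st; have tt : 0 <= t by lra.
have [t' [h' [tt' t'l ch' ph']]] := EP c x y t h g' gc tt le1 cth yg'.
have st' : step E S c (mdist x y) t h t' h' by [].
apply: (IH t h t' h' st'); last exact: ind It st st'.
by move: NS; rewrite -natr1 mulrDl mul1r; lra.
Qed.

(** Three points in order on a geodesic have product 0 at the middle one, and each of the three
    orbit points is off by at most [thickR]. The bound is free of [S], so transversality constants
    can be fixed before [S]. *)
Lemma step_gp E S c (x y : M) t g t1 g1 t2 g2 : 0 < S -> geod c x y ->
  step E S c (mdist x y) t g t1 g1 -> step E S c (mdist x y) t1 g1 t2 g2 ->
  gromov_product o (a (g1^-1 * g)%g o) (a (g1^-1 * g2)%g o) <= 3 * thickR.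
Proof.
move=> S0 gc [t0 tt1 t1l cg [cg1 _]] [t10 tt2 t2l _ [cg2 _]].
rewrite -(gromov_product_iact a g1) -!iactM !mulVKg.
have := gp_base (a g1 o) (c t1) (a g o) (a g2 o).
have := gp_move (c t1) (a g o) (a g2 o) (c t) (c t2).
rewrite (@gp_geodesic _ _ (c t1) (c t) (c t2)); last first.
  by rewrite !(geod_dist gc); lra.
rewrite [mdist (a g o) _]metric_sym [mdist (a g1 o) _]metric_sym [mdist (a g2 o) _]metric_sym.
lra.
Qed.

Lemma step_len E S c (x y : M) t g t1 g1 : 0 < S -> geod c x y ->
  step E S c (mdist x y) t g t1 g1 ->
  S - 2 * thickR <= len (g^-1 * g1)%g /\ len (g^-1 * g1)%g <= t1 - t + 2 * thickR.
Proof.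
move=> S0 gc [t0 tt1 t1l cg [cg1 _]].
have d : mdist (c t) (c t1) = t1 - t by rewrite (geod_dist gc) //; lra.
rewrite -d; split; last exact: len_near.
rewrite -mdist_orbit; have := mtri (a g o) (c t) (c t1).
have := mtri (a g1 o) (a g o) (c t1); rewrite [mdist (a g1 o) _]metric_sym; lra.
Qed.

End Decomposition.

(** * Boundary points as limits of orbits *)

Section BoundaryPoints.
Variables (R : realType) (Gam : groupType) (P : set (set Gam)).
Variables (M : gromov_model R P) (o : M).
Local Notation a := (model_action M).
Local Notation len := (len o).
Local Notation delta := (hdelta M).
Local Notation thickR := (thickR o).
Local Notation thick := (thick o).
Local Notation hb := (hball (M := M)).
Local Notation sh := (shadow o).

Hypothesis rel : relatively_hyperbolic R P.

Lemma hypd (o' x y z : M) :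
  Num.min (gromov_product o' x y) (gromov_product o' y z) - delta
    <= gromov_product o' x z.
Proof. exact: hypM. Qed.

Let hyp := hypd.

Lemma delta_pos : 0 <= delta.
Proof. exact: (delta_ge0 hyp o). Qed.

(** The centre of a horoball differs from [p] or from [q], and the shadows of the differing point
    eventually miss it. Only finitely many horoballs come near [o], so one [r] serves all. *)
Lemma hball_escape (p q : gromov_boundary M) K : p <> q -> exists r,
  forall H, near_hballs (M := M) o K H ->
  (forall x, sh r p x -> ~ hb H x) \/ (forall x, sh r q x -> ~ hb H x).
Proof.
move=> pq; have /choice[f fP] : forall H, exists r, conjugates P H ->
    (forall x, sh r p x -> ~ hb H x) \/ (forall x, sh r q x -> ~ hb H x).
  move=> H; have [cH|nH] := pselect (conjugates P H); last by exists 0.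
  have [xi xiP] := hball_center o cH.
  have [pxi|/xiP[r rP]] := pselect (p = xi); last by exists r; left.
  have /xiP[r rP] : q <> xi by move=> qxi; apply: pq; rewrite pxi qxi.
  by exists r; right.
have [r rP] := finite_bound f (near_hballs_finite o rel K).
exists r => H HK; have fr := rP H HK; have [cH _] := HK.
by have [fH|fH] := fP H cH; [left|right] => x /(shadow_le fr); exact: fH.
Qed.

(** The geodesic comes near [o] at [c t0], but possibly inside a horoball. If no thick time lay
    within [T + 1] of [t0], this whole stretch would stay in one horoball meeting a fixed ball about
    [o]; its two ends would lie in shadows of [p] and of [q], against [hball_escape]. *)
Lemma pass_near (p q : gromov_boundary M) : p <> q -> exists r K, forall c x y,
  geod c x y -> sh r p x -> sh r q y -> thick x -> thick y ->
  exists t g, [/\ 0 <= t, t <= mdist x y, mdist (c t) (a g o) <= thickR & len g <= K].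
Proof.
move=> pq; have [r1 r1P] := shadow_separate hyp o pq.
have d0 := delta_pos; have R0 := thickR_ge0 o.
pose K0 := r1 + 2 * delta; have [r2 r2P] := hball_escape K0 pq.
pose T := Num.max 1 (K0 + r2 + delta).
have T1 : 1 <= T by rewrite le_max lexx.
have T2 : K0 + r2 + delta <= T by rewrite le_max lexx orbT.
exists (Num.max r1 (r2 + delta)), (K0 + T + 1 + thickR) => c x y gc px qy thx thy.
have r1m : r1 <= Num.max r1 (r2 + delta) by rewrite le_max lexx.
have r2m : r2 + delta <= Num.max r1 (r2 + delta) by rewrite le_max lexx orbT.
have [t0 [t00 t0l ct0]] := geod_near hyp o gc.
have ot0 : mdist o (c t0) <= K0.
  by have := r1P _ _ (shadow_le r1m px) (shadow_le r1m qy); rewrite /K0; lra.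
have [[s [s0 sl ds thc]]|nos] := pselect (exists s,
    [/\ 0 <= s, s <= mdist x y, `|s - t0| <= T + 1 & thick (c s)]).
  have [g cg] := thc; exists s, g; split=> //.
  have := mtri (c s) o (a g o); have := mtri (c t0) o (c s).
  have -> : mdist (c t0) (c s) = `|s - t0|.
    have [st|ts] := leP t0 s; first by rewrite (geod_dist gc) // ger0_norm // subr_ge0.
    by rewrite metric_sym (geod_dist gc) ?(ltW ts) // distrC ger0_norm // subr_ge0 ltW.
  rewrite /len; lra.
exfalso; have [c0 c1 _] := gc.
have t0T : T + 1 < t0.
  rewrite ltNge; apply/negP => tT; apply: nos; exists 0; split=> //; first exact: mdist_ge0.
    by rewrite distrC subr0 ger0_norm.
  by rewrite c0.
have t0T' : t0 + T + 1 < mdist x y.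
  rewrite ltNge; apply/negP => tT; apply: nos; exists (mdist x y).
  split=> //; first exact: mdist_ge0; last by rewrite c1.
  by rewrite ger0_norm ?subr_ge0 //; lra.
have f1 : 0 <= t0 - (T + 1) by lra.
have f2 : t0 - (T + 1) < t0 + (T + 1) by lra.
have f3 : t0 + (T + 1) <= mdist x y by lra.
have [H cH HP] : exists2 H, conjugates P H &
    forall t, t0 - (T + 1) < t -> t < t0 + (T + 1) -> hb H (c t).
  apply: (hball_interval gc f1 f2 f3).
  move=> t t1 t2 tht; apply: nos; exists t; split; [lra|lra| |exact: tht].
  by rewrite ler_norml; apply/andP; split; lra.
have HK : near_hballs (M := M) o K0 H.
  by split=> //; exists (c t0) => //; apply: HP; lra.
have Hm : hb H (c (t0 - T)) by apply: HP; lra.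
have Hp : hb H (c (t0 + T)) by apply: HP; lra.
have dm : mdist (c (t0 - T)) (c t0) = T by rewrite (geod_dist gc); lra.
have dp : mdist (c t0) (c (t0 + T)) = T by rewrite (geod_dist gc); lra.
have [nH|nH] := r2P H HK.
  apply: (nH _ _ Hm); apply: filterS px => n; rewrite gpC => xn.
  rewrite -(addrK delta r2) gpC; apply: (hyp_le hyp (y := x)); first exact: le_trans xn.
  have dx : mdist x (c (t0 - T)) = t0 - T by rewrite -{1}c0 (geod_dist gc) ?subr0; lra.
  have dxt : mdist x (c t0) = t0 by rewrite -{1}c0 (geod_dist gc) ?subr0; lra.
  rewrite /gromov_product dx; have := mtri o (c (t0 - T)) (c t0).
  have := mtri o x (c t0); rewrite dm dxt [mdist x o]metric_sym.
  rewrite [mdist (c (t0 - T)) o]metric_sym; lra.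
apply: (nH _ _ Hp); apply: filterS qy => n; rewrite gpC => xn.
rewrite -(addrK delta r2) gpC; apply: (hyp_le hyp (y := y)); first exact: le_trans xn.
have dy : mdist (c (t0 + T)) y = mdist x y - (t0 + T) by rewrite -{1}c1 (geod_dist gc); lra.
have dyt : mdist (c t0) y = mdist x y - t0 by rewrite -{1}c1 (geod_dist gc); lra.
rewrite /gromov_product [mdist y _]metric_sym dy.
have := mtri o (c t0) (c (t0 + T)); have := mtri o (c t0) y.
rewrite dp dyt [mdist (c t0) o]metric_sym; lra.
Qed.

Lemma orbit_ultra (I : Type) (U : set_system I) (UU : UltraFilter U) (f : I -> Gam) :
  (forall m : nat, U [set i | m%:R <= len (f i)]) ->
  exists p, forall r, U [set i | sh r p (a (f i) o)].
Proof.
by move=> far; apply: (shadow_ultra (@model_geodesic _ _ _ M) (@model_proper _ _ _ M) hyp UU).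
Qed.

Lemma infinite_far (e : nat -> Gam) (r : R) : injective e ->
  \forall n \near \oo, r <= len (e n).
Proof.
move=> e_inj; have fA : finite_set (e @^-1` [set g | len g <= r]).
  apply: finite_preimage; last exact: len_finite.
  by move=> i j _ _; exact: e_inj.
have [N NP] : exists N, forall n, (e @^-1` [set g | len g <= r]) n -> (n < N)%N.
  have [s sE] := (finite_seqP _).1 fA; exists (\max_(i <- s) i).+1 => n.
  by rewrite sE /= => ns; rewrite ltnS; apply: leq_bigmax_seq.
exists N => // n /= Nn; rewrite leNgt; apply/negP => /ltW /NP.
by rewrite ltnNge Nn.
Qed.

(** If the shadow contained no orbit point, geodesics towards [p] would eventually run inside one of
    the finitely many horoballs near the ball of radius [s0 + 1], and [p] would be the centre of
    such a horoball ([main]). The infinite stabiliser of that horoball then still produces orbit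
    points converging to [p]. *)
Lemma shadow_orbit p r : exists g, sh r p (a g o).
Proof.
apply: contrapT => /forallNP no; have d0 := delta_pos; have R0 := thickR_ge0 o.
pose s0 := Num.max 0 (r + delta + thickR); have s00 : 0 <= s0 by rewrite le_max lexx.
have s0r : r + delta + thickR <= s0 by rewrite le_max lexx orbT.
have main : exists H, [/\ conjugates P H, hb H !=set0 &
    forall q, q <> p -> exists r, forall x, sh r q x -> ~ hb H x].
  have [fin|] := pselect (forall H, near_hballs (M := M) o (s0 + 1) H ->
      exists r, forall x, sh r p x -> ~ hb H x); last first.
    move=> /existsNP[H /not_implyP[[cH [x _ Hx]] nH]].
    exists H; split=> //; first by exists x.
    have [xi xiP] := hball_center o cH => q qp.
    have pxi : p = xi by apply: contrapT => /xiP.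
    by apply: xiP; rewrite -pxi.
  have /choice[f fP] : forall H, exists r, near_hballs (M := M) o (s0 + 1) H ->
      forall x, sh r p x -> ~ hb H x.
    move=> H; have [/fin[r' r'P]|nH] := pselect (near_hballs (M := M) o (s0 + 1) H).
      by exists r'.
    by exists 0.
  have [r2 r2P] := finite_bound f (near_hballs_finite o rel (s0 + 1)).
  exfalso; pose s := Num.max (s0 + 2) (r2 + delta).
  have s1 : s0 + 2 <= s by rewrite le_max lexx.
  have s2 : r2 + delta <= s by rewrite le_max lexx orbT.
  have /near2_natP[N NP] := @brep_asym _ _ p o (s + 1).
  set u := brep p in NP.
  have ds : s + 1 <= mdist o (u N) by rewrite -gpxx; apply: NP.
  have [c gc] := @model_geodesic _ _ _ M o (u N); have [c0 c1 _] := gc.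
  have csh t : 0 <= t -> t <= s + 1 -> sh (t - delta) p (c t).
    move=> t0 ts; exists N => // n /= Nn.
    apply: (hyp_le hyp (y := u N)); last exact: le_trans ts (NP N n (leqnn N) Nn).
    have dt : mdist o (c t) = t by rewrite -{1}c0 (geod_dist gc) ?subr0; lra.
    have dt' : mdist (c t) (u N) = mdist o (u N) - t by rewrite -{1}c1 (geod_dist gc); lra.
    rewrite /gromov_product dt dt'; lra.
  have f2 : s0 < s + 1 by lra.
  have [H cH HP] : exists2 H, conjugates P H &
      forall t, s0 < t -> t < s + 1 -> hb H (c t).
    apply: (hball_interval gc s00 f2 ds).
    move=> t t1 t2 [g cg]; apply: (no g); apply: (shadow_move (x := c t)).
    by apply: shadow_le (csh t _ _); lra.
  have HK : near_hballs (M := M) o (s0 + 1) H.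
    split=> //; exists (c (s0 + 1)); last by apply: HP; lra.
    by rewrite -{1}c0 (geod_dist gc) ?subr0; lra.
  have fr2 := r2P H HK.
  have Hcs : hb H (c s) by apply: HP; lra.
  by apply: (fP H HK _ _ Hcs); apply: shadow_le (csh s _ _); lra.
have [H [cH [x Hx] HP]] := main.
have Hinf : infinite_set H.
  have [Q PQ [g HE]] := cH; have [_ _ subP _] := rel.
  have [_ _ infQ] := subP Q PQ; move=> fH; apply: infQ.
  apply: sub_finite_set (finite_image (fun y => g^-1 * y * g)%g fH) => y Qy.
  exists (g * y * g^-1)%g; first by rewrite HE; exists y.
  by rewrite !mulgA mulVg mul1g mulgVK.
(* Distinct stabiliser elements move [o] to infinity, towards some [q]. They keep a point [x] of the
   horoball inside it, and deep shadows of any point other than [p] miss the horoball, so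
   [q = p]. *)
have [e e_inj eH] := infinite_injection Hinf.
have [U [UU sU]] := @ultraFilterLemma nat \oo _.
have [|q qP] := @orbit_ultra nat U UU e.
  by move=> m; apply: sU; exact: infinite_far.
have [qp|/HP[r' r'P]] := pselect (q = p).
  by have [n /=] := filter_ex (qP r); rewrite qp; exact: no.
have [n /= sn] := filter_ex (qP (r' + mdist o x)).
apply: (r'P (a (e n) x)).
  by apply: (shadow_move (x := a (e n) o)); rewrite iact_isom.
have [_ _ _ stab _] := hballP M.
have : stabilizer a (hb H) (e n) by rewrite stab //; exact: eH.
by rewrite /stabilizer /= => <-; exists x.
Qed.

(** The two ends of a bi-infinite geodesic supplied by tautness. A second boundary point is needed
    to find flags transverse to a given attracting flag. *)
Lemma two_points : exists p q : gromov_boundary M, p <> q.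
Proof.
have [r r0 taut] := model_taut M; have [c [cd _]] := taut o.
pose u := fun n : nat => c n%:R; pose v := fun n : nat => c (- n%:R).
have gpd s t : gromov_product (c 0) (c s) (c t) = (`|s| + `|t| - `|s - t|) / 2.
  by rewrite /gromov_product !cd !sub0r !normrN.
have au : asymptotic u u.
  suff H bb : exists N, forall i j, (N <= i)%N -> (N <= j)%N ->
    bb <= gromov_product (c 0) (u i) (u j) by exact: (proj2 (asymptoticP (c 0) u u) H).
  have [N bN] := exists_nat_ge bb.
  exists N => i j Ni Nj; rewrite /u gpd (ger0_norm (ler0n _ i)) (ger0_norm (ler0n _ j)).
  have iN : N%:R <= i%:R :> R by rewrite ler_nat.
  have jN : N%:R <= j%:R :> R by rewrite ler_nat.
  by rewrite ler_pdivlMr //; have [ij|ji] := ger0P (i%:R - j%:R : R); lra.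
have av : asymptotic v v.
  suff H bb : exists N, forall i j, (N <= i)%N -> (N <= j)%N ->
    bb <= gromov_product (c 0) (v i) (v j) by exact: (proj2 (asymptoticP (c 0) v v) H).
  have [N bN] := exists_nat_ge bb.
  exists N => i j Ni Nj; rewrite /v gpd !normrN (ger0_norm (ler0n _ i)) (ger0_norm (ler0n _ j)).
  have iN : N%:R <= i%:R :> R by rewrite ler_nat.
  have jN : N%:R <= j%:R :> R by rewrite ler_nat.
  by rewrite ler_pdivlMr //; have [ij|ji] := ger0P (- i%:R - - j%:R : R); lra.
have cu : exists2 w, asymptotic w w & gromov_class u = gromov_class w by exists u.
have cv : exists2 w, asymptotic w w & gromov_class v = gromov_class w by exists v.
exists (GromovBoundary cu), (GromovBoundary cv) => pq.
have uv : asymptotic v u.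
  have : gromov_class u u by split.
  have -> : gromov_class u = gromov_class v by move: (congr1 (@bd_class _ _) pq).
  by case.
have [N NP] := (asymptoticP (c 0) v u).1 uv 1.
have := NP N N (leqnn N) (leqnn N); rewrite /u /v gpd normrN -opprD normrN.
by rewrite !ger0_norm ?addr_ge0 // subrr mul0r; lra.
Qed.

Lemma conv_shadow (gs : nat -> Gam) p : converges_to_boundary a gs p <->
  forall r, \forall n \near \oo, sh r p (a (gs n) o).
Proof.
split=> [cv r|shs o']; first exact: shadow_seq (cv o).
apply: (shadow_class hyp (o := o)) => r.
apply: filterS (shs (r + mdist o o')) => n.
by move=> sn; apply: (shadow_move (x := a (gs n) o)); rewrite iact_isom.
Qed.

Lemma shadow_bd_act g p r x :
  sh (r + delta + len g) p x -> sh r (bd_act a g p) (a g x).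
Proof.
move=> [N _ NP].
apply: (shadow_member hyp (u := a g \o brep p)).
  by exists (brep p) => //; rewrite brepE; split; exact: brep_asym.
exists N => // n /= /NP xn.
rewrite -(gromov_product_iact a g^-1%g) !iactK.
have := gp_base o (a g^-1%g o) x (brep p n).
by rewrite -/(len _) lenV; lra.
Qed.

Lemma orbit_far_shadow (I : Type) (U : set_system I) (FU : Filter U) (f : I -> Gam) p :
  (forall r, U [set i | sh r p (a (f i) o)]) ->
  forall m : R, U [set i | m <= len (f i)].
Proof. by move=> H m; apply: filterS (H m) => i /=; exact: shadow_dist. Qed.

End BoundaryPoints.

(** * Representations conjugate on the peripheral subgroups *)

Section NearbyConjugates.
Variables (R : realType) (F : scalar_kind) (d : nat).
Local Notation K := (scalars R F).

(** As column vectors, matrices form [K^(d * d)], so a space of intertwiners becomes a point of a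
    Grassmannian and the results on frames and limits of subspaces apply to it. *)
Definition colvec (X : 'M[K]_d) : 'cV[K]_(d * d) := (mxvec X)^T.
Definition uncol (v : 'cV[K]_(d * d)) : 'M[K]_d := vec_mx v^T.

Lemma colvecK : cancel colvec uncol.
Proof. by move=> X; rewrite /uncol /colvec trmxK mxvecK. Qed.

Lemma uncolK : cancel uncol colvec.
Proof. by move=> v; rewrite /uncol /colvec vec_mxK trmxK. Qed.

Lemma mul_colvec (f : {linear 'M[K]_d -> 'M[K]_d}) X :
  (lin_mx f)^T *m colvec X = colvec (f X).
Proof. by rewrite /colvec -trmx_mul mul_vec_lin. Qed.

Lemma mcvg_uncol I (G : set_system I) {PG : ProperFilter G} v_ v :
  mcvg G v_ v -> mcvg G (fun i => uncol (v_ i)) (uncol v).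
Proof.
move=> cv e e0; pose N := (d * d).+1%:R : R; have N0 : 0 < N by rewrite ltr0n.
have eN : 0 < e / N by rewrite divr_gt0.
apply: filterS (cv _ eN) => i /= vi.
have : mn (uncol (v_ i) - uncol v) <= (d * d)%:R * (e / N).
  apply: mn_le => a b; apply: le_trans (ltW vi).
  have -> : (uncol (v_ i) - uncol v) a b = (v_ i - v) (mxvec_index a b) 0.
    by rewrite !mxE.
  exact: mn_entry.
move=> h; apply: le_lt_trans h _; rewrite mulrA ltr_pdivrMr // mulrC ltr_pM2l //.
by rewrite /N ltr_nat.
Qed.

Lemma commutant_vspace (As : seq 'M[K]_d) : exists Z : {vspace 'cV[K]_(d * d)},
  forall X, colvec X \in Z <-> forall A, A \in As -> X *m A = A *m X.
Proof.
elim: As => [|A As [Z ZP]]; first by exists fullv => X; split=> // _; exact: memvf.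
pose f := linfun (mulmx ((lin_mx (mulmxr A))^T - (lin_mx (mulmx A))^T)
  : 'cV[K]_(d * d) -> 'cV[K]_(d * d)).
have fP X : colvec X \in lker f <-> X *m A = A *m X.
  rewrite memv_ker lfunE /= mulmxBl !mul_colvec subr_eq0.
  by split=> [/eqP /(can_inj colvecK)//|/= ->].
exists (Z :&: lker f)%VS => X; rewrite memv_cap; split.
  move=> /andP[/ZP XZ /fP XA] B; rewrite inE => /orP[/eqP ->//|]; exact: XZ.
move=> H; apply/andP; split; last by apply/fP; apply: H; rewrite mem_head.
by apply/ZP => B Bs; apply: H; rewrite inE Bs orbT.
Qed.

(* The intertwiners between A and h A h^-1 form the translate by h of the
   commutant of A, whose dimension does not depend on h; hence, as the
   conjugates tend to A, these spaces tend to the commutant, which contains 1. *)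
Lemma conj_near (As : seq 'M[K]_d) (eps : R) : 0 < eps ->
  exists2 eta : R, 0 < eta & forall h, h \in unitmx ->
    (forall A, A \in As -> mn (h *m A *m invmx h - A) < eta) ->
  exists2 X, mn (X - 1%:M) < eps &
    forall A, A \in As -> X *m A = h *m A *m invmx h *m X.
Proof.
move=> eps0; apply: contrapT => no.
have /choice[h hP] : forall n : nat, exists h, [/\ h \in unitmx,
    forall A, A \in As -> mn (h *m A *m invmx h - A) < n.+1%:R^-1 &
    ~ exists2 X, mn (X - 1%:M) < eps &
      forall A, A \in As -> X *m A = h *m A *m invmx h *m X].
  move=> n; apply: contrapT => /forallNP nh; apply: no.
  exists n.+1%:R^-1; first by rewrite invr_gt0.
  by move=> h uh hA; apply: contrapT => nX; apply: (nh h).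
have uh n : h n \in unitmx by have [] := hP n.
have [Z ZP] := commutant_vspace As.
have [g0 u0 g0P] := basis_frame (subvv Z); pose j := (\dim Z)%VS.
have jd : (j <= d * d)%N.
  by have := dimvS (subvf Z); rewrite dimvf dim_matrix => le_d; exact: (leq_trans le_d (eq_leq (muln1 _))).
pose ZG := Grassmannian (eqxx (\dim Z)) : grassmannian K (d * d) j.
have ZGE : ZG = grass jd g0 by apply: grass_eq => // v /((g0P v).1).
have memZ v : v \in Z <-> forall i : 'I_(d * d), (j <= i)%N -> (invmx g0 *m v) i 0 = 0.
  have -> : (v \in Z) = (v \in gr_space ZG) by [].
  by rewrite ZGE; have := mem_gframe g0 v jd; rewrite gnE.
pose H n := (lin_mx (mulmx (h n)))^T : 'M[K]_(d * d).
have uH n : H n \in unitmx.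
  rewrite unitmx_tr -row_free_unit; apply: inj_row_free => v.
  rewrite mul_rV_lin => /(congr1 vec_mx); rewrite mxvecK linear0 => hv.
  by rewrite -[v]vec_mxK -[vec_mx v](mulKmx (uh n)) hv mulmx0 linear0.
(* The matrices [h n] may be unbounded, but the translate of [Z] by [h n] depends only on a
   subspace, and elimination gives it a bounded frame [g n]. This frame has a limit [gl] along
   [U]. *)
have [c cP] := bounded_lu R F (d * d).
have /choice[g gP] : forall n, exists g, bnd c g /\
    forall i l : 'I_(d * d), (l < i)%N -> (invmx g *m (H n *m g0)) i l = 0.
  by move=> n; have [|g bg gH] := cP (H n *m g0); [rewrite unitmx_mul uH|exists g].
have ug n : g n \in unitmx by have [[]] := gP n.
have gx n (x : 'cV[K]_(d * d)) : (forall i : 'I_(d * d), (j <= i)%N -> x i 0 = 0) ->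
    forall A, A \in As ->
      uncol (g n *m x) *m A = h n *m A *m invmx (h n) *m uncol (g n *m x).
  move=> x0 A AA; pose y := invmx (H n *m g0) *m (g n *m x).
  have uHg : H n *m g0 \in unitmx by rewrite unitmx_mul uH.
  have y0 (i : 'I_(d * d)) : (j <= i)%N -> y i 0 = 0.
    have /(mem_gframe _ _ jd) : g n *m x \in colspan (gframe j (H n *m g0)).
      have -> : colspan (gframe j (H n *m g0)) = gr_space (grass jd (H n *m g0)) by [].
      rewrite (lu_colspan jd uHg (ug n) (gP n).2); apply/(mem_gframe _ _ jd).
      by rewrite gnE // mulKmx.
    by rewrite gnE //; apply.
  have gxE : g n *m x = H n *m (g0 *m y) by rewrite mulmxA /y mulKVmx.
  have : colvec (uncol (g0 *m y)) \in Z by rewrite uncolK; apply/memZ; rewrite mulKmx.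
  move=> /ZP/(_ A AA) zA.
  have -> : uncol (g n *m x) = h n *m uncol (g0 *m y).
    by rewrite gxE -[g0 *m y]uncolK mul_colvec /= colvecK uncolK.
  by rewrite -!mulmxA mulKmx // zA.
have [U [UU sU]] := @ultraFilterLemma nat \oo _.
have [gl cg bgl] : exists2 gl, mcvg U g gl & bnd c gl.
  by apply: mcvg_bnd_ultra; apply: filterS filterT => n _; exact: (gP n).1.
have [ugl _ _] := bgl.
have cgx (x : 'cV[K]_(d * d)) : mcvg U (fun n => uncol (g n *m x)) (uncol (gl *m x)).
  have cx : mcvg U (fun n => g n *m x) (gl *m x).
    by apply: (mcvgM cg); exact: mcvg_cst.
  exact: mcvg_uncol.
(* Limits of intertwiners commute with [As], so the limit space lies in [Z]; the dimensions agree,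
   hence it is [Z] and contains the identity. *)
have glZ : grass jd gl = grass jd g0.
  apply: grass_eq => // v /(mem_gframe _ _ jd); rewrite gnE // => v0.
  exists (invmx g0 *m v); split; first by rewrite mulKVmx.
  apply/memZ; rewrite -[v]uncolK; apply/ZP => A AA.
  have cX := cgx (invmx gl *m v); rewrite mulKVmx // in cX.
  have cXA : mcvg U (fun n => uncol (g n *m (invmx gl *m v)) *m A) (uncol v *m A).
    by apply: (mcvgM cX); exact: mcvg_cst.
  apply: (mcvg_unique cXA).
  have cB : mcvg U (fun n => h n *m A *m invmx (h n)) A.
    move=> e e0; have [N eN] := exists_nat_ge e^-1.
    apply: sU; exists N => // n /= Nn; have [_ hA _] := hP n.
    apply: lt_le_trans (hA A AA) _; rewrite invf_ple ?posrE //.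
    apply: le_trans eN _; rewrite ler_nat; exact: leq_trans (leqnSn _).
  have cBX : mcvg U (fun n => h n *m A *m invmx (h n) *m
      uncol (g n *m (invmx gl *m v))) (A *m uncol v) by exact: (mcvgM cB cX).
  apply: mcvg_near cBX; apply: filterS filterT => n _ /=.
  by rewrite gx.
pose x := invmx gl *m colvec 1%:M.
have x0 (i : 'I_(d * d)) : (j <= i)%N -> x i 0 = 0.
  have : colvec 1%:M \in gr_space (grass jd gl).
    rewrite glZ -ZGE; apply/(ZP 1%:M) => A _; by rewrite mulmx1 mul1mx.
  by move=> /(mem_gframe _ _ jd); rewrite gnE //; apply.
have c1 := cgx x; rewrite mulKVmx // colvecK in c1.
have [n n1] := filter_ex (c1 _ eps0).
by have [_ _] := hP n; apply; exists (uncol (g n *m x)) => //; exact: gx.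
Qed.

End NearbyConjugates.

Section Representations.
Variables (R : realType) (F : scalar_kind) (d : nat) (Gam : groupType).
Local Notation K := (scalars R F).
Implicit Types rho : Gam -> special_linear K d.

Section OneRepresentation.
Variable rho : Gam -> special_linear K d.
Hypothesis rep : representations Gam K d rho.

Lemma repM x y : sl_mx (rho (x * y)%g) = rho x *m rho y.
Proof. by rewrite rep. Qed.

Lemma rep1 : sl_mx (rho 1%g) = 1%:M.
Proof.
have := repM 1 1; rewrite mulg1 => /(congr1 (mulmx (invmx (rho 1%g)))).
by rewrite mulmxA mulVmx ?sl_unit // mul1mx.
Qed.

Lemma repV x : sl_mx (rho x^-1%g) = invmx (rho x).
Proof.
by rewrite -[RHS]mulmx1 -rep1 -(mulgV x) repM mulKmx // sl_unit.
Qed.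

End OneRepresentation.

(** Intertwining is a condition preserved under products and inverses, so one matrix that
    intertwines the finitely many generators does so on all of [Q]. This is how closeness on
    finitely many elements controls an infinite peripheral subgroup. *)
Lemma near_intertwiner (Q S : set Gam) rho0 (eps : R) : finite_set S ->
  Q = smallest (@is_subgroup Gam) S -> representations Gam K d rho0 -> 0 < eps ->
  exists2 eta : R, 0 < eta & forall rho, representations Gam K d rho ->
    conjugate_on Q rho rho0 -> (forall s, S s -> mn (sl_mx (rho s) - sl_mx (rho0 s)) < eta) ->
  exists2 X : 'M[K]_d, mn (X - 1%:M) < eps &
    forall x, Q x -> X *m rho0 x = rho x *m X.
Proof.
move=> /finite_seqP[ss sE] QE rep0 eps0.
have SQ : S `<=` Q by rewrite QE; exact: sub_smallest.
have [eta eta0 etaP] := conj_near [seq sl_mx (rho0 s) | s <- ss] eps0.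
exists eta => // rho rep [h hP] near.
have rhoE x : Q x -> sl_mx (rho x) = h *m rho0 x *m invmx h by move=> /hP ->.
have inS s : s \in ss -> S s by rewrite sE.
have [|X X1 XP] := etaP h (sl_unit h).
  by move=> _ /mapP[s /inS Ss ->]; rewrite -rhoE; [exact: near|exact: SQ].
exists X => //.
have sub : is_subgroup [set x | X *m rho0 x = rho x *m X].
  split; first by rewrite /= !rep1 // mulmx1 mul1mx.
  move=> x y /= xE yE; rewrite !repM // !repV // mulmxA xE -!mulmxA; congr (_ *m _).
  by rewrite -[X in RHS](mulmxK (sl_unit (rho0 y))) yE !mulmxA mulVmx ?sl_unit // mul1mx.
rewrite QE; apply: smallest_sub => // s Ss /=.
rewrite rhoE; last exact: SQ.
by apply: XP; apply: map_f; move: Ss; rewrite sE.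
Qed.

Lemma eval_near rho0 (s : Gam) (eta : R) : 0 < eta ->
  nbhs (rho0 : {ptws Gam -> special_linear K d}) [set rho | mn (sl_mx (rho s) - sl_mx (rho0 s)) < eta].
Proof.
move=> eta0.
have c1 := @proj_continuous _ (fun=> special_linear K d) s rho0.
have c2 := @initial_continuous _ _ (@sl_mx K d) (rho0 s).
have near : nbhs (sl_mx (rho0 s)) [set B | mn (B - sl_mx (rho0 s)) < eta] by exact: mcvg_nbhs.
exact: (c1 _ (c2 _ near)).
Qed.

Lemma finite_min (T : Type) (A : set T) (f : T -> R) : finite_set A ->
  (forall x, A x -> 0 < f x) -> exists2 e : R, 0 < e & forall x, A x -> e <= f x.
Proof.
move=> fA f0; have [M MP] := finite_bound (fun x => (f x)^-1) fA.
have M1 : 0 < Num.max M 1 by rewrite lt_max ltr01 orbT.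
exists (Num.max M 1)^-1; first by rewrite invr_gt0.
move=> x Ax; rewrite invf_ple ?posrE ?f0 //.
by rewrite le_max MP.
Qed.

(* On a piece f x f' with x peripheral, conjugating by an intertwiner X near 1
   gives rho (f x f') = (rho f X rho0 f^-1) rho0 (f x f') (rho0 f'^-1 X^-1 rho f'). *)
Lemma near_pieces (P : set (set Gam)) rho0 (E : set Gam) (eps : R) :
  finite_set P -> (forall Q, P Q -> finitely_generated Q) ->
  representations Gam K d rho0 -> finite_set E -> 0 < eps ->
  exists O : set (subspace (relative_representations P rho0)),
    [/\ open O, O rho0, O `<=` relative_representations P rho0 &
      forall rho, O rho -> forall h, piece P E h -> exists a b : 'M[K]_d,
        [/\ mn (a - 1%:M) <= eps, mn (b - 1%:M) <= eps &
          sl_mx (rho h) = a *m rho0 h *m b]].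
Proof.
move=> fP fg rep0 fE eps0.
have [C CP] := finite_bound (fun f => mn (rho0 f) + mn (invmx (rho0 f))) fE.
pose C1 := 1 + Num.max C 0.
have C1P f : E f -> mn (rho0 f) <= C1 /\ mn (invmx (rho0 f)) <= C1.
  move=> /CP; have := mn_ge0 (rho0 f); have := mn_ge0 (invmx (rho0 f)).
  have : C <= Num.max C 0 by rewrite le_max lexx.
  by rewrite /C1; split; lra.
have C10 : 1 <= C1 by rewrite /C1 lerDl le_max lexx orbT.
pose N := 2 * d%:R + 2 : R; have N0 : 2 <= N by rewrite /N lerDr mulr_ge0.
(* [N] bounds [X] and its inverse, [C1] the matrices [rho0 f] and their inverses. Each of [a - 1]
   and [b - 1] is a sum of two terms of order [e1 * N * C1 ^+ 2], which [budget] and [budget'] fit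
   under [eps]. *)
pose e1 := Num.min (1 / 2) (eps / (4 * N * C1 ^+ 2)).
have C20 : 0 < 4 * N * C1 ^+ 2 by rewrite !mulr_gt0 ?exprn_gt0 //; lra.
have e10 : 0 < e1 by rewrite lt_min !divr_gt0.
have e1h : e1 <= 1 / 2 by rewrite ge_min lexx.
have e1e : e1 * (4 * N * C1 ^+ 2) <= eps.
  by rewrite -ler_pdivlMr // ge_min lexx orbT.
have /choice[S SP] : forall Q, exists S : set Gam, P Q ->
    finite_set S /\ Q = smallest (@is_subgroup Gam) S.
  move=> Q; have [/fg[S fS QE]|nP] := pselect (P Q); first by exists S.
  by exists set0.
have /choice[eta etaP] : forall Q, exists eta : R, P Q -> 0 < eta /\
    forall rho, representations Gam K d rho -> conjugate_on Q rho rho0 ->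
      (forall s, S Q s -> mn (sl_mx (rho s) - sl_mx (rho0 s)) < eta) ->
      exists2 X : 'M[K]_d, mn (X - 1%:M) < e1 &
        forall x, Q x -> X *m rho0 x = rho x *m X.
  move=> Q; have [PQ|nP] := pselect (P Q); last by exists 0.
  have [fS QE] := SP Q PQ.
  by have [eta eta0 etaP] := near_intertwiner fS QE rep0 e10; exists eta.
have [e2 e20 e2P] := finite_min fP (fun Q PQ => (etaP Q PQ).1).
pose e3 := Num.min e2 e1; have e30 : 0 < e3 by rewrite lt_min e20.
have fG : finite_set (E `|` \bigcup_(Q in P) S Q).
  by rewrite finite_setU; split=> //; apply: bigcup_finite => // Q /SP[].
have [ss sE] := finite_fsetP.1 fG.
pose W : set {ptws Gam -> special_linear K d} :=
  \bigcap_(s in E `|` \bigcup_(Q in P) S Q) [set rho | mn (sl_mx (rho s) - sl_mx (rho0 s)) < e3].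
have nW : nbhs (rho0 : {ptws Gam -> special_linear K d}) W.
  have FN : Filter (nbhs (rho0 : {ptws Gam -> special_linear K d})) by exact: nbhs_filter.
  by rewrite /W sE; apply: filter_bigI => s _; exact: eval_near.
have rel0 : relative_representations P rho0 rho0.
  split=> // H _; exists 1%g => x _; by rewrite invg1 mulg1 mul1g.
exists (relative_representations P rho0 `&` interior W); split.
- by apply: openI; [exact: open_subspaceT|apply: open_subspaceW; exact: open_interior].
- by split.
- by move=> rho [].
move=> rho [[rep conj] /interior_subset Wrho] _ [f [x [f' [Ef Ef' xQ ->]]]].
have Wn s : (E `|` \bigcup_(Q in P) S Q) s -> mn (sl_mx (rho s) - sl_mx (rho0 s)) < e3.
  by move=> /Wrho.
have nE f1 : E f1 -> mn (sl_mx (rho f1) - sl_mx (rho0 f1)) <= e1.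
  move=> Ef1; have : mn (sl_mx (rho f1) - sl_mx (rho0 f1)) < e3 by apply: Wn; left.
  by rewrite lt_min => /andP[_ /ltW].
have [X X1 XP] : exists2 X : 'M[K]_d, mn (X - 1%:M) < e1 & X *m rho0 x = rho x *m X.
  case: xQ => [->|[Q PQ Qx]].
    by exists 1%:M; rewrite ?subrr ?mn0 // !rep1 // mulmx1.
  have [_ QP] := etaP Q PQ; have [|X X1 XP] := QP rho rep (conj Q PQ).
    move=> s Ss; have : mn (sl_mx (rho s) - sl_mx (rho0 s)) < e3 by apply: Wn; right; exists Q.
    move=> h; apply: lt_le_trans h _.
    by rewrite ge_min e2P.
  by exists X => //; exact: XP.
have [uX VX] : X \in unitmx /\ mn (invmx X) <= N.
  have [|uX VX] := @unitmx_near1 R F d (X - 1%:M); first by apply: le_trans (ltW X1) _.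
  by rewrite addrC subrK in uX VX; split=> //; apply: le_trans VX _; rewrite /N; lra.
have XN : mn X <= N.
  rewrite -[X](subrK 1%:M); apply: le_trans (ler_mnD _ _) _; rewrite mn1 /N.
  have : 0 <= d%:R :> R by [].
  by have := ltW X1; lra.
have VX1 : mn (invmx X - 1%:M) <= N * e1.
  have -> : invmx X - 1%:M = invmx X *m (1%:M - X) by rewrite mulmxBr mulmx1 mulVmx.
  by apply: mnM_le => //; rewrite mnB ltW.
have p1 : 0 <= e1 * N * C1 * (C1 - 1) by rewrite !mulr_ge0 //; lra.
have p2 : 0 <= e1 * (C1 * C1) * (N - 1) by rewrite !mulr_ge0 //; lra.
have p3 : 0 <= e1 * N * (C1 * C1) by rewrite !mulr_ge0 //; lra.
have budget : e1 * N * C1 + C1 * e1 * C1 <= e1 * (4 * N * C1 ^+ 2).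
  by rewrite expr2; move: p1 p2 p3; clear; nra.
have budget' : C1 * (N * e1) + C1 * ((N * e1) * C1) <= e1 * (4 * N * C1 ^+ 2).
  by rewrite expr2; move: p1 p2 p3; clear; nra.
exists (rho f *m X *m invmx (rho0 f)), (invmx (rho0 f') *m invmx X *m rho f'); split.
- have -> : rho f *m X *m invmx (rho0 f) - 1%:M =
      (sl_mx (rho f) - sl_mx (rho0 f)) *m X *m invmx (rho0 f) + rho0 f *m (X - 1%:M) *m invmx (rho0 f).
    rewrite -mulmxDl mulmxBl mulmxBr mulmx1 addrA subrK mulmxBl mulmxV ?sl_unit //.
  have h1 : mn ((sl_mx (rho f) - sl_mx (rho0 f)) *m X *m invmx (rho0 f)) <= e1 * N * C1.
    apply: mnM_le; [apply: mnM_le => //; exact: nE|exact: (C1P _ Ef).2].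
  have h2 : mn (rho0 f *m (X - 1%:M) *m invmx (rho0 f)) <= C1 * e1 * C1.
    apply: mnM_le; [apply: mnM_le; [exact: (C1P _ Ef).1|exact: ltW]|exact: (C1P _ Ef).2].
  apply: le_trans (ler_mnD _ _) _; apply: le_trans (lerD h1 h2) _.
  apply: le_trans e1e; exact: budget.
- have -> : invmx (rho0 f') *m invmx X *m rho f' - 1%:M =
      invmx (rho0 f') *m (invmx X *m (sl_mx (rho f') - sl_mx (rho0 f'))) +
      invmx (rho0 f') *m (invmx X - 1%:M) *m rho0 f'.
    rewrite -!mulmxA -mulmxDr mulmxBr mulmxBl mul1mx addrA subrK mulmxBr mulVmx ?sl_unit //.
  have h1 : mn (invmx (rho0 f') *m (invmx X *m (sl_mx (rho f') - sl_mx (rho0 f')))) <= C1 * (N * e1).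
    apply: mnM_le; [exact: (C1P _ Ef').2|apply: mnM_le => //; exact: nE].
  have h2 : mn (invmx (rho0 f') *m (invmx X - 1%:M) *m rho0 f') <= C1 * (N * e1) * C1.
    apply: mnM_le; [apply: mnM_le => //; exact: (C1P _ Ef').2|exact: (C1P _ Ef').1].
  apply: le_trans (ler_mnD _ _) _; apply: le_trans (lerD h1 h2) _.
  apply: le_trans e1e; rewrite -[C1 * (N * e1) * C1]mulrA; exact: budget'.
rewrite !repM //.
have -> : rho f *m X *m invmx (rho0 f) *m (rho0 f *m rho0 x *m rho0 f') *m
    (invmx (rho0 f') *m invmx X *m rho f') =
    rho f *m (X *m rho0 x *m invmx X) *m rho f'.
  rewrite -!mulmxA mulKmx ?sl_unit //; do 3 congr (_ *m _).
  by rewrite mulKVmx ?sl_unit.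
by rewrite XP mulmxK.
Qed.

End Representations.

(** * Attracting flags *)

Section FlagPositions.
Variables (R : realType) (F : scalar_kind) (d k : nat).
Local Notation K := (scalars R F).
Hypothesis kd : (k <= d - k)%N.

Let kd' : (k <= d)%N. Proof. exact: leq_trans kd (leq_subr _ _). Qed.
Let dkd : (d - k <= d)%N. Proof. exact: leq_subr. Qed.

(** Reverses the coordinates, turning conditions on the first ones into conditions on the last ones,
    the form in which [mem_gframe] describes a subspace. *)
Definition rvm : 'M[K]_d := perm_mx (perm (@rev_ord_inj d)).

Lemma rvm_unit : rvm \in unitmx.
Proof. exact: unitmx_perm. Qed.

Lemma mul_rvm n (A : 'M[K]_(d, n)) i j : (rvm *m A) i j = A (rev_ord i) j.
Proof. by rewrite /rvm -row_permE mxE permE. Qed.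

(* The rows of P of index < k annihilate the first d - k columns of Q; by
   dimension their common kernel is spanned by these columns. *)
Lemma kernel_eq (P Q : 'M[K]_d) (v : 'cV[K]_d) : P \in unitmx -> Q \in unitmx ->
  (forall i j : 'I_d, (i < k)%N -> (j < d - k)%N -> (P *m Q) i j = 0) ->
  (forall i : 'I_d, (i < k)%N -> (P *m v) i 0 = 0) <->
  (forall j : 'I_d, (d - k <= j)%N -> (invmx Q *m v) j 0 = 0).
Proof.
move=> uP uQ PQ.
have lowP (w : 'cV[K]_d) : (forall j : 'I_d, (d - k <= j)%N -> (invmx Q *m w) j 0 = 0) ->
    forall i : 'I_d, (i < k)%N -> (P *m w) i 0 = 0.
  move=> w0 i ik; rewrite -[w](mulKVmx uQ) [P *m _]mulmxA mxE; apply: big1 => l _.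
  have [ld|dl] := ltnP l (d - k); first by rewrite PQ // mul0r.
  by rewrite w0 ?mulr0.
split; last exact: lowP.
have uW : invmx (rvm *m P) \in unitmx by rewrite unitmx_inv unitmx_mul rvm_unit.
have uW' : rvm *m P \in unitmx by rewrite -unitmx_inv.
have QW : grass dkd Q = grass dkd (invmx (rvm *m P)).
  apply: grass_eq => // w /(mem_gframe _ _ dkd); rewrite gnE // => /lowP w0.
  exists (rvm *m P *m w); split; first by rewrite mulKmx.
  move=> i di; rewrite -mulmxA mul_rvm; apply: w0 => /=.
  by rewrite ltn_subLR // addSn ltnS addnC -leq_subLR.
move=> v0; have : v \in gr_space (grass dkd (invmx (rvm *m P))).
  apply/(mem_gframe _ _ dkd) => i di; rewrite gnE // invmxK -mulmxA mul_rvm; apply: v0 => /=.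
  by rewrite ltn_subLR // addSn ltnS addnC -leq_subLR.
by rewrite -QW => /(mem_gframe _ _ dkd); rewrite gnE.
Qed.

Lemma grass_complementary (V : grassmannian K d k) (W : grassmannian K d (d - k)) :
  (forall v, v \in gr_space V -> v \in gr_space W -> v = 0) -> complementary V W.
Proof.
move=> H; have cap0 : (gr_space V :&: gr_space W = 0)%VS.
  apply/eqP; rewrite -subv0; apply/subvP => v; rewrite memv_cap memv0.
  by move=> /andP[v1 v2]; apply/eqP; exact: H.
split=> //; apply/eqP; rewrite eqEdim subvf /= dimv_disjoint_sum //.
rewrite (eqP (gr_dim V)) (eqP (gr_dim W)) subnKC // dimvf dim_matrix.
by rewrite leq_eqVlt; apply/orP; left; apply/eqP; exact: muln1.
Qed.

(** One of the two halves of transversality; complementary dimensions make trivial intersection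
    sufficient. The halves are separated because [minor_unit] characterises one direction at a
    time. *)
Definition disjoint_flags (x y : flags K d k) : Prop :=
  forall v, v \in gr_space (set_val x).1 -> v \in gr_space (set_val y).2 -> v = 0.

Lemma transverseP (x y : flags K d k) :
  transverse x y <-> disjoint_flags x y /\ disjoint_flags y x.
Proof.
split=> [[[_ xy] [_ yx]]|[xy yx]]; last first.
  by split; exact: grass_complementary.
split=> v v1 v2; apply/eqP; rewrite -memv0; first by rewrite -xy memv_cap v1.
by rewrite -yx memv_cap v1.
Qed.

Lemma not_transverse_self (x : flags K d k) : (0 < k)%N -> ~ transverse x x.
Proof.
move=> k0 /transverseP[xx _]; pose V := gr_space (set_val x).1.
have := memv_pick V; have : vpick V = 0.
  by apply: xx; [exact: memv_pick|apply: (subvP (set_mem (valP x))); exact: memv_pick].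
move/eqP; rewrite vpick0 => /eqP V0 _; have := gr_dim (set_val x).1.
by rewrite -/V V0 dimv0 => /eqP k00; rewrite -k00 in k0.
Qed.

Lemma flag_eq (g g' : 'M[K]_d) : g \in unitmx -> g' \in unitmx ->
  (forall v : 'cV[K]_d, (forall j : 'I_d, (k <= j)%N -> (invmx g *m v) j 0 = 0) ->
    forall j : 'I_d, (k <= j)%N -> (invmx g' *m v) j 0 = 0) ->
  (forall v : 'cV[K]_d, (forall j : 'I_d, (d - k <= j)%N -> (invmx g *m v) j 0 = 0) ->
    forall j : 'I_d, (d - k <= j)%N -> (invmx g' *m v) j 0 = 0) ->
  mflag kd g = mflag kd g'.
Proof.
move=> ug ug' H1 H2; apply: val_inj.
rewrite -[LHS]/(set_val (mflag kd g)) -[RHS]/(set_val (mflag kd g')) !mflag_val.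
congr pair; apply: grass_eq => // v /mem_gframe; rewrite gnE // => vg.
  by exists (invmx g' *m v); rewrite mulKVmx //; split=> //; apply: H1; exact: vg kd'.
by exists (invmx g' *m v); rewrite mulKVmx //; split=> //; apply: H2; exact: vg dkd.
Qed.

Hypothesis k0 : (0 < k)%N.

(** A component of [V a] in an expanding coordinate forces [A a] to be long, while the contracted
    coordinates of [A a] stay short. The product of both estimates is homogeneous in [a] and in
    [A a], so the two vectors can be normalised independently. *)
Lemma gap_product (A : 'M[K]_d) (a : 'cV[K]_d) (i j : 'I_d) : A \in unitmx ->
  (i < k)%N -> (k <= j)%N ->
  nrm ((udvV A *m a) i 0) * nrm ((invmx (udvU A) *m (A *m a)) j 0) <=
  udvc R F d ^+ 2 * (udvd A k / udvd A k.-1) * (mn a * mn (A *m a)).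
Proof.
move=> uA ik kj; set b := A *m a; set c := udvc R F d.
have [uU _ VU] := udvU_bnd A; have [uV Vc _] := udvV_bnd A.
have bE : invmx (udvU A) *m b = diag_mx (udvD A) *m (udvV A *m a).
  by rewrite /b {2}(udvE A) -!mulmxA mulKmx.
have k1 : (k.-1 < d)%N by rewrite prednK // kd'.
have l0 : 0 < udvd A k.-1 by apply: udvd_gt0.
have h1 : nrm ((udvV A *m a) i 0) * udvd A k.-1 <= c * mn b.
  apply: (@le_trans _ _ (nrm ((invmx (udvU A) *m b) i 0))).
    rewrite bE mul_diag_entry nrmM mulrC -udvdE; apply: ler_wpM2r; first exact: nrm_ge0.
    by apply: udvd_le => //; exact: leq_predr.
  by apply: le_trans (mn_entry _ _ _) _; apply: mnM_le.
have h2 : nrm ((invmx (udvU A) *m b) j 0) <= udvd A k * (c * mn a).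
  rewrite bE mul_diag_entry nrmM -udvdE; apply: ler_pM; rewrite ?udvd_ge0 ?nrm_ge0 //.
    by apply: udvd_le.
  by apply: le_trans (mn_entry _ _ _) _; apply: mnM_le.
have h3 := ler_pM (mulr_ge0 (nrm_ge0 _) (udvd_ge0 _ _)) (nrm_ge0 _) h1 h2.
rewrite -(ler_pM2r l0); apply: le_trans (le_trans _ h3) _.
  by rewrite le_eqVlt; apply/orP; left; apply/eqP; ring.
by rewrite le_eqVlt; apply/orP; left; apply/eqP; field; rewrite gt_eqF.
Qed.

Lemma normalize_col (w : 'cV[K]_d) : w != 0 ->
  exists s : K, [/\ s != 0, 1 <= mn (s *: w) & mn (s *: w) <= d%:R].
Proof.
move=> w0; have /existsP[i0 wi0] : [exists i, w i 0 != 0].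
  apply: contraNT w0 => /existsPn H; apply/eqP/matrixP => i j.
  by rewrite ord1 mxE; apply/eqP; have := H i; rewrite negbK.
have [i _ iP] := @arg_maxP _ _ _ i0 xpredT (fun i => nrm (w i 0)) isT.
have wi : w i 0 != 0 by rewrite -nrm_gt0; apply: lt_le_trans (iP i0 isT); rewrite nrm_gt0.
exists (w i 0)^-1; split; first by rewrite invr_eq0.
  by apply: le_trans (mn_entry _ i 0); rewrite mxE mulVf // nrm1.
have := @mn_le R F d 1 ((w i 0)^-1 *: w) 1; rewrite muln1 mulr1; apply=> l j.
rewrite ord1 mxE nrmM nrmV mulrC ler_pdivrMr ?nrm_gt0 // mul1r; exact: iP.
Qed.

Section Attraction.
Variables (I : Type) (G : set_system I).
Hypothesis UG : UltraFilter G.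

Definition gap_cvg (B_ : I -> 'M[K]_d) : Prop :=
  forall e : R, 0 < e -> G [set i | udvd (B_ i) k <= e * udvd (B_ i) k.-1].

Lemma gap_ratio B_ : (forall i, B_ i \in unitmx) -> gap_cvg B_ ->
  forall e : R, 0 < e -> G [set i | udvd (B_ i) k / udvd (B_ i) k.-1 < e].
Proof.
move=> uB gB e e0; have e20 : 0 < e / 2 by rewrite divr_gt0.
apply: filterS (gB _ e20) => i /= Bi.
have k1 : (k.-1 < d)%N by rewrite prednK // kd'.
have l0 : 0 < udvd (B_ i) k.-1 by apply: udvd_gt0.
rewrite ltr_pdivrMr //; apply: le_lt_trans Bi _; rewrite ltr_pM2r //; lra.
Qed.

(** Projective dynamics in the limit: unless the limit of the sources is annihilated by the first
    [k] rows of [V], the images converge into the span of the first [k] columns of [U]. The scalars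
    [s_] cancel by the homogeneity of [gap_product]. *)
Lemma gap_limit (B_ : I -> 'M[K]_d) (a_ b_ : I -> 'cV[K]_d) (s_ : I -> K)
    (U V : 'M[K]_d) (a b : 'cV[K]_d) (i j : 'I_d) :
  (forall n, B_ n \in unitmx) -> gap_cvg B_ ->
  mcvg G (fun n => udvU (B_ n)) U -> mcvg G (fun n => udvV (B_ n)) V ->
  U \in unitmx -> mcvg G a_ a -> mcvg G b_ b ->
  (forall n, s_ n != 0) -> (forall n, B_ n *m a_ n = s_ n *: b_ n) ->
  (i < k)%N -> (k <= j)%N -> (V *m a) i 0 != 0 -> (invmx U *m b) j 0 = 0.
Proof.
move=> uB gB cU cV uU ca cb s0 Bab ik kj Va0.
have cUb : mcvg G (fun n => invmx (udvU (B_ n)) *m b_ n) (invmx U *m b).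
  by apply: mcvgM cb; exact: mcvg_inv.
have cVa : mcvg G (fun n => (udvV (B_ n) *m a_ n)^T) (V *m a)^T.
  by apply: mcvg_tr; exact: (mcvgM cV ca).
have cp : mcvg G (fun n => (invmx (udvU (B_ n)) *m b_ n) *m (udvV (B_ n) *m a_ n)^T)
  ((invmx U *m b) *m (V *m a)^T) by exact: (mcvgM cUb cVa).
have prodE (x y : 'cV[K]_d) p q : (x *m y^T) p q = x p 0 * y q 0.
  by rewrite mxE big_ord1 mxE.
have : ((invmx U *m b) *m (V *m a)^T) j i = 0.
  apply: (mcvg_entry0 cp) => e e0.
  pose N := udvc R F d ^+ 2 * ((mn a + 1) * (mn b + 1)).
  have N0 : 0 <= N by rewrite mulr_ge0 ?sqr_ge0 // mulr_ge0 // addr_ge0 // mn_ge0.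
  have eN : 0 < e / (N + 1) by rewrite divr_gt0 // ltr_wpDl.
  apply: filterS3 (ca _ ltr01) (cb _ ltr01) (gap_ratio uB gB eN) => n /= an bn gn'.
  have near_le (x y : 'cV[K]_d) : mn (x - y) < 1 -> mn x <= mn y + 1.
    move=> xy; rewrite -[x](subrK y) addrC; apply: le_trans (ler_mnD _ _) _.
    by rewrite lerD2l ltW.
  have {}an := near_le _ _ an; have {}bn := near_le _ _ bn.
  have := gap_product (a_ n) (uB n) ik kj; rewrite Bab.
  have -> : (invmx (udvU (B_ n)) *m (s_ n *: b_ n)) j 0 =
      s_ n * (invmx (udvU (B_ n)) *m b_ n) j 0 by rewrite -scalemxAr mxE.
  have -> : mn (s_ n *: b_ n) = nrm (s_ n) * mn (b_ n).
    rewrite /mn mulr_sumr; apply: eq_bigr => l _; rewrite mulr_sumr.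
    by apply: eq_bigr => l' _; rewrite mxE nrmM.
  rewrite prodE !nrmM; set x := nrm _; set s := nrm (s_ n); set y := nrm _.
  set q := udvd _ _ / _; move=> h.
  have sp : 0 < s by rewrite nrm_gt0.
  have {}h : y * x <= udvc R F d ^+ 2 * q * (mn (a_ n) * mn (b_ n)).
    rewrite -(ler_pM2l sp).
    have -> : s * (y * x) = x * (s * y) by ring.
    by apply: le_trans h _; rewrite le_eqVlt; apply/orP; left; apply/eqP; ring.
  apply: le_lt_trans h _.
  have q0 : 0 <= q by rewrite divr_ge0 // udvd_ge0.
  apply: (@le_lt_trans _ _ (N * q)).
    have -> : N * q = udvc R F d ^+ 2 * q * ((mn a + 1) * (mn b + 1)) by rewrite /N; ring.
    apply: ler_wpM2l; first by rewrite mulr_ge0 // sqr_ge0.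
    by apply: ler_pM => //; exact: mn_ge0.
  have : N * q <= N * (e / (N + 1)) by apply: ler_wpM2l => //; exact: ltW.
  move=> h; apply: le_lt_trans h _; rewrite mulrA ltr_pdivrMr ?ltr_wpDl //.
  by rewrite mulrC ltr_pM2l // ltrDl.
rewrite prodE => /eqP; rewrite mulf_eq0 (negbTE Va0) orbF => /eqP.
exact.
Qed.

Lemma unit_limit (w_ : I -> 'cV[K]_d) : (forall i, w_ i != 0) ->
  exists (s_ : I -> K) w, [/\ forall i, s_ i != 0,
    mcvg G (fun i => s_ i *: w_ i) w & w != 0].
Proof.
move=> w0; have /choice[s sP] := fun i => normalize_col (w0 i).
have [w cw] : exists w, mcvg G (fun i => s i *: w_ i) w.
  apply: (mcvg_ultra UG (c := d%:R)); apply: filterS filterT => i _ /=.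
  by have [] := sP i.
exists s, w; split=> //; first by move=> i; have [] := sP i.
apply/eqP => w00; have [n /=] := filter_ex (cw 1 ltr01).
by rewrite w00 subr0; have [_ s1 _] := sP n; rewrite ltNge s1.
Qed.

Lemma support_limit n (g_ : I -> 'M[K]_d) g (v_ : I -> 'cV[K]_d) v :
  g \in unitmx -> mcvg G g_ g -> mcvg G v_ v ->
  G [set i | forall j : 'I_d, (n <= j)%N -> (invmx (g_ i) *m v_ i) j 0 = 0] ->
  forall j : 'I_d, (n <= j)%N -> (invmx g *m v) j 0 = 0.
Proof.
move=> ug cg cv H j nj.
have c : mcvg G (fun i => invmx (g_ i) *m v_ i) (invmx g *m v).
  by apply: mcvgM cv; exact: mcvg_inv.
by apply: (mcvg_entry0 c) => e e0; apply: filterS H => i /= ->; rewrite ?nrm0.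
Qed.

(** Links the repelling data of the inverses with the attracting data of the matrices: for
    invertible limits, [kernel_eq] then identifies the common kernel of the first [k] rows of [V]
    with the [(d - k)]-space of the flag of [U]. *)
Lemma udv_inv_limit (B_ : I -> 'M[K]_d) (V U : 'M[K]_d) (i j : 'I_d) :
  (forall n, B_ n \in unitmx) -> gap_cvg (fun n => invmx (B_ n)) ->
  mcvg G (fun n => udvV (invmx (B_ n))) V -> mcvg G (fun n => udvU (B_ n)) U ->
  (i < k)%N -> (j < d - k)%N -> (V *m U) i j = 0.
Proof.
move=> uB gB cV cU ik jk.
have c : mcvg G (fun n => udvV (invmx (B_ n)) *m udvU (B_ n)) (V *m U) by exact: (mcvgM cV cU).
apply: (mcvg_entry0 c) => e e0; set N := (udvc R F d * udvc R F d) ^+ 3.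
have c0 : 0 <= udvc R F d by exact: bnd_ge0 (udvU_bnd (0 : 'M[K]_d)).
have N0 : 0 <= N by rewrite exprn_ge0 // mulr_ge0.
have eN : 0 < e / (N + 1) by rewrite divr_gt0 // ltr_wpDl.
have uV n : invmx (B_ n) \in unitmx by rewrite unitmx_inv.
apply: filterS (gap_ratio uV gB eN) => n /= qn.
have := udv_inv_small (uB n) k0 ik jk; rewrite -/N => h.
apply: le_lt_trans h _; apply: le_lt_trans (ler_wpM2l N0 (ltW qn)) _.
by rewrite mulrA ltr_pdivrMr ?ltr_wpDl // mulrC ltr_pM2l // ltrDl.
Qed.

(** Let [g] represent the limit of the image flags. A vector of its [k]-space, pulled back by [A_]
    and normalised, tends to a vector [w] of the [k]-space of [h]; transversality to [Q] gives [w]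
    an expanding component, so [gap_limit] puts the vector into the [k]-space of [U]. For the
    [(d - k)]-space the same argument is run for the inverses, from the image back to [w]. *)
Lemma attract (A_ h_ : I -> 'M[K]_d) (U Q h : 'M[K]_d) :
  (forall i, A_ i \in unitmx) -> gap_cvg A_ -> gap_cvg (fun i => invmx (A_ i)) ->
  mcvg G (fun i => udvU (A_ i)) U -> mcvg G (fun i => udvU (invmx (A_ i))) Q ->
  (forall i, h_ i \in unitmx) -> h \in unitmx -> mcvg G h_ h ->
  transverse (mflag kd h) (mflag kd Q) ->
  (fun i => mflag kd (A_ i *m h_ i)) @ G --> mflag kd U.
Proof.
move=> uA gA gV cU cQ uh_ uh ch /transverseP[hQ Qh].
have uVA i : invmx (A_ i) \in unitmx by rewrite unitmx_inv.
have uAh i : A_ i *m h_ i \in unitmx by rewrite unitmx_mul uA uh_.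
have uU : U \in unitmx.
  by case: (mcvg_bnd (c := udvc R F d) _ cU) => //; apply: filterS filterT => i _; exact: udvU_bnd.
have uQ : Q \in unitmx.
  by case: (mcvg_bnd (c := udvc R F d) _ cQ) => //; apply: filterS filterT => i _; exact: udvU_bnd.
have [V cV [uV _ _]] : exists2 V, mcvg G (fun i => udvV (A_ i)) V & bnd (udvc R F d) V.
  by apply: mcvg_bnd_ultra; apply: filterS filterT => i _; exact: udvV_bnd.
have [P cP [uP _ _]] : exists2 P, mcvg G (fun i => udvV (invmx (A_ i))) P & bnd (udvc R F d) P.
  by apply: mcvg_bnd_ultra; apply: filterS filterT => i _; exact: udvV_bnd.
have VQ (i j : 'I_d) : (i < k)%N -> (j < d - k)%N -> (V *m Q) i j = 0.
  apply: (@udv_inv_limit (fun n => invmx (A_ n))) => //.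
    by move=> e /gA; apply: filterS => n /=; rewrite invmxK.
  by apply: mcvg_near cV; apply: filterS filterT => n _ /=; rewrite invmxK.
have PU (i j : 'I_d) : (i < k)%N -> (j < d - k)%N -> (P *m U) i j = 0.
  by apply: (@udv_inv_limit A_).
have [g [[ug _ _] cg fg]] := flags_ultra kd UG (fun i => mflag kd (A_ i *m h_ i)).
set g_ := frep kd \o _ in cg.
have ug_ i : g_ i \in unitmx by exact: frep_unit.
have gE i : mflag kd (g_ i) = mflag kd (A_ i *m h_ i) by exact: frepK.
suff <- : mflag kd g = mflag kd U by [].
apply: flag_eq => // v vg j kj.
  have [->|v0] := eqVneq v 0; first by rewrite mulmx0 mxE.
  pose x := invmx g *m v; pose v_ i := g_ i *m x.
  have cv : mcvg G v_ v.
    rewrite -[v](mulKVmx ug); apply: (mcvgM cg); exact: mcvg_cst.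
  have v0_ i : invmx (A_ i) *m v_ i != 0.
    apply: contra_neq v0 => /(congr1 (mulmx (A_ i))); rewrite mulKVmx // mulmx0.
    move=> /(congr1 (mulmx (invmx (g_ i)))); rewrite mulKmx // mulmx0 => x0.
    by rewrite -[v](mulKVmx ug) -/x x0 mulmx0.
  have [s [w [s0 cw w0]]] := unit_limit v0_.
  have supp i (l : 'I_d) : (k <= l)%N ->
      (invmx (h_ i) *m (s i *: (invmx (A_ i) *m v_ i))) l 0 = 0.
    move=> kl; have : v_ i \in gr_space (set_val (mflag kd (A_ i *m h_ i))).1.
      rewrite -gE; apply/mem_mflag1; rewrite gnE // => l' kl'.
      by rewrite mulKmx //; exact: vg.
    move=> /mem_mflag1; rewrite gnE // invmxM // => /(_ l kl) h0.
    by rewrite -scalemxAr mxE mulmxA h0 mulr0.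
  have wh (j' : 'I_d) : (k <= j')%N -> (invmx h *m w) j' 0 = 0.
    by apply: (support_limit uh ch cw); apply: filterS filterT => i _; exact: supp.
  have [i ik Vi] : exists2 i : 'I_d, (i < k)%N & (V *m w) i 0 != 0.
    apply: contrapT => nV; move/eqP: w0; apply; apply: hQ.
      by apply/mem_mflag1; rewrite gnE.
    apply/mem_mflag2; rewrite gnE //; apply/(kernel_eq _ uV uQ VQ) => i ik.
    by apply/eqP; apply: contrapT => /negP Vi; apply: nV; exists i.
  apply: (gap_limit uA gA cU cV uU cw cv s0 _ ik kj Vi) => n.
  by rewrite -scalemxAr mulKVmx.
have [->|v0] := eqVneq v 0; first by rewrite mulmx0 mxE.
pose x := invmx g *m v; pose v_ i := g_ i *m x.
have cv : mcvg G v_ v.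
  rewrite -[v](mulKVmx ug); apply: (mcvgM cg); exact: mcvg_cst.
have v0_ i : invmx (A_ i) *m v_ i != 0.
  apply: contra_neq v0 => /(congr1 (mulmx (A_ i))); rewrite mulKVmx // mulmx0.
  move=> /(congr1 (mulmx (invmx (g_ i)))); rewrite mulKmx // mulmx0 => x0.
  by rewrite -[v](mulKVmx ug) -/x x0 mulmx0.
have [s [w [s0 cw w0]]] := unit_limit v0_.
have supp i (l : 'I_d) : (d - k <= l)%N ->
    (invmx (h_ i) *m (s i *: (invmx (A_ i) *m v_ i))) l 0 = 0.
  move=> kl; have : v_ i \in gr_space (set_val (mflag kd (A_ i *m h_ i))).2.
    rewrite -gE; apply/mem_mflag2; rewrite gnE // => l' kl'.
    by rewrite mulKmx //; exact: vg.
  move=> /mem_mflag2; rewrite gnE // invmxM // => /(_ l kl) h0.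
  by rewrite -scalemxAr mxE mulmxA h0 mulr0.
have wh (j' : 'I_d) : (d - k <= j')%N -> (invmx h *m w) j' 0 = 0.
  by apply: (support_limit uh ch cw); apply: filterS filterT => i _; exact: supp.
have [l kl Ql] : exists2 l : 'I_d, (k <= l)%N & (invmx Q *m w) l 0 != 0.
  apply: contrapT => nQ; move/eqP: w0; apply; apply: Qh.
    apply/mem_mflag1; rewrite gnE // => l kl.
    by apply/eqP; apply: contrapT => /negP Ql; apply: nQ; exists l.
  by apply/mem_mflag2; rewrite gnE.
move: j kj; apply/(kernel_eq _ uP uU PU) => i ik.
apply/eqP; apply: contrapT => /negP Pi; move/negP: Ql; apply; apply/eqP.
have sV0 n : (s n)^-1 != 0 by rewrite invr_eq0.
apply: (gap_limit uVA gV cQ cP uQ cv cw sV0 _ ik kl Pi) => n.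
by rewrite scalerA mulVf // scale1r.
Qed.

End Attraction.
End FlagPositions.

(** * General position and leading minors *)

Section GenericPosition.
Variables (R : realType) (F : scalar_kind) (d k : nat).
Local Notation K := (scalars R F).
Hypothesis kd : (k <= d - k)%N.

Let kd' : (k <= d)%N. Proof. exact: leq_trans kd (leq_subr _ _). Qed.
Let dkd : (d - k <= d)%N. Proof. exact: leq_subr. Qed.

Definition minor n (nd : (n <= d)%N) (N : 'M[K]_d) : 'M[K]_n :=
  mxsub (widen_ord nd) (widen_ord nd) N.

Lemma minor_mul n (nd : (n <= d)%N) N (y : 'cV[K]_d) (i : 'I_n) :
  (forall j : 'I_d, (n <= j)%N -> y j 0 = 0) ->
  (N *m y) (widen_ord nd i) 0 = (minor nd N *m \col_l y (widen_ord nd l) 0) i 0.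
Proof.
move=> y0; rewrite !mxE.
under [RHS]eq_bigr => l _ do rewrite !mxE.
rewrite -(big_ord_narrow nd (F := fun l => N (widen_ord nd i) l * y l 0)).
rewrite [LHS](bigID (fun l : 'I_d => (l < n)%N)) /= [X in _ + X]big1 ?addr0 //.
by move=> l; rewrite -leqNgt => /y0 ->; rewrite mulr0.
Qed.

Lemma minor_support n (nd : (n <= d)%N) N (y : 'cV[K]_d) :
  minor nd N \in unitmx -> (forall j : 'I_d, (n <= j)%N -> y j 0 = 0) ->
  (forall i : 'I_d, (i < n)%N -> (N *m y) i 0 = 0) -> y = 0.
Proof.
move=> uN y0 Ny; pose x : 'cV[K]_n := \col_l y (widen_ord nd l) 0.
have x0 : x = 0.
  rewrite -[x](mulKmx uN); suff -> : minor nd N *m x = 0 by rewrite mulmx0.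
  by apply/matrixP => i j; rewrite ord1 -(minor_mul nd N i y0) [RHS]mxE; apply: Ny => /=; exact: ltn_ord.
apply/matrixP => i j; rewrite ord1 [RHS]mxE; have [i_n|] := ltnP i n; last exact: y0.
have := congr1 (fun z : 'cV_n => z (Ordinal i_n) 0) x0; rewrite !mxE => <-.
by congr (y _ 0); exact: val_inj.
Qed.

Lemma unit_addscalar n (N : 'M[K]_n) t :
  ~~ root (char_poly (- N)) t -> N + t%:M \in unitmx.
Proof.
move=> nr; rewrite -row_free_unit; apply: inj_row_free => v vN.
apply/eqP; apply: contraNT nr => v0; rewrite -eigenvalue_root_char.
apply/eigenvalueP; exists v => //; rewrite mulmxN; apply/eqP.
rewrite eq_sym -subr_eq0 opprK addrC; apply/eqP.
by rewrite -[RHS]vN mulmxDr mul_mx_scalar.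
Qed.

Lemma small_nonroot (p : {poly K}) N : p != 0 ->
  exists2 n, (N <= n)%N & ~~ root p n.+1%:R^-1.
Proof.
move=> p0; apply: contrapT => no.
pose s := [seq (N + i).+1%:R^-1 : K | i <- iota 0 (size p)].
have := @max_poly_roots _ p s p0; rewrite size_map size_iota ltnn => h.
suff : false by []; apply: h.
  apply/allP => _ /mapP[i _ ->]; apply: contrapT => /negP nr.
  by apply: no; exists (N + i)%N => //; exact: leq_addr.
rewrite map_inj_uniq ?iota_uniq // => i j /invr_inj /eqP.
by rewrite eqr_nat eqSS eqn_add2l => /eqP.
Qed.

(** With [h = h0 + t W^-1] one has [W h = W h0 + t], so invertibility and both transversality
    conditions fail only at roots of three characteristic polynomials. Among the values
    [1 / (n + 1)] arbitrarily small ones avoid these roots. *)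
Lemma generic_near (h0 Q : 'M[K]_d) (e : R) : Q \in unitmx -> 0 < e ->
  exists h, [/\ mn (h - h0) < e, h \in unitmx & transverse (mflag kd h) (mflag kd Q)].
Proof.
move=> uQ e0; pose W := rvm R F d *m invmx Q.
have uW : W \in unitmx by rewrite unitmx_mul rvm_unit unitmx_inv.
pose p := char_poly (- (W *m h0)) * (char_poly (- minor kd' (W *m h0)) *
   char_poly (- minor dkd (W *m h0))).
have p0 : p != 0 by rewrite !mulf_neq0 // monic_neq0 // char_poly_monic.
have [N NP] := exists_nat_ge ((mn (invmx W) + 1) / e).
have [n Nn] := small_nonroot N p0; set t := n.+1%:R^-1.
rewrite !rootM !negb_or => /and3P[r1 r2 r3].
pose h := h0 + t *: invmx W.
have WhE : W *m h = W *m h0 + t%:M by rewrite mulmxDr -scalemxAr mulmxV // scalemx1.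
have uWh : W *m h \in unitmx by rewrite WhE; exact: unit_addscalar.
have minorE j (jd : (j <= d)%N) : minor jd (W *m h) = minor jd (W *m h0) + t%:M.
  by rewrite WhE; apply/matrixP => a b; rewrite !mxE -!val_eqE.
have u1 : minor kd' (W *m h) \in unitmx by rewrite minorE; exact: unit_addscalar.
have u2 : minor dkd (W *m h) \in unitmx by rewrite minorE; exact: unit_addscalar.
have uh : h \in unitmx by move: uWh; rewrite unitmx_mul => /andP[].
have Wv (v : 'cV[K]_d) (i : 'I_d) : (W *m v) i 0 = (invmx Q *m v) (rev_ord i) 0.
  by rewrite -mulmxA mul_rvm.
exists h; split=> //.
  rewrite addrC addKr; apply: (@le_lt_trans _ _ (nrm t * mn (invmx W))).
    rewrite /mn mulr_sumr; apply: ler_sum => i _; rewrite mulr_sumr.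
    by apply: ler_sum => j _; rewrite mxE nrmM.
  rewrite /t nrmV nrm_nat mulrC ltr_pdivrMr // mulrC.
  have : (mn (invmx W) + 1) / e <= n.+1%:R.
    apply: le_trans NP _; rewrite ler_nat; exact: leq_trans (leqnSn _).
  by rewrite ler_pdivrMr // => h1; apply: lt_le_trans h1; rewrite ltrDl.
apply/(transverseP kd); split=> v.
  move=> /(mem_mflag1 kd); rewrite gnE // => v1 /(mem_mflag2 kd); rewrite gnE // => v2.
  rewrite -[v](mulKVmx uh) (_ : invmx h *m v = 0) ?mulmx0 //.
  apply: (minor_support u1) => // i ik; rewrite -mulmxA mulKVmx // Wv; apply: v2 => /=.
  exact: leq_sub2l.
move=> /(mem_mflag1 kd); rewrite gnE // => v1 /(mem_mflag2 kd); rewrite gnE // => v2.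
rewrite -[v](mulKVmx uh) (_ : invmx h *m v = 0) ?mulmx0 //.
apply: (minor_support u2) => // i ik; rewrite -mulmxA mulKVmx // Wv; apply: v1 => /=.
by rewrite leq_subRL // addSn addnC -ltn_subRL.
Qed.

(** The rows of [P] of index below [k] are equations of the [(d - k)]-space of [Q], so
    transversality becomes invertibility of one [k] by [k] block and can be made quantitative by
    bounding the inverse of this block. *)
Lemma minor_unit (P G Q : 'M[K]_d) : P \in unitmx -> G \in unitmx -> Q \in unitmx ->
  (forall i j : 'I_d, (i < k)%N -> (j < d - k)%N -> (P *m Q) i j = 0) ->
  disjoint_flags (mflag kd G) (mflag kd Q) <-> minor kd' (P *m G) \in unitmx.
Proof.
move=> uP uG uQ PQ; split=> [dis|uN v].
  rewrite -unitmx_tr -row_free_unit; apply: inj_row_free => v vN.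
  have Nv : minor kd' (P *m G) *m v^T = 0.
    by apply: trmx_inj; rewrite trmx_mul trmxK vN trmx0.
  pose y : 'cV[K]_d := \col_i (if insub (i : nat) is Some l then v 0 (l : 'I_k) else 0).
  have y0 (j : 'I_d) : (k <= j)%N -> y j 0 = 0.
    by move=> kj; rewrite mxE insubF // ltnNge kj.
  have yE : \col_l y (widen_ord kd' l) 0 = v^T.
    by apply/matrixP => l j; rewrite !mxE /= (valK l) ord1.
  have Gy0 : G *m y = 0.
    apply: dis; first by apply/(mem_mflag1 kd); rewrite gnE // mulKmx.
    apply/(mem_mflag2 kd); rewrite gnE //; apply/(kernel_eq _ uP uQ PQ) => i ik.
    have -> : i = widen_ord kd' (Ordinal ik) by exact: val_inj.
    by rewrite mulmxA minor_mul // yE Nv mxE.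
  have {}y0' : y = 0 by rewrite -[y](mulKmx uG) Gy0 mulmx0.
  by apply: trmx_inj; rewrite trmx0 -yE y0'; apply/matrixP => i j; rewrite !mxE.
move=> /(mem_mflag1 kd); rewrite gnE // => v1 /(mem_mflag2 kd); rewrite gnE // => v2.
rewrite -[v](mulKVmx uG) (_ : invmx G *m v = 0) ?mulmx0 //.
apply: (minor_support uN) => // i ik; rewrite -mulmxA mulKVmx //.
by move: i ik; apply/(kernel_eq v uP uQ PQ).
Qed.

Lemma mn_minor n (nd : (n <= d)%N) N : mn (minor nd N) <= mn N.
Proof.
have narrow (f : 'I_d -> R) : (forall i, 0 <= f i) ->
    \sum_(i < n) f (widen_ord nd i) <= \sum_i f i.
  move=> f0; rewrite -(big_ord_narrow nd (F := f)) [leRHS](bigID (fun l : 'I_d => (l < n)%N)).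
  by rewrite /= lerDl; apply: sumr_ge0.
rewrite /mn; under eq_bigr => i _ do under eq_bigr => j _ do rewrite mxE.
apply: le_trans (narrow (fun i => \sum_j nrm (N i j)) _).
  by apply: ler_sum => i _; apply: (narrow (fun j => nrm (N _ j))) => j; exact: nrm_ge0.
by move=> i; apply: sumr_ge0 => j _; exact: nrm_ge0.
Qed.

Lemma mcvg_minor n (nd : (n <= d)%N) I (G : set_system I) {PG : ProperFilter G} N_ N :
  mcvg G N_ N -> mcvg G (fun i => minor nd (N_ i)) (minor nd N).
Proof.
move=> cN e /cN; apply: filterS => i /=; apply: le_lt_trans.
have -> : minor nd (N_ i) - minor nd N = minor nd (N_ i - N).
  by apply/matrixP => a b; rewrite !mxE.
exact: mn_minor.
Qed.

End GenericPosition.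

Section DivergentGaps.
Variables (R : realType) (F : scalar_kind) (d k : nat) (Gam : groupType).
Variables (P : set (set Gam)) (M : gromov_model R P) (o : M).
Local Notation K := (scalars R F).
Local Notation len := (len o).
Hypotheses (k0 : (0 < k)%N) (kd : (k < d)%N).
Variable rho : Gam -> special_linear K d.

Lemma sigma_gt0 (A : 'M[K]_d) p : A \in unitmx -> (0 < p)%N -> (p <= d)%N ->
  0 < sigma p A.
Proof.
move=> uA p0 pd; have p1 : (p.-1 < d)%N by rewrite prednK.
have := udvd_le_sigma A p0 pd; have := udvd_gt0 uA p1.
move=> h1 h2; have := lt_le_trans h1 h2; rewrite pmulr_rgt0 //.
rewrite mulr_gt0 ?exprn_gt0 ?ltr0n ?(leq_trans p0) //.
by apply: (bnd_gt0 (leq_trans p0 pd) (udvU_bnd A)).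
Qed.

(** For each [B] the elements with a smaller gap are finitely many, since otherwise they would
    contain an injective sequence violating divergence; finitely many elements have bounded length.
    The gap is thus uniform in [len], with no sequence left. *)
Lemma divergent_gap : divergent k rho ->
  forall B : R, exists l, forall g, l <= len g ->
    B * udvd (rho g) k <= udvd (rho g) k.-1.
Proof.
move=> div B; pose A := [set g | udvd (rho g) k.-1 < B * udvd (rho g) k].
pose C := udvc R F d ^+ 2 * d%:R.
have d0 : (0 < d)%N := leq_ltn_trans (leq0n k) kd.
have C0 : 0 < C.
  rewrite mulr_gt0 ?exprn_gt0 ?ltr0n //.
  exact: (bnd_gt0 d0 (udvU_bnd (1%:M : 'M[K]_d))).
have fA : finite_set A.
  apply: contrapT => /infinite_injection[e e_inj eA].
  have /cvgryPge/(_ (C * (B * C) + 1)) := div e e_inj.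
  move=> /filter_ex[n /=]; have un := sl_unit (rho (e n)).
  have s0 := sigma_gt0 un (ltn0Sn k) kd.
  have ln : udvd (rho (e n)) k.-1 < B * udvd (rho (e n)) k := eA n.
  have B0 : 0 < B.
    rewrite ltNge; apply/negP => B0.
    have := mulr_le0_ge0 B0 (udvd_ge0 (rho (e n)) k).
    by have := udvd_ge0 (rho (e n)) k.-1; lra.
  have le1 := sigma_le_udvd (rho (e n)) k0 (ltnW kd).
  have le2 := udvd_le_sigma (rho (e n)) (ltn0Sn k) kd.
  rewrite ler_pdivlMr //; apply/negP; rewrite -ltNge.
  apply: le_lt_trans le1 _; rewrite -/C in le2 *.
  apply: (@le_lt_trans _ _ (C * (B * (C * sigma k.+1 (rho (e n)))))).
    apply: ler_wpM2l; first exact: ltW.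
    by apply: le_trans (ltW ln) _; apply: ler_wpM2l => //; exact: ltW.
  rewrite mulrDl mul1r.
  have -> : C * (B * (C * sigma k.+1 (rho (e n)))) = C * (B * C) * sigma k.+1 (rho (e n)).
    by ring.
  by rewrite ltrDl.
have [m mP] := finite_bound len fA.
exists (m + 1) => g mg; rewrite leNgt; apply/negP => Ag.
by have := mP g Ag; lra.
Qed.

Lemma far_gap_cvg I (U : set_system I) {PU : ProperFilter U} (f : I -> Gam) :
  (forall B : R, exists l, forall g, l <= len g ->
    B * udvd (rho g) k <= udvd (rho g) k.-1) ->
  (forall m : R, U [set i | m <= len (f i)]) ->
  gap_cvg k U (fun i => sl_mx (rho (f i))).
Proof.
move=> gap far e e0; have [l lP] := gap e^-1.
by apply: filterS (far l) => i /= /lP; rewrite mulrC ler_pdivrMr // mulrC.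
Qed.

End DivergentGaps.

Section AttractingFlags.
Variables (R : realType) (F : scalar_kind) (d k : nat) (Gam : groupType).
Variables (P : set (set Gam)) (M : gromov_model R P) (o : M).
Local Notation K := (scalars R F).
Local Notation a := (model_action M).
Local Notation len := (len o).
Local Notation sh := (shadow o).
Hypotheses (k0 : (0 < k)%N) (kd : (k <= d - k)%N).

Variable rho : Gam -> special_linear K d.
Hypothesis rep : representations Gam K d rho.
Hypothesis gap : forall B : R, exists l, forall g, l <= len g ->
  B * udvd (rho g) k <= udvd (rho g) k.-1.

Lemma rep_gap_cvg I (U : set_system I) (UU : UltraFilter U) (f : I -> Gam) p :
  (forall r, U [set i | sh r p (a (f i) o)]) ->
  gap_cvg k U (fun i => sl_mx (rho (f i))).
Proof.
by move=> fp; apply: (far_gap_cvg (o := o)) => // m; exact: (orbit_far_shadow _ fp).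
Qed.

Lemma rep_attract I (U : set_system I) (UU : UltraFilter U) (f : I -> Gam) p q
    (A Q h : 'M[K]_d) (h_ : I -> 'M[K]_d) :
  (forall r, U [set i | sh r p (a (f i) o)]) ->
  (forall r, U [set i | sh r q (a (f i)^-1%g o)]) ->
  mcvg U (fun i => udvU (rho (f i))) A ->
  mcvg U (fun i => udvU (rho (f i)^-1%g)) Q ->
  (forall i, h_ i \in unitmx) -> h \in unitmx -> mcvg U h_ h ->
  transverse (mflag kd h) (mflag kd Q) ->
  (fun i => mflag kd (rho (f i) *m h_ i)) @ U --> mflag kd A.
Proof.
move=> fp fq cA cQ uh_ uh ch tr.
have EV : (fun i => invmx (rho (f i))) = (fun i => sl_mx (rho (f i)^-1%g)).
  by apply/funext => i; rewrite repV.
have cQ' : mcvg U (fun i => udvU (invmx (rho (f i)))) Q.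
  by apply: mcvg_near cQ; apply: filterS filterT => i _ /=; rewrite repV.
apply: (attract k0 UU _ _ _ cA cQ' uh_ uh ch tr).
- by move=> i; exact: sl_unit.
- exact: rep_gap_cvg fp.
- by rewrite EV; exact: rep_gap_cvg fq.
Qed.

Lemma rep_udv_limit I (U : set_system I) (UU : UltraFilter U) (f : I -> Gam) q
    (V A : 'M[K]_d) (i j : 'I_d) :
  (forall r, U [set n | sh r q (a (f n)^-1%g o)]) ->
  mcvg U (fun n => udvV (rho (f n)^-1%g)) V ->
  mcvg U (fun n => udvU (rho (f n))) A ->
  (i < k)%N -> (j < d - k)%N -> (V *m A) i j = 0.
Proof.
move=> fq cV cA; apply: (udv_inv_limit kd k0 UU (B_ := fun n => sl_mx (rho (f n)))) => //.
- by move=> n; exact: sl_unit.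
- have gV : gap_cvg k U (fun n => sl_mx (rho (f n)^-1%g)) by exact: rep_gap_cvg fq.
  by move=> e /gV; apply: filterS => n /=; rewrite repV.
- by apply: mcvg_near cV; apply: filterS filterT => n _ /=; rewrite repV.
Qed.

Lemma closed_bd1 (p : gromov_boundary M) : open (~` [set p]).
Proof.
suff : bd_open (~` [set p]) by [].
move=> o' q /= qp; have [r rP] := shadow_separate (@hypd _ _ _ M) o' qp.
exists r => s [u [v [qu sv near]]] /= sp; rewrite sp in sv.
have /near2_natP[m mP] := near.
have [N [[/= U1 V2] mN]] := filter_ex (filterI (filterI (shadow_seq o' r qu)
  (shadow_seq o' r sv)) (nbhs_infty_ge m)).
by have := rP _ _ U1 V2; rewrite ltNge mP.
Qed.

End AttractingFlags.

(** * Limit flags of an extended geometrically finite representation *)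

Section LimitFlags.
Variables (R : realType) (F : scalar_kind) (d k : nat) (Gam : groupType).
Variables (P : set (set Gam)) (M : gromov_model R P) (o : M).
Local Notation K := (scalars R F).
Local Notation a := (model_action M).
Local Notation len := (len o).
Local Notation sh := (shadow o).
Local Notation delta := (hdelta M).
Hypotheses (k0 : (0 < k)%N) (kd : (k <= d - k)%N).

Let kd' : (k <= d)%N. Proof. exact: leq_trans kd (leq_subr _ _). Qed.

Variable rho : Gam -> special_linear K d.
Hypothesis rep : representations Gam K d rho.
Hypothesis gap : forall B : R, exists l, forall g, l <= len g ->
  B * udvd (rho g) k <= udvd (rho g) k.-1.

Variables (Lam : set (flags K d k)) (act : Gam -> Lam -> Lam).
Variable zeta : Lam -> bowditch_boundary M.
Hypothesis ext : flag_boundary_extension rho act zeta.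
Hypothesis trans : transverse_extension zeta.
Hypothesis dyn : extended_dynamics rho zeta.

Lemma fiber_closed p : closed (fiber zeta p).
Proof.
have [cL _ [_ [_ czeta _ _]]] := ext.
move=> y cy; have Ly : Lam y.
  by apply: cL; apply: closureS cy => _ [x _ <-]; exact: set_mem (valP x).
pose x : Lam := exist _ y (mem_set Ly).
have [xp|xp] := pselect (zeta x = p); first by exists x.
have oC : open (zeta @^-1` (~` [set p])).
  by apply: open_comp; [move=> z _; exact: czeta|exact: closed_bd1].
case: oC => Q oQ QE; have Qy : Q y.
  have : (zeta @^-1` (~` [set p])) x by [].
  by rewrite -QE.
have [_ [[x' x'p <-] Qx']] := cy Q (open_nbhs_nbhs (conj oQ Qy)).
have nx' : (zeta @^-1` (~` [set p])) x' by rewrite -QE.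
by exfalso; exact: nx' x'p.
Qed.

(** A flag over some [s] different from [q] lies in the open set [C q], but need not be transverse
    to the repelling flag [Q]; inside [C q] it can be moved to a generic [h] that is. Then
    [rep_attract] sends [h] to the flag of [A], while the extended dynamics sends it into every
    neighbourhood of the fibre over [p]. *)
Lemma limit_flag_fiber I (U : set_system I) (UU : UltraFilter U) (f : I -> Gam) p q
    (A : 'M[K]_d) :
  (forall r, U [set i | sh r p (a (f i) o)]) ->
  (forall r, U [set i | sh r q (a (f i)^-1%g o)]) ->
  mcvg U (fun i => udvU (rho (f i))) A -> fiber zeta p (mflag kd A).
Proof.
move=> fp fq cA; apply: contrapT => nA.
have [cL _ [_ [_ czeta szeta _]]] := ext.
have [C [CP CD]] := dyn.
have [s sq] : exists s, s <> q.
  have [s1 [s2 s12]] := two_points o.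
  by have [s1q|s1q] := pselect (s1 = q); [exists s2 => s2q; apply: s12; rewrite s1q|exists s1].
have [x _ xs] := szeta s Logic.I.
have [oC CL] := CP q.
have Cx : C q (set_val x).
  apply: CL; split; first exact: set_mem (valP x).
  by move=> [x' x'q /val_inj xx']; apply: sq; rewrite -xs -xx'.
have [Q cQ [uQ _ _]] : exists2 Q, mcvg U (fun i => udvU (rho (f i)^-1%g)) Q &
    bnd (udvc R F d) Q.
  by apply: mcvg_bnd_ultra; apply: filterS filterT => i _; exact: udvU_bnd.
have Cx' : C q (mflag kd (frep kd (set_val x))) by rewrite frepK.
have [e e0 eC] := mflag_continuous (frep_unit kd _) oC Cx'.
have [h [hx uh hQ]] := generic_near kd (frep kd (set_val x)) uQ e0.
have [_ Ch] := eC h hx.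
have conv : (fun i => mflag kd (rho (f i) *m h)) @ U --> mflag kd A.
  have ch : mcvg U (fun=> h) h by exact: mcvg_cst.
  exact: (rep_attract k0 rep gap UU fp fq cA cQ (fun=> uh) uh ch hQ).
have : nbhs (mflag kd A) (~` fiber zeta p).
  by apply: open_nbhs_nbhs; split=> //; rewrite openC; exact: fiber_closed.
rewrite flag_nbhsE => -[e1 /= e10 e1P].
have e20 : 0 < e1 / 2 by rewrite divr_gt0.
(* The closure of the half-radius ball still misses the fibre, so its complement is an open
   neighbourhood of the fibre to which the dynamics applies. The dynamics speaks of sequences, hence
   the selection of indices [i n] below. *)
pose W : set (flags K d k) := closure [set z | fdist kd (mflag kd A) z < e1 / 2].
have /choice[i iP] : forall n : nat, exists i, [/\ sh n%:R p (a (f i) o),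
    sh n%:R q (a (f i)^-1%g o) & fdist kd (mflag kd A) (mflag kd (rho (f i) *m h)) < e1 / 2].
  move=> n; have c : U [set i | fdist kd (mflag kd A) (mflag kd (rho (f i) *m h)) < e1 / 2].
    exact: (conv _ (fdist_ball kd (mflag kd A) e20)).
  by have [i [[i1 i2] i3]] := filter_ex (filterI (filterI (fp n%:R) (fq n%:R)) c); exists i.
have shn (g : nat -> Gam) s' : (forall n, sh n%:R s' (a (g n) o)) ->
    converges_to_boundary a g s'.
  move=> gs; apply/(conv_shadow o) => r; have [N rN] := exists_nat_ge r.
  exists N => // n /= Nn; apply: shadow_le (gs n).
  by apply: le_trans rN _; rewrite ler_nat.
have cp := shn (fun n => f (i n)) p (fun n => let: And3 h1 _ _ := iP n in h1).
have cq := shn (fun n => (f (i n))^-1%g) q (fun n => let: And3 _ h1 _ := iP n in h1).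
have oW : open (~` W) by rewrite openC; exact: closed_closure.
have fW : fiber zeta p `<=` ~` W.
  move=> y py Wy; have [z [/= Az yz]] := Wy _ (fdist_ball kd y e20).
  apply: (e1P y) py => /=; apply: le_lt_trans (fdist_triangle kd _ z _) _.
  by rewrite [e1]splitr ltrD // fdistC.
have := CD _ _ _ cp cq [set mflag kd h] (~` W) (@compact_set1 _ _).
move=> /(_ _ oW fW) near; have [|n /= nW] := filter_ex (near _).
  by move=> _ ->.
apply: (nW (flag_act (rho (f (i n))) (mflag kd h))); first by exists (mflag kd h).
apply: subset_closure => /=; rewrite mflag_act //; by have [_ _] := iP n.
Qed.

(* Along a sequence violating the bound, the limits of the attracting flags
   of alpha_n and beta_n lie over distinct points, hence are transverse. *)
Lemma uniform_transversality (r : R) : exists c N : R, forall al be,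
  N <= len al -> N <= len be ->
  gromov_product o (a al o) (a be o) <= r ->
  minor kd' (udvV (rho al^-1%g) *m udvU (rho be)) \in unitmx /\
  mn (invmx (minor kd' (udvV (rho al^-1%g) *m udvU (rho be)))) <= c.
Proof.
apply: contrapT => /forallNP no.
pose Mm (t : Gam * Gam) := udvV (rho t.1^-1%g) *m udvU (rho t.2).
have /choice[t tP] : forall n : nat, exists t : Gam * Gam, [/\ n%:R <= len t.1,
    n%:R <= len t.2, gromov_product o (a t.1 o) (a t.2 o) <= r &
    ~ (minor kd' (Mm t) \in unitmx /\ mn (invmx (minor kd' (Mm t))) <= n%:R)].
  move=> n; apply: contrapT => /forallNP nt; apply: (no n%:R); exists n%:R.
  move=> al be la lb gr; apply: contrapT => nb; exact: (nt (al, be)).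
have [U [UU sU]] := @ultraFilterLemma nat \oo _.
have bdlim (f : nat -> Gam) : (forall n, n%:R <= len (f n)) ->
    exists p, forall r, U [set i | sh r p (a (f i) o)].
  move=> fn; apply: orbit_ultra => m; apply: sU; exists m => // n /= mn'.
  by apply: le_trans (fn n); rewrite ler_nat.
have [p pP] : exists p, forall r, U [set i | sh r p (a (t i).1 o)].
  by apply: bdlim => n; have [] := tP n.
have [q qP] : exists p, forall r, U [set i | sh r p (a (t i).2 o)].
  by apply: bdlim => n; have [] := tP n.
have [p' p'P] : exists p, forall r, U [set i | sh r p (a (t i).1^-1%g o)].
  by apply: bdlim => n; rewrite lenV; have [] := tP n.
have [q' q'P] : exists p, forall r, U [set i | sh r p (a (t i).2^-1%g o)].
  by apply: bdlim => n; rewrite lenV; have [] := tP n.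
have ulim (g : nat -> 'M[K]_d) : (forall n, bnd (udvc R F d) (g n)) ->
    exists2 A, mcvg U g A & bnd (udvc R F d) A.
  by move=> bg; apply: mcvg_bnd_ultra; apply: filterS filterT => n _; exact: bg.
have [A cA [uA _ _]] := ulim (fun n => udvU (rho (t n).1)) (fun n => udvU_bnd _).
have [B cB [uB _ _]] := ulim (fun n => udvU (rho (t n).2)) (fun n => udvU_bnd _).
have [V cV [uV _ _]] := ulim (fun n => udvV (rho (t n).1^-1%g)) (fun n => udvV_bnd _).
have fA := limit_flag_fiber UU pP p'P cA.
have fB := limit_flag_fiber UU qP q'P cB.
have pq : p <> q.
  move=> pq; rewrite -pq in qP; pose s := r + delta + 1.
  have [n [/= n1 n2]] := filter_ex (filterI (pP s) (qP s)).
  have [m [m1 m2]] := filter_ex (filterI n1 n2).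
  rewrite gpC in m2; have := hyp_le (@hypd _ _ _ M) m1 m2.
  by have [_ _ + _] := tP n; rewrite /s; lra.
have /(transverseP kd)[_ BA] := trans pq fA fB.
have VA : forall i j : 'I_d, (i < k)%N -> (j < d - k)%N -> (V *m A) i j = 0.
  by move=> i j; exact: (rep_udv_limit k0 kd rep gap UU p'P cV cA).
have uVB : minor kd' (V *m B) \in unitmx.
  by have := (minor_unit kd uV uB uA VA).1 BA; set pf := (X in minor X _); rewrite (bool_irrelevance pf kd').
have cM : mcvg U (fun n => minor kd' (Mm (t n))) (minor kd' (V *m B)).
  by apply: mcvg_minor; exact: (mcvgM cV cB).
set c := 1 + mn (invmx (minor kd' (V *m B))).
have c0 : 0 < c by rewrite ltr_pwDl // mn_ge0.
have e0 : 0 < 1 / (2 * c) by rewrite divr_gt0 // mulr_gt0.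
have [N NP] := exists_nat_ge (2 * k%:R * c).
have [n [/= Mn Nn]] := filter_ex (filterI (cM _ e0) (sU _ (nbhs_infty_ge N))).
have [_ _ _] := tP n; apply.
have [||uM Mc] := unitmx_near (c := c) (B := minor kd' (Mm (t n))) uVB.
- by rewrite lerDr.
- apply: le_trans (ler_wpM2l (ltW c0) (ltW Mn)) _.
  by rewrite le_eqVlt; apply/orP; left; apply/eqP; field; rewrite gt_eqF.
split=> //; apply: le_trans Mc _; apply: le_trans NP _.
by rewrite ler_nat.
Qed.

End LimitFlags.

(** * Products along geodesics *)

(** Growth of the gap [l / mu] with the length [x] covered so far, up to the target [B]. A short
    step increases [x] by at most 1 but doubles the gap, and doubling suffices because the gap is at
    least 1. A long step has by itself a gap that survives the loss [C ^+ 2] and reaches [B]. *)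
Lemma ratio_step (R : realType) (B C x y l mu l1 mu1 : R) : 0 < C -> 0 <= B ->
  0 <= mu -> 0 <= mu1 -> mu <= l -> Num.min B x * mu <= l ->
  2 * C ^+ 2 * mu1 <= l1 -> y <= x + 1 \/ B * C ^+ 2 * mu1 <= l1 ->
  Num.min B y * (C * mu * mu1) <= l * l1 / C.
Proof.
move=> C0 B0 mu0 mu10 mul xl h2 cases; rewrite ler_pdivlMr //.
have l0 : 0 <= l := le_trans mu0 mul.
case: cases => [yx|hB].
  have h3 := ler_wpM2l l0 h2.
  have : Num.min B y * mu <= 2 * l.
    apply: (@le_trans _ _ ((Num.min B x + 1) * mu)); last by rewrite mulrDl mul1r; lra.
    apply: ler_wpM2r => //; rewrite minElt; case: ifP => By; rewrite minElt; case: ifP => Bx.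
    - lra.
    - by apply: le_trans (ltW By) _.
    - by move: By; rewrite ltNge => /negbT; rewrite negbK; lra.
    - exact: yx.
  move=> h4; have := ler_wpM2r (mulr_ge0 (sqr_ge0 C) mu10) h4; lra.
have h3 := ler_pM (mulr_ge0 (mulr_ge0 B0 (sqr_ge0 C)) mu10) mu0 hB mul.
apply: (@le_trans _ _ (B * (C * mu * mu1) * C)).
  do 2 (apply: ler_wpM2r; first by rewrite ?mulr_ge0 // ltW).
  by rewrite ge_min lexx.
apply: le_trans (le_trans _ h3) _; last by rewrite mulrC.
by rewrite le_eqVlt; apply/orP; left; apply/eqP; ring.
Qed.

Section Chains.
Variables (R : realType) (F : scalar_kind) (k m : nat) (Gam : groupType).
Variables (P : set (set Gam)) (M : gromov_model R P) (o : M).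
Local Notation K := (scalars R F).
Local Notation a := (model_action M).
Local Notation len := (len o).
Local Notation thickR := (thickR o).
Variables (rr : Gam -> 'M[K]_(k + m)).
Hypothesis rrM : forall g h, rr (g * h)%g = rr g *m rr h.
Hypothesis rr_unit : forall g, rr g \in unitmx.
Variables (E : set Gam) (S : R).
Hypothesis S0 : 0 < S.
Hypothesis EP : forall c (x y : M) t g g', geod c x y -> 0 <= t -> t + S <= mdist x y ->
  mdist (c t) (a g o) <= thickR -> mdist y (a g' o) <= thickR ->
  exists t' h, [/\ t + S <= t', t' <= mdist x y, mdist (c t') (a h o) <= thickR &
    piece P E (g^-1 * h)%g].

Variables (kap c e L cU : R).
Let C := ltgC k m kap c.
Hypotheses (kap0 : 0 <= kap) (c0 : 0 <= c) (e0 : 0 < e) (e1 : e <= 1).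
Hypothesis (ck : c * (e * kap) <= 1 / 2).
Hypotheses (L1 : 2 * C ^+ 2 <= L) (L2 : 2 * C <= L * e).

Variables (Ub Vb : Gam -> 'M[K]_(k + m)) (lb mb : Gam -> R).

Definition long_piece (h : Gam) : Prop := piece P E h /\ S - 2 * thickR <= len h.

Hypothesis Hb : forall h, long_piece h ->
  bform cU (rr h) (Ub h) (Vb h) (lb h) (mb h) /\ L * mb h <= lb h.
Hypothesis Hj : forall h1 h2, long_piece h1 -> long_piece h2 ->
  gromov_product o (a h1^-1%g o) (a h2 o) <= 3 * thickR ->
  [/\ mn (Vb h1 *m Ub h2) <= kap, ulsubmx (Vb h1 *m Ub h2) \in unitmx &
    mn (invmx (ulsubmx (Vb h1 *m Ub h2))) <= c].
Hypothesis Hg : forall B : R, exists l, forall h, long_piece h -> l <= len h ->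
  B * mb h <= lb h.

Let stp := step o E S.

Lemma step_long cc (x y : M) t g t1 g1 : geod cc x y ->
  stp cc (mdist x y) t g t1 g1 -> long_piece (g^-1 * g1)%g.
Proof.
move=> gc st; split; first by have [_ _ _ _ []] := st.
by have [] := step_len S0 gc st.
Qed.

Let C1 : 1 <= C := @ltgC_ge1 R k m kap c kap0 c0.
Let C0 : 0 < C := lt_le_trans ltr01 C1.

(** [dform_step] is iterated along the path, with [ell] a length beyond which a single step has a
    gap at least [B * C ^+ 2]. The first step [h] and the smallness of [T] are recorded because the
    expanding space at the start is later compared with that of a second chain; [c1] is independent
    of [B]. *)
Lemma chain : exists c1, forall B, 0 <= B -> exists D, forall cc (x y : M) t0 g0 g',
  geod cc x y -> 0 <= t0 -> t0 + D <= mdist x y ->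
  mdist (cc t0) (a g0 o) <= thickR -> mdist y (a g' o) <= thickR ->
  exists h s T V l mu, [/\ stp cc (mdist x y) t0 g0 s (g0 * h)%g,
    bform c1 (rr (g0^-1 * g')%g) (Ub h *m lower T) V l mu,
    mn T <= e & B * mu <= l].
Proof.
have [cf cfP] : exists cf, forall f, len f <= S + 2 * thickR -> bnd cf (rr f).
  have [cf cfP] := finite_bound (fun f => mn (rr f) + mn (invmx (rr f)))
    (len_finite o (S + 2 * thickR)).
  exists cf => f /cfP; have := mn_ge0 (rr f); have := mn_ge0 (invmx (rr f)).
  by split=> //; lra.
pose c1 := ((k + m)%:R + e) * cU.
exists (Num.max c1 (c1 * cf)) => B B0.
have [lB lBP] := Hg (Num.max 1 (B * C ^+ 2)).
pose ell := Num.max 1 (lB + 2 * thickR).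
have ell0 : 0 < ell by rewrite lt_max ltr01.
(* A length [S] guarantees a first step, at most [S] is lost at the unfinished end, and what remains
   makes [(t1 - t0) / ell] at least [B]. *)
exists (S + ell * B + S) => cc x y t0 g0 g' gc t00 t0D cg0 yg'.
have D0 : t0 + S <= mdist x y by have := mulr_ge0 (ltW ell0) B0; have := S0; lra.
have ell_piece t g t1 g1 : stp cc (mdist x y) t g t1 g1 ->
    t1 - t <= ell \/ Num.max 1 (B * C ^+ 2) * mb (g^-1 * g1)%g <= lb (g^-1 * g1)%g.
  move=> st; have [le|gt] := leP (t1 - t) ell; [by left|right].
  have lp := step_long gc st; apply: lBP => //.
  have [t'0 tt1 t1l ct [ct1 _]] := st.
  have d : mdist (cc t) (cc t1) = t1 - t by rewrite (geod_dist gc) //; have := S0; lra.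
  have := mtri (a g1 o) (a g o) (cc t1); have := mtri (a g o) (cc t) (cc t1).
  rewrite d mdist_orbit [mdist (a g1 o) (cc t1)]metric_sym.
  have : lB + 2 * thickR <= ell by rewrite le_max lexx orbT.
  lra.
pose Inv (t : R) (g : Gam) (t1 : R) (g1 : Gam) := exists h s,
  stp cc (mdist x y) t0 g0 s (g0 * h)%g /\ exists l mu,
  [/\ dform kap c e (rr (g0^-1 * g1)%g) (Ub h) (Vb (g^-1 * g1)%g) l mu, t0 <= t1, mu <= l &
    Num.min B ((t1 - t0) / ell) * mu <= l].
have L1' : 1 <= L.
  apply: le_trans L1; have := sqr_ge0 (C - 1); rewrite sqrrB1.
  by have := C1; rewrite mulr_natl; lra.
have [t [g [t1 [g1 [[h [s [st0 [l [mu [df t01 mul Bl]]]]]] st tend]]]]] :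
    exists t g t1 g1, [/\ Inv t g t1 g1, stp cc (mdist x y) t g t1 g1 & mdist x y < t1 + S].
  apply: (decomposition_ind S0 EP gc t00 D0 cg0 yg').
    move=> t g st; exists (g0^-1 * g)%g, t; rewrite mulVKg; split=> //.
    exists (lb (g0^-1 * g)%g), (mb (g0^-1 * g)%g).
    have [bf Lm] := Hb (step_long gc st).
    have [[_ _ l0 mu0] _] := bf.
    have ml : mb (g0^-1 * g)%g <= lb (g0^-1 * g)%g.
      by apply: le_trans Lm; rewrite -{1}[mb _]mul1r; exact: ler_wpM2r.
    split=> //; first exact: (dform_base kap0 c0 e0 L2 bf Lm).
      by have [_ + _ _ _] := st; have := S0; lra.
    have [le|gt] := ell_piece _ _ _ _ st.
      apply: le_trans ml; rewrite -{2}[mb _]mul1r; apply: ler_wpM2r => //.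
      by rewrite ge_min ler_pdivrMr // mul1r le orbT.
    apply: le_trans gt; apply: ler_wpM2r => //; rewrite ge_min le_max; apply/orP; left.
    apply/orP; right; rewrite -{1}[B]mulr1; apply: ler_wpM2l => //.
    by rewrite expr_ge1 // ltW.
  move=> t g t1 g1 t2 g2 [h [s [st0 [l [mu [df t01 mul Bl]]]]]] st1 st2.
  exists h, s; split=> //.
  have [lp1 lp2] := (step_long gc st1, step_long gc st2).
  have [bf Lm] := Hb lp2; have [[_ _ l10 mu10] _] := bf.
  have gp := step_gp S0 gc st1 st2.
  have [|jk ju jc] := Hj lp1 lp2; first by rewrite invgM invgK.
  have [l0 mu0 _] := df.
  exists (l * lb (g1^-1 * g2)%g / C), (C * mu * mb (g1^-1 * g2)%g).
  have L1m : 2 * C ^+ 2 * mb (g1^-1 * g2)%g <= lb (g1^-1 * g2)%g.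
    by apply: le_trans Lm; exact: ler_wpM2r.
  split.
  - have -> : (g0^-1 * g2 = (g0^-1 * g1) * (g1^-1 * g2))%g by rewrite !mulgA mulgK.
    by rewrite rrM; exact: (dform_step kap0 c0 e0 e1 ck L1 L2 df bf Lm jk ju jc).
  - by have [_ + _ _ _] := st2; have := S0; lra.
  - rewrite ler_pdivlMr //; have h1 : 0 <= 2 * C ^+ 2 * mb (g1^-1 * g2)%g.
      by rewrite !mulr_ge0 // ltW.
    apply: le_trans (ler_pM mu0 h1 mul L1m).
    have : 0 <= mu * C ^+ 2 * mb (g1^-1 * g2)%g by rewrite !mulr_ge0 // ltW.
    lra.
  apply: (ratio_step C0 B0 mu0 mu10 mul Bl L1m).
  have [le|gt] := ell_piece _ _ _ _ st2; [left|right].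
    have h1 : (t2 - t1) / ell <= 1 by rewrite ler_pdivrMr // mul1r.
    by have -> : (t2 - t0) / ell = (t2 - t1) / ell + (t1 - t0) / ell; [ring|lra].
  by apply: le_trans gt; apply: ler_wpM2r => //; rewrite le_max lexx orbT.
have lp0 : long_piece h.
  by have := step_long gc st0; rewrite mulKg.
have lp1 := step_long gc st.
have [[[bU _ _ _] _] _] := Hb lp0; have [[[_ bV _ _] _] _] := Hb lp1.
have [T [T' [Te T'e bf]]] := dform_bform kap0 c0 bU bV df.
have ff : bnd cf (rr (g1^-1 * g')%g).
  have [t'0 tt1 t1l ct [ct1 _]] := st; have [_ cl _] := gc.
  apply: cfP; apply: le_trans (len_near ct1 yg') _; rewrite lerD2r.
  rewrite -{1}cl (geod_dist gc) //; have := S0; lra.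
(* The end of the geodesic beyond the last step has length below [S]; its matrix is bounded by [cf]
   and is absorbed into [V]. *)
exists h, s, T, (upper T' *m Vb (g^-1 * g1)%g *m rr (g1^-1 * g')%g), l, mu; split=> //.
  have -> : (g0^-1 * g' = (g0^-1 * g1) * (g1^-1 * g'))%g by rewrite !mulgA mulgK.
  have [[b1 b2 l0 mu0] [Y [Z [AE uY Yl Zm]]]] := bf.
  rewrite rrM; split; first split=> //.
  - by apply: bnd_le b1; rewrite le_max lexx.
  - by apply: (@bnd_le _ _ _ (c1 * cf)); [rewrite le_max lexx orbT|exact: bnd_mul].
  by exists Y, Z; split=> //; rewrite AE -!mulmxA.
apply: le_trans Bl; apply: ler_wpM2r; first by have [] := df.
by rewrite le_min lexx /= ler_pdivlMr //; have := S0; lra.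
Qed.

End Chains.

(** * Passing from chain decompositions to the canonical one *)

Section ComparedDecompositions.
Variables (R : realType) (F : scalar_kind) (k m : nat).
Local Notation K := (scalars R F).
Hypotheses (k0 : (0 < k)%N) (m0 : (0 < m)%N).

Lemma bform_le c c' (A U V : 'M[K]_(k + m)) l mu :
  c <= c' -> bform c A U V l mu -> bform c' A U V l mu.
Proof. by move=> cc' [[bU bV l0 mu0] H]; split=> //; split=> //; exact: bnd_le cc' _. Qed.

Lemma bform_mul c ca cb (A U V x y : 'M[K]_(k + m)) l mu :
  bform c A U V l mu -> bnd ca x -> bnd cb y ->
  bform (Num.max (ca * c) (c * cb)) (x *m A *m y) (x *m U) (V *m y) l mu.
Proof.
move=> [[bU bV l0 mu0] [Y [Z [-> uY Yl Zm]]]] bx bY; split; first split=> //.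
- by apply: (@bnd_le _ _ _ (ca * c)); [rewrite le_max lexx|exact: bnd_mul].
- by apply: (@bnd_le _ _ _ (c * cb)); [rewrite le_max lexx orbT|exact: bnd_mul].
by exists Y, Z; split=> //; rewrite !mulmxA.
Qed.

Lemma bform_tr c (A U V : 'M[K]_(k + m)) l mu :
  bform c A U V l mu -> bform c A^T V^T U^T l mu.
Proof.
move=> [[bU bV l0 mu0] [Y [Z [-> uY Yl Zm]]]]; split.
  by split=> //; exact: bnd_tr.
exists Y^T, Z^T; split; rewrite ?unitmx_tr -?trmx_inv ?mn_tr //.
by rewrite !trmx_mul bdiag_tr mulmxA.
Qed.

Let X c : R := udvc R F (k + m) ^+ 2 * (k + m)%:R * (c ^+ 2 * (k + m)%:R).

Lemma bform_X_gt0 c (A U V : 'M[K]_(k + m)) l mu : bform c A U V l mu -> 0 < X c.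
Proof.
move=> [[bU _ _ _] _]; have km0 : (0 < k + m)%N by rewrite addn_gt0 k0.
have c0 := bnd_gt0 km0 bU; have u0 := bnd_gt0 km0 (udvU_bnd (1%:M : 'M[K]_(k + m))).
by rewrite !mulr_gt0 ?exprn_gt0 ?ltr0n.
Qed.

Lemma bform_udvd c (A U V : 'M[K]_(k + m)) l mu : bform c A U V l mu ->
  l <= X c * udvd A k.-1 /\ udvd A k <= X c * mu.
Proof.
move=> bf; have km0 : (0 < k + m)%N by rewrite addn_gt0 k0.
have kd : (k <= k + m)%N := leq_addr m k.
have kd1 : (k.+1 <= k + m)%N by rewrite -addn1 leq_add2l.
have [[bU _ _ _] _] := bf; have c0 := bnd_gt0 km0 bU.
have u0 := bnd_gt0 km0 (udvU_bnd (1%:M : 'M[K]_(k + m))).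
have x1 : 0 <= c ^+ 2 * (k + m)%:R by rewrite mulr_ge0 // sqr_ge0.
have x2 : 0 <= udvc R F (k + m) ^+ 2 * (k + m)%:R by rewrite mulr_ge0 // sqr_ge0.
split.
  apply: le_trans (bform_sigma_ge k0 bf) _.
  apply: le_trans (ler_wpM2l x1 (sigma_le_udvd A k0 kd)) _.
  by rewrite /X le_eqVlt; apply/orP; left; apply/eqP; ring.
apply: le_trans (udvd_le_sigma A (ltn0Sn k) kd1) _.
apply: le_trans (ler_wpM2l x2 (bform_sigma_le m0 bf)) _.
by rewrite /X le_eqVlt; apply/orP; left; apply/eqP; ring.
Qed.

Lemma bform_gap c B (A U V : 'M[K]_(k + m)) l mu : bform c A U V l mu -> 0 <= B ->
  B * X c ^+ 2 * mu <= l -> B * udvd A k <= udvd A k.-1.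
Proof.
move=> bf B0 Bl; have [h1 h2] := bform_udvd bf; have X0 := bform_X_gt0 bf.
rewrite -(ler_pM2l X0); apply: le_trans h1; apply: le_trans Bl.
have := ler_wpM2l (mulr_ge0 B0 (ltW X0)) h2.
have -> : B * X c * udvd A k = X c * (B * udvd A k) by ring.
by have -> : B * X c * (X c * mu) = B * X c ^+ 2 * mu by ring.
Qed.

Lemma mcvg_unit_near n I (G : set_system I) {PG : ProperFilter G} (A_ : I -> 'M[K]_n) A :
  A \in unitmx -> mcvg G A_ A ->
  G [set i | A_ i \in unitmx /\ mn (invmx (A_ i)) <= 2 * n%:R * (1 + mn (invmx A))].
Proof.
move=> uA cA; set c := 1 + mn (invmx A).
have c0 : 0 < c by rewrite ltr_pwDl // mn_ge0.
have e0 : 0 < 1 / (2 * c) by rewrite divr_gt0 // mulr_gt0.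
apply: filterS (cA _ e0) => i /= Ai; apply: (unitmx_near uA); first by rewrite lerDr.
apply: le_trans (ler_wpM2l (ltW c0) (ltW Ai)) _.
by rewrite le_eqVlt; apply/orP; left; apply/eqP; field; rewrite gt_eqF.
Qed.

(** By compactness a failure for all [eta] would have a limit in which [N1] is block lower and [N2]
    block upper triangular. There the corner of the product is the product of the three corners, all
    invertible, and invertibility with a bound persists nearby. *)
Lemma block_product_unit c : exists eta c' : R, 0 < eta /\
  forall N1 W N2 : 'M[K]_(k + m), bnd c N1 -> bnd c N2 -> mn W <= c ->
    ulsubmx W \in unitmx -> mn (invmx (ulsubmx W)) <= c ->
    mn (ursubmx N1) <= eta -> mn (dlsubmx N2) <= eta ->
    ulsubmx (N1 *m W *m N2) \in unitmx /\ mn (invmx (ulsubmx (N1 *m W *m N2))) <= c'.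
Proof.
apply: contrapT => no.
have /choice[t tP] : forall n : nat, exists t : 'M[K]_(k + m) * 'M[K]_(k + m) * 'M[K]_(k + m),
    [/\ bnd c t.1.1, bnd c t.2, mn t.1.2 <= c &
    [/\ ulsubmx t.1.2 \in unitmx /\ mn (invmx (ulsubmx t.1.2)) <= c,
      mn (ursubmx t.1.1) <= n.+1%:R^-1, mn (dlsubmx t.2) <= n.+1%:R^-1 &
      ~ (ulsubmx (t.1.1 *m t.1.2 *m t.2) \in unitmx /\
        mn (invmx (ulsubmx (t.1.1 *m t.1.2 *m t.2))) <= n%:R)]].
  move=> n; apply: contrapT => /forallNP nt; apply: no; exists n.+1%:R^-1, n%:R.
  split; first by rewrite invr_gt0.
  move=> N1 W N2 b1 b2 Wc uW VW h1 h2; apply: contrapT => nb.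
  by apply: (nt (N1, W, N2)).
have [U [UU sU]] := @ultraFilterLemma nat \oo _.
have [N1 c1 [u1 _ _]] : exists2 A, mcvg U (fun n => (t n).1.1) A & bnd c A.
  by apply: mcvg_bnd_ultra; apply: filterS filterT => n _; have [] := tP n.
have [N2 c2 [u2 _ _]] : exists2 A, mcvg U (fun n => (t n).2) A & bnd c A.
  by apply: mcvg_bnd_ultra; apply: filterS filterT => n _; have [] := tP n.
have [W cW] : exists A, mcvg U (fun n => (t n).1.2) A.
  by apply: (mcvg_ultra UU (c := c)); apply: filterS filterT => n _; have [] := tP n.
have small p q (f : nat -> 'M[K]_(p, q)) A : (forall n, mn (f n) <= n.+1%:R^-1) ->
    mcvg U f A -> A = 0.
  move=> fn cf; apply/matrixP => i j; rewrite [RHS]mxE; apply: (mcvg_entry0 cf) => e e0.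
  have [N eN] := exists_nat_ge e^-1; apply: sU; exists N => // n /= Nn.
  apply: le_lt_trans (mn_entry _ _ _) _; apply: le_lt_trans (fn n) _.
  rewrite invf_plt ?posrE //; apply: le_lt_trans eN _.
  by rewrite ltr_nat ltnS.
have r1 : ursubmx N1 = 0.
  by apply: small (mcvg_ursub c1) => n; have [_ _ _ []] := tP n.
have l2 : dlsubmx N2 = 0.
  by apply: small (mcvg_dlsub c2) => n; have [_ _ _ []] := tP n.
have [uW _] : ulsubmx W \in unitmx /\ mn (invmx (ulsubmx W)) <= c.
  by apply: mcvg_inv_le (mcvg_ulsub cW); apply: filterS filterT => n _; have [_ _ _ []] := tP n.
have E : ulsubmx (N1 *m W *m N2) = ulsubmx N1 *m ulsubmx W *m ulsubmx N2.
  rewrite -[N1 in LHS]submxK -[W in LHS]submxK -[N2 in LHS]submxK r1 l2 !mulmx_block block_mxKul.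
  by rewrite !mul0mx mulmx0 !addr0.
have v1 : ulsubmx N1 \in unitmx.
  move: u1; rewrite -{1}(submxK N1) r1 unitmxE det_lblock unitrM => /andP[+ _].
  by rewrite unitmxE.
have v2 : ulsubmx N2 \in unitmx.
  move: u2; rewrite -{1}(submxK N2) l2 unitmxE det_ublock unitrM => /andP[+ _].
  by rewrite unitmxE.
have uL : ulsubmx (N1 *m W *m N2) \in unitmx by rewrite E !unitmx_mul v1 uW.
have cL : mcvg U (fun n => ulsubmx ((t n).1.1 *m (t n).1.2 *m (t n).2)) (ulsubmx (N1 *m W *m N2)).
  by apply: mcvg_ulsub; exact: (mcvgM (mcvgM c1 cW) c2).
have nearL : U [set n | ulsubmx ((t n).1.1 *m (t n).1.2 *m (t n).2) \in unitmx /\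
    mn (invmx (ulsubmx ((t n).1.1 *m (t n).1.2 *m (t n).2))) <=
    2 * k%:R * (1 + mn (invmx (ulsubmx (N1 *m W *m N2))))].
  by apply: mcvg_unit_near uL cL.
have [N NP] := exists_nat_ge (2 * k%:R * (1 + mn (invmx (ulsubmx (N1 *m W *m N2))))).
have [n [/= [ut tc] Nn]] := filter_ex (filterI nearL (sU _ (nbhs_infty_ge N))).
have [_ _ _ [_ _ _]] := tP n; apply; split=> //.
by apply: le_trans tc _; apply: le_trans NP _; rewrite ler_nat.
Qed.

(** By [bform_unique], a large gap makes the changes from the given [V], [U'] to the canonical ones
    nearly block triangular, on the sides required by [block_product_unit]; [B] is the gap at which
    the off-diagonal blocks fall below [eta]. *)
Lemma udv_transverse c : exists B c' : R, 0 <= B /\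
  forall (A A' U V U' V' : 'M[K]_(k + m)) l mu l' mu',
    A \in unitmx -> A' \in unitmx ->
    bform c A U V l mu -> bform c A' U' V' l' mu' -> B * mu <= l -> B * mu' <= l' ->
    ulsubmx (V *m U') \in unitmx -> mn (invmx (ulsubmx (V *m U'))) <= c ->
    ulsubmx (udvV A *m udvU A') \in unitmx /\
    mn (invmx (ulsubmx (udvV A *m udvU A'))) <= c'.
Proof.
set u := udvc R F (k + m).
have km0 : (0 < k + m)%N by rewrite addn_gt0 k0.
have u0 : 0 < u := bnd_gt0 km0 (udvU_bnd (1%:M : 'M[K]_(k + m))).
pose c2 := Num.max c (Num.max (c * c) (u * c)).
have [eta [c' [eta0 H]]] := block_product_unit c2.
have [cpos|cneg] := ltP 0 c; last first.
  exists 0, 0; split=> // A A' U V U' V' l mu l' mu' _ _ [[bU _ _ _] _].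
  by have := bnd_gt0 km0 bU; rewrite ltNge cneg.
have X0 : 0 < X c by rewrite !mulr_gt0 ?exprn_gt0 ?ltr0n.
pose Q := (k%:R + m%:R) * (c * u) * X c.
have kR : 0 < k%:R :> R by rewrite ltr0n.
have mR : 0 < m%:R :> R by rewrite ltr0n.
have Q0 : 0 < Q by apply: mulr_gt0 => //; apply: mulr_gt0; [exact: addr_gt0|exact: mulr_gt0].
exists (Q / eta), c'; split; first by rewrite ltW // divr_gt0.
move=> A A' U V U' V' l mu l' mu' uA uA' bf bf' Bl Bl' uW VW.
have [[bU bV l0 mu0] _] := bf; have [[bU' bV' l'0 mu'0] _] := bf'.
have dA := udv_bform k0 uA; have dA' := udv_bform k0 uA'.
have [g1 g2] := bform_udvd bf; have [g1' g2'] := bform_udvd bf'.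
have [_ n1] := bform_unique dA bf; have [n2 _] := bform_unique bf' dA'.
have etaE (x y z : R) : 0 < x -> 0 <= y -> x <= X c * z -> 0 < z -> Q / eta * y <= x ->
    (z / k%:R)^-1 * (u * c) * y <= eta /\ y * (c * u) * (z / k%:R)^-1 <= eta.
  move=> x0 y0 xz z0 h.
  have h' : Q * y <= eta * (X c * z).
    apply: le_trans (ler_wpM2l (ltW eta0) xz); rewrite mulrC -ler_pdivrMl //.
    by apply: le_trans h; rewrite le_eqVlt; apply/orP; left; apply/eqP; ring.
  have h3 : k%:R * (c * u) * y <= eta * z.
    rewrite -(ler_pM2l X0); apply: le_trans (le_trans _ h') _; last first.
      by rewrite le_eqVlt; apply/orP; left; apply/eqP; ring.
    rewrite /Q.
    have -> : X c * (k%:R * (c * u) * y) = k%:R * (c * u) * X c * y by ring.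
    apply: ler_wpM2r => //; apply: ler_wpM2r; first exact: ltW.
    by apply: ler_wpM2r; rewrite ?lerDl // mulr_ge0 // ltW.
  have e1 : (z / k%:R)^-1 * (u * c) * y = k%:R * (c * u) * y / z.
    by field; rewrite !gt_eqF.
  have e2 : y * (c * u) * (z / k%:R)^-1 = k%:R * (c * u) * y / z.
    by field; rewrite !gt_eqF.
  by rewrite e1 e2 ler_pdivrMr.
have zpos B : B \in unitmx -> 0 < udvd (B : 'M[K]_(k + m)) k.-1.
  by move=> uB; apply: udvd_gt0 => //; rewrite prednK // leq_addr.
have [n1' _] := etaE _ _ _ l0 mu0 g1 (zpos _ uA) Bl.
have [_ n2'] := etaE _ _ _ l'0 mu'0 g1' (zpos _ uA') Bl'.
have uUA' := udvU_bnd A'; have uVA := udvV_bnd A.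
have [uVV _ _] := bV; have [uUU _ _] := bU'.
have -> : udvV A *m udvU A' =
    (udvV A *m invmx V) *m (V *m U') *m (invmx U' *m udvU A').
  by rewrite !mulmxA mulmxKV // -!mulmxA mulKVmx.
have le1 : u * c <= c2 by rewrite !le_max lexx !orbT.
have le2 : c * c <= c2 by rewrite !le_max lexx !orbT.
have le3 : c <= c2 by rewrite !le_max lexx.
apply: H => //.
- by apply: bnd_le le1 _; apply: bnd_mul => //; exact: bnd_inv.
- by apply: bnd_le le1 _; rewrite mulrC; apply: bnd_mul => //; exact: bnd_inv.
- by apply: le_trans le2; apply: mnM_le; [case: bV|case: bU'].
- exact: le_trans le3.
- exact: le_trans n1'.
- exact: le_trans n2'.
Qed.

(** The junction of two chains that start at one point, corrected by the [T] of each of them. The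
    corner changes by three terms, each of size at most [e * kap], whence the factor 3. *)
Lemma middle_block c e kap (W : 'M[K]_(k + m)) (T : 'M[K]_(m, k)) (T' : 'M[K]_(k, m)) :
  0 <= c -> 0 <= e -> e <= 1 -> mn W <= kap -> ulsubmx W \in unitmx ->
  mn (invmx (ulsubmx W)) <= c -> mn T <= e -> mn T' <= e -> c * (3 * e * kap) <= 1 / 2 ->
  ulsubmx (upper T' *m W *m lower T) \in unitmx /\
  mn (invmx (ulsubmx (upper T' *m W *m lower T))) <= 2 * k%:R * c.
Proof.
move=> c0 e0 e1 Wk uW VW Te T'e h; apply: (unitmx_near uW VW).
apply: le_trans h; apply: ler_wpM2l => //.
have -> : ulsubmx (upper T' *m W *m lower T) - ulsubmx W =
    T' *m dlsubmx W + (ursubmx W *m T + T' *m drsubmx W *m T).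
  have -> : ulsubmx (upper T' *m W *m lower T) = ulsubmx W + T' *m dlsubmx W +
      (ursubmx W + T' *m drsubmx W) *m T.
    rewrite -[W in LHS]submxK /upper /lower !mulmx_block block_mxKul.
    by rewrite !mul1mx !mulmx1.
  by rewrite mulmxDl -[_ + _ + (_ + _)]addrA [ulsubmx W + _]addrC addrK.
have kap0 : 0 <= kap := le_trans (mn_ge0 _) Wk.
have h1 : mn (T' *m dlsubmx W) <= e * kap.
  by apply: mnM_le => //; exact: le_trans (mn_dlsub _) _.
have h2 : mn (ursubmx W *m T) <= kap * e.
  by apply: mnM_le => //; exact: le_trans (mn_ursub _) _.
have h3 : mn (T' *m drsubmx W *m T) <= e * kap * e.
  by apply: mnM_le => //; apply: mnM_le => //; exact: le_trans (mn_drsub _) _.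
have h4 : e * kap * e <= e * kap.
  by rewrite -{2}[e * kap]mulr1; apply: ler_wpM2l => //; rewrite mulr_ge0.
apply: le_trans (ler_mnD _ _) _.
have := ler_mnD (ursubmx W *m T) (T' *m drsubmx W *m T); lra.
Qed.

End ComparedDecompositions.

Section SymmetricPieces.
Variables (R : realType) (Gam : groupType) (P : set (set Gam)).
Variables (M : gromov_model R P) (o : M).
Local Notation a := (model_action M).
Local Notation thickR := (thickR o).

Lemma subgroupV (H : set Gam) x : is_subgroup H -> H x -> H x^-1%g.
Proof. by move=> [H1 HM] Hx; have := HM _ _ H1 Hx; rewrite mul1g. Qed.

(** Closing [E] under inverses makes the pieces of a reversed geodesic inverses of pieces, as needed
    for the backward chain. *)
Lemma next_point_sym (rel : relatively_hyperbolic R P) S : 0 < S ->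
  exists E : set Gam, [/\ finite_set E, forall h, piece P E h -> piece P E h^-1%g &
  forall c (x y : M) t g g', geod c x y -> 0 <= t -> t + S <= mdist x y ->
  mdist (c t) (a g o) <= thickR -> mdist y (a g' o) <= thickR ->
  exists t' h, [/\ t + S <= t', t' <= mdist x y, mdist (c t') (a h o) <= thickR &
    piece P E (g^-1 * h)%g]].
Proof.
move=> S0; have [E0 fE0 E0P] := next_point o rel S0.
exists (E0 `|` [set x^-1%g | x in E0]); split.
- by rewrite finite_setU; split=> //; exact: finite_image.
- have sym x : (E0 `|` [set x^-1%g | x in E0]) x -> (E0 `|` [set x^-1%g | x in E0]) x^-1%g.
    by move=> [Ex|[y Ey <-]]; [right; exists x|left; rewrite invgK].
  move=> _ [f [x [f' [Ef Ef' xQ ->]]]]; exists f'^-1%g, x^-1%g, f^-1%g.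
  split; [exact: sym|exact: sym| |by rewrite !invgM !mulgA].
  case: xQ => [->|[Q PQ Qx]]; [by left; rewrite invg1|right; exists Q => //].
  by have [_ _ subP _] := rel; have [sQ _ _] := subP Q PQ; exact: subgroupV.
move=> c x y t g g' gc t0 tS cg yg'.
have [t' [h [h1 h2 h3 [f [z [f' [Ef Ef' zQ E']]]]]]] := E0P c x y t g g' gc t0 tS cg yg'.
exists t', h; split=> //; exists f, z, f'; split=> //; by left.
Qed.

Lemma step_rev E S c (x y : M) t g t' h :
  (forall h, piece P E h -> piece P E h^-1%g) -> geod c x y ->
  step o E S (fun s => c (mdist x y - s)) (mdist y x) t g t' h ->
  step o E S c (mdist x y) (mdist x y - t') h (mdist x y - t) g.
Proof.
move=> sym gc; rewrite [mdist y x]metric_sym => -[t0 tS t'l cg [ch pc]]; split=> //.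
- by rewrite subr_ge0.
- by move: tS; rewrite addrC; lra.
- by rewrite gerBl.
- by split=> //; have := sym _ pc; rewrite invgM invgK.
Qed.

End SymmetricPieces.

(** * Chains for a perturbed representation *)

Section Perturbed.
Variables (R : realType) (F : scalar_kind) (k m : nat) (Gam : groupType).
Variables (P : set (set Gam)) (M : gromov_model R P) (o : M).
Local Notation K := (scalars R F).
Local Notation a := (model_action M).
Local Notation len := (len o).
Local Notation thickR := (thickR o).
Local Notation sh := (shadow o).
Hypothesis rel : relatively_hyperbolic R P.
Hypotheses (k0 : (0 < k)%N) (m0 : (0 < m)%N).

Variables rho0 rho : Gam -> special_linear K (k + m).
Hypotheses (rep : representations Gam K (k + m) rho).
Hypothesis gap0 : forall B : R, exists l, forall g, l <= len g ->
  B * udvd (rho0 g) k <= udvd (rho0 g) k.-1.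

Variables (E : set Gam) (S : R).
Hypothesis S0 : 0 < S.
Hypothesis Esym : forall h, piece P E h -> piece P E h^-1%g.
Hypothesis EP : forall c (x y : M) t g g', geod c x y -> 0 <= t -> t + S <= mdist x y ->
  mdist (c t) (a g o) <= thickR -> mdist y (a g' o) <= thickR ->
  exists t' h, [/\ t + S <= t', t' <= mdist x y, mdist (c t') (a h o) <= thickR &
    piece P E (g^-1 * h)%g].

Variables (cT N0 eps e L : R).
(** [ca] bounds matrices within one half of the identity and their inverses ([bnd_near1]), [cU] the
    outer factors of perturbed steps, [kap] their junctions, and [cJ] the inverse of a junction
    corner after perturbing the bound [cT] valid for [rho0]. *)
Let ca : R := 2 * (k + m)%:R + 1.
Let u := udvc R F (k + m).
Let cU := ca * u.
Let kap := cU * cU.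
Let cJ := 2 * k%:R * cT.
Let C := ltgC k m kap cJ.
Hypotheses (cT0 : 0 <= cT) (e0 : 0 < e) (e1 : e <= 1).
Hypothesis ek : cJ * (3 * e * kap) <= 1 / 2.
Hypotheses (L1 : 2 * C ^+ 2 <= L) (L2 : 2 * C <= L * e).
Hypotheses (eps2 : eps <= 1 / 2) (epsT : cT * (u * ((ca + 1) * eps) * u) <= 1 / 2).
Hypothesis T0 : forall al be, N0 <= len al -> N0 <= len be ->
  gromov_product o (a al o) (a be o) <= 3 * thickR ->
  ulsubmx (udvV (rho0 al^-1%g) *m udvU (rho0 be)) \in unitmx /\
  mn (invmx (ulsubmx (udvV (rho0 al^-1%g) *m udvU (rho0 be)))) <= cT.

Let lf h := udvd (rho0 h) k.-1 / k%:R.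
Let mf h := m%:R * udvd (rho0 h) k.
Hypothesis Slong : forall h, S - 2 * thickR <= len h -> N0 <= len h /\ L * mf h <= lf h.

Variables pa pb : Gam -> 'M[K]_(k + m).
Hypothesis Hab : forall h, piece P E h -> [/\ mn (pa h - 1%:M) <= eps,
  mn (pb h - 1%:M) <= eps & sl_mx (rho h) = pa h *m rho0 h *m pb h].

(** The perturbation is put entirely into the outer factors; the diagonal part, hence the gap of a
    step, is exactly that of [rho0]. *)
Let Uf h := pa h *m udvU (rho0 h).
Let Vf h := udvV (rho0 h) *m pb h.
Let long := long_piece o E S.

Let km0 : (0 < k + m)%N. Proof. by rewrite addn_gt0 k0. Qed.
Let u0 : 0 < u. Proof. exact: bnd_gt0 km0 (udvU_bnd (1%:M : 'M[K]_(k + m))). Qed.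
Let ca1 : 1 <= ca. Proof. by rewrite lerDr mulr_ge0. Qed.
Let cU0 : 0 < cU. Proof. by rewrite mulr_gt0 //; exact: lt_le_trans ltr01 ca1. Qed.
Let kap0 : 0 <= kap. Proof. by rewrite mulr_ge0 // ltW. Qed.
Let cJ0 : 0 <= cJ. Proof. by rewrite !mulr_ge0. Qed.
Let ck : cJ * (e * kap) <= 1 / 2.
Proof.
apply: le_trans ek; apply: ler_wpM2l => //; apply: ler_wpM2r => //.
by have := e0; lra.
Qed.

Lemma bnd_near1 (x : 'M[K]_(k + m)) : mn (x - 1%:M) <= eps -> bnd ca x.
Proof.
move=> xe; have xh : mn (x - 1%:M) <= 1 / 2 := le_trans xe eps2.
have [ux Vx] := unitmx_near1 xh; rewrite addrC subrK in ux Vx.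
split=> //; last by apply: le_trans Vx _; rewrite lerDl.
rewrite -[x](subrK 1%:M); apply: le_trans (ler_mnD _ _) _; rewrite mn1 /ca.
have : 0 <= (k + m)%:R :> R by [].
by have := xh; lra.
Qed.

Lemma long_inv h : long h -> long h^-1%g.
Proof. by move=> [pc hl]; split; [exact: Esym|rewrite lenV]. Qed.

Lemma forward_bform h : long h ->
  bform cU (rho h) (Uf h) (Vf h) (lf h) (mf h) /\ L * mf h <= lf h.
Proof.
move=> [pc hl]; have [ae be ->] := Hab pc; split; last by have [] := Slong hl.
have := bform_mul (udv_bform k0 (sl_unit (rho0 h))) (bnd_near1 ae) (bnd_near1 be).
apply: bform_le; rewrite ge_max lexx /= /cU /u mulrC; exact: lexx.
Qed.

(** The junction differs from that of [rho0] by [V (b a - 1) U], with [a] and [b] near the identity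
    uniformly in the steps; [epsT] keeps this below the radius on which the corner stays
    invertible. *)
Lemma forward_junction h1 h2 : long h1 -> long h2 ->
  gromov_product o (a h1^-1%g o) (a h2 o) <= 3 * thickR ->
  [/\ mn (Vf h1 *m Uf h2) <= kap, ulsubmx (Vf h1 *m Uf h2) \in unitmx &
    mn (invmx (ulsubmx (Vf h1 *m Uf h2))) <= cJ].
Proof.
move=> l1 l2 gp.
have [[[_ bV _ _] _] _] := forward_bform l1; have [[[bU _ _ _] _] _] := forward_bform l2.
have [N1 _] := Slong l1.2; have [N2 _] := Slong l2.2.
have [uW VW] : ulsubmx (udvV (rho0 h1) *m udvU (rho0 h2)) \in unitmx /\
    mn (invmx (ulsubmx (udvV (rho0 h1) *m udvU (rho0 h2)))) <= cT.
  by have := T0 (al := h1^-1%g) _ N2 gp; rewrite lenV invgK; exact.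
have [ub Vb] : ulsubmx (Vf h1 *m Uf h2) \in unitmx /\
    mn (invmx (ulsubmx (Vf h1 *m Uf h2))) <= cJ.
  apply: (unitmx_near uW VW); apply: le_trans epsT; apply: ler_wpM2l => //.
  have -> : ulsubmx (Vf h1 *m Uf h2) - ulsubmx (udvV (rho0 h1) *m udvU (rho0 h2)) =
      ulsubmx (udvV (rho0 h1) *m (pb h1 *m pa h2 - 1%:M) *m udvU (rho0 h2)).
    have -> : udvV (rho0 h1) *m (pb h1 *m pa h2 - 1%:M) *m udvU (rho0 h2) =
        Vf h1 *m Uf h2 - udvV (rho0 h1) *m udvU (rho0 h2).
      by rewrite mulmxBr mulmx1 mulmxBl /Vf /Uf !mulmxA.
    by apply/matrixP => i j; rewrite !mxE.
  apply: le_trans (mn_ulsub _) _; have [_ Vu _] := udvV_bnd (rho0 h1).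
  have [_ Uu _] := udvU_bnd (rho0 h2); apply: mnM_le => //; apply: mnM_le => //.
  have [_ b1 _] := Hab l1.1; have [a2 _ _] := Hab l2.1.
  have -> : pb h1 *m pa h2 - 1%:M = pb h1 *m (pa h2 - 1%:M) + (pb h1 - 1%:M).
    by rewrite mulmxBr mulmx1 addrA subrK.
  apply: le_trans (ler_mnD _ _) _; rewrite mulrDl mul1r; apply: lerD => //.
  by apply: mnM_le => //; have [] := bnd_near1 b1.
by split=> //; apply: mnM_le; [case: bV|case: bU].
Qed.

Lemma forward_growth (B : R) : exists l, forall h, long h -> l <= len h -> B * mf h <= lf h.
Proof.
have [l lP] := gap0 (B * m%:R * k%:R); exists l => h _ /lP hl.
rewrite /lf ler_pdivlMr ?ltr0n //; apply: le_trans hl.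
by rewrite le_eqVlt; apply/orP; left; apply/eqP; rewrite /mf; ring.
Qed.

(* Transposing the inverses turns a chain read along the reversed geodesic into
   a chain again. *)
Let rb g := (sl_mx (rho g^-1%g))^T.

Lemma backwardM g h : rb (g * h)%g = rb g *m rb h.
Proof. by rewrite /rb invgM repM // trmx_mul. Qed.

Lemma backward_bform h : long h ->
  bform cU (rb h) (Vf h^-1%g)^T (Uf h^-1%g)^T (lf h^-1%g) (mf h^-1%g) /\
  L * mf h^-1%g <= lf h^-1%g.
Proof. by move=> /long_inv /forward_bform[bf Lm]; split=> //; exact: bform_tr. Qed.

Lemma backward_junction h1 h2 : long h1 -> long h2 ->
  gromov_product o (a h1^-1%g o) (a h2 o) <= 3 * thickR ->
  [/\ mn ((Uf h1^-1%g)^T *m (Vf h2^-1%g)^T) <= kap,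
    ulsubmx ((Uf h1^-1%g)^T *m (Vf h2^-1%g)^T) \in unitmx &
    mn (invmx (ulsubmx ((Uf h1^-1%g)^T *m (Vf h2^-1%g)^T))) <= cJ].
Proof.
move=> l1 l2 gp; rewrite -trmx_mul -trmx_ulsub -trmx_inv !mn_tr unitmx_tr.
by apply: forward_junction; rewrite ?invgK 1?gpC //; exact: long_inv.
Qed.

Lemma backward_growth (B : R) : exists l, forall h, long h -> l <= len h ->
  B * mf h^-1%g <= lf h^-1%g.
Proof.
have [l lP] := forward_growth B; exists l => h /long_inv lh hl.
by apply: lP => //; rewrite lenV.
Qed.

Let chain_forward := chain (repM rep) (fun g => sl_unit (rho g)) S0 EP kap0 cJ0 e0 e1 ck
  L1 L2 forward_bform forward_junction forward_growth.

Let rb_unit g : rb g \in unitmx. Proof. by rewrite unitmx_tr sl_unit. Qed.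

Let chain_backward := chain backwardM rb_unit S0 EP kap0 cJ0 e0 e1 ck
  L1 L2 backward_bform backward_junction backward_growth.

Lemma perturbed_gap (B : R) : exists l, forall g, l <= len g ->
  B * udvd (rho g) k <= udvd (rho g) k.-1.
Proof.
have [c1 H] := chain_forward.
pose X := udvc R F (k + m) ^+ 2 * (k + m)%:R * (c1 ^+ 2 * (k + m)%:R).
have B0 : 0 <= Num.max B 0 by rewrite le_max lexx orbT.
have [D DP] := H (Num.max B 0 * X ^+ 2) (mulr_ge0 B0 (sqr_ge0 _)).
exists D => g gD; have [cc gc] := @model_geodesic _ _ _ M o (a g o).
have R0 := thickR_ge0 o; have [cc0 _ _] := gc.
have [|||h [s [T [V [l [mu [_ bf _ Bm]]]]]]] := DP cc o (a g o) 0 1%g g gc (lexx 0).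
- by rewrite add0r.
- by rewrite cc0 iact1 mdistxx.
- by rewrite mdistxx.
rewrite invg1 mul1g in bf.
have := bform_gap k0 m0 bf B0 Bm; apply: le_trans; apply: ler_wpM2r.
  exact: udvd_ge0.
by rewrite le_max lexx.
Qed.

(** The geodesic between the two orbit points passes near a point [a g o] with [g] in a finite set.
    A forward chain from there to [be] and a backward chain to [al] give decompositions of [rho be]
    and [rho al^-1%g] after moving the bounded factor [rho g], whose inner factors meet at one
    junction. *)
Lemma perturbed_transverse (p q : gromov_boundary M) : p <> q ->
  exists r c, forall al be, sh r p (a al o) -> sh r q (a be o) ->
    ulsubmx (udvV (rho al^-1%g) *m udvU (rho be)) \in unitmx /\
    mn (invmx (ulsubmx (udvV (rho al^-1%g) *m udvU (rho be)))) <= c.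
Proof.
move=> pq; have [r [Kr near]] := pass_near o rel pq.
have [c1 H1] := chain_forward; have [c2 H2] := chain_backward.
have [cK cKP] : exists cK, forall f, len f <= Kr -> bnd cK (rho f) /\ bnd cK (rho f^-1%g).
  have [cf cfP] := finite_bound (fun f => mn (rho f) + mn (invmx (rho f))) (len_finite o Kr).
  exists cf => f /cfP; have := mn_ge0 (rho f); have := mn_ge0 (invmx (rho f)).
  have := sl_unit (rho f); rewrite repV // => uf ? ? ?.
  by split; split; rewrite ?unitmx_inv ?invmxK //; lra.
pose c3 := Num.max (2 * k%:R * cJ)
  (Num.max (Num.max (cK * c1) (c1 * (k + m)%:R)) (Num.max ((k + m)%:R * c2) (c2 * cK))).
have [B [c [B0 BP]]] := udv_transverse F k0 m0 c3.
have [D1 D1P] := H1 B B0; have [D2 D2P] := H2 B B0.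
pose D := Num.max D1 D2.
have DD1 : D1 <= D by rewrite le_max lexx.
have DD2 : D2 <= D by rewrite le_max lexx orbT.
have thR := thickR_ge0 o.
pose r' := Num.max r (D + Kr + thickR).
have rr' : r <= r' by rewrite le_max lexx.
have rD : D + Kr + thickR <= r' by rewrite le_max lexx orbT.
exists r', c => al be sal sbe.
have [cc gc] := @model_geodesic _ _ _ M (a al o) (a be o); have [cc0 ccl _] := gc.
have thk g : thick o (a g o) by exists g; rewrite mdistxx.
have [t [g [t0 tl cg gK]]] :=
  near cc _ _ gc (shadow_le rr' sal) (shadow_le rr' sbe) (thk al) (thk be).
have dal := shadow_dist sal; have dbe := shadow_dist sbe.
have tri1 := mtri (a g o) o (a al o); have tri2 := mtri (a g o) o (a be o).
have tri3 := mtri (cc t) (a g o) (a al o); have tri4 := mtri (cc t) (a g o) (a be o).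
have d1 : mdist (cc t) (a al o) = t.
  by rewrite metric_sym -{1}cc0 (geod_dist gc) ?subr0.
have d2 : mdist (cc t) (a be o) = mdist (a al o) (a be o) - t.
  by rewrite -{1}ccl (geod_dist gc).
rewrite d1 [mdist (a g o) (cc t)]metric_sym in tri3.
rewrite d2 [mdist (a g o) (cc t)]metric_sym in tri4.
have gK' : mdist o (a g o) <= Kr := gK.
have tD1 : t + D1 <= mdist (a al o) (a be o) by lra.
have tD2 : mdist (a be o) (a al o) - t + D2 <= mdist (a be o) (a al o) by lra.
have nb : mdist (a be o) (a be o) <= thickR by rewrite mdistxx.
have na : mdist (a al o) (a al o) <= thickR by rewrite mdistxx.
have [h [s [T [V [l [mu [st bf Te Bm]]]]]]] := D1P cc _ _ t g be gc t0 tD1 cg nb.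
have t0' : 0 <= mdist (a be o) (a al o) - t by rewrite [mdist (a be o) _]metric_sym subr_ge0.
have cg' : mdist (cc (mdist (a al o) (a be o) - (mdist (a be o) (a al o) - t))) (a g o) <= thickR.
  by rewrite [mdist (a be o) _]metric_sym subKr.
have [h' [s' [T' [V' [l' [mu' [st' bf' Te' Bm']]]]]]] :=
  D2P _ _ _ _ g al (geod_rev gc) t0' tD2 cg' na.
(* Read backwards, the first step towards [al] ends where the first step towards [be] begins, so the
   two are consecutive steps along one geodesic and [step_gp] applies. *)
have {}st' := step_rev Esym gc st'.
rewrite [mdist (a be o) (a al o)]metric_sym subKr in st'.
have gp := step_gp S0 gc st' st; rewrite !mulKg in gp.
have lh : long h by have := step_long S0 gc st; rewrite mulKg.
have lh' : long h'^-1%g by have := step_long S0 gc st'; rewrite invgM mulgVK.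
have [|Jk Ju Jc] := forward_junction lh' lh; first by rewrite invgK.
have [bg bgV] := cKP g gK.
have {}bf : bform c3 (rho be) (rho g *m (Uf h *m lower T)) V l mu.
  have := bform_mul bf bg (bnd1 R F (k + m)); rewrite !mulmx1 -repM // mulVKg.
  by apply: bform_le; rewrite /c3 le_max; apply/orP; right; rewrite le_max lexx.
have {}bf' : bform c3 (rho al^-1%g) V'^T (upper T'^T *m Vf h'^-1%g *m rho g^-1%g) l' mu'.
  have := bform_mul (bform_tr bf') (bnd1 R F (k + m)) bgV.
  rewrite !mul1mx trmx_mul trmxK lower_tr trmxK -repM // invgM invgK mulgK.
  by apply: bform_le; rewrite /c3 le_max; apply/orP; right; rewrite le_max lexx orbT.
have [uW VW] : ulsubmx (upper T'^T *m (Vf h'^-1%g *m Uf h) *m lower T) \in unitmx /\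
    mn (invmx (ulsubmx (upper T'^T *m (Vf h'^-1%g *m Uf h) *m lower T))) <= 2 * k%:R * cJ.
  by apply: (middle_block cJ0 (ltW e0) e1 Jk Ju Jc Te _ ek); rewrite mn_tr.
have WE : upper T'^T *m Vf h'^-1%g *m rho g^-1%g *m (rho g *m (Uf h *m lower T)) =
    upper T'^T *m (Vf h'^-1%g *m Uf h) *m lower T.
  by rewrite repV // -!mulmxA mulKmx ?sl_unit.
apply: (BP _ _ _ _ _ _ _ _ _ _ (sl_unit _) (sl_unit _) bf' bf Bm' Bm); rewrite WE //.
by apply: le_trans VW _; rewrite /c3 le_max lexx.
Qed.

End Perturbed.

(** * The boundary extension of a perturbed representation *)

(** Reduces statements about neighbourhoods or about large indices to ultrafilters, along which
    bounded matrices and flags have limits. *)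
Lemma filter_ultra (T : Type) (F : set_system T) (FF : Filter F) (A : set T) :
  (forall U, UltraFilter U -> F `<=` U -> U A) -> F A.
Proof.
move=> H; apply: contrapT => nFA.
have PW : ProperFilter (within (~` A) F).
  apply: Build_ProperFilter; rewrite /within /= => F0; apply: nFA.
  by apply: filterS F0 => x /= nA; apply: contrapT => /nA.
have [U [UU sU]] := ultraFilterLemma PW.
have UA : U A by apply: H => // B FB; apply: sU; rewrite /within /=; apply: filterS FB.
have UnA : U (~` A) by apply: sU; rewrite /within /=; apply: filterS filterT.
by have [x [Ax]] := filter_ex (filterI UA UnA).
Qed.

Section FlagLimits.
Variables (R : realType) (F : scalar_kind) (d k : nat).
Local Notation K := (scalars R F).
Local Notation flags := (flags K d k).
Hypotheses (k0 : (0 < k)%N) (kd : (k <= d - k)%N).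

Lemma flag_cvgP I (U : set_system I) (FU : Filter U) (y_ : I -> flags) (y : flags) :
  y_ @ U --> y <-> forall e, 0 < e -> U [set i | fdist kd y (y_ i) < e].
Proof.
split=> [yc e e0|H A]; first exact: (yc _ (fdist_ball kd y e0)).
rewrite (flag_nbhsE kd) => -[e /= e0 eA].
by suff : U [set i | A (y_ i)] by []; apply: filterS (H e e0) => i /=; exact: eA.
Qed.

Lemma flag_cvg_unique I (U : set_system I) {PU : ProperFilter U} (y_ : I -> flags) (y z : flags) :
  y_ @ U --> y -> y_ @ U --> z -> y = z.
Proof.
move=> /flag_cvgP yc /flag_cvgP zc; apply/(fdist0 kd); apply/eqP.
rewrite eq_le fdist_ge0 andbT; apply/ler_addgt0Pl => e e0; rewrite addr0.
have e20 : 0 < e / 2 by rewrite divr_gt0.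
have [i [/= yi zi]] := filter_ex (filterI (yc _ e20) (zc _ e20)).
apply: le_trans (fdist_triangle kd _ (y_ i) _) _; rewrite [e]splitr.
by rewrite lerD ?ltW // fdistC.
Qed.

Lemma flag_limit I (U : set_system I) (UU : UltraFilter U) (y_ : I -> flags) (y : flags) :
  y_ @ U --> y -> exists h, [/\ h \in unitmx, mcvg U (frep kd \o y_) h & y = mflag kd h].
Proof.
move=> yc; have [h [[uh _ _] ch hc]] := flags_ultra kd UU y_.
by exists h; split=> //; exact: flag_cvg_unique yc hc.
Qed.

Lemma flag_act_continuous (h : special_linear K d) : continuous (flag_act h : flags -> flags).
Proof.
move=> x A nA; suff : nbhs x (flag_act h @^-1` A) by [].
apply: filter_ultra => U UU sU.
have [g [ug cg xg]] := flag_limit UU (y_ := id) sU.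
have : (fun y => mflag kd (h *m frep kd y)) @ U --> mflag kd (h *m g).
  apply: mflag_cvg; first by rewrite unitmx_mul sl_unit.
  by apply: mcvgM cg; exact: mcvg_cst.
rewrite -mflag_act // -xg => /(_ A nA).
have E : (fun y => mflag kd (h *m frep kd y)) = flag_act h.
  by apply/funext => y; rewrite -mflag_act ?frep_unit // frepK.
by rewrite E.
Qed.

(** If intersections were nontrivial along [U], normalised common vectors would converge to a
    nonzero common vector of the limit flags. *)
Lemma disjoint_near I (U : set_system I) (UU : UltraFilter U) (y_ z_ : I -> flags) (y z : flags) :
  y_ @ U --> y -> z_ @ U --> z -> disjoint_flags y z ->
  U [set i | disjoint_flags (y_ i) (z_ i)].
Proof.
move=> yc zc yz; have [//|nD] := in_ultra_setVsetC [set i | disjoint_flags (y_ i) (z_ i)] UU.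
have d0 : (0 < d)%N.
  by apply: leq_trans k0 (leq_trans kd _); exact: leq_subr.
have /choice[v vP] : forall i, exists v : 'cV[K]_d, v != 0 /\
    (~ disjoint_flags (y_ i) (z_ i) -> v \in gr_space (set_val (y_ i)).1 /\
       v \in gr_space (set_val (z_ i)).2).
  move=> i; have [dis|ndis] := pselect (disjoint_flags (y_ i) (z_ i)).
    (* An arbitrary nonzero value where the intersection is trivial, so that the whole family can be
       normalised. *)
    exists (const_mx 1); split=> //; apply/eqP => /matrixP/(_ (Ordinal d0) 0).
    by rewrite !mxE => /eqP; rewrite oner_eq0.
  move/existsNP: ndis => [v /not_implyP[v1 /not_implyP[v2 v0]]].
  by exists v; split=> //; exact/eqP.
have [s [w [s0 cw w0]]] := unit_limit UU (fun i => (vP i).1).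
have [h [uh ch yh]] := flag_limit UU yc; have [g [ug cg zg]] := flag_limit UU zc.
exfalso; move/eqP: w0; apply; apply: yz.
  rewrite yh; apply/mem_mflag1; rewrite gnE //; apply: (support_limit UU uh ch cw).
  apply: filterS nD => i /(vP i).2[+ _] j kj; rewrite -{1}(frepK kd (y_ i)).
  move=> /mem_mflag1; rewrite gnE ?frep_unit // => /(_ j kj) h0.
  by rewrite -scalemxAr mxE h0 mulr0.
rewrite zg; apply/mem_mflag2; rewrite gnE //; apply: (support_limit UU ug cg cw).
apply: filterS nD => i /(vP i).2[_ +] j kj; rewrite -{1}(frepK kd (z_ i)).
move=> /mem_mflag2; rewrite gnE ?frep_unit // => /(_ j kj) h0.
by rewrite -scalemxAr mxE h0 mulr0.
Qed.

Lemma transverse_near I (U : set_system I) (UU : UltraFilter U) (y_ z_ : I -> flags) (y z : flags) :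
  y_ @ U --> y -> z_ @ U --> z -> transverse y z -> U [set i | transverse (y_ i) (z_ i)].
Proof.
move=> yc zc /(transverseP kd)[yz zy].
apply: filterS2 (disjoint_near UU yc zc yz) (disjoint_near UU zc yc zy) => i /= h1 h2.
by apply/(transverseP kd).
Qed.

Lemma flag_seq_cvg (U : set_system nat) (UU : UltraFilter U) (y_ : nat -> flags) (y : flags) :
  \oo `<=` U -> (forall n, fdist kd y (y_ n) < n.+1%:R^-1) -> y_ @ U --> y.
Proof.
move=> sU yn; apply/flag_cvgP => e e0; have [N eN] := exists_nat_ge e^-1.
apply: sU; exists N => // n /= Nn; apply: lt_le_trans (yn n) _.
rewrite invf_ple ?posrE //; apply: le_trans eN _; rewrite ler_nat.
exact: leq_trans (leqnSn _).
Qed.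

Lemma flag_nbhs_seq (y : flags) (A : set flags) :
  ~ (exists2 e : R, 0 < e & forall z, fdist kd y z < e -> A z) ->
  exists y_ : nat -> flags, forall n, fdist kd y (y_ n) < n.+1%:R^-1 /\ ~ A (y_ n).
Proof.
move=> no; have /choice[f fP] : forall n, exists z, fdist kd y z < n.+1%:R^-1 /\ ~ A z.
  move=> n; apply: contrapT => /forallNP nz; apply: no.
  exists n.+1%:R^-1; first by rewrite invr_gt0.
  by move=> z yz; apply: contrapT => nA; exact: (nz z).
by exists f.
Qed.

Section SubspaceOfFlags.
Variable Lam : set flags.

Lemma subflags_nbhs (x : Lam) (A : set Lam) : nbhs x A <->
  exists2 e : R, 0 < e & forall y : Lam, fdist kd (set_val x) (set_val y) < e -> A y.
Proof.
split=> [|[e e0 eA]].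
  rewrite nbhsE => -[B [oB Bx] BA]; case: oB => Q oQ QE.
  have Qx : Q (set_val x) by move: Bx; rewrite -QE.
  have := open_nbhs_nbhs (conj oQ Qx); rewrite (flag_nbhsE kd) => -[e /= e0 eQ].
  by exists e => // y /eQ Qy; apply: BA; rewrite -QE.
have cv := @initial_continuous _ _ (@set_val _ Lam) x.
have near_x : nbhs x (set_val @^-1` [set y | fdist kd (set_val x) y < e]).
  exact: (cv _ (fdist_ball kd (set_val x) e0)).
by apply: filterS near_x => y /=; exact: eA.
Qed.

Lemma subflags_metrizable : metrizable R Lam.
Proof.
exists (fun x y => fdist kd (set_val x) (set_val y)); split.
- by move=> x y; split=> [/fdist0/val_inj//|->]; apply/fdist0.
- by move=> x y; exact: fdistC.
- by move=> x y z; exact: fdist_triangle.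
move=> x; apply/seteqP; split=> A; first by move=> /subflags_nbhs[e e0 eA]; exists e.
by move=> [e /= e0 eA]; apply/subflags_nbhs; exists e.
Qed.

Lemma subflags_hausdorff : hausdorff_space Lam.
Proof.
move=> x y xy; apply: val_inj; apply/(fdist0 kd); apply/eqP.
rewrite eq_le fdist_ge0 andbT; apply/ler_addgt0Pl => e e0; rewrite addr0.
have e20 : 0 < e / 2 by rewrite divr_gt0.
have nb z : nbhs z [set w : Lam | fdist kd (set_val z) (set_val w) < e / 2].
  by apply/subflags_nbhs; exists (e / 2).
have [z [/= xz yz]] := xy _ _ (nb x) (nb y).
apply: le_trans (fdist_triangle kd _ (set_val z) _) _; rewrite [e]splitr.
by rewrite lerD ?ltW // fdistC.
Qed.

Lemma subflags_compact : closed Lam -> compact [set: Lam].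
Proof.
move=> cL; rewrite compact_ultra => U UU _.
have [g [_ _ gc]] := flags_ultra kd UU (@set_val _ Lam).
have Lg : Lam (mflag kd g).
  apply: contrapT => ng; have : nbhs (mflag kd g) (~` Lam).
    by apply: open_nbhs_nbhs; split=> //; rewrite openC.
  move=> /gc h; have {}h : U [set x : Lam | ~ Lam (set_val x)] by [].
  by have [x /= nx] := filter_ex h; apply: nx; exact: set_mem (valP x).
exists (exist _ (mflag kd g) (mem_set Lg)); split=> //.
move=> A /subflags_nbhs[e e0 eA].
have near_g : U [set x : Lam | fdist kd (mflag kd g) (set_val x) < e].
  exact: (gc _ (fdist_ball kd (mflag kd g) e0)).
by apply: filterS near_g => x /=; exact: eA.
Qed.

End SubspaceOfFlags.
End FlagLimits.

Section Attractors.
Variables (R : realType) (F : scalar_kind) (d k : nat) (Gam : groupType).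
Variables (P : set (set Gam)) (M : gromov_model R P) (o : M).
Local Notation K := (scalars R F).
Local Notation a := (model_action M).
Local Notation len := (len o).
Local Notation sh := (shadow o).
Local Notation delta := (hdelta M).
Local Notation bd := (gromov_boundary M).
Local Notation flags := (flags K d k).
Hypothesis rel : relatively_hyperbolic R P.
Hypotheses (k0 : (0 < k)%N) (kd : (k <= d - k)%N) (kd' : (k <= d)%N).

Variable rho : Gam -> special_linear K d.
Hypothesis rep : representations Gam K d rho.
Hypothesis gap : forall B : R, exists l, forall g, l <= len g ->
  B * udvd (rho g) k <= udvd (rho g) k.-1.
Hypothesis Ttr : forall p q : bd, p <> q -> exists r c, forall al be,
  sh r p (a al o) -> sh r q (a be o) ->
  minor kd' (udvV (rho al^-1%g) *m udvU (rho be)) \in unitmx /\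
  mn (invmx (minor kd' (udvV (rho al^-1%g) *m udvU (rho be)))) <= c.

(** The fibre over [p] of the new extension. Taking ultrafilters on [Gam] itself yields all limits
    of attracting flags of elements tending to [p]. *)
Definition att (p : bd) : set flags := [set y | exists U A,
  [/\ UltraFilter U, forall r, U [set g | sh r p (a g o)],
    mcvg U (fun g => udvU (rho g)) A & y = mflag kd A]].

Lemma att_intro I (U : set_system I) (UU : UltraFilter U) (f : I -> Gam) p A :
  (forall r, U [set i | sh r p (a (f i) o)]) ->
  mcvg U (fun i => udvU (rho (f i))) A -> att p (mflag kd A).
Proof.
by move=> fp cA; exists (f @ U), A; split=> //; exact: ultra_fmap.
Qed.

Lemma udvU_limit I (U : set_system I) (UU : UltraFilter U) (f : I -> Gam) :
  exists2 A, mcvg U (fun i => udvU (rho (f i))) A & A \in unitmx.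
Proof.
have [A cA [uA _ _]] : exists2 A, mcvg U (fun i => udvU (rho (f i))) A & bnd (udvc R F d) A.
  by apply: mcvg_bnd_ultra; apply: filterS filterT => i _; exact: udvU_bnd.
by exists A.
Qed.

Lemma inverse_limit I (U : set_system I) (UU : UltraFilter U) (f : I -> Gam) p :
  (forall r, U [set i | sh r p (a (f i) o)]) ->
  exists q, forall r, U [set i | sh r q (a (f i)^-1%g o)].
Proof.
move=> fp; apply: (orbit_ultra UU) => n.
by apply: filterS (orbit_far_shadow _ fp n%:R) => i /=; rewrite lenV.
Qed.

(** The uniform bound of [Ttr] survives two successive limits: first the elements tending to [p]
    with the other one fixed, then the elements tending to [q]. The limit [W] of their [V] factors
    supplies equations for the [(d - k)]-space of [A], so [minor_unit] applies. *)
Lemma att_disjoint p q x y : p <> q -> att p x -> att q y -> disjoint_flags y x.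
Proof.
move=> pq [U [A [UU Up cA ->]]] [V [B [UV Vq cB ->]]].
have [p' Up'] := inverse_limit UU (f := id) Up.
have [W cW [uW _ _]] : exists2 W, mcvg U (fun g => udvV (rho g^-1%g)) W & bnd (udvc R F d) W.
  by apply: mcvg_bnd_ultra; apply: filterS filterT => i _; exact: udvV_bnd.
have [r [c rc]] := Ttr pq.
have uA : A \in unitmx.
  by have [A' cA' uA'] := udvU_limit UU id; rewrite (mcvg_unique cA cA').
have uB : B \in unitmx.
  by have [B' cB' uB'] := udvU_limit UV id; rewrite (mcvg_unique cB cB').
have WA (i j : 'I_d) : (i < k)%N -> (j < d - k)%N -> (W *m A) i j = 0.
  exact: (rep_udv_limit k0 kd rep gap UU Up' cW cA).
apply/(minor_unit kd uW uB uA WA).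
have near be : sh r q (a be o) -> minor kd' (W *m udvU (rho be)) \in unitmx /\
    mn (invmx (minor kd' (W *m udvU (rho be)))) <= c.
  move=> sbe; have cM : mcvg U (fun g => minor kd' (udvV (rho g^-1%g) *m udvU (rho be)))
      (minor kd' (W *m udvU (rho be))).
    by apply: mcvg_minor; apply: mcvgM cW _; exact: mcvg_cst.
  by apply: mcvg_inv_le cM; apply: filterS (Up r) => g /= sg; exact: rc.
have cM : mcvg V (fun g => minor kd' (W *m udvU (rho g))) (minor kd' (W *m B)).
  by apply: mcvg_minor; apply: mcvgM cB; exact: mcvg_cst.
have [uM _] := mcvg_inv_le (filterS near (Vq r)) cM.
by move: uM; set pf := (X in _ -> is_true (minor X _ \in _)); rewrite (bool_irrelevance pf kd').
Qed.

Lemma att_trans p q x y : p <> q -> att p x -> att q y -> transverse x y.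
Proof.
move=> pq px qy; apply/(transverseP kd); split; last exact: att_disjoint pq px qy.
by apply: (@att_disjoint q p) => // qp; apply: pq.
Qed.

Lemma att_unique p q x : att p x -> att q x -> p = q.
Proof.
move=> px qx; apply: contrapT => pq.
exact: (not_transverse_self kd k0 (att_trans pq px qx)).
Qed.

Lemma att_nonempty p : exists y, att p y.
Proof.
have /choice[f fP] := fun n : nat => shadow_orbit o rel p n%:R.
have [U [UU sU]] := @ultraFilterLemma nat \oo _.
have [A cA _] := udvU_limit UU f; exists (mflag kd A); apply: att_intro cA => r.
have [N rN] := exists_nat_ge r; apply: sU; exists N => // n /= Nn.
by apply: shadow_le (fP n); apply: le_trans rN _; rewrite ler_nat.
Qed.

(** The chosen decompositions of [rho x] and [rho (g * x)%g] are unrelated, so the attracting flags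
    are compared through orbits. A flag [h] over a point other than [q] is transverse to both
    repelling flags; the images of [h] under [rho (g * x)%g] then tend both to the flag of [A2] and
    to the translate by [rho g] of the flag of [A]. *)
Lemma att_act g p y : att p y -> att (bd_act a g p) (flag_act (rho g) y).
Proof.
move=> [U [A [UU Up cA ->]]].
have [q Uq] := inverse_limit UU (f := id) Up.
have [Q cQ uQ] := udvU_limit UU (fun x => x^-1%g).
have [A2 cA2 uA2] := udvU_limit UU (fun x => (g * x)%g).
have [Q2 cQ2 uQ2] := udvU_limit UU (fun x => (g * x)^-1%g).
have Up2 r : U [set x | sh r (bd_act a g p) (a (g * x)%g o)].
  by apply: filterS (Up (r + delta + len g)) => x /=; rewrite iactM; exact: shadow_bd_act.
have Uq2 r : U [set x | sh r q (a (g * x)^-1%g o)].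
  apply: filterS (Uq (r + len g^-1%g)) => x /= sx; apply: (shadow_move (x := a x^-1%g o)).
  by rewrite mdist_orbit invgK invgM mulVKg.
have attQ : att q (mflag kd Q) := att_intro UU Uq cQ.
have attQ2 : att q (mflag kd Q2) := att_intro UU Uq2 cQ2.
have [s sq] : exists s, s <> q.
  have [s1 [s2 s12]] := two_points o.
  by have [s1q|s1q] := pselect (s1 = q); [exists s2 => s2q; apply: s12; rewrite s1q|exists s1].
have [z sz] := att_nonempty s; pose h := frep kd z.
have uh : h \in unitmx by exact: frep_unit.
have ch : mcvg U (fun=> h) h by exact: mcvg_cst.
have zQ : transverse (mflag kd h) (mflag kd Q) by rewrite frepK; exact: att_trans sq sz attQ.
have zQ2 : transverse (mflag kd h) (mflag kd Q2) by rewrite frepK; exact: att_trans sq sz attQ2.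
have c1 := rep_attract k0 rep gap UU Up Uq cA cQ (fun=> uh) uh ch zQ.
have c2 := rep_attract k0 rep gap UU Up2 Uq2 cA2 cQ2 (fun=> uh) uh ch zQ2.
have c3 : (fun x => mflag kd (rho (g * x)%g *m h)) @ U --> flag_act (rho g) (mflag kd A).
  have E : (fun x => mflag kd (rho (g * x)%g *m h)) =
      flag_act (rho g) \o (fun x => mflag kd (rho x *m h)).
    by apply/funext => x /=; rewrite mflag_act ?unitmx_mul ?sl_unit // repM // mulmxA.
  rewrite E; apply: cvg_comp c1 _; exact: flag_act_continuous.
rewrite (flag_cvg_unique kd c3 c2).
exact: (att_intro UU Up2 cA2).
Qed.

Lemma bd_near_shadow p q r x :
  sh (r + delta) p x -> sh (r + delta) q x -> bd_near o r p q.
Proof.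
move=> [N1 _ H1] [N2 _ H2]; exists (brep p), (brep q); split.
- by rewrite brepE; split; exact: brep_asym.
- by rewrite brepE; split; exact: brep_asym.
apply/near2_natP; exists (maxn N1 N2) => i j; rewrite !geq_max => /andP[i1 _] /andP[_ j2].
rewrite -(addrK delta r); apply: (hyp_le (@hypd _ _ _ M) (y := x)); last exact: H2.
by rewrite gpC; exact: H1.
Qed.

(** A diagonal choice: [g n] moves [o] deep into the shadow of [p_ n], and its attracting flag is
    close to [y_ n]. The limit point of the [g n] lies under [y]; that it is near [p_ n] is recorded
    by a common point of shadows, which gives closedness of the attractor and continuity of [zeta]
    together. *)
Lemma att_seq (U : set_system nat) (UU : UltraFilter U) (y_ : nat -> flags) (y : flags)
    (p_ : nat -> bd) : \oo `<=` U -> (forall n, att (p_ n) (y_ n)) -> y_ @ U --> y ->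
  exists2 p, att p y &
    forall r, U [set n | exists2 x, sh r p x & sh r (p_ n) x].
Proof.
move=> sU yp yc.
have /choice[g gP] : forall n, exists g, sh n%:R (p_ n) (a g o) /\
    fdist kd (y_ n) (mflag kd (udvU (rho g))) < n.+1%:R^-1.
  move=> n; have [V [A [UV Vp cA ->]]] := yp n.
  have uA : A \in unitmx.
    by have [A' cA' uA'] := udvU_limit UV id; rewrite (mcvg_unique cA cA').
  have near : V [set x | fdist kd (mflag kd A) (mflag kd (udvU (rho x))) < n.+1%:R^-1].
    have e0 : 0 < n.+1%:R^-1 :> R by rewrite invr_gt0.
    have c1 : (fun x => mflag kd (udvU (rho x))) @ V --> mflag kd A by exact: mflag_cvg.
    exact: (c1 _ (fdist_ball kd _ e0)).
  by have [x [h1 h2]] := filter_ex (filterI (Vp n%:R) near); exists x.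
have [p pP] : exists p, forall r, U [set n | sh r p (a (g n) o)].
  apply: (orbit_ultra UU) => m; apply: sU; exists m => // n /= mn'.
  by apply: le_trans (shadow_dist (gP n).1); rewrite ler_nat.
have [A cA uA] := udvU_limit UU g.
have yA : y = mflag kd A.
  apply: (flag_cvg_unique kd yc); apply/(flag_cvgP kd) => e e0.
  have e20 : 0 < e / 2 by rewrite divr_gt0.
  have c0 : (fun n => mflag kd (udvU (rho (g n)))) @ U --> mflag kd A by exact: mflag_cvg.
  have c1 : U [set n | fdist kd (mflag kd A) (mflag kd (udvU (rho (g n)))) < e / 2].
    exact: (c0 _ (fdist_ball kd _ e20)).
  have [N eN] := exists_nat_ge (e / 2)^-1.
  apply: filterS2 c1 (sU _ (nbhs_infty_ge N)) => n /= h1 Nn.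
  apply: le_lt_trans (fdist_triangle kd _ (mflag kd (udvU (rho (g n)))) _) _.
  rewrite [e]splitr ltrD // fdistC; apply: lt_le_trans (gP n).2 _.
  rewrite invf_ple ?posrE //; apply: le_trans eN _; rewrite ler_nat.
  exact: leq_trans (leqnSn _).
exists p; first by rewrite yA; exact: (att_intro UU pP cA).
move=> r; have [N rN] := exists_nat_ge r.
apply: filterS2 (pP r) (sU _ (nbhs_infty_ge N)) => n /= h1 Nn.
exists (a (g n) o) => //; apply: shadow_le (gP n).1.
by apply: le_trans rN _; rewrite ler_nat.
Qed.

Definition attractor : set flags := [set y | exists p, att p y].

Lemma attractor_closed : closed attractor.
Proof.
move=> y cy.
have /choice[f fP] : forall n : nat, exists z, attractor z /\ fdist kd y z < n.+1%:R^-1.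
  move=> n; have e0 : 0 < n.+1%:R^-1 :> R by rewrite invr_gt0.
  by have [z [az yz]] := cy _ (fdist_ball kd y e0); exists z.
have [U [UU sU]] := @ultraFilterLemma nat \oo _.
have fd n : fdist kd y (f n) < n.+1%:R^-1 := (fP n).2.
have fc := flag_seq_cvg UU sU fd.
have /choice[p_ pP] := fun n => (fP n).1.
by have [p py _] := att_seq UU sU pP fc; exists p.
Qed.

Definition zeta (x : attractor) : bowditch_boundary M := projT1 (cid (set_mem (valP x))).

Lemma zetaP (x : attractor) : att (zeta x) (set_val x).
Proof. by rewrite /zeta; case: cid. Qed.

Lemma zeta_eq (x : attractor) p : att p (set_val x) -> zeta x = p.
Proof. exact: att_unique (zetaP x). Qed.

Lemma fiberP p y : fiber zeta p y <-> att p y.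
Proof.
split=> [[x <- <-]|py]; first exact: zetaP.
have Ly : attractor y by exists p.
exists (exist _ y (mem_set Ly)) => //; exact: zeta_eq.
Qed.

Lemma zeta_continuous : continuous zeta.
Proof.
move=> x B; rewrite nbhsE => -[B' [oB' B'x] B'B].
suff : nbhs x (zeta @^-1` B) by [].
apply/(subflags_nbhs kd); apply: contrapT => no.
have /choice[f fP] : forall n : nat, exists z : attractor,
    fdist kd (set_val x) (set_val z) < n.+1%:R^-1 /\ ~ B (zeta z).
  move=> n; apply: contrapT => /forallNP nz; apply: no.
  exists n.+1%:R^-1; first by rewrite invr_gt0.
  by move=> z yz; apply: contrapT => nA; exact: (nz z).
have [U [UU sU]] := @ultraFilterLemma nat \oo _.
have fc : (fun n => set_val (f n)) @ U --> set_val x.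
  by exact: (flag_seq_cvg UU sU (fun n => (fP n).1)).
have [p /zeta_eq zp pP] := att_seq UU sU (fun n => zetaP (f n)) fc.
have : bd_open B' by [].
move=> /(_ o _ B'x)[r rB].
have [n [y y1 y2]] := filter_ex (pP (r + delta)).
apply: (fP n).2; apply: B'B; apply: rB.
by rewrite zp; exact: bd_near_shadow y1 y2.
Qed.

Lemma attractor_act_subproof (g : Gam) (x : attractor) :
  flag_act (rho g) (set_val x) \in attractor.
Proof. by apply: mem_set; exists (bd_act a g (zeta x)); exact: att_act (zetaP x). Qed.

Definition attractor_act (g : Gam) (x : attractor) : attractor :=
  exist (fun y => y \in attractor) _ (attractor_act_subproof g x).

Lemma attractor_action : continuous_action attractor_act.
Proof.
split.
- move=> x; apply: val_inj; rewrite -[LHS]/(flag_act (rho 1%g) (set_val x)).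
  by rewrite -[RHS]/(set_val x) -(frepK kd (set_val x)) mflag_act ?frep_unit // rep1 // mul1mx.
- move=> g h x; apply: val_inj; rewrite -[LHS]/(flag_act (rho (g * h)%g) (set_val x)).
  rewrite -[RHS]/(flag_act (rho g) (flag_act (rho h) (set_val x))) -(frepK kd (set_val x)).
  by rewrite !mflag_act ?unitmx_mul ?sl_unit ?frep_unit // repM // mulmxA.
move=> g x B /(subflags_nbhs kd)[e e0 eB].
suff : nbhs x (attractor_act g @^-1` B) by [].
have near_x : nbhs (set_val x) (flag_act (rho g) @^-1`
    [set z | fdist kd (flag_act (rho g) (set_val x)) z < e]).
  exact: (flag_act_continuous kd (fdist_ball kd _ e0)).
move: near_x; rewrite (flag_nbhsE kd) => -[e1 /= e10 e1P].
by apply/(subflags_nbhs kd); exists e1 => // y /e1P ye; exact: eB.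
Qed.

Lemma attractor_extension : flag_boundary_extension rho attractor_act zeta.
Proof.
split=> //; first exact: attractor_closed.
split; split.
- exact: (subflags_compact kd attractor_closed).
- exact: (subflags_hausdorff kd).
- exact: (subflags_metrizable kd).
- exact: attractor_action.
- exact: zeta_continuous.
- move=> p _; have [y py] := att_nonempty p; have Ly : attractor y by exists p.
  by exists (exist _ y (mem_set Ly)) => //; exact: zeta_eq.
- by move=> g x; apply: zeta_eq; exact: att_act (zetaP x).
Qed.

(** The candidate for the set [C_p] of the dynamics: flags transverse to the whole fibre. Its
    openness rests on [att_seq], by which flags chosen in the fibre over [p] have their limits there
    too. *)
Definition att_opposite (p : bd) : set flags :=
  [set y | forall z, att p z -> transverse y z].

Lemma att_opposite_open p : open (att_opposite p).
Proof.
rewrite openE => y py; rewrite /interior (flag_nbhsE kd); apply: contrapT => no.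
have [f fP] := flag_nbhs_seq (kd := kd) (y := y) (A := att_opposite p)
  (fun h => no (let: ex_intro2 e e0 eA := h in ex_intro2 _ _ e e0 eA)).
have /choice[z zP] : forall n, exists z, att p z /\ ~ transverse (f n) z.
  by move=> n; have [_ /existsNP[z /not_implyP[h1 h2]]] := fP n; exists z.
have [U [UU sU]] := @ultraFilterLemma nat \oo _.
have fc : f @ U --> y by exact: (flag_seq_cvg UU sU (fun n => (fP n).1)).
have [g [_ _ zc]] := flags_ultra kd UU z.
have [q qz qP] := att_seq UU sU (fun n => (zP n).1) zc.
have qp : q = p.
  apply: contrapT => qp; have [r rP] := shadow_separate (@hypd _ _ _ M) o qp.
  have [n [x xq xp]] := filter_ex (qP r); have := rP _ _ xq xp.
  by rewrite gpxx ltNge (shadow_dist xq).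
rewrite qp in qz; have near := transverse_near k0 kd UU fc zc (py _ qz).
by have [n] := filter_ex near; exact: (zP n).2.
Qed.

(** Points of [L] whose images leave [W] have a limit in [L], by compactness. The repelling flag of
    the sequence lies in the fibre over [q], so this limit is transverse to it and [rep_attract]
    brings the images to a flag in the fibre over [p], hence into [W]. *)
Lemma attractor_dynamics : extended_dynamics rho zeta.
Proof.
exists att_opposite; split=> [p|gs p q gp gq L W cL LC oW pW].
  split; first exact: att_opposite_open.
  move=> y [[q qy] npy] z pz; apply: (@att_trans q p) => // qp.
  by apply: npy; apply/fiberP; rewrite -qp.
apply: filter_ultra => U UU sU.
have [//|nU] := in_ultra_setVsetC [set n | flag_act (rho (gs n)) @` L `<=` W] UU.
have bad n : ~ flag_act (rho (gs n)) @` L `<=` W ->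
    exists2 y, L y & ~ W (flag_act (rho (gs n)) y).
  move=> nW; apply: contrapT => no; apply: nW => _ [y Ly <-].
  by apply: contrapT => nWy; apply: no; exists y.
have [n0 /bad[y0 Ly0 _]] := filter_ex nU.
have /choice[y yP] : forall n, exists y, L y /\
    (~ flag_act (rho (gs n)) @` L `<=` W -> ~ W (flag_act (rho (gs n)) y)).
  move=> n; have [sub|nsub] := pselect (flag_act (rho (gs n)) @` L `<=` W); first by exists y0.
  by have [y Ly nWy] := bad n nsub; exists y.
have shp r : U [set n | sh r p (a (gs n) o)] by apply: sU; exact: ((conv_shadow o gs p).1 gp r).
have shq r : U [set n | sh r q (a (gs n)^-1%g o)].
  by apply: sU; exact: ((conv_shadow o (fun n => (gs n)^-1%g) q).1 gq r).
have UF := ultra_fmap y UU.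
move: cL; rewrite compact_ultra => /(_ _ UF)[|yl [Lyl yc]].
  by rewrite /nbhs /=; apply: filterS filterT => n _; exact: (yP n).1.
have [h [uh ch yh]] := flag_limit kd UU yc.
have [A cA uA] := udvU_limit UU gs.
have [Q cQ uQ] := udvU_limit UU (fun n => (gs n)^-1%g).
have tr : transverse (mflag kd h) (mflag kd Q).
  by rewrite -yh; apply: LC => //; exact: (att_intro UU shq cQ).
have conv := rep_attract k0 rep gap UU shp shq cA cQ (fun n => frep_unit kd (y n)) uh ch tr.
have WA : W (mflag kd A).
  by apply: pW; apply/fiberP; exact: (att_intro UU shp cA).
have {}conv : U [set n | W (mflag kd (rho (gs n) *m frep kd (y n)))].
  by apply: (conv W); apply: open_nbhs_nbhs.
have [n [/= Wn nW]] := filter_ex (filterI conv nU).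
exfalso; apply: ((yP n).2 nW).
by rewrite -(frepK kd (y n)) mflag_act ?frep_unit.
Qed.

Lemma attractor_egf : extended_geometrically_finite M k rho.
Proof.
exists attractor, attractor_act, zeta; split.
- exact: attractor_extension.
- move=> p q pq x y /fiberP px /fiberP qy; exact: att_trans pq px qy.
- exact: attractor_dynamics.
Qed.

End Attractors.

Lemma minor_ulsub (R : realType) (F : scalar_kind) (k m : nat) (nd : (k <= k + m)%N)
    (N : 'M[scalars R F]_(k + m)) : minor nd N = ulsubmx N.
Proof. by apply/matrixP => i j; rewrite !mxE; congr (N _ _); exact: val_inj. Qed.

Lemma gap_divergent (R : realType) (F : scalar_kind) (d k : nat) (Gam : groupType)
    (P : set (set Gam)) (M : gromov_model R P) (o : M)
    (rho : Gam -> special_linear (scalars R F) d) :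
  (0 < k)%N -> (k < d)%N ->
  (forall B : R, exists l, forall g, l <= len o g ->
    B * udvd (rho g) k <= udvd (rho g) k.-1) ->
  divergent k rho.
Proof.
move=> k0 kd gap e e_inj; apply/cvgryPge => A.
pose C := udvc R F d ^+ 2 * d%:R.
have d0 : (0 < d)%N := leq_ltn_trans (leq0n k) kd.
have C0 : 0 < C.
  rewrite mulr_gt0 ?exprn_gt0 ?ltr0n //.
  exact: (bnd_gt0 d0 (udvU_bnd (1%:M : 'M[scalars R F]_d))).
pose A' := Num.max A 0; have A0 : 0 <= A' by rewrite le_max lexx orbT.
have [l lP] := gap (C * (A' * C)).
apply: filterS (infinite_far o l e_inj) => n /= ln.
have un := sl_unit (rho (e n)).
rewrite ler_pdivlMr ?sigma_gt0 //.
have le1 := sigma_le_udvd (rho (e n)) (ltn0Sn k) kd.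
have le2 := udvd_le_sigma (rho (e n)) k0 (ltnW kd).
rewrite -/C in le1 le2.
apply: (@le_trans _ _ (A' * (C * udvd (rho (e n)) k))).
  apply: (@le_trans _ _ (A' * sigma k.+1 (rho (e n)))); last exact: ler_wpM2l.
  by apply: ler_wpM2r; [apply: ltW; exact: sigma_gt0|rewrite le_max lexx].
rewrite -(ler_pM2l C0); apply: le_trans le2; apply: le_trans (lP _ ln).
by rewrite le_eqVlt; apply/orP; left; apply/eqP; ring.
Qed.

Theorem theorem1p4 (R : realType) (F : scalar_kind) (d k : nat)
    (Gam : groupType) (P : set (set Gam))
    (rho0 : Gam -> special_linear (scalars R F) d) :
  (1 <= k)%N -> (2 * k <= d)%N ->
  relatively_hyperbolic R P ->
  representations Gam (scalars R F) d rho0 ->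
  forall M : gromov_model R P,
  divergent k rho0 ->
  extended_geometrically_finite M k rho0 ->
  exists O : set (subspace (relative_representations P rho0)),
    [/\ open O, O rho0, O `<=` relative_representations P rho0 &
        forall rho, O rho ->
          divergent k rho /\ extended_geometrically_finite M k rho].
Proof.
move=> k0 k2d rel rep0 M div0 [Lam [act [zeta [ext trans dyn]]]].
have [m dE] : exists m, d = (k + m)%N by exists (d - k)%N; lia.
subst d; have km : (k <= m)%N by lia.
have m0 : (0 < m)%N := leq_trans k0 km.
have kd : (k <= k + m - k)%N by rewrite addKn.
have kd' : (k <= k + m)%N := leq_addr m k.
have kdm : (k < k + m)%N by rewrite -{1}(addn0 k) ltn_add2l.
have [x0 _] := model_inhabited M; pose o := x0.
have [_ finP subP _] := rel.
have gap0 := divergent_gap o k0 kdm div0.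
have R0 := thickR_ge0 o.
(* The radius is the bound of [step_gp], valid for every step length, so these constants may precede
   the choice of [S]. *)
have [c [N0 T0]] := uniform_transversality k0 kd rep0 gap0 ext trans dyn (3 * thickR o).
pose cT := Num.max 0 c.
have cT0 : 0 <= cT by rewrite le_max lexx.
have {}T0 al be : N0 <= len o al -> N0 <= len o be ->
    gromov_product o (model_action M al o) (model_action M be o) <= 3 * thickR o ->
    ulsubmx (udvV (rho0 al^-1%g) *m udvU (rho0 be)) \in unitmx /\
    mn (invmx (ulsubmx (udvV (rho0 al^-1%g) *m udvU (rho0 be)))) <= cT.
  move=> la lb gp; have [u1 u2] := T0 al be la lb gp; move: u1 u2.
  rewrite !minor_ulsub => u1 u2; split=> //.
  by apply: le_trans u2 _; rewrite le_max lexx orbT.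
pose ca : R := 2 * (k + m)%:R + 1.
pose u := udvc R F (k + m).
pose kap := ca * u * (ca * u).
pose cJ := 2 * k%:R * cT.
pose C := ltgC k m kap cJ.
have u0 : 0 <= u := bnd_ge0 (udvU_bnd (1%:M : 'M[scalars R F]_(k + m))).
have ca0 : 0 <= ca by rewrite addr_ge0 // mulr_ge0.
have kap0 : 0 <= kap by rewrite !mulr_ge0.
have cJ0 : 0 <= cJ by rewrite !mulr_ge0.
have cJkap : 0 <= cJ * kap by rewrite mulr_ge0.
have D0 : 0 < 1 + 6 * (cJ * kap) by rewrite ltr_pwDl // mulr_ge0.
(* With [x = cJ * kap], both [e <= 1] and [3 x / (1 + 6 x) <= 1 / 2] hold, the latter being [ek]. *)
pose e := (1 + 6 * (cJ * kap))^-1.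
have e0 : 0 < e by rewrite invr_gt0.
have e1 : e <= 1 by rewrite invf_le1 // lerDl mulr_ge0.
have ek : cJ * (3 * e * kap) <= 1 / 2.
  have -> : cJ * (3 * e * kap) = 3 * (cJ * kap) / (1 + 6 * (cJ * kap)) by rewrite /e; ring.
  rewrite ler_pdivrMr //; lra.
pose L := Num.max (2 * C ^+ 2) (2 * C / e).
have L1 : 2 * C ^+ 2 <= L by rewrite le_max lexx.
have L2 : 2 * C <= L * e by rewrite -ler_pdivrMr // le_max lexx orbT.
pose X := cT * (u * (ca + 1) * u).
have X0 : 0 <= X by rewrite !mulr_ge0 // addr_ge0.
(* The first bound keeps intertwining factors invertible with bounded inverse, the second gives
   [eps * X <= 1 / 2] for [epsT]; [1 + X] keeps the quotient positive when [X] vanishes. *)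
pose eps := Num.min (1 / 2) (1 / (2 * (1 + X))).
have X1 : 0 < 2 * (1 + X) by rewrite mulr_gt0 // ltr_pwDl.
have eps0 : 0 < eps by rewrite lt_min !divr_gt0.
have eps2 : eps <= 1 / 2 by rewrite ge_min lexx.
have epsT : cT * (u * ((ca + 1) * eps) * u) <= 1 / 2.
  have -> : cT * (u * ((ca + 1) * eps) * u) = eps * X by rewrite /X; ring.
  have : eps * (2 * (1 + X)) <= 1 by rewrite -ler_pdivlMr // ge_min lexx orbT.
  by move: eps0; clear; nra.
have [l lP] := gap0 (L * m%:R * k%:R).
(* The term [2 * thickR o] offsets the loss in [step_len], so that each step is long enough for the
   transversality threshold [N0] and for the gap [L] beyond [l]. The set [E] and then the
   neighbourhood [W] depend on this [S]. *)
pose S := Num.max 1 (Num.max N0 l + 2 * thickR o).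
have S0 : 0 < S by rewrite lt_max ltr01.
have Slong h : S - 2 * thickR o <= len o h -> N0 <= len o h /\
    L * (m%:R * udvd (rho0 h) k) <= udvd (rho0 h) k.-1 / k%:R.
  have S1 : Num.max N0 l + 2 * thickR o <= S by rewrite le_max lexx orbT.
  move=> lh; have : Num.max N0 l <= len o h by lra.
  rewrite ge_max => /andP[h1 /lP h2]; split=> //.
  by rewrite ler_pdivlMr ?ltr0n // mulrA mulrAC.
have [E [finE Esym EP]] := next_point_sym o rel S0.
have fg Q : P Q -> finitely_generated Q by move=> /subP[].
have [W [oW W0 Wrel WP]] := near_pieces finP fg rep0 finE eps0.
exists W; split; [exact: oW|exact: W0|exact: Wrel|move=> rho Wrho].
have [rep _] := Wrel _ Wrho.
have /choice[ab abP] : forall h, exists ab : 'M[scalars R F]_(k + m) * 'M[scalars R F]_(k + m),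
    piece P E h -> [/\ mn (ab.1 - 1%:M) <= eps, mn (ab.2 - 1%:M) <= eps &
      sl_mx (rho h) = ab.1 *m rho0 h *m ab.2].
  move=> h; have [/(WP _ Wrho)[x [y H]]|nh] := pselect (piece P E h); first by exists (x, y).
  by exists (0, 0).
have gap := perturbed_gap k0 m0 rep gap0 S0 EP cT0 e0 e1 ek L1 L2 eps2 epsT T0 Slong
  (pa := fun h => (ab h).1) (pb := fun h => (ab h).2) abP.
split; first exact: (gap_divergent k0 kdm gap).
apply: (attractor_egf rel k0 kd (kd' := kd') rep gap) => p q pq.
have [r [c' H]] := perturbed_transverse rel k0 m0 rep gap0 S0 Esym EP cT0 e0 e1 ek L1 L2
  eps2 epsT T0 Slong (pa := fun h => (ab h).1) (pb := fun h => (ab h).2) abP pq.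
exists r, c' => al be sal sbe; rewrite !minor_ulsub; exact: H.
Qed.
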